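(* Let $n\ge3$. The Hilbert function of the action of $\mathcal{G}$ on the equation $\mathcal{E}$ of general Kundt metrics is given by $\mathcal{H}^n_0=0$, $\mathcal{H}^n_1=1$, $$\mathcal{H}^n_2=n-5+(n-1)\left(\tbinom{n+2}{n}-\tbinom{n+2}{n-1}\right)+\tbinom{n-1}{2}\tbinom{n+1}{n-1}=\frac{n^4-4n^3+11n^2+16n-72}{12},$$ $$\mathcal{H}^n_k=(n-1)\left(\tbinom{n+k-1}{n-1}-\tbinom{n+k-1}{n-2}\right)+\tbinom{n-1}{2}\tbinom{n+k-2}{n-2}-1\quad\text{for }k\ge3 .$$
   Context: Coordinates on $M=\mathbb{R}^n$ (locally) are $(u,x^1,\dots,x^{n-2},v)$; $i,j$ run over $1,\dots,n-2$, repeated indices are summed. Kundt metrics in adapted coordinates are $g=du\,(dv+H\,du+W_i\,dx^i)+h_{ij}\,dx^i\,dx^j$ with $H,W_i$ functions of $(u,x,v)$, $h_{ij}=h_{ji}$ functions of $(u,x)$, $(h_{ij})$ positive definite. Let $\pi:M\times F\to M$, where $F\subset\mathbb{R}^N$, $N=\binom n2$, is the open set with fiber coordinates $H,W_i,h_{ij}$ ($i\le j$) on which $(h_{ij})$ is positive definite; $J^k\pi$ is the bundle of $k$-jets of sections. $\mathcal{E}^0=J^0\pi$ and, for $k\ge1$, $\mathcal{E}^k\subset J^k\pi$ is given by the equations $(h_{ij})_v=0$ and all their total derivatives of order $\le k$. $\mathcal{G}$ is the Lie pseudogroup of local diffeomorphisms $(u,x^i,v)\mapsto(C(u),A^i(u,x),v/C'(u)+B(u,x))$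 with $\det[A^i_{x^j}]\ne0$, $C'\neq0$ (the transformations preserving the form $g=du\,(dv+H\,du+W_i\,dx^i)+h_{ij}\,dx^i\,dx^j$ of Kundt metrics). It acts on such metrics, hence on $J^0\pi$ (so that $g$, viewed as a horizontal symmetric 2-form, is invariant), and the action prolongs to $J^k\pi$ preserving $\mathcal{E}^k$. Let $s^n_k$ be the codimension in $\mathcal{E}^k$ of a $\mathcal{G}$-orbit in general position. The Hilbert function is $\mathcal{H}^n_0=s^n_0$, $\mathcal{H}^n_k=s^n_k-s^n_{k-1}$ for $k\ge1$. *)

(* Defs.v *)
From mathcomp Require Import all_boot all_order all_algebra.
From mathcomp Require Import all_classical all_reals all_analysis.

Set Implicit Arguments.
Unset Strict Implicit.
Unset Printing Implicit Defensive.
Import Order.TTheory GRing.Theory Num.Theory.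
Import numFieldNormedType.Exports.
Local Open Scope classical_set_scope.
Local Open Scope ring_scope.

Section Smooth.
Variables (R : realType) (V W : normedModType R).

Definition iterD (vs : seq V) (f : V -> W) : V -> W :=
  foldr (fun v g x => 'D_v g x) f vs.

(* C^oo on the open set U of a finite-dimensional space V *)
Definition smooth_on (U : set V) (f : V -> W) : Prop :=
  forall (vs : seq V) (x : V), U x ->
    {for x, continuous (iterD vs f)} /\ forall v, derivable (iterD vs f) x v.

End Smooth.

Section Submanifolds.
Variables (R : realType) (D : nat).

(* S is an immersed submanifold of R^D of dimension d: it is covered by the
   images of countably many injective immersions f i : U i -> R^D, and these
   parametrizations are compatible, i.e. all the change-of-chart maps
   (f j)^-1 \o f i have open domain and are continuous (hence smooth, the f j
   being immersions). The manifold topology of S may be finer than the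
   topology induced by R^D. Some of the U i may be empty. *)
Definition immersed_submanifold (d : nat) (S : set 'rV[R]_D) : Prop :=
  exists (U : nat -> set 'rV[R]_d) (f : nat -> 'rV[R]_d -> 'rV[R]_D),
    [/\ forall i, open (U i) /\ smooth_on (U i) (f i),
        forall i, set_inj (U i) (f i),
        forall i x, U i x -> \rank ('J (f i) x) = d,
        S = \bigcup_i (f i @` U i) &
        forall i j (V : set 'rV[R]_d), open V -> V `<=` U j ->
          open (U i `&` f i @^-1` (f j @` V))].

Definition has_codim_in (S O : set 'rV[R]_D) (c : nat) : Prop :=
  O `<=` S /\
  exists d, immersed_submanifold (d + c) S /\ immersed_submanifold d O.

End Submanifolds.

(* Throughout, m = n - 2 is the number of coordinates x^i, so that points of
   M = R^n are row vectors (u, x^1, ..., x^m, v) of length 1 + m + 1. *)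
Notation point R m := 'rV[R]_(1 + m + 1) (only parsing).

(* Index set of the N = 'C(n, 2) fiber coordinates H, W_i, h_ij (i <= j). *)
Notation fiber_index m :=
  (unit + 'I_m + {ij : 'I_m * 'I_m | (ij.1 <= ij.2)%N})%type (only parsing).

Notation multi_index m k :=
  {sigma : {ffun 'I_(1 + m + 1) -> 'I_k.+1} | (\sum_l sigma l <= k)%N}
  (only parsing).

(* Standard jet coordinates: base coordinates and derivatives, with respect to
   multi-indices of length at most k, of the fiber coordinates. *)
Notation jet_index m k :=
  ('I_(1 + m + 1) + fiber_index m * multi_index m k)%type (only parsing).

Notation jet_vec R m k := 'rV[R]_#|{: jet_index m k}| (only parsing).

Section Kundt.
Variables (R : realType) (m : nat).
Local Notation pt := (point R m).

Definition iu : 'I_(1 + m + 1) := lshift 1 (lshift m ord0).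
Definition ix (i : 'I_m) : 'I_(1 + m + 1) := lshift 1 (rshift 1 i).
Definition iv : 'I_(1 + m + 1) := rshift (1 + m) ord0.

Definition ucoord (a : pt) : R := a 0 iu.
Definition xcoord (a : pt) : 'rV[R]_m := \row_i a 0 (ix i).
Definition vcoord (a : pt) : R := a 0 iv.
Definition mkpt (u : R) (x : 'rV[R]_m) (v : R) : pt :=
  row_mx (row_mx u%:M x) v%:M.

Lemma sort_pair_subproof (i j : 'I_m) :
  let ij := if (i <= j)%N then (i, j) else (j, i) in (ij.1 <= ij.2)%N.
Proof. by case: ifPn => //=; rewrite -ltnNge => /ltnW. Qed.

Definition fH : fiber_index m := inl (inl tt).
Definition fW (i : 'I_m) : fiber_index m := inl (inr i).
Definition fh (i j : 'I_m) : fiber_index m :=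
  inr (exist (fun ij : 'I_m * 'I_m => (ij.1 <= ij.2)%N) _
         (sort_pair_subproof i j)).

Definition in_F (y : fiber_index m -> R) : Prop :=
  forall w : 'rV[R]_m, w != 0 ->
    0 < \sum_i \sum_j y (fh i j) * w 0 i * w 0 j.

(* The symmetric 2-form du (dv + H du + W_i dx^i) + h_ij dx^i dx^j, given
   through its quadratic form on tangent vectors. *)
Definition kundt_form (y : fiber_index m -> R) (xi : pt) : R :=
  ucoord xi * (vcoord xi + y fH * ucoord xi
               + \sum_i y (fW i) * xcoord xi 0 i)
  + \sum_i \sum_j y (fh i j) * xcoord xi 0 i * xcoord xi 0 j.

(* Only the restriction of s to some neighborhood of a is a section of pi. *)
Definition local_section (a : pt) (s : pt -> fiber_index m -> R) : Prop :=
  exists U : set pt, [/\ open U, U a,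
    forall c, smooth_on U (fun b => s b c : R) &
    forall b, U b -> in_F (s b)].

(* phi is, on a neighborhood of a, an element of the pseudogroup G; there
   C, A and B are smooth on the projections of that neighborhood. By the
   inverse function theorem phi is injective on a smaller neighborhood. *)
Definition kundt_transf (a : pt) (phi : pt -> pt) : Prop :=
  exists (U : set pt) (C : R -> R) (A : R * 'rV[R]_m -> 'rV[R]_m)
         (B : R * 'rV[R]_m -> R),
    [/\ open U, U a,
        [/\ smooth_on (ucoord @` U) C,
            smooth_on ((fun b => (ucoord b, xcoord b)) @` U) A &
            smooth_on ((fun b => (ucoord b, xcoord b)) @` U) B],
        forall b, U b ->
          derive1 C (ucoord b) != 0 /\
          \det ('J (fun y => A (ucoord b, y)) (xcoord b)) != 0 &
        forall b, U b -> let u := ucoord b in let x := xcoord b in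
          phi b = mkpt (C u) (A (u, x)) (vcoord b / derive1 C u + B (u, x))].

Lemma multi_index0_subproof (k : nat) :
  (\sum_l ([ffun=> ord0] : {ffun 'I_(1 + m + 1) -> 'I_k.+1}) l <= k)%N.
Proof. by rewrite big1 // => l _; rewrite ffunE. Qed.

Definition multi_index0 (k : nat) : multi_index m k :=
  exist (fun sigma : {ffun 'I_(1 + m + 1) -> 'I_k.+1} =>
           (\sum_l sigma l <= k)%N) _ (multi_index0_subproof k).

Definition jcoord (k : nat) (p : jet_vec R m k) (c : jet_index m k) : R :=
  p 0 (enum_rank c).

Definition multi_derive (k : nat) (sigma : multi_index m k) (f : pt -> R) :
    pt -> R :=
  iterD (flatten [seq nseq (val sigma l) (delta_mx 0 l : pt)
                 | l <- enum 'I_(1 + m + 1)]) f.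

Definition jet (k : nat) (s : pt -> fiber_index m -> R) (a : pt) :
    jet_vec R m k :=
  \row_r match enum_val r : jet_index m k with
         | inl l => a 0 l
         | inr (c, sigma) => multi_derive sigma (fun b => s b c) a
         end.

(* J^k pi, as an open subset of the space of all values of jet coordinates *)
Definition jet_space (k : nat) : set (jet_vec R m k) :=
  [set p | in_F (fun c => jcoord p (inr (c, multi_index0 k)))].

(* E^k: the total derivative D_tau of the equation (h_ij)_v = 0 is the
   vanishing of the jet coordinate (h_ij)_sigma with sigma = tau + 1_v. *)
Definition kundt_equation (k : nat) : set (jet_vec R m k) :=
  [set p | jet_space p /\
    forall (i j : 'I_m) (sigma : multi_index m k), (0 < val sigma iv)%N ->
      jcoord p (inr (fh i j, sigma)) = 0].

(* The G-orbit of a k-jet p: phi in G maps the jet of s at a to the jet at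
   phi a of the section s' such that phi^* g_{s'} = g_s. *)
Definition kundt_orbit (k : nat) (p : jet_vec R m k) : set (jet_vec R m k) :=
  [set q | exists (a : pt) (phi : pt -> pt) (s s' : pt -> fiber_index m -> R),
    [/\ kundt_transf a phi,
        local_section a s /\ local_section (phi a) s',
        \forall b \near a, forall xi : pt,
          kundt_form (s b) xi = kundt_form (s' (phi b)) ('d phi b xi),
        p = jet k s a & q = jet k s' (phi a)]].

(* c is the codimension in E^k of the orbits in general position, i.e. of the
   orbits of all points of some relatively open dense subset of E^k. *)
Definition generic_orbit_codim (k c : nat) : Prop :=
  exists V : set (jet_vec R m k), [/\ open V,
    @kundt_equation k `<=` closure (@kundt_equation k `&` V) &
    forall p, @kundt_equation k p -> V p ->
      has_codim_in (@kundt_equation k) (kundt_orbit p) c].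

End Kundt.

Definition hilbert_function (s : nat -> nat) (k : nat) : int :=
  if k is k'.+1 then (s k)%:Z - (s k')%:Z else (s 0%N)%:Z.

(* Main.v *)
(** Sections are pulled back rather than pushed forward: the orbit of a jet p is the set of
    k-jets, at a varying base point, of psi^* s, where s is the Taylor polynomial of p and psi
    runs through Kundt maps with polynomial components, whose coefficients of degree at most
    k + 1 parametrize the orbit.

    For k >= 2 and generic p this parametrization is an injective immersion. Put
    w = W_v, z = W_vv and I = w h^-1 w^T, a scalar invariant. Then I_v transforms by the
    factor v_v, which it determines; the 2-form dw - (z ^ I_x) / I_v is invariant, and the
    Krylov vectors that it generates from w form a frame, which determines the derivatives
    of x with respect to x; the gradient of I and W itself give the remaining first
    derivatives of psi. Higher derivatives then follow by the Koszul formula. "Determines" is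
    used uniformly by means of a field K of functions of the parameters, closed under
    differentiation along psi; the same argument with K the smooth functions and the
    rational functions of a line shows that genericity is an open and dense condition.

    For k = 0 the orbit is all of E^0. For k = 1 it is a level set of I: transformations
    of first order are composed of Householder reflections and Cholesky factors, and second
    derivatives are given by Christoffel symbols. The codimension is thus 0 for k = 0, 1 for
    k = 1 and dim E^k - dim of the parameter space for k >= 2, and counting monomials gives
    the Hilbert function. *)
Require Import Defs.
From mathcomp Require Import all_boot all_order all_algebra.
From mathcomp Require Import all_classical all_reals all_analysis.
Import Order.TTheory GRing.Theory Num.Theory.
Local Open Scope ring_scope.
From HB Require Import structures.
From mathcomp Require Import ring.

Set Implicit Arguments.
Unset Strict Implicit.
Unset Printing Implicit Defensive.
Import numFieldNormedType.Exports.
Local Open Scope classical_set_scope.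
Local Open Scope ring_scope.

(** Weights explain the invariants. As h does not depend on v and u_u v_v = 1, [w] transforms by the
    derivatives of x along x alone, although W does not; with h it yields the scalar I.
    Differentiation along x is not invariant, since v may be shifted by a function of x; I_x has the
    same defect with the known factor I_v, and can therefore serve as a correction. The pair (h, w)
    still leaves the orthogonal group of the complement of w undetermined. An invariant 2-form
    breaks this symmetry: the powers of one endomorphism, applied to one covector, give a frame in
    every dimension.

    Submanifolds are given by explicit charts, so injectivity and immersivity of the parametrization
    have to be shown on the whole parameter domain. Both follow once the parameters are obtained
    from the jet coordinates by field operations, which is the reason for working with classes of
    functions closed under these. That generic jets exist at all, on which density rests, is shown
    by an explicit metric in each dimension. *)

Local Notation iterD := Defs.iterD.

(** * Directional derivatives: mean values, additivity in the direction, symmetry *)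

Section Directional.
Variables (R : realType) (V W : normedModType R).

Lemma derivableZv (f : V -> W) x v (k : R) :
  derivable f x v -> derivable f x (k *: v) /\ 'D_(k *: v) f x = k *: 'D_v f x.
Proof.
have [->|k0] := eqVneq k 0.
  by rewrite !scale0r; split; [exact: derivable0|rewrite derive0].
move=> /cvg_ex[/= l fl].
have E : (fun h : R => h^-1 *: ((f \o shift x) (h *: (k *: v)) - f x)) =
    (fun h => k *: ((h * k)^-1 *: ((f \o shift x) ((h * k) *: v) - f x))).
  apply/funext => h; rewrite !scalerA; congr (_ *: _).
  by rewrite invfM mulrCA divff ?mulr1.
have H : (fun h : R => h^-1 *: ((f \o shift x) (h *: (k *: v)) - f x)) @ 0^' --> k *: l.
  rewrite E; apply: cvgZl_tmp.
  apply: (cvg_comp _ _ _ fl).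
  move=> A /= [e /= e0 eA]; exists (e / `|k|); first by rewrite /= divr_gt0 ?normr_gt0.
  move=> y /=; rewrite !sub0r !normrN ltr_pdivlMr ?normr_gt0// => yk y0; apply: eA.
    by rewrite /= sub0r normrN normrM.
  by rewrite mulf_neq0.
split; first by apply/cvg_ex; exists (k *: l).
rewrite /derive (cvg_lim _ H)//.
by congr (_ *: _); apply/esym/cvg_lim.
Qed.

Lemma derive_line (f : V -> W) a v (t : R) :
  derivable f (a + t *: v) v ->
  is_derive t 1 (fun s : R => f (a + s *: v)) ('D_v f (a + t *: v)).
Proof.
have E : (fun h : R => h^-1 *: (((fun s : R => f (a + s *: v)) \o shift t) (h *: 1) - f (a + t *: v)))
    = (fun h => h^-1 *: ((f \o shift (a + t *: v)) (h *: v) - f (a + t *: v))).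
  apply/funext => h /=; congr (_ *: (f _ - _)).
  by rewrite [h%:A]mulr1 scalerDl addrCA.
by move=> fd; split; rewrite /derivable /derive E.
Qed.

End Directional.

Section MeanValue.
Variables (R : realType) (V : normedModType R).

Lemma mean_value_segment (f : V -> R) a v :
  (forall t : R, t \in `[0, 1] -> derivable f (a + t *: v) v) ->
  exists2 t : R, t \in `[0, 1] & f (a + v) - f a = 'D_v f (a + t *: v).
Proof.
move=> fd.
have gd (t : R) : t \in `[0, 1] -> is_derive t 1 (fun s : R => f (a + s *: v)) ('D_v f (a + t *: v)).
  by move=> /fd; exact: derive_line.
pose g (s : R) := f (a + s *: v).
have gc : {within `[0, 1], continuous g}.
  by apply: derivable_within_continuous => t /gd[].
have go (t : R) : t \in `]0, 1[ -> is_derive t 1 g ('D_v f (a + t *: v)).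
  by move=> t01; apply: gd; apply: subset_itv_oo_cc.
have [t t01] := MVT ltr01 go gc.
rewrite /g scale1r scale0r addr0 subr0 mulr1 => E; exists t => //.
exact: subset_itv_oo_cc.
Qed.

End MeanValue.

Section Partials.
Variables (R : realType) (V : normedModType R).

Lemma norm_itv01M (t h d : R) : t \in `[0, 1] -> `|h| <= d -> `|t * h| <= d.
Proof.
move=> t01 hd; rewrite normrM (le_trans _ hd)// ler_piMl// ger0_norm.
  by rewrite (itvP t01).
by rewrite (itvP t01).
Qed.

Lemma near0_line (a v w : V) (P : set V) : nbhs a P ->
  exists2 e : R, 0 < e & forall s t : R, `|s| <= e -> `|t| <= e ->
    P (a + s *: v + t *: w).
Proof.
move=> /nbhs_ballP[e /= e0 eP].
have d0 : 0 < 1 + `|v| + `|w| by rewrite -addrA ltr_pwDl// addr_ge0.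
exists (e / 2 / (1 + `|v| + `|w|)); first by rewrite !divr_gt0.
move=> s t se te; apply: eP; rewrite -ball_normE /= -!addrA opprD addrA subrr add0r normrN.
apply: (@le_lt_trans _ _ (e / 2 / (1 + `|v| + `|w|) * (`|v| + `|w|))).
  rewrite (le_trans (ler_normD _ _))// !normrZ mulrDr lerD// ler_wpM2r//.
rewrite -mulrA -[ltRHS]mulr1.
apply: (@le_lt_trans _ _ (e / 2 * 1)).
  rewrite ler_wpM2l ?divr_ge0 ?(ltW e0)//.
  by rewrite mulrC ler_pdivrMr// mul1r -addrA lerDr.
by rewrite !mulr1 ltr_pdivrMr// ltr_pMr// ltr1n.
Qed.

(** The increment along [v + w] is that along [v] followed by a step along [w] from [x + h *: v].
    The mean value theorem turns this second step into a value of ['D_w f] near x, so continuity of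
    one of the two derivatives is enough. *)
Lemma derivableD_dir (f : V -> R) x v w :
  derivable f x v -> (\forall y \near x, derivable f y w) ->
  {for x, continuous ('D_w f)} ->
  derivable f x (v + w) /\ 'D_(v + w) f x = 'D_v f x + 'D_w f x.
Proof.
move=> fv fw cw.
have key : (fun h => h^-1 *: ((f \o shift x) (h *: (v + w)) - (f \o shift x) (h *: v)))
    @ 0^' --> 'D_w f x.
  apply/cvgrPdist_lt => e e0.
  have /(near0_line v w)[d d0 H] : \forall y \near x,
      derivable f y w /\ `|'D_w f x - 'D_w f y| < e.
    near=> y; split; near: y => //.
    by move/cvgrPdist_lt: cw => /(_ _ e0).
  near=> h; have hd : `|h| <= d.
    by apply: ltW; near: h; exact: dnbhs0_lt.
  have h0 : h != 0 by near: h; exact: nbhs_dnbhs_neq.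
  have [t t01|t t01] := @mean_value_segment R V f (x + h *: v) (h *: w).
    rewrite scalerA; apply: (derivableZv h _).1; apply: (H h _ _ _).1 => //.
    exact: norm_itv01M.
  move=> E; have tn0 := norm_itv01M t01 hd.
  rewrite /= [f (h *: (v + w) + x)]( _ : _ = f (x + h *: (v + w))); last by rewrite addrC.
  rewrite [f (h *: v + x)]( _ : _ = f (x + h *: v)); last by rewrite addrC.
  rewrite [h *: (v + w)]scalerDr [x + (_ + _)]addrA E scalerA.
  have [H1 H2] := H h (t * h) hd tn0.
  by rewrite (derivableZv h H1).2 scalerA mulVf// scale1r.
have fvc : (fun h => h^-1 *: ((f \o shift x) (h *: v) - f x)) @ 0^' --> 'D_v f x := fv.
have S : (fun h => h^-1 *: ((f \o shift x) (h *: (v + w)) - f x)) @ 0^' --> 'D_v f x + 'D_w f x.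
  apply: cvg_trans (cvgD fvc key); apply: near_eq_cvg; near=> h.
  rewrite -[LHS]/(h^-1 *: ((f \o shift x) (h *: v) - f x) +
    h^-1 *: ((f \o shift x) (h *: (v + w)) - (f \o shift x) (h *: v))).
  rewrite -scalerDr; congr (_ *: _); ring.
by split; [apply/cvg_ex; eexists; exact: S|exact: cvg_lim S].
Unshelve. all: by end_near. Qed.

Lemma dist_half_absurd (A B r : R) :
  `|A - r| < `|A - B| / 2 -> `|B - r| < `|A - B| / 2 -> False.
Proof.
move=> n1 n2; suff: `|A - B| < `|A - B| by rewrite ltxx.
rewrite {2}(splitr `|A - B|) -{1}(subrK r A) -addrA.
apply: le_lt_trans (ler_normD _ _) _.
by apply: ltrD => //; rewrite distrC.
Qed.

(* Second differences: both mixed derivatives are values near x of the same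
   difference quotient. *)
Lemma derive_comm (f : V -> R) x v w :
  (\forall y \near x, [/\ derivable f y v, derivable f y w,
     derivable ('D_v f) y w & derivable ('D_w f) y v]) ->
  {for x, continuous ('D_w ('D_v f))} -> {for x, continuous ('D_v ('D_w f))} ->
  'D_w ('D_v f) x = 'D_v ('D_w f) x.
Proof.
move=> fd c1 c2.
have half v' w' (c : {for x, continuous ('D_w' ('D_v' f))}) (e : R) :
    (\forall y \near x, derivable f y v' /\ derivable ('D_v' f) y w') ->
    0 < e -> exists2 d : R, 0 < d & forall h : R, `|h| <= d -> exists2 r,
    f (x + h *: v' + h *: w') - f (x + h *: v') - (f (x + h *: w') - f x)
      = h ^+ 2 * r & `|'D_w' ('D_v' f) x - r| < e.
  move=> fd' e0.
  have /(near0_line v' w')[d d0 H] : \forall y \near x,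
      [/\ derivable f y v', derivable ('D_v' f) y w' &
        `|'D_w' ('D_v' f) x - 'D_w' ('D_v' f) y| < e].
    near=> y.
    have [? ?] : derivable f y v' /\ derivable ('D_v' f) y w' by near: y.
    split=> //; near: y.
    by move/cvgrPdist_lt: c => /(_ _ e0).
  exists d => // h hd.
  have scl t (t01 : t \in `[0, 1]%R) := norm_itv01M t01 hd.
  pose g y := f (y + h *: w') - f y.
  have gd (t : R) : t \in `[0, 1] -> is_derive (x + t *: (h *: v')) (h *: v') g
     (h * ('D_v' f (x + (t * h) *: v' + h *: w') - 'D_v' f (x + (t * h) *: v'))).
    move=> t01.
    have [H1 _ _] := H (t * h) h (scl _ t01) hd.
    have H2 : derivable f (x + (t * h) *: v') v'.
      have := H (t * h) 0 (scl _ t01); rewrite normr0 scale0r addr0 => H2.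
      case: (H2 (ltW d0)) => H20 _ _; exact: H20.
    rewrite scalerA mulrBr.
    have sh : is_derive (x + (t * h) *: v') (h *: v') (fun y => f (y + h *: w'))
        (h * 'D_v' f (x + (t * h) *: v' + h *: w')).
      have [K1 K2] := derivableZv h H1.
      have E : (fun k : R => k^-1 *: (((fun y => f (y + h *: w')) \o shift (x + (t * h) *: v')) (k *: (h *: v')) - f (x + (t * h) *: v' + h *: w'))) =
        (fun k => k^-1 *: ((f \o shift (x + (t * h) *: v' + h *: w')) (k *: (h *: v')) - f (x + (t * h) *: v' + h *: w'))).
        by apply/funext => k /=; congr (_ *: (f _ - _)); rewrite !addrA.
      by split; rewrite /derivable /derive E.
    have s0 : is_derive (x + (t * h) *: v') (h *: v') f (h * 'D_v' f (x + (t * h) *: v')).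
      by have [K1 K2] := derivableZv h H2; split.
    exact: is_deriveB.
  have [t /gd[]//|t t01] := @mean_value_segment R V g x (h *: v').
  have [_ ->] := gd t t01; rewrite /g => E.
  have [s|s s01] := @mean_value_segment R V ('D_v' f) (x + (t * h) *: v') (h *: w').
    move=> s01; rewrite scalerA; apply: (derivableZv h _).1.
    by have [] := H (t * h) (s * h) (scl _ t01) (scl _ s01).
  rewrite scalerA => E2; have [_ K Kn] := H (t * h) (s * h) (scl _ t01) (scl _ s01).
  rewrite (derivableZv h K).2 in E2.
  exists ('D_w' ('D_v' f) (x + (t * h) *: v' + (s * h) *: w')) => //.
  by rewrite E E2 mulrA expr2.
apply: contrapT => ne.
have e0 : 0 < `|'D_w ('D_v f) x - 'D_v ('D_w f) x| / 2.
  apply: divr_gt0; last exact: ltr0n.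
  by rewrite normr_gt0 subr_eq0; exact/eqP.
have [|d1 d10 H1] := half v w c1 _ _ e0; first by apply: filterS fd => y [? ? ? ?]; split; assumption.
have [|d2 d20 H2] := half w v c2 _ _ e0; first by apply: filterS fd => y [? ? ? ?]; split; assumption.
have [h h0 [hd1 hd2]] : exists2 h : R, 0 < h & `|h| <= d1 /\ `|h| <= d2.
  clear -d10 d20; exists (Num.min d1 d2); first by rewrite lt_min d10.
  rewrite gtr0_norm ?lt_min ?d10//.
  by rewrite !ge_min !lexx orbT.
have [r1 E1 n1] := H1 h hd1.
have [r2 E2 n2] := H2 h hd2.
have r12 : r1 = r2.
  apply: (mulfI (lt0r_neq0 (exprn_gt0 2 h0))).
  rewrite -E1 -E2 [x + h *: v + h *: w]addrAC; ring.
by move: n1 n2; rewrite -r12; exact: dist_half_absurd.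
Unshelve. all: by end_near. Qed.

End Partials.

(** * Closure properties of smooth functions *)

Section SmoothGeneral.
Variables (R : realType) (V W : normedModType R).
Implicit Types (f g : V -> W) (U : set V).

Lemma iterD_rcons (vs : seq V) v f : iterD (rcons vs v) f = iterD vs ('D_v f).
Proof. by rewrite /iterD foldr_rcons. Qed.

Lemma open_nearT U (P : V -> Prop) x : open U -> U x -> (forall y, U y -> P y) ->
  \forall y \near x, P y.
Proof. by move=> oU Ux UP; apply: filterS UP _; exact: open_nbhs_nbhs. Qed.

Lemma continuous_eq_on U f g x : open U -> U x -> (forall y, U y -> f y = g y) ->
  {for x, continuous f} -> {for x, continuous g}.
Proof.
move=> oU Ux fg cf; rewrite /prop_for /continuous_at -(fg x Ux).
apply: cvg_trans cf; apply: near_eq_cvg.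
by apply: (open_nearT oU Ux) => y Uy; rewrite fg.
Qed.

Lemma iterD_eq_on U f g : open U -> (forall x, U x -> f x = g x) ->
  forall vs x, U x -> iterD vs f x = iterD vs g x.
Proof.
move=> oU fg; elim=> [|v vs IH] x Ux /=; first exact: fg.
by apply: near_eq_derive; exact: (open_nearT oU Ux IH).
Qed.

Lemma smooth_on_eq U f g : open U -> (forall x, U x -> f x = g x) ->
  smooth_on U f -> smooth_on U g.
Proof.
move=> oU fg sf vs x Ux; have [cf df] := sf vs x Ux.
have E := iterD_eq_on oU fg vs; split=> [|v].
  exact: continuous_eq_on E cf.
apply: near_eq_derivable (df v); apply: (open_nearT oU Ux) => y Uy; exact: E.
Qed.

Lemma smooth_on_subset U U' f : U' `<=` U -> smooth_on U f -> smooth_on U' f.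
Proof. by move=> sU sf vs x /sU; exact: sf. Qed.

Lemma smooth_on_derive U f v : smooth_on U f -> smooth_on U ('D_v f).
Proof. by move=> sf vs x Ux; rewrite -iterD_rcons; exact: sf. Qed.

Lemma smooth_on_continuous U f x : smooth_on U f -> U x -> {for x, continuous f}.
Proof. by move=> sf /(sf [::])[]. Qed.

Lemma smooth_on_derivable U f x v : smooth_on U f -> U x -> derivable f x v.
Proof. by move=> sf /(sf [::])[_]; apply. Qed.

Lemma smooth_on_local U f :
  (forall x, U x -> exists2 U', U' x & smooth_on U' f) -> smooth_on U f.
Proof. by move=> H vs x /H[U' U'x sf]; exact: sf. Qed.

End SmoothGeneral.

Section SmoothAffine.
Variables (R : realType) (V' V W : normedModType R).
Variables (l : V' -> V) (l0 : V' -> V).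
Hypothesis l_affine : forall (h : R) v x, l (h *: v + x) = h *: l0 v + l x.
Hypothesis l_continuous : continuous l.

(** Here [l0] is the linear part of [l]. No differentiability is assumed: the difference quotients
    on the two sides are the same functions of h. *)
Lemma iterD_affine (f : V -> W) vs x :
  iterD vs (f \o l) x = iterD (map l0 vs) f (l x).
Proof.
elim: vs x => //= v vs IH x; rewrite /derive.
suff -> : (fun h : R => h^-1 *: ((iterD vs (f \o l) \o shift x) (h *: v) -
    iterD vs (f \o l) x)) = (fun h => h^-1 *:
    ((iterD (map l0 vs) f \o shift (l x)) (h *: l0 v) - iterD (map l0 vs) f (l x))) by [].
by apply/funext => h /=; rewrite !IH l_affine.
Qed.

Lemma smooth_on_affine U (f : V -> W) : smooth_on U f -> smooth_on (l @^-1` U) (f \o l).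
Proof.
move=> sf vs x Ux; have [cf df] := sf (map l0 vs) _ Ux.
have E : iterD vs (f \o l) = iterD (map l0 vs) f \o l.
  by apply/funext => y; exact: iterD_affine.
rewrite E; split=> [|v].
  by apply: continuous_comp => //; exact: l_continuous.
have := df (l0 v); rewrite /derivable.
suff -> : (fun h : R => h^-1 *: (((iterD (map l0 vs) f \o l) \o shift x) (h *: v) -
    (iterD (map l0 vs) f \o l) x)) = (fun h => h^-1 *: ((iterD (map l0 vs) f \o shift (l x)) (h *: l0 v) -
    iterD (map l0 vs) f (l x))) by [].
by apply/funext => h /=; rewrite l_affine.
Qed.

End SmoothAffine.

Section SmoothRow.
Variables (R : realType) (V : normedModType R) (n : nat).

Lemma continuous_rowP (f : V -> 'rV[R]_n) x :
  {for x, continuous f} <-> forall i, {for x, continuous (fun y => f y 0 i)}.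
Proof.
split=> [cf i|cf].
  by apply: (@continuous_comp _ _ _ f (fun M : 'rV_n => M 0 i)) => //; exact: coord_continuous.
apply/cvgrPdist_lt => e e0; near=> y.
rewrite /Num.Def.normr /= mx_normrE (bigmax_lt _ e0)// => -[i j] _.
rewrite !mxE (ord1 i); move: j {i}; near: y.
by apply: filter_forall => j; have /cvgrPdist_lt := cf j; apply.
Unshelve. all: by end_near. Qed.

Lemma iterD_row U (f : V -> 'rV[R]_n) : open U ->
  (forall vs x v, U x -> derivable (iterD vs f) x v) ->
  forall vs x i, U x -> iterD vs f x 0 i = iterD vs (fun y => f y 0 i) x.
Proof.
move=> oU fd; elim=> // v vs IH x i Ux /=.
rewrite derive_mx ?mxE; last exact: fd.
by apply: near_eq_derive; apply: (open_nearT oU Ux) => y Uy; exact: IH.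
Qed.

Lemma smooth_on_rowP U (f : V -> 'rV[R]_n) : open U ->
  smooth_on U f <-> forall i, smooth_on U (fun y => f y 0 i : R).
Proof.
move=> oU; split=> [sf i vs x Ux|sf].
  have E := @iterD_row _ f oU (fun vs x v Ux => (sf vs x Ux).2 v) vs.
  have [cf df] := sf vs x Ux; split=> [|v].
    have /continuous_rowP/(_ i) cfi := cf.
    by apply: (continuous_eq_on oU Ux _ cfi) => y Uy; exact: E.
  have /derivable_mxP/(_ 0 i) := df v; apply: near_eq_derivable.
  by apply: (open_nearT oU Ux) => y Uy; rewrite E.
have E : forall vs x, U x -> iterD vs f x = \row_i iterD vs (fun y => f y 0 i) x.
  elim=> [|v vs IH] x Ux /=; first by apply/rowP => i; rewrite mxE.
  have nE : \forall y \near x, \row_i iterD vs (fun y => f y 0 i) y = iterD vs f y.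
    by apply: (open_nearT oU Ux) => y Uy; rewrite IH.
  rewrite -(near_eq_derive v nE) derive_mx.
    apply/rowP => i; rewrite !mxE.
    by congr (derive _ x v); apply/funext => y; rewrite mxE.
  apply/derivable_mxP => i j; have := (sf j vs x Ux).2 v.
  suff -> : (fun x => (\row_i iterD vs (fun y => f y 0 i) x) i j) =
    iterD vs (fun y => f y 0 j) by [].
  by apply/funext => y; rewrite mxE.
move=> vs x Ux.
have nE : \forall y \near x, \row_i iterD vs (fun y => f y 0 i) y = iterD vs f y.
  by apply: (open_nearT oU Ux) => y Uy; rewrite E.
have coordE j : (fun x => (\row_i iterD vs (fun y => f y 0 i) x) 0 j) =
    iterD vs (fun y => f y 0 j) by apply/funext => y; rewrite mxE.
split=> [|v].
  have c : {for x, continuous (fun y => \row_i iterD vs (fun y => f y 0 i) y)}.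
    by apply/continuous_rowP => j; rewrite coordE; exact: (sf j vs x Ux).1.
  by apply: (continuous_eq_on oU Ux _ c) => y Uy; rewrite E.
apply: (near_eq_derivable nE); apply/derivable_mxP => i j.
by rewrite (ord1 i) coordE; exact: (sf j vs x Ux).2.
Qed.

End SmoothRow.

Section SmoothCalculus.
Variables (R : realType) (V : normedModType R).
Implicit Types (f g : V -> R) (U : set V).

(** Differentiability of finite order, for induction: the derivative of a product, an inverse or a
    composite is built from functions of one order less and from factors of the given order, which
    no induction over lists of directions would keep apart. *)
Fixpoint Cr (r : nat) U f : Prop :=
  (forall x, U x -> {for x, continuous f}) /\
  if r is r'.+1 then
    forall v, (forall x, U x -> derivable f x v) /\ Cr r' U ('D_v f)
  else True.

Lemma smooth_onP U f : smooth_on U f <-> forall r, Cr r U f.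
Proof.
split=> [sf r|sf vs].
  elim: r f sf => [|r IH] f sf /=.
    by split=> // x Ux; exact: smooth_on_continuous sf Ux.
  split=> [x Ux|v]; first exact: smooth_on_continuous sf Ux.
  split=> [x Ux|]; first exact: smooth_on_derivable sf Ux.
  by apply: IH; exact: smooth_on_derive.
elim/last_ind: vs f sf => [|vs v IH] f sf x Ux.
  have [cf df] := sf 1%N; split=> [|v]; first exact: cf.
  by have [dv _] := df v; exact: dv.
rewrite iterD_rcons; apply: IH => // r.
by have [_ /(_ v)[]] := sf r.+1.
Qed.

Lemma Cr_eq r U f g : open U -> (forall x, U x -> f x = g x) -> Cr r U f -> Cr r U g.
Proof.
move=> oU; elim: r f g => [|r IH] f g fg.
  by case=> cf _; split=> // x Ux; exact: continuous_eq_on fg (cf x Ux).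
case=> cf df; split=> [x Ux|v]; first exact: continuous_eq_on fg (cf x Ux).
have [dv Cv] := df v; split=> [x Ux|].
  by apply: near_eq_derivable (dv x Ux); apply: (open_nearT oU Ux) => y; exact: fg.
apply: IH Cv => x Ux; apply: near_eq_derive.
by apply: (open_nearT oU Ux) => y; exact: fg.
Qed.

Lemma Cr_pred r U f : Cr r.+1 U f -> Cr r U f.
Proof.
elim: r f => [|r IH] f [cf df]; split=> // v.
by have [dv Cv] := df v; split=> //; exact: IH.
Qed.

Lemma CrS r U f (df : V -> V -> R) : open U ->
  (forall x, U x -> {for x, continuous f}) ->
  (forall v x, U x -> is_derive x v f (df v x)) ->
  (forall v, Cr r U (df v)) -> Cr r.+1 U f.
Proof.
move=> oU cf fd Cd; split=> // v; split=> [x Ux|].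
  by have [] := fd v x Ux.
by apply: Cr_eq (Cd v) => // x Ux; have [_ ->] := fd v x Ux.
Qed.

Lemma Cr_continuous r U f x : Cr r U f -> U x -> {for x, continuous f}.
Proof. by case: r => [|r] [cf _]; exact: cf. Qed.

Lemma Cr_is_derive r U f x v : Cr r.+1 U f -> U x -> is_derive x v f ('D_v f x).
Proof. by case=> _ /(_ v)[df _] Ux; apply: DeriveDef => //; exact: df. Qed.

Lemma Cr_derive r U f v : Cr r.+1 U f -> Cr r U ('D_v f).
Proof. by case=> _ /(_ v)[]. Qed.

Lemma Cr_cst r U c : open U -> Cr r U (cst c).
Proof.
move=> oU; elim: r c => [|r IH] c.
  by split=> // x _; exact: cst_continuous.
apply: (@CrS _ _ _ (fun _ => cst 0)) => //; first by move=> x _; exact: cst_continuous.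
Qed.

Lemma Cr_add r U f g : open U -> Cr r U f -> Cr r U g -> Cr r U (fun x => f x + g x).
Proof.
move=> oU; elim: r f g => [|r IH] f g Cf Cg.
  split=> // x Ux.
  apply: continuousD; [exact: (Cr_continuous Cf Ux)|exact: (Cr_continuous Cg Ux)].
apply: (@CrS _ _ _ (fun v x => 'D_v f x + 'D_v g x)) => //.
- move=> x Ux.
  apply: continuousD; [exact: (Cr_continuous Cf Ux)|exact: (Cr_continuous Cg Ux)].
- move=> v x Ux; exact: (is_deriveD (Cr_is_derive v Cf Ux) (Cr_is_derive v Cg Ux)).
- by move=> v; apply: IH; exact: Cr_derive.
Qed.

Lemma Cr_mul r U f g : open U -> Cr r U f -> Cr r U g -> Cr r U (fun x => f x * g x).
Proof.
move=> oU; elim: r f g => [|r IH] f g Cf Cg.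
  split=> // x Ux.
  apply: continuousM; [exact: (Cr_continuous Cf Ux)|exact: (Cr_continuous Cg Ux)].
apply: (@CrS _ _ _ (fun v x => f x * 'D_v g x + g x * 'D_v f x)) => //.
- move=> x Ux.
  apply: continuousM; [exact: (Cr_continuous Cf Ux)|exact: (Cr_continuous Cg Ux)].
- move=> v x Ux; exact: (is_deriveM (Cr_is_derive v Cf Ux) (Cr_is_derive v Cg Ux)).
- move=> v; apply: Cr_add => //; apply: IH; try exact: Cr_derive; exact: Cr_pred.
Qed.

Lemma Cr_inv r U f : open U -> (forall x, U x -> f x != 0) -> Cr r U f ->
  Cr r U (fun x => (f x)^-1).
Proof.
move=> oU f0; elim: r => [|r IH] Cf.
  by split=> // x Ux; apply: continuousV; [exact: f0|exact: (Cr_continuous Cf Ux)].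
have IC := IH (Cr_pred Cf).
apply: (@CrS _ _ _ (fun v x => - 1 * ((f x)^-1 * (f x)^-1) * 'D_v f x)) => //.
- move=> x Ux; apply: continuousV; [exact: f0|exact: (Cr_continuous Cf Ux)].
- move=> v x Ux; have [df _] := Cr_is_derive v Cf Ux; split.
    exact: (derivableV (f0 x Ux) df).
  rewrite (deriveV (f0 x Ux) df) mulN1r -invfM -expr2.
  by [].
- move=> v; apply: Cr_mul => //; last exact: Cr_derive.
  by apply: Cr_mul => //; [exact: Cr_cst|exact: Cr_mul].
Qed.

Lemma smooth_on_cst U c : open U -> smooth_on U (cst c : V -> R).
Proof. by move=> oU; apply/smooth_onP => r; exact: Cr_cst. Qed.

Lemma smooth_on_add U f g : open U -> smooth_on U f -> smooth_on U g ->
  smooth_on U (fun x => f x + g x).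
Proof. by move=> oU /smooth_onP sf /smooth_onP sg; apply/smooth_onP => r; exact: Cr_add. Qed.

Lemma smooth_on_mul U f g : open U -> smooth_on U f -> smooth_on U g ->
  smooth_on U (fun x => f x * g x).
Proof. by move=> oU /smooth_onP sf /smooth_onP sg; apply/smooth_onP => r; exact: Cr_mul. Qed.

Lemma smooth_on_inv U f : open U -> (forall x, U x -> f x != 0) -> smooth_on U f ->
  smooth_on U (fun x => (f x)^-1).
Proof. by move=> oU f0 /smooth_onP sf; apply/smooth_onP => r; exact: Cr_inv. Qed.

Lemma smooth_on_sum (I : finType) U (F : I -> V -> R) : open U ->
  (forall i, smooth_on U (F i)) -> smooth_on U (fun x => \sum_i F i x).
Proof.
move=> oU sF; rewrite (_ : (fun x => _) = (fun x => \sum_(i <- enum I) F i x)).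
  elim: (enum I) => [|i s IH].
    apply: smooth_on_eq (smooth_on_cst 0 oU) => // x _; by rewrite big_nil.
  apply: smooth_on_eq (smooth_on_add oU (sF i) IH) => // x _; by rewrite big_cons.
by apply/funext => x; rewrite big_enum.
Qed.

End SmoothCalculus.

(** * Differentials and the chain rule in finite dimension *)

Section FiniteDim.
Variables (R : realType) (n : nat).
Local Notation pt := 'rV[R]_n.
Implicit Types (f g : pt -> R) (U : set pt).

Lemma is_derive_coord (x v : pt) i : is_derive x v (fun y : pt => y 0 i : R) (v 0 i).
Proof.
have H : (fun h : R => h^-1 *: (((fun y : pt => y 0 i) \o shift x) (h *: v) - x 0 i)) @ 0^'
    --> (v 0 i : R).
  apply: (@cvg_trans _ ((fun h : R => v 0 i) @ 0^')); last exact: cvg_cst.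
  apply: near_eq_cvg; near=> h; rewrite /= !mxE addrK scalerA mulVf ?scale1r//.
  by near: h; exact: nbhs_dnbhs_neq.
by split; [apply/cvg_ex; eexists; exact: H|exact: cvg_lim H].
Unshelve. all: by end_near. Qed.

Lemma smooth_on_coord U i : open U -> smooth_on U (fun y : pt => y 0 i : R).
Proof.
move=> oU; apply/smooth_onP => r; case: r => [|r].
  by split=> // x Ux; exact: coord_continuous.
apply: (@CrS _ _ _ _ _ (fun v : pt => cst (v 0 i : R) : pt -> R)) => //.
- by move=> x Ux; exact: coord_continuous.
- by move=> v x _; exact: is_derive_coord.
- by move=> v; exact: Cr_cst.
Qed.

Lemma derive_smooth_add f U x v w : open U -> smooth_on U f -> U x ->
  'D_(v + w) f x = 'D_v f x + 'D_w f x.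
Proof.
move=> oU sf Ux; apply: (derivableD_dir _ _ _).2.
- exact: smooth_on_derivable sf Ux.
- by apply: (open_nearT oU Ux) => y; exact: smooth_on_derivable.
- exact: smooth_on_continuous (smooth_on_derive w sf) Ux.
Qed.

Lemma derive_smooth_partial f U x v : open U -> smooth_on U f -> U x ->
  'D_v f x = \sum_l v 0 l * 'D_('e_l) f x.
Proof.
move=> oU sf Ux; rewrite {1}(row_sum_delta v).
elim: (index_enum 'I_n) => [|l s IH]; first by rewrite !big_nil derive0.
rewrite !big_cons (derive_smooth_add _ _ oU sf Ux) IH; congr (_ + _).
by rewrite (derivableZv (v 0 l) (smooth_on_derivable sf Ux)).2.
Qed.

Lemma derive_smooth_comm f U x v w : open U -> smooth_on U f -> U x ->
  'D_w ('D_v f) x = 'D_v ('D_w f) x.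
Proof.
move=> oU sf Ux; apply: derive_comm.
- apply: (open_nearT oU Ux) => y Uy; split.
  + exact: smooth_on_derivable sf Uy.
  + exact: smooth_on_derivable sf Uy.
  + exact: smooth_on_derivable (smooth_on_derive v sf) Uy.
  + exact: smooth_on_derivable (smooth_on_derive w sf) Uy.
- exact: smooth_on_continuous (smooth_on_derive w (smooth_on_derive v sf)) Ux.
- exact: smooth_on_continuous (smooth_on_derive v (smooth_on_derive w sf)) Ux.
Qed.

Definition grad_form f x (v : pt) : R := \sum_l v 0 l * 'D_('e_l) f x.

Lemma grad_form_linear f x : linear (grad_form f x).
Proof.
move=> k v w; rewrite /grad_form scaler_sumr -big_split; apply: eq_bigr => l _ /=.
by rewrite !mxE mulrDl -mulrA.
Qed.

HB.instance Definition _ f x := GRing.isLinear.Build R pt R _ _ (@grad_form_linear f x).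

Lemma grad_form_continuous f x : continuous (grad_form f x).
Proof.
move=> v; apply: (@smooth_on_continuous _ _ _ setT) => //.
apply: smooth_on_sum; first exact: openT.
move=> l; apply: smooth_on_mul; [exact: openT|apply: smooth_on_coord; exact: openT|].
apply: smooth_on_cst; exact: openT.
Qed.

Lemma norm_coord_le (v : pt) l : `|v 0 l| <= `|v|.
Proof.
rewrite [leRHS]/Num.Def.normr /= mx_normrE.
exact: (le_bigmax _ (fun i : 'I_1 * 'I_n => `|v i.1 i.2|) (0, l)).
Qed.

Lemma smooth_diff f U x : open U -> smooth_on U f -> U x ->
  differentiable f x /\ 'd f x = grad_form f x :> (pt -> R).
Proof.
move=> oU sf Ux.
have H : f \o shift x = cst (f x) + grad_form f x +o_ (0 : pt) id.
  apply/eqaddoP => eps eps0.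
  (* The tolerance is divided by n + 1 instead of n to cover dimension 0. *)
  have n0 : 0 < n.+1%:R :> R by rewrite ltr0n.
  have e0 : 0 < eps / n.+1%:R by apply: divr_gt0.
  have : \forall y \near x, U y /\ forall l, `|'D_('e_l) f x - 'D_('e_l) f y| < eps / n.+1%:R.
    near=> y; split; first by near: y; exact: open_nbhs_nbhs.
    near: y; apply: filter_forall => l.
    have := smooth_on_continuous (smooth_on_derive 'e_l sf) Ux.
    by move=> /cvgrPdist_lt; apply.
  move=> /nbhs_ballP[d /= d0 dP].
  apply/nbhs_ballP; exists d => // h; rewrite -ball_normE /= sub0r normrN => hd.
  have seg t : t \in `[0, 1] -> U (x + t *: h) /\
      forall l, `|'D_('e_l) f x - 'D_('e_l) f (x + t *: h)| < eps / n.+1%:R.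
    move=> t01; apply: dP; rewrite -ball_normE /= opprD addrA subrr add0r normrN normrZ.
    rewrite ger0_norm ?(itvP t01)//; apply: le_lt_trans hd.
    by rewrite ler_piMl// (itvP t01).
  have [t /seg[Ut _]|t /seg[Ut nt] E] := @mean_value_segment R pt f x h.
    exact: smooth_on_derivable sf Ut.
  have -> : (f \o shift x - (cst (f x) + grad_form f x)) h =
     (f (x + h) - f x) - grad_form f x h.
    by rewrite -[LHS]/(f (h + x) - (f x + grad_form f x h)) opprD addrA [h + x]addrC.
  rewrite E (derive_smooth_partial _ oU sf Ut) /grad_form -sumrB.
  apply: le_trans (ler_norm_sum _ _ _) _.
  apply: (@le_trans _ _ (\sum_(l < n) `|h| * (eps / n.+1%:R))).
    apply: ler_sum => l _; rewrite -mulrBr normrM ler_pM//; first exact: norm_coord_le.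
    by rewrite distrC ltW.
  rewrite sumr_const card_ord -mulrnAr [leRHS]mulrC ler_wpM2l//.
  rewrite -mulr_natr -mulrA ler_piMr ?(ltW eps0)//.
  by rewrite mulrC ler_pdivrMr// mul1r ler_nat.
have dE := diff_unique (@grad_form_continuous f x) H.
split; last by rewrite dE.
by apply/diff_locallyP; rewrite dE; split; first exact: grad_form_continuous.
Unshelve. all: by end_near. Qed.

End FiniteDim.

Section ChainRule.
Variables (R : realType) (V : normedModType R) (n : nat).
Implicit Types (phi : 'I_n -> V -> R) (f : 'rV[R]_n -> R).

Definition row_fun phi (x : V) : 'rV[R]_n := \row_i phi i x.

(** The maps [phi i] are only known to be derivable along v. Restricting them to the line through x
    gives a curve in a finite-dimensional space, and for a function of one variable derivability is
    differentiability, so the usual chain rule applies. *)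
Lemma is_derive_comp phi f U x v : open U -> smooth_on U f -> U (row_fun phi x) ->
  (forall i, derivable (phi i) x v) ->
  is_derive x v (f \o row_fun phi)
    (\sum_i 'D_('e_i) f (row_fun phi x) * 'D_v (phi i) x).
Proof.
move=> oU sf Ux dphi.
have [dfx dE] := smooth_diff oU sf Ux.
have dr : derivable (row_fun phi) x v.
  apply/derivable_mxP => i j; rewrite /row_fun.
  rewrite (_ : (fun y => _) = phi j)//.
  by apply/funext => y; rewrite mxE.
have rE i : 'D_v (row_fun phi) x 0 i = 'D_v (phi i) x.
  rewrite derive_mx// mxE; congr (derive _ x v).
  by apply/funext => y; rewrite mxE.
pose c (t : R) := row_fun phi (x + t *: v).
have dc : is_derive (0 : R) 1 c ('D_v (row_fun phi) x).
  have dr' : derivable (row_fun phi) (x + (0 : R) *: v) v by rewrite scale0r addr0; exact: dr.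
  by have := derive_line dr'; rewrite scale0r addr0 => dc; exact: dc.
have c0 : c 0 = row_fun phi x by rewrite /c scale0r addr0.
have dfc : differentiable (f \o c) (0 : R).
  apply: differentiable_comp; first by apply/derivable1_diffP; case: dc.
  by rewrite c0.
have E1 : is_derive (0 : R) 1 (f \o c) (\sum_i 'D_('e_i) f (row_fun phi x) * 'D_v (phi i) x).
  split; first exact/derivable1_diffP.
  rewrite (deriveE _ dfc) diff_comp//=; first last.
  - by rewrite c0.
  - by apply/derivable1_diffP; case: dc.
  rewrite c0 dE -deriveE; last by apply/derivable1_diffP; case: dc.
  case: dc => _ ->; rewrite /grad_form; apply: eq_bigr => i _; by rewrite rE mulrC.
have growE : (fun h : R => h^-1 *: (((f \o row_fun phi) \o shift x) (h *: v) - (f \o row_fun phi) x))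
  = (fun h => h^-1 *: (((f \o c) \o shift 0) (h *: 1) - (f \o c) 0)).
  apply/funext => h; rewrite /= /c scale0r !addr0 [h%:A]mulr1.
  by rewrite [x + h *: v]addrC.
by case: E1; rewrite /derivable /derive -growE.
Qed.

Lemma Cr_comp r phi f U U' : open U -> open U' -> smooth_on U f ->
  (forall x, U' x -> U (row_fun phi x)) ->
  (forall i, Cr r U' (phi i)) -> Cr r U' (f \o row_fun phi).
Proof.
move=> oU oU' sf UU'; elim: r f sf => [|r IH] f sf Cp.
  split=> // x U'x; apply: continuous_comp; last exact: smooth_on_continuous sf (UU' _ U'x).
  apply/continuous_rowP => i; rewrite /row_fun (_ : (fun y => _) = phi i).
    exact: Cr_continuous (Cp i) U'x.
  by apply/funext => y; rewrite mxE.
apply: (@CrS _ _ _ _ _ (fun v x => \sum_i ('D_('e_i) f \o row_fun phi) x * 'D_v (phi i) x)) => //.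
- move=> x U'x; apply: continuous_comp; last exact: smooth_on_continuous sf (UU' _ U'x).
  apply/continuous_rowP => i; rewrite /row_fun (_ : (fun y => _) = phi i).
    exact: Cr_continuous (Cp i) U'x.
  by apply/funext => y; rewrite mxE.
- move=> v x U'x; apply: (is_derive_comp oU sf (UU' _ U'x)) => i.
  by have [] := Cr_is_derive v (Cp i) U'x.
- move=> v.
  have H (s : seq 'I_n) : Cr r U' (fun x => \sum_(i <- s) ('D_('e_i) f \o row_fun phi) x * 'D_v (phi i) x).
    elim: s => [|i s IHs].
      by apply: Cr_eq (Cr_cst r 0 oU') => // x _; rewrite big_nil.
    apply: (Cr_eq oU' (f := fun x => ('D_('e_i) f \o row_fun phi) x * 'D_v (phi i) x +
        \sum_(i <- s) ('D_('e_i) f \o row_fun phi) x * 'D_v (phi i) x)).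
      by move=> x _; rewrite big_cons.
    apply: Cr_add => //; apply: Cr_mul => //; last exact: Cr_derive.
    by apply: IH; [exact: smooth_on_derive|move=> j; exact: Cr_pred].
  exact: H.
Qed.

Lemma smooth_on_comp phi f U U' : open U -> open U' -> smooth_on U f ->
  (forall x, U' x -> U (row_fun phi x)) ->
  (forall i, smooth_on U' (phi i)) -> smooth_on U' (f \o row_fun phi).
Proof.
move=> oU oU' sf UU' sp; apply/smooth_onP => r.
exact: (Cr_comp oU oU' sf UU' (fun i => (smooth_onP _ _).1 (sp i) r)).
Qed.

End ChainRule.

(** * Germs at a point and their partial derivatives *)

Section Germs.
Variables (R : realType) (n : nat).
Local Notation pt := 'rV[R]_n.
Implicit Types (f g : pt -> R) (a : pt).

Lemma near_openP a (P : pt -> Prop) : (\forall y \near a, P y) ->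
  exists U : set pt, [/\ open U, U a & forall y, U y -> P y].
Proof.
move=> nP; have : nbhs a P by [].
by rewrite nbhsE => -[U [oU Ua] UP]; exists U; split.
Qed.

Lemma near_forall_fin (I : finType) a (P : I -> pt -> Prop) :
  (forall i, \forall y \near a, P i y) -> \forall y \near a, forall i, P i y.
Proof. by move=> H; apply: (filter_forall (F := nbhs a)). Qed.

(* Opaque, like [partial] below, since [done] may otherwise unfold limits. *)
Fact smooth_at_subproof : {P : pt -> (pt -> R) -> Prop |
  forall a f, P a f <-> exists U, [/\ open U, U a & smooth_on U f]}.
Proof. by exists (fun a f => exists U, [/\ open U, U a & smooth_on U f]). Qed.

Definition smooth_at a f : Prop := sval smooth_at_subproof a f.

Lemma smooth_atP a f : smooth_at a f <-> exists U, [/\ open U, U a & smooth_on U f].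
Proof. exact: (svalP smooth_at_subproof). Qed.

Fact partial_subproof : {p : 'I_n -> (pt -> R) -> pt -> R |
  forall l f, p l f = 'D_('e_l) f}.
Proof. by exists (fun l f => 'D_('e_l) f). Qed.

Definition partial (l : 'I_n) f : pt -> R := sval partial_subproof l f.

Lemma partialE l f : partial l f = 'D_('e_l) f.
Proof. exact: (svalP partial_subproof). Qed.

Lemma smooth_at_near a f : smooth_at a f -> \forall y \near a, smooth_at y f.
Proof.
by move=> /smooth_atP[U [oU Ua sf]]; apply: (open_nearT oU Ua) => y Uy; apply/smooth_atP; exists U.
Qed.

Lemma smooth_on_at U a f : open U -> U a -> smooth_on U f -> smooth_at a f.
Proof. by move=> oU Ua sf; apply/smooth_atP; exists U. Qed.

Lemma smooth_at_on U f : (forall a, U a -> smooth_at a f) -> smooth_on U f.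
Proof. by move=> H; apply: smooth_on_local => a /H/smooth_atP[U' [? ? ?]]; exists U'. Qed.

Lemma smooth_at_eq a f g : {near a, f =1 g} -> smooth_at a f -> smooth_at a g.
Proof.
move=> fg /smooth_atP[U [oU Ua sf]].
have [V [oV Va Vfg]] := near_openP fg.
apply/smooth_atP; exists (U `&` V); split; [exact: openI|by []|].
apply: (@smooth_on_eq _ _ _ _ f); first exact: openI.
  by move=> y [_ /Vfg].
by apply: smooth_on_subset sf => y [].
Qed.

Lemma smooth_at_common a f g : smooth_at a f -> smooth_at a g ->
  exists U, [/\ open U, U a, smooth_on U f & smooth_on U g].
Proof.
move=> /smooth_atP[U [oU Ua sf]] /smooth_atP[V [oV Va sg]]; exists (U `&` V).
split; [exact: openI|by []| |].
  by apply: smooth_on_subset sf => y [].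
by apply: smooth_on_subset sg => y [].
Qed.

Lemma smooth_at_common_fin (I : finType) a (F : I -> pt -> R) : (forall i, smooth_at a (F i)) ->
  exists U, [/\ open U, U a & forall i, smooth_on U (F i)].
Proof.
move=> sF.
have /near_openP[U [oU Ua UF]] := near_forall_fin (fun i => smooth_at_near (sF i)).
exists U; split; [exact: oU|exact: Ua|move=> i].
by apply: smooth_at_on => y Uy; exact: UF.
Qed.

Lemma smooth_at_cst a c : smooth_at a (fun=> c).
Proof. apply/smooth_atP; exists setT; split=> //; [exact: openT|apply: smooth_on_cst; exact: openT]. Qed.

Lemma smooth_at_coord a i : smooth_at a (fun y => y 0 i).
Proof. apply/smooth_atP; exists setT; split=> //; [exact: openT|apply: smooth_on_coord; exact: openT]. Qed.

Lemma smooth_at_add a f g : smooth_at a f -> smooth_at a g -> smooth_at a (fun y => f y + g y).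
Proof.
move=> sf sg; have [U [oU Ua uf ug]] := smooth_at_common sf sg.
by apply/smooth_atP; exists U; split; [exact: oU|exact: Ua|exact: smooth_on_add].
Qed.

Lemma smooth_at_mul a f g : smooth_at a f -> smooth_at a g -> smooth_at a (fun y => f y * g y).
Proof.
move=> sf sg; have [U [oU Ua uf ug]] := smooth_at_common sf sg.
by apply/smooth_atP; exists U; split; [exact: oU|exact: Ua|exact: smooth_on_mul].
Qed.

Lemma smooth_at_continuous a f : smooth_at a f -> {for a, continuous f}.
Proof. by move=> /smooth_atP[U [oU Ua sf]]; exact: smooth_on_continuous sf Ua. Qed.

Lemma smooth_at_neq0 a f : smooth_at a f -> f a != 0 -> \forall y \near a, f y != 0.
Proof.
move=> /smooth_at_continuous cf fa0.
have oD : open [set y : R | y != 0] by exact: open_neq.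
have := open_nbhs_nbhs (conj oD fa0); exact: cf.
Qed.

Lemma smooth_at_inv a f : smooth_at a f -> f a != 0 -> smooth_at a (fun y => (f y)^-1).
Proof.
move=> sf fa0; have nP : \forall y \near a, smooth_at y f /\ f y != 0.
  by apply: filterI; [exact: smooth_at_near|exact: smooth_at_neq0].
have [U [oU Ua UP]] := near_openP nP.
apply/smooth_atP; exists U; split; [exact: oU|exact: Ua|apply: smooth_on_inv; first exact: oU].
  by move=> y /UP[].
by apply: smooth_at_on => y /UP[].
Qed.

Lemma smooth_at_derivable a f v : smooth_at a f -> derivable f a v.
Proof. by move=> /smooth_atP[U [_ Ua sf]]; exact: smooth_on_derivable sf Ua. Qed.

Lemma smooth_at_partial a f l : smooth_at a f -> smooth_at a (partial l f).
Proof. by move=> /smooth_atP[U [oU Ua sf]]; apply/smooth_atP; exists U; split; [exact: oU|exact: Ua|rewrite partialE; exact: smooth_on_derive]. Qed.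

Lemma partial_eq a f g l : {near a, f =1 g} -> {near a, partial l f =1 partial l g}.
Proof.
by move=> /near_join fg; apply: filterS fg => y ?; rewrite !partialE; exact: near_eq_derive.
Qed.

Lemma partial_cst a c l : partial l (fun=> c) a = 0.
Proof. by rewrite partialE; exact: derive_cst. Qed.

Lemma partial_coord a l i : partial l (fun y => y 0 i) a = (l == i)%:R.
Proof.
have [_ E] := is_derive_coord a ('e_l) i.
by rewrite partialE E mxE eqxx eq_sym.
Qed.

Lemma partial_add a f g l : smooth_at a f -> smooth_at a g ->
  partial l (fun y => f y + g y) a = partial l f a + partial l g a.
Proof. by move=> sf sg; rewrite !partialE; apply: deriveD; exact: smooth_at_derivable. Qed.

Lemma partial_mul a f g l : smooth_at a f -> smooth_at a g ->
  partial l (fun y => f y * g y) a = partial l f a * g a + f a * partial l g a.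
Proof.
move=> sf sg; rewrite !partialE (@deriveM _ _ f g); try exact: smooth_at_derivable.
by rewrite addrC; congr (_ + _); rewrite mulrC.
Qed.

Lemma partial_inv a f l : smooth_at a f -> f a != 0 ->
  partial l (fun y => (f y)^-1) a = - 1 * ((f a)^-1 * (f a)^-1) * partial l f a.
Proof.
move=> sf fa0; rewrite !partialE (deriveV fa0); last exact: smooth_at_derivable.
by rewrite mulN1r -invfM -expr2.
Qed.

Lemma smooth_at_sum (I : Type) (s : seq I) (F : I -> pt -> R) a :
  (forall i, smooth_at a (F i)) -> smooth_at a (fun y => \sum_(i <- s) F i y).
Proof.
move=> sF; elim: s => [|i s IH].
  by rewrite (_ : (fun y => _) = fun=> 0); [exact: smooth_at_cst|apply/funext => y; rewrite big_nil].
rewrite (_ : (fun y => _) = fun y => F i y + \sum_(i <- s) F i y).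
  exact: (smooth_at_add (sF i) IH).
by apply/funext => y; rewrite big_cons.
Qed.

Lemma partial_sum (I : Type) (s : seq I) (F : I -> pt -> R) a l :
  (forall i, smooth_at a (F i)) ->
  partial l (fun y => \sum_(i <- s) F i y) a = \sum_(i <- s) partial l (F i) a.
Proof.
move=> sF; elim: s => [|i s IH].
  rewrite [RHS]big_nil (_ : (fun y => _) = fun=> 0); first exact: partial_cst.
  by apply/funext => y; rewrite big_nil.
rewrite big_cons -IH -partial_add//; last exact: smooth_at_sum.
by congr (partial _ _ _); apply/funext => y; rewrite big_cons.
Qed.

Lemma partial_comm a f l l' : smooth_at a f -> partial l (partial l' f) a = partial l' (partial l f) a.
Proof. by move=> /smooth_atP[U [oU Ua sf]]; rewrite !partialE; exact: derive_smooth_comm sf Ua. Qed.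

Lemma row_fun_continuous (phi : 'I_n -> pt -> R) a : (forall i, smooth_at a (phi i)) ->
  {for a, continuous (row_fun phi)}.
Proof.
move=> sp; apply/continuous_rowP => i.
rewrite (_ : (fun y => _) = phi i); last by apply/funext => y; rewrite mxE.
exact: smooth_at_continuous.
Qed.

Lemma smooth_at_comp (phi : 'I_n -> pt -> R) f a :
  (forall i, smooth_at a (phi i)) -> smooth_at (row_fun phi a) f ->
  smooth_at a (f \o row_fun phi).
Proof.
move=> sp /smooth_atP[U [oU Ua sf]].
have [U' [oU' U'a uphi]] := smooth_at_common_fin sp.
have nP : \forall y \near a, U' y /\ U (row_fun phi y).
  apply: filterI; first exact: (open_nbhs_nbhs (conj oU' U'a)).
  by have := open_nbhs_nbhs (conj oU Ua); exact: (row_fun_continuous sp).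
have [W [oW Wa WP]] := near_openP nP; apply/smooth_atP; exists W; split; [exact: oW|exact: Wa|].
apply: (@smooth_on_comp _ _ _ phi f U W oU oW sf) => [x /WP[]//|i].
by apply: smooth_on_subset (uphi i) => y /WP[].
Qed.

Lemma partial_comp (phi : 'I_n -> pt -> R) f a l :
  (forall i, smooth_at a (phi i)) -> smooth_at (row_fun phi a) f ->
  partial l (f \o row_fun phi) a =
  \sum_i partial i f (row_fun phi a) * partial l (phi i) a.
Proof.
move=> sp /smooth_atP[U [oU Ua sf]].
have dp i : derivable (phi i) a 'e_l by apply: smooth_at_derivable; exact: sp.
have [_ E] := is_derive_comp oU sf Ua dp.
by rewrite partialE E; apply: eq_bigr => i _; rewrite !partialE.
Qed.

Lemma derive_partial a f v : smooth_at a f -> 'D_v f a = \sum_l v 0 l * partial l f a.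
Proof.
move=> /smooth_atP[U [oU Ua sf]]; rewrite (derive_smooth_partial v oU sf Ua).
by apply: eq_bigr => l _; rewrite partialE.
Qed.

End Germs.

Section IteratedPartials.
Variables (R : realType) (n : nat).
Local Notation pt := 'rV[R]_n.
Implicit Types (f g : pt -> R) (a : pt) (ls : seq 'I_n).

Definition ipartial ls f : pt -> R := foldr (@partial R n) f ls.

Lemma ipartialE ls f : ipartial ls f = iterD (map (fun l => 'e_l : pt) ls) f.
Proof. by elim: ls => //= l ls <-; rewrite partialE. Qed.

Lemma ipartial_rcons ls l f : ipartial (rcons ls l) f = ipartial ls (partial l f).
Proof. by rewrite /ipartial foldr_rcons. Qed.

Lemma ipartial_cat ls ls' f : ipartial (ls ++ ls') f = ipartial ls (ipartial ls' f).
Proof. by rewrite /ipartial foldr_cat. Qed.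

Lemma smooth_at_ipartial a ls f : smooth_at a f -> smooth_at a (ipartial ls f).
Proof. by move=> sf; elim: ls => //= l ls; exact: smooth_at_partial. Qed.

Lemma ipartial_eq a ls f g : {near a, f =1 g} -> {near a, ipartial ls f =1 ipartial ls g}.
Proof. by move=> fg; elim: ls => //= l ls; exact: partial_eq. Qed.

Lemma ipartial_partial a ls l f : smooth_at a f ->
  ipartial ls (partial l f) a = partial l (ipartial ls f) a.
Proof.
elim: ls a => //= k ls IH a sf.
have nE : {near a, ipartial ls (partial l f) =1 partial l (ipartial ls f)}.
  by apply: filterS (smooth_at_near sf) => y; exact: IH.
rewrite (nbhs_singleton (partial_eq k nE)).
by rewrite partial_comm//; exact: smooth_at_ipartial.
Qed.

Lemma ipartial_perm a ls ls' f : smooth_at a f -> perm_eq ls ls' ->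
  ipartial ls f a = ipartial ls' f a.
Proof.
elim: ls a ls' => [|l ls IH] a ls' sf; first by rewrite perm_sym => /perm_nilP ->.
move=> pe; have lin : l \in ls' by rewrite -(perm_mem pe) mem_head.
move: pe; case/splitPr: lin => p1 p2 pe.
have pe' : perm_eq ls (p1 ++ p2).
  by rewrite -(perm_cons l) (perm_trans pe)// perm_catC/= perm_cons perm_catC.
rewrite ipartial_cat /= ipartial_partial; last exact: smooth_at_ipartial.
rewrite -ipartial_cat; apply: (nbhs_singleton (partial_eq l _)).
by apply: filterS (smooth_at_near sf) => y sy; exact: IH.
Qed.

End IteratedPartials.

(** * Fields of functions, and matrices over them *)

Section SubfieldOn.
Variables (R : realType) (T : Type).
Implicit Types (f g : T -> R).

(* Functions nonvanishing on E only are inverted. *)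
Record subfield_on (E : set T) (P : (T -> R) -> Prop) : Prop := SubfieldOn {
  sf_cst : forall c, P (fun=> c);
  sf_add : forall f g, P f -> P g -> P (fun t => f t + g t);
  sf_mul : forall f g, P f -> P g -> P (fun t => f t * g t);
  sf_inv : forall f, (forall t, E t -> f t != 0) -> P f -> P (fun t => (f t)^-1) }.

Variables (E : set T) (P : (T -> R) -> Prop).
Hypothesis sfP : subfield_on E P.

Lemma sf_opp f : P f -> P (fun t => - f t).
Proof.
move=> Pf; rewrite (_ : (fun t => _) = fun t => -1 * f t).
  exact: (sf_mul sfP (sf_cst sfP _) Pf).
by apply/funext => t; rewrite mulN1r.
Qed.

Lemma sf_sub f g : P f -> P g -> P (fun t => f t - g t).
Proof. by move=> Pf Pg; exact: (sf_add sfP Pf (sf_opp Pg)). Qed.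

Lemma sf_div f g : (forall t, E t -> g t != 0) -> P f -> P g -> P (fun t => f t / g t).
Proof. by move=> g0 Pf Pg; exact: (sf_mul sfP Pf (sf_inv sfP g0 Pg)). Qed.

Lemma sf_sum (I : Type) (s : seq I) (Q : pred I) (F : I -> T -> R) :
  (forall i, P (F i)) -> P (fun t => \sum_(i <- s | Q i) F i t).
Proof.
move=> PF; elim: s => [|i s IH].
  rewrite (_ : (fun t => _) = fun=> 0); first exact: (sf_cst sfP).
  by apply/funext => t; rewrite big_nil.
case Qi : (Q i).
  rewrite (_ : (fun t => _) = fun t => F i t + \sum_(i <- s | Q i) F i t).
    exact: (sf_add sfP (PF i) IH).
  by apply/funext => t; rewrite big_cons Qi.
rewrite (_ : (fun t => _) = fun t => \sum_(i <- s | Q i) F i t)//.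
by apply/funext => t; rewrite big_cons Qi.
Qed.

Lemma sf_prod (I : Type) (s : seq I) (Q : pred I) (F : I -> T -> R) :
  (forall i, P (F i)) -> P (fun t => \prod_(i <- s | Q i) F i t).
Proof.
move=> PF; elim: s => [|i s IH].
  rewrite (_ : (fun t => _) = fun=> 1); first exact: (sf_cst sfP).
  by apply/funext => t; rewrite big_nil.
case Qi : (Q i).
  rewrite (_ : (fun t => _) = fun t => F i t * \prod_(i <- s | Q i) F i t).
    exact: (sf_mul sfP (PF i) IH).
  by apply/funext => t; rewrite big_cons Qi.
rewrite (_ : (fun t => _) = fun t => \prod_(i <- s | Q i) F i t)//.
by apply/funext => t; rewrite big_cons Qi.
Qed.

Lemma sf_exp f k : P f -> P (fun t => f t ^+ k).
Proof.
move=> Pf; rewrite (_ : (fun t => _) = fun t => \prod_(i < k) f t).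
  exact: sf_prod.
by apply/funext => t; rewrite prodr_const card_ord.
Qed.

Definition in_mx p q (A : T -> 'M[R]_(p, q)) := forall i j, P (fun t => A t i j).

Lemma in_mx_mul p q r (A : T -> 'M[R]_(p, q)) (B : T -> 'M[R]_(q, r)) :
  in_mx A -> in_mx B -> in_mx (fun t => A t *m B t).
Proof.
move=> PA PB i j; rewrite (_ : (fun t => _) = fun t => \sum_k A t i k * B t k j).
  by apply: sf_sum => k; exact: (sf_mul sfP (PA i k) (PB k j)).
by apply/funext => t; rewrite mxE.
Qed.

Lemma in_mx_add p q (A B : T -> 'M[R]_(p, q)) :
  in_mx A -> in_mx B -> in_mx (fun t => A t + B t).
Proof.
move=> PA PB i j; rewrite (_ : (fun t => _) = fun t => A t i j + B t i j).
  exact: (sf_add sfP (PA i j) (PB i j)).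
by apply/funext => t; rewrite mxE.
Qed.

Lemma in_mx_sub p q (A B : T -> 'M[R]_(p, q)) :
  in_mx A -> in_mx B -> in_mx (fun t => A t - B t).
Proof.
move=> PA PB i j; rewrite (_ : (fun t => _) = fun t => A t i j - B t i j).
  exact: (sf_sub (PA i j) (PB i j)).
by apply/funext => t; rewrite !mxE.
Qed.

Lemma in_mx_scale p q f (A : T -> 'M[R]_(p, q)) :
  P f -> in_mx A -> in_mx (fun t => f t *: A t).
Proof.
move=> Pf PA i j; rewrite (_ : (fun t => _) = fun t => f t * A t i j).
  exact: (sf_mul sfP Pf (PA i j)).
by apply/funext => t; rewrite mxE.
Qed.

Lemma in_mx_tr p q (A : T -> 'M[R]_(p, q)) : in_mx A -> in_mx (fun t => (A t)^T).
Proof.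
move=> PA i j; rewrite (_ : (fun t => _) = fun t => A t j i); first exact: PA.
by apply/funext => t; rewrite mxE.
Qed.

Lemma sf_det p (A : T -> 'M[R]_p) : in_mx A -> P (fun t => \det (A t)).
Proof.
move=> PA; apply: sf_sum => s; apply: (sf_mul sfP (sf_cst sfP _)).
by apply: sf_prod => i; exact: PA.
Qed.

Lemma in_mx_adj p (A : T -> 'M[R]_p) : in_mx A -> in_mx (fun t => \adj (A t)).
Proof.
move=> PA i j; rewrite (_ : (fun t => _) =
    fun t => (-1) ^+ (j + i) * \det (row' j (col' i (A t)))).
  apply: (sf_mul sfP (sf_cst sfP _)); apply: sf_det => k l.
  rewrite (_ : (fun t => _) = fun t => A t (lift j k) (lift i l)); first exact: PA.
  by apply/funext => t; rewrite !mxE.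
by apply/funext => t; rewrite mxE.
Qed.

Lemma in_mx_inv p (A : T -> 'M[R]_p) : (forall t, E t -> \det (A t) != 0) ->
  in_mx A -> in_mx (fun t => (\det (A t))^-1 *: \adj (A t)).
Proof.
move=> A0 PA; apply: in_mx_scale; last exact: in_mx_adj.
by apply: (sf_inv sfP A0); exact: sf_det.
Qed.

End SubfieldOn.

(** * Derivatives at a moving point, with values in a field of functions *)

Section JetsIn.
Variables (R : realType) (n : nat) (Gam : Type) (G : set Gam).
Variable K : (Gam -> R) -> Prop.
Hypothesis sfK : subfield_on G K.
Hypothesis K_ext : forall f g, (forall c, G c -> f c = g c) -> K f -> K g.
Local Notation pt := 'rV[R]_n.
Implicit Types (f g : Gam * pt -> R) (b : Gam -> pt).

Lemma near_all (a : pt) (P : pt -> Prop) : (forall y, P y) -> \forall y \near a, P y.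
Proof. by move=> H; exact: filterE. Qed.

Definition gpartial l g : Gam * pt -> R :=
  fun x => partial l (fun y => g (x.1, y)) x.2.

Definition germ_eq b f g := forall c, G c -> \forall y \near b c, f (c, y) = g (c, y).

(* K is a class of functions of the parameter c: smooth functions, functions determined by
   given ones, rational functions, or, for two parameters, functions taking equal values.
   The derivatives of g (c, _) of order at most r at b c, as functions of c, are in K. *)
Fixpoint jets_in b r g : Prop :=
  [/\ forall c, G c -> smooth_at (b c) (fun y => g (c, y)),
      K (fun c => g (c, b c)) &
      if r is r'.+1 then forall l, jets_in b r' (gpartial l g) else True].

Definition graph b : set (Gam * pt) := [set x | G x.1 /\ x.2 = b x.1].

Lemma jets_in_smooth b r g c : jets_in b r g -> G c -> smooth_at (b c) (fun y => g (c, y)).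
Proof. by case: r => [|r] [sg _ _]; exact: sg. Qed.

Lemma jets_in_val b r g : jets_in b r g -> K (fun c => g (c, b c)).
Proof. by case: r => [|r] []. Qed.

Lemma jets_in_partial b r g l : jets_in b r.+1 g -> jets_in b r (gpartial l g).
Proof. by case=> _ _; apply. Qed.

Lemma gpartial_eq b l f g : germ_eq b f g -> germ_eq b (gpartial l f) (gpartial l g).
Proof. by move=> fg c Gc; exact: (partial_eq l (fg c Gc)). Qed.

Lemma jets_in_eq b r f g : germ_eq b f g -> jets_in b r f -> jets_in b r g.
Proof.
elim: r f g => [|r IH] f g fg [sf vf df]; split=> //.
- by move=> c Gc; exact: smooth_at_eq (fg c Gc) (sf c Gc).
- by apply: K_ext vf => c Gc; exact: (nbhs_singleton (fg c Gc)).
- by move=> c Gc; exact: smooth_at_eq (fg c Gc) (sf c Gc).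
- by apply: K_ext vf => c Gc; exact: (nbhs_singleton (fg c Gc)).
- by move=> l; apply: IH (df l); exact: gpartial_eq.
Qed.

Lemma jets_in_pred b r g : jets_in b r.+1 g -> jets_in b r g.
Proof.
elim: r g => [|r IH] g [sg vg dg]; split=> //.
by move=> l; apply: IH; exact: dg.
Qed.

Lemma jets_in_le b r r' g : (r <= r')%N -> jets_in b r' g -> jets_in b r g.
Proof.
move=> /subnKC <-; elim: (r' - r)%N => [|d IH]; first by rewrite addn0.
by rewrite addnS => /jets_in_pred.
Qed.

(** Common induction step of the closure properties: it suffices to have a formula for the
    derivatives near each base point, and to treat that formula at the lower order. *)
Lemma jets_inS b r g (dg : 'I_n -> Gam * pt -> R) :
  (forall c, G c -> smooth_at (b c) (fun y => g (c, y))) ->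
  K (fun c => g (c, b c)) ->
  (forall l, germ_eq b (dg l) (gpartial l g)) ->
  (forall l, jets_in b r (dg l)) -> jets_in b r.+1 g.
Proof. by move=> sg vg E jd; split=> // l; apply: jets_in_eq (jd l); exact: E. Qed.

Lemma jets_in_base b r (k : Gam -> R) : K k -> jets_in b r (fun x => k x.1).
Proof.
elim: r k => [|r IH] k Kk.
  by split=> // c _; exact: (smooth_at_cst _ (k c)).
apply: (@jets_inS _ _ _ (fun _ _ => 0)) => //.
- by move=> c _; exact: (smooth_at_cst _ (k c)).
- by move=> l c _; apply: near_all => y; rewrite /gpartial /= partial_cst.
- by move=> l; apply: (IH (fun=> 0)); exact: (sf_cst sfK).
Qed.

Lemma jets_in_cst b r k : jets_in b r (fun=> k).
Proof. by apply: (jets_in_base b r (k := fun=> k)); exact: (sf_cst sfK). Qed.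

Lemma jets_in_add b r f g : jets_in b r f -> jets_in b r g -> jets_in b r (fun x => f x + g x).
Proof.
elim: r f g => [|r IH] f g jf jg.
  split=> [c Gc||//].
    exact: (smooth_at_add (jets_in_smooth jf Gc) (jets_in_smooth jg Gc)).
  exact: (sf_add sfK (jets_in_val jf) (jets_in_val jg)).
apply: (@jets_inS _ _ _ (fun l x => gpartial l f x + gpartial l g x)).
- by move=> c Gc; exact: (smooth_at_add (jets_in_smooth jf Gc) (jets_in_smooth jg Gc)).
- exact: (sf_add sfK (jets_in_val jf) (jets_in_val jg)).
- move=> l c Gc.
  apply: filterS2 (smooth_at_near (jets_in_smooth jf Gc))
    (smooth_at_near (jets_in_smooth jg Gc)) => y sf sg.
  by rewrite /gpartial /= partial_add.
- by move=> l; apply: IH; exact: jets_in_partial.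
Qed.

Lemma jets_in_mul b r f g : jets_in b r f -> jets_in b r g -> jets_in b r (fun x => f x * g x).
Proof.
elim: r f g => [|r IH] f g jf jg.
  split=> [c Gc||//].
    exact: (smooth_at_mul (jets_in_smooth jf Gc) (jets_in_smooth jg Gc)).
  exact: (sf_mul sfK (jets_in_val jf) (jets_in_val jg)).
apply: (@jets_inS _ _ _ (fun l x => gpartial l f x * g x + f x * gpartial l g x)).
- by move=> c Gc; exact: (smooth_at_mul (jets_in_smooth jf Gc) (jets_in_smooth jg Gc)).
- exact: (sf_mul sfK (jets_in_val jf) (jets_in_val jg)).
- move=> l c Gc.
  apply: filterS2 (smooth_at_near (jets_in_smooth jf Gc))
    (smooth_at_near (jets_in_smooth jg Gc)) => y sf sg.
  by rewrite /gpartial /= partial_mul.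
- move=> l; apply: jets_in_add; apply: IH; try exact: jets_in_partial; exact: jets_in_pred.
Qed.

Lemma jets_in_inv b r f : (forall x, graph b x -> f x != 0) -> jets_in b r f ->
  jets_in b r (fun x => (f x)^-1).
Proof.
move=> f0; have f0' c : G c -> f (c, b c) != 0 by move=> Gc; apply: f0.
elim: r => [|r IH] jf.
  split=> [c Gc||//].
    exact: (smooth_at_inv (jets_in_smooth jf Gc) (f0' c Gc)).
  exact: (sf_inv sfK f0' (jets_in_val jf)).
apply: (@jets_inS _ _ _ (fun l x => - 1 * ((f x)^-1 * (f x)^-1) * gpartial l f x)).
- by move=> c Gc; exact: (smooth_at_inv (jets_in_smooth jf Gc) (f0' c Gc)).
- exact: (sf_inv sfK f0' (jets_in_val jf)).
- move=> l c Gc; have sf := jets_in_smooth jf Gc.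
  by apply: filterS2 (smooth_at_near sf) (smooth_at_neq0 sf (f0' c Gc)) => y sy fy; rewrite /gpartial /= partial_inv.
- have IJ := IH (jets_in_pred jf).
  move=> l; apply: jets_in_mul; last exact: jets_in_partial.
  by apply: jets_in_mul; [exact: jets_in_cst|exact: jets_in_mul].
Qed.

(** The class is again a field, now of functions of the pair (c, y), with division allowed by what
    does not vanish on the graph of b. Matrix products, determinants and inverses are therefore
    available at the level of jets. *)
Lemma sf_jets_in b r : subfield_on (graph b) (jets_in b r).
Proof.
split; [exact: jets_in_cst|exact: jets_in_add|exact: jets_in_mul|].
by move=> f; exact: jets_in_inv.
Qed.

Lemma jets_in_coord b r i : K (fun c => b c 0 i) -> jets_in b r (fun x => x.2 0 i).
Proof.
case: r => [|r] Kb.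
  by split=> // c _; exact: smooth_at_coord.
apply: (@jets_inS _ _ _ (fun l _ => (l == i)%:R)) => //.
- by move=> c _; exact: smooth_at_coord.
- by move=> l c _; apply: near_all => y; rewrite /gpartial /= partial_coord.
- by move=> l; exact: jets_in_cst.
Qed.

Definition rowf (phi : 'I_n -> Gam * pt -> R) (x : Gam * pt) : pt := \row_i phi i x.
Definition compf f (phi : 'I_n -> Gam * pt -> R) (x : Gam * pt) : R := f (x.1, rowf phi x).
Definition base_image (phi : 'I_n -> Gam * pt -> R) b (c : Gam) : pt := rowf phi (c, b c).

Lemma gpartial_comp b phi f l :
  (forall i c, G c -> smooth_at (b c) (fun y => phi i (c, y))) ->
  (forall c, G c -> smooth_at (base_image phi b c) (fun y => f (c, y))) ->
  germ_eq b (fun x => \sum_i compf (gpartial i f) phi x * gpartial l (phi i) x)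
    (gpartial l (compf f phi)).
Proof.
move=> sp sf c Gc.
have np : \forall y \near b c, forall i, smooth_at y (fun y => phi i (c, y)).
  by apply: near_forall_fin => i; exact: smooth_at_near (sp i c Gc).
have nf : \forall y \near b c, smooth_at (row_fun (fun i y => phi i (c, y)) y) (fun y => f (c, y)).
  exact: (row_fun_continuous (fun i => sp i c Gc) (smooth_at_near (sf c Gc))).
apply: filterS2 np nf => y spy sfy.
by rewrite /gpartial /=; exact: (esym (partial_comp l spy sfy)).
Qed.

Lemma smooth_at_compf b phi f c : G c ->
  (forall i c, G c -> smooth_at (b c) (fun y => phi i (c, y))) ->
  smooth_at (base_image phi b c) (fun y => f (c, y)) ->
  smooth_at (b c) (fun y => compf f phi (c, y)).
Proof.
by move=> Gc sp sf; exact: (@smooth_at_comp R n (fun i y => phi i (c, y)) (fun y => f (c, y)) (b c)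
  (fun i => sp i c Gc) sf).
Qed.

Lemma jets_in_comp b r phi f : (forall i, jets_in b r (phi i)) ->
  jets_in (base_image phi b) r f -> jets_in b r (compf f phi).
Proof.
move=> jp; have sp i c : G c -> smooth_at (b c) (fun y => phi i (c, y)).
  exact: (jets_in_smooth (jp i)).
elim: r jp f => [|r IH] jp f jf.
  split=> [c Gc||//]; last exact: (jets_in_val jf).
  by apply: (smooth_at_compf Gc sp); exact: (jets_in_smooth jf Gc).
apply: (@jets_inS _ _ _ (fun l x => \sum_i compf (gpartial i f) phi x * gpartial l (phi i) x)).
- by move=> c Gc; apply: (smooth_at_compf Gc sp); exact: (jets_in_smooth jf Gc).
- exact: (jets_in_val jf).
- by move=> l; apply: gpartial_comp => // c Gc; exact: (jets_in_smooth jf Gc).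
- move=> l; apply: (sf_sum (sf_jets_in b r)) => i.
  apply: jets_in_mul; last exact: jets_in_partial.
  by apply: IH; [move=> j; exact: jets_in_pred|exact: jets_in_partial].
Qed.

Definition gjac (phi : 'I_n -> Gam * pt -> R) (x : Gam * pt) : 'M[R]_n :=
  \matrix_(i, l) gpartial i (phi l) x.

Lemma jets_in_gjac b r phi : (forall i, jets_in b r.+1 (phi i)) -> in_mx (jets_in b r) (gjac phi).
Proof.
move=> jp i l; rewrite (_ : (fun x => _) = gpartial i (phi l)); first exact: jets_in_partial.
by apply/funext => x; rewrite mxE.
Qed.

(** Converse of the chain rule: the derivatives of f at the image point solve a linear system whose
    matrix is the Jacobian of phi and whose right-hand side consists of the derivatives of the
    composite. *)
Lemma jets_in_compV b r phi f :
  (forall c, G c -> \det (gjac phi (c, b c)) != 0) ->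
  (forall i, jets_in b r (phi i)) ->
  (forall c, G c -> smooth_at (base_image phi b c) (fun y => f (c, y))) ->
  jets_in b r (compf f phi) -> jets_in (base_image phi b) r f.
Proof.
move=> det0 jp; have sp i c : G c -> smooth_at (b c) (fun y => phi i (c, y)).
  exact: (jets_in_smooth (jp i)).
elim: r jp f => [|r IH] jp f sf jf.
  by split=> //; exact: (jets_in_val jf).
split=> [//||l]; first exact: (jets_in_val jf).
have jP := fun i => jets_in_pred (jp i).
apply: (IH jP).
  by move=> c Gc; exact: (smooth_at_partial l (sf c Gc)).
have jJ := jets_in_gjac jp.
have JI : in_mx (jets_in b r) (fun x => (\det (gjac phi x))^-1 *: \adj (gjac phi x)).
  by apply: (in_mx_inv (sf_jets_in b r)) => // -[c y] /= [/= Gc ->]; exact: det0.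
apply: (@jets_in_eq _ _ (fun x => \sum_i ((\det (gjac phi x))^-1 *: \adj (gjac phi x)) l i *
    gpartial i (compf f phi) x)); last first.
  apply: (sf_sum (sf_jets_in b r)) => i; apply: jets_in_mul; first exact: JI.
  exact: jets_in_partial.
move=> c Gc.
have nE : \forall y \near b c, forall i,
    \sum_j compf (gpartial j f) phi (c, y) * gpartial i (phi j) (c, y) =
    gpartial i (compf f phi) (c, y).
  by apply: near_forall_fin => i; exact: (gpartial_comp i sp sf Gc).
have nD : \forall y \near b c, \det (gjac phi (c, y)) != 0.
  have jD := sf_det (sf_jets_in b r) jJ.
  exact: (smooth_at_neq0 (jets_in_smooth jD Gc) (det0 c Gc)).
apply: filterS2 nE nD => y Ey Dy.
set J := gjac phi (c, y) in Dy *.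
pose F := \col_j compf (gpartial j f) phi (c, y).
have -> : \sum_i ((\det J)^-1 *: \adj J) l i * gpartial i (compf f phi) (c, y) =
    (((\det J)^-1 *: \adj J) *m (J *m F)) l 0.
  rewrite mxE; apply: eq_bigr => i _; congr (_ * _); rewrite -Ey mxE.
  by apply: eq_bigr => j _; rewrite !mxE mulrC.
by rewrite mulmxA -scalemxAl mul_adj_mx scale_scalar_mx mulVf// mul1mx mxE.
Qed.

Lemma jets_in_ipartial b r g ls : jets_in b r g -> (size ls <= r)%N ->
  K (fun c => ipartial ls (fun y => g (c, y)) (b c)).
Proof.
elim/last_ind: ls r g => [|ls l IH] r g jg; first by move=> _; exact: (jets_in_val jg).
rewrite size_rcons; case: r jg => // r jg lr.
have := IH r _ (jets_in_partial l jg) lr.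
by apply: K_ext => c _; rewrite ipartial_rcons.
Qed.

Lemma ipartial_jets_in b r g : (forall c, G c -> smooth_at (b c) (fun y => g (c, y))) ->
  (forall ls, (size ls <= r)%N -> K (fun c => ipartial ls (fun y => g (c, y)) (b c))) ->
  jets_in b r g.
Proof.
elim: r g => [|r IH] g sg Kg; first by split=> //; exact: (Kg [::]).
split=> //; first exact: (Kg [::]).
move=> l; apply: IH => [c Gc|ls lr]; first exact: (smooth_at_partial l (sg c Gc)).
have := Kg (rcons ls l); rewrite size_rcons => /(_ lr).
by apply: K_ext => c _; rewrite ipartial_rcons.
Qed.

End JetsIn.

(** * Monomials, multi-indices and Taylor polynomials *)

Section Monomials.
Variables (R : realType) (n : nat).
Local Notation pt := 'rV[R]_n.
Implicit Types (a b y : pt) (l j : 'I_n) (e : 'I_n -> nat).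

(** Divided powers: a derivative lowers the exponent without introducing a factor, so that the
    coefficients of a polynomial in these are exactly its derivatives at b. *)
Definition pw b j k (y : pt) : R := (y 0 j - b 0 j) ^+ k / k`!%:R.

Definition mono b e (y : pt) : R := \prod_j pw b j (e j) y.

Lemma smooth_at_pw a b j k : smooth_at a (pw b j k).
Proof.
rewrite /pw; elim: k => [|k IH].
  rewrite (_ : (fun y => _) = fun=> 1); first exact: smooth_at_cst.
  by apply/funext => y; rewrite expr0 fact0 divr1.
rewrite (_ : (fun y : pt => _) = fun y : pt => ((y 0 j + - b 0 j) * k.+1%:R^-1) *
    ((y 0 j - b 0 j) ^+ k / k`!%:R)).
  apply: smooth_at_mul IH; apply: smooth_at_mul; last exact: smooth_at_cst.
  by apply: smooth_at_add; [exact: smooth_at_coord|exact: smooth_at_cst].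
by apply/funext => y; rewrite factS natrM invfM exprS mulrACA.
Qed.

Lemma partial_pw b l j k y : partial l (pw b j k) y =
  if (l == j) && (0 < k)%N then pw b j k.-1 y else 0.
Proof.
elim: k => [|k IH].
  rewrite andbF (_ : pw b j 0 = fun=> 1); first exact: partial_cst.
  by apply/funext => z; rewrite /pw expr0 fact0 divr1.
rewrite andbT (_ : pw b j k.+1 = fun y : pt => ((y 0 j + - b 0 j) * k.+1%:R^-1) * pw b j k y);
  last by apply/funext => z; rewrite /pw factS natrM invfM exprS mulrACA.
have s1 : smooth_at y (fun y : pt => y 0 j + - b 0 j).
  by apply: smooth_at_add; [exact: smooth_at_coord|exact: smooth_at_cst].
have s2 : smooth_at y (fun y : pt => (y 0 j + - b 0 j) * k.+1%:R^-1).
  by apply: smooth_at_mul s1 _; exact: smooth_at_cst.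
rewrite (partial_mul l s2 (smooth_at_pw y b j k)) IH.
rewrite (partial_mul l s1 (smooth_at_cst y _)).
rewrite (partial_add l (smooth_at_coord y j) (smooth_at_cst y _)).
rewrite !partial_cst partial_coord mulr0 !addr0.
case: (l == j) => /=; last by rewrite !mul0r mulr0 addr0.
rewrite mul1r; case: k {IH s2} => [|k] /=; first by rewrite mulr0 addr0 invr1 mul1r.
rewrite /pw factS natrM invfM exprS.
have k0 : k.+1%:R != 0 :> R by rewrite pnatr_eq0.
have k1 : k.+2%:R != 0 :> R by rewrite pnatr_eq0.
have kE : k.+2%:R = k.+1%:R + 1 :> R by rewrite -[in LHS]addn1 natrD.
have f0 : (k`!)%:R != 0 :> R by rewrite pnatr_eq0 -lt0n fact_gt0.
move: (y 0 j - b 0 j) => z; move: k0 k1 f0; rewrite kE.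
move: (k.+1%:R : R) (k`!%:R : R) (z ^+ k) => A B C A0 A1 B0.
by field; rewrite A0 A1 B0.
Qed.

Lemma smooth_at_prod (I : Type) (s : seq I) (P : pred I) (F : I -> pt -> R) a :
  (forall i, smooth_at a (F i)) -> smooth_at a (fun y => \prod_(i <- s | P i) F i y).
Proof.
move=> sF; elim: s => [|i s IH].
  rewrite (_ : (fun y => _) = fun=> 1); first exact: smooth_at_cst.
  by apply/funext => y; rewrite big_nil.
case Pi : (P i).
  rewrite (_ : (fun y => _) = fun y => F i y * \prod_(i <- s | P i) F i y).
    exact: (smooth_at_mul (sF i) IH).
  by apply/funext => y; rewrite big_cons Pi.
rewrite (_ : (fun y => _) = fun y => \prod_(i <- s | P i) F i y)//.
by apply/funext => y; rewrite big_cons Pi.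
Qed.

Lemma partial_prod0 (I : Type) (s : seq I) (P : pred I) (F : I -> pt -> R) a l :
  (forall i, smooth_at a (F i)) -> (forall i, P i -> partial l (F i) a = 0) ->
  partial l (fun y => \prod_(i <- s | P i) F i y) a = 0.
Proof.
move=> sF dF; elim: s => [|i s IH].
  rewrite (_ : (fun y => _) = fun=> 1); first exact: partial_cst.
  by apply/funext => y; rewrite big_nil.
case Pi : (P i).
  rewrite (_ : (fun y => _) = fun y => F i y * \prod_(i <- s | P i) F i y).
    rewrite (partial_mul l (sF i) (smooth_at_prod s P sF)).
    by rewrite IH dF// mul0r mulr0 addr0.
  by apply/funext => y; rewrite big_cons Pi.
rewrite (_ : (fun y => _) = fun y => \prod_(i <- s | P i) F i y)//.
by apply/funext => y; rewrite big_cons Pi.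
Qed.

Lemma smooth_at_mono a b e : smooth_at a (mono b e).
Proof. by apply: smooth_at_prod => j; exact: smooth_at_pw. Qed.

Lemma partial_mono b e l y : partial l (mono b e) y =
  if (0 < e l)%N then mono b (fun j => e j - (j == l))%N y else 0.
Proof.
rewrite (_ : mono b e = fun y => pw b l (e l) y * \prod_(j | j != l) pw b j (e j) y);
  last by apply/funext => z; rewrite /mono (bigD1 l).
have sp : smooth_at y (fun y => \prod_(j | j != l) pw b j (e j) y).
  by apply: smooth_at_prod => j; exact: smooth_at_pw.
rewrite (partial_mul l (smooth_at_pw y b l (e l)) sp).
rewrite partial_prod0; first last.
- by move=> j jl; rewrite partial_pw eq_sym (negbTE jl).
- by move=> j; exact: smooth_at_pw.
rewrite mulr0 addr0 partial_pw eqxx /=; case: ifP => el; last by rewrite mul0r.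
rewrite [RHS]/mono [RHS](bigD1 l)//= eqxx subn1; congr (_ * _).
by apply: eq_bigr => j jl; rewrite (negbTE jl) subn0.
Qed.

Lemma partial0 l (y : pt) : partial l (fun=> 0) y = 0.
Proof. exact: partial_cst. Qed.

Lemma ipartial_mono b e ls y : ipartial ls (mono b e) y =
  if [forall l, count_mem l ls <= e l]%N
  then mono b (fun j => e j - count_mem j ls)%N y else 0.
Proof.
elim: ls y => [|l ls IH] y.
  rewrite (_ : [forall l, _]); last by apply/forallP => l.
  by congr mono; apply/funext => j /=; rewrite subn0.
rewrite /= (_ : ipartial ls (mono b e) =
  fun y => if [forall l, count_mem l ls <= e l]%N
  then mono b (fun j => e j - count_mem j ls)%N y else 0); last exact/funext.
case: (boolP [forall j, (count_mem j ls <= e j)%N]) => [/forallP H|H]; last first.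
  rewrite partial0 ifF//; apply/negbTE; apply: contra H => /forallP H.
  by apply/forallP => j; apply: leq_trans (H j); rewrite leq_addl.
rewrite partial_mono subn_gt0; case: ifP => el.
  rewrite ifT; last first.
    apply/forallP => j; rewrite /= eq_sym; case: (eqVneq j l) => [->|jl].
      by rewrite add1n.
    by rewrite add0n.
  by congr mono; apply/funext => j; rewrite -subnDA addnC eq_sym.
rewrite ifF//; apply/negbTE/negP => /forallP /(_ l).
by rewrite /= eqxx add1n el.
Qed.

Lemma mono_base b e : mono b e b = [forall j, e j == 0%N]%:R.
Proof.
case: (boolP [forall j, _]) => [/forallP H|].
  rewrite /mono big1// => j _; rewrite /pw (eqP (H j)) expr0 fact0 divr1//.
rewrite negb_forall => /existsP[j ej].
by rewrite /mono (bigD1 j)//= /pw subrr expr0n (negbTE ej) mul0r mul0r.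
Qed.

Lemma ipartial_mono_base b e ls : ipartial ls (mono b e) b =
  [forall j, count_mem j ls == e j]%:R.
Proof.
rewrite ipartial_mono; case: ifP => [/forallP H|/negbT].
  rewrite mono_base; congr ((nat_of_bool _)%:R); apply: eq_forallb => j.
  by rewrite subn_eq0 eqn_leq H.
rewrite negb_forall => /existsP[j ej].
case: (boolP [forall j, _]) => [/forallP/(_ j)/eqP E|//].
by rewrite E leqnn in ej.
Qed.

End Monomials.

Section MultiIndices.
Variables (R : realType) (m k : nat).
Local Notation n := (1 + m + 1)%N.
Local Notation pt := 'rV[R]_(1 + m + 1).
Implicit Types (sigma tau : multi_index m k) (ls : seq 'I_n).

Definition expo sigma : 'I_n -> nat := fun l => val sigma l.

Definition flat sigma : seq 'I_n :=
  flatten [seq nseq (val sigma l) l | l <- enum 'I_n].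

Lemma count_flat sigma l : count_mem l (flat sigma) = expo sigma l.
Proof.
rewrite /flat count_flatten -map_comp sumnE big_map big_enum /=.
rewrite (bigD1 l)//= count_nseq /= eqxx mul1n big1 ?addn0// => j jl.
by rewrite count_nseq /= (negbTE jl).
Qed.

Lemma size_count ls : size ls = (\sum_l count_mem l ls)%N.
Proof.
elim: ls => [|l ls IH]; first by rewrite big1.
have -> : (\sum_j count_mem j (l :: ls) = \sum_j (l == j : nat) + \sum_j count_mem j ls)%N.
  by rewrite -big_split.
rewrite -IH (bigD1 l)//= eqxx big1 ?addn0 ?add1n// => j jl.
by rewrite eq_sym (negbTE jl).
Qed.

Lemma size_flat sigma : (size (flat sigma) <= k)%N.
Proof.
rewrite size_count; under eq_bigr do rewrite count_flat.
exact: (valP sigma).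
Qed.

(** Passage from lists of differentiations, convenient for induction, to the multi-indices of the
    jet coordinates. The value is meaningful for lists of length at most k only. *)
Definition mi ls : multi_index m k :=
  insubd (multi_index0 m k) [ffun l => inord (count_mem l ls)].

Lemma expo_mi ls l : (size ls <= k)%N -> expo (mi ls) l = count_mem l ls.
Proof.
move=> lk; have ck j : (count_mem j ls < k.+1)%N.
  by rewrite ltnS (leq_trans _ lk)// count_size.
rewrite /expo /mi val_insubd ifT; first by rewrite ffunE inordK.
apply: leq_trans lk; rewrite size_count leq_sum// => j _.
by rewrite ffunE inordK.
Qed.

Lemma expo_inj sigma tau : expo sigma =1 expo tau -> sigma = tau.
Proof. by move=> E; apply/val_inj/ffunP => l; apply/val_inj; exact: E. Qed.

Lemma mi_flat sigma : mi (flat sigma) = sigma.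
Proof. by apply: expo_inj => l; rewrite expo_mi ?size_flat// count_flat. Qed.

Lemma perm_flat_mi ls : (size ls <= k)%N -> perm_eq ls (flat (mi ls)).
Proof. by move=> lk; apply/allP => l _ /=; rewrite count_flat expo_mi. Qed.

Lemma multi_deriveE sigma (f : pt -> R) : multi_derive sigma f = ipartial (flat sigma) f.
Proof.
rewrite ipartialE /multi_derive /flat; congr (Defs.iterD _ f).
rewrite map_flatten; congr flatten; rewrite -[RHS]map_comp; apply: eq_map => l /=.
by rewrite map_nseq.
Qed.

Lemma multi_derive_mi ls (f : pt -> R) a : smooth_at a f -> (size ls <= k)%N ->
  multi_derive (mi ls) f a = ipartial ls f a.
Proof.
move=> sf lk; rewrite multi_deriveE; apply: ipartial_perm => //.
by rewrite perm_sym perm_flat_mi.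
Qed.

Definition tpoly (c : multi_index m k -> R) (b y : pt) : R :=
  \sum_sigma c sigma * mono b (expo sigma) y.

Lemma smooth_at_tpoly a c b : smooth_at a (tpoly c b).
Proof.
apply: smooth_at_sum => sigma; apply: smooth_at_mul; first exact: smooth_at_cst.
exact: smooth_at_mono.
Qed.

Lemma ipartial_sum (I : Type) (s : seq I) (c : I -> R) (F : I -> pt -> R) ls y :
  (forall i z, smooth_at z (F i)) ->
  ipartial ls (fun y => \sum_(i <- s) c i * F i y) y = \sum_(i <- s) c i * ipartial ls (F i) y.
Proof.
move=> sF; elim: ls y => //= l ls IH y.
rewrite (_ : ipartial ls _ = fun y => \sum_(i <- s) c i * ipartial ls (F i) y);
  last exact/funext.
have sI i : smooth_at y (ipartial ls (F i)) by apply: smooth_at_ipartial; exact: sF.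
rewrite partial_sum => [|i]; last by apply: smooth_at_mul; [exact: smooth_at_cst|exact: sI].
apply: eq_bigr => i _.
by rewrite (partial_mul l (smooth_at_cst y (c i)) (sI i)) partial_cst mul0r add0r.
Qed.

Lemma ipartial_tpoly c b ls : (size ls <= k)%N -> ipartial ls (tpoly c b) b = c (mi ls).
Proof.
move=> lk; rewrite /tpoly ipartial_sum => [|s z]; last exact: smooth_at_mono.
rewrite (bigD1 (mi ls))//= ipartial_mono_base big1 => [|s sl].
  rewrite addr0 (_ : [forall j, _]) ?mulr1//.
  by apply/forallP => j; rewrite expo_mi.
rewrite ipartial_mono_base; case: (boolP [forall j, _]) => [/forallP H|_]; last by rewrite mulr0.
case/eqP: sl; apply: expo_inj => j; rewrite expo_mi//.
by apply/esym/eqP; exact: H.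
Qed.

Lemma multi_derive_tpoly c b sigma : multi_derive sigma (tpoly c b) b = c sigma.
Proof. by rewrite multi_deriveE ipartial_tpoly ?size_flat// mi_flat. Qed.

End MultiIndices.

Section JetsTpoly.
Variables (R : realType) (m : nat) (Gam : Type) (G : set Gam).
Variable K : (Gam -> R) -> Prop.
Hypothesis sfK : subfield_on G K.
Hypothesis K_ext : forall f g, (forall c, G c -> f c = g c) -> K f -> K g.
Local Notation pt := 'rV[R]_(1 + m + 1).

Lemma jets_in_tpoly k (c : Gam -> multi_index m k -> R) (b : Gam -> pt) r :
  (forall sigma, K (fun t => c t sigma)) -> (forall i, K (fun t => b t 0 i)) ->
  jets_in G K b r (fun x => tpoly (c x.1) (b x.1) x.2).
Proof.
move=> Kc Kb; have sfJ := sf_jets_in sfK K_ext b r.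
apply: (sf_sum sfJ) => sigma; apply: (sf_mul sfJ).
  exact: (jets_in_base sfK K_ext b r (Kc sigma)).
apply: (sf_prod sfJ) => j; apply: (sf_mul sfJ); last exact: (sf_cst sfJ).
apply: (sf_exp sfJ); apply: (sf_sub sfJ).
  exact: (jets_in_coord sfK K_ext r (Kb j)).
exact: (jets_in_base sfK K_ext b r (Kb j)).
Qed.

End JetsTpoly.

(** * Linear algebra of Kundt metrics and of Kundt Jacobians *)

Section KundtAlgebra.
Variables (R : realType) (m : nat).
Local Notation n := (1 + m + 1)%N.
Local Notation pt := 'rV[R]_n.
Local Notation iu := (iu m).
Local Notation iv := (iv m).
Local Notation fH := (fH m).
Implicit Types (y : fiber_index m -> R) (M J : 'M[R]_n) (l : 'I_n).

Variant index_spec : 'I_n -> Type :=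
| IndexU : index_spec iu
| IndexX i : index_spec (ix i)
| IndexV : index_spec iv.

Lemma indexP l : index_spec l.
Proof.
case: (split_ordP l) => [j ->|j ->]; last by rewrite (ord1 j); exact: IndexV.
case: (split_ordP j) => [i ->|i ->]; last exact: IndexX.
by rewrite (ord1 i); exact: IndexU.
Qed.

Lemma sum_index (V : zmodType) (F : 'I_n -> V) :
  \sum_l F l = F iu + \sum_i F (ix i) + F iv.
Proof. by rewrite big_split_ord big_split_ord !big_ord1. Qed.

Lemma iu_ix i : (iu == ix i) = false. Proof. by rewrite eq_lshift eq_lrshift. Qed.
Lemma ix_iu i : (ix i == iu) = false. Proof. by rewrite eq_sym iu_ix. Qed.
Lemma iu_iv : (iu == iv) = false. Proof. by rewrite eq_lrshift. Qed.
Lemma iv_iu : (iv == iu) = false. Proof. by rewrite eq_sym iu_iv. Qed.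
Lemma ix_iv i : (ix i == iv) = false. Proof. by rewrite eq_lrshift. Qed.
Lemma iv_ix i : (iv == ix i) = false. Proof. by rewrite eq_sym ix_iv. Qed.
Lemma ix_ix (i j : 'I_m) : (ix i == ix j) = (i == j).
Proof. by rewrite eq_lshift eq_rshift. Qed.
Definition index_eqE := (iu_ix, ix_iu, iu_iv, iv_iu, ix_iv, iv_ix, ix_ix, eqxx).

Lemma fhC (i j : 'I_m) : fh i j = fh j i.
Proof.
congr inr; apply: val_inj => /=; case: (leqP i j) => ij; case: (leqP j i) => ji //.
  by have /val_inj -> : i = j :> nat by apply/eqP; rewrite eqn_leq ij.
by have := ltn_trans ij ji; rewrite ltnn.
Qed.

Lemma fh_sorted (ij : {ij : 'I_m * 'I_m | (ij.1 <= ij.2)%N}) :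
  fh (val ij).1 (val ij).2 = inr ij.
Proof. by congr inr; apply: val_inj => /=; rewrite (valP ij); case: (val ij). Qed.

Definition hmx y : 'M[R]_m := \matrix_(i, j) y (fh i j).
Definition wrow y : 'rV[R]_m := \row_i y (fW i).

(** The coefficients of the mixed products du dv and du dx^i are halved, being shared by two
    symmetric entries. *)
Definition gmx y : 'M[R]_n :=
  block_mx (block_mx (y fH)%:M (2^-1 *: wrow y) (2^-1 *: wrow y)^T (hmx y))
    (col_mx 2^-1%:M 0) (row_mx 2^-1%:M 0) 0.

Lemma gmx_uu y : gmx y iu iu = y fH.
Proof. by rewrite /gmx /Defs.iu block_mxEul block_mxEul mxE eqxx. Qed.
Lemma gmx_ux y i : gmx y iu (ix i) = 2^-1 * y (fW i).
Proof. by rewrite /gmx /Defs.iu /ix block_mxEul block_mxEur !mxE. Qed.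
Lemma gmx_xu y i : gmx y (ix i) iu = 2^-1 * y (fW i).
Proof. by rewrite /gmx /Defs.iu /ix block_mxEul block_mxEdl !mxE. Qed.
Lemma gmx_xx y i j : gmx y (ix i) (ix j) = y (fh i j).
Proof. by rewrite /gmx /ix block_mxEul block_mxEdr mxE. Qed.
Lemma gmx_uv y : gmx y iu iv = 2^-1.
Proof. by rewrite /gmx /Defs.iu /Defs.iv block_mxEur col_mxEu mxE eqxx. Qed.
Lemma gmx_vu y : gmx y iv iu = 2^-1.
Proof. by rewrite /gmx /Defs.iu /Defs.iv block_mxEdl row_mxEl mxE eqxx. Qed.
Lemma gmx_xv y i : gmx y (ix i) iv = 0.
Proof. by rewrite /gmx /ix /Defs.iv block_mxEur col_mxEd mxE. Qed.
Lemma gmx_vx y i : gmx y iv (ix i) = 0.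
Proof. by rewrite /gmx /ix /Defs.iv block_mxEdl row_mxEr mxE. Qed.
Lemma gmx_vv y : gmx y iv iv = 0.
Proof. by rewrite /gmx /Defs.iv block_mxEdr mxE. Qed.
Definition gmxE := (gmx_uu, gmx_ux, gmx_xu, gmx_xx, gmx_uv, gmx_vu, gmx_xv, gmx_vx, gmx_vv).

Lemma gmx_sym y : (gmx y)^T = gmx y.
Proof.
apply/matrixP => a b; rewrite mxE.
by case: (indexP a) => [|i|]; case: (indexP b) => [|j|]; rewrite !gmxE// fhC.
Qed.

(** Total left inverse of [gmx], which allows a pullback to be written for any Jacobian; that no
    information is lost has to be proved, see [gmx_pull]. *)
Definition comps M (c : fiber_index m) : R :=
  match c with
  | inl (inl _) => M iu iu
  | inl (inr i) => 2 * M iu (ix i)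
  | inr ij => M (ix (val ij).1) (ix (val ij).2)
  end.

Lemma compsK y : comps (gmx y) = y.
Proof.
apply/funext => -[[[]|i]|ij] /=; rewrite gmxE//; last by rewrite fh_sorted.
by rewrite mulrA divff ?mul1r// pnatr_eq0.
Qed.

Lemma comps_fh M i j : M^T = M -> comps M (fh i j) = M (ix i) (ix j).
Proof. by move=> sM; rewrite /=; case: (leqP i j) => //= _; rewrite -[in LHS]sM mxE. Qed.

Lemma kundt_formE y (xi : pt) : kundt_form y xi = (xi *m gmx y *m xi^T) 0 0.
Proof.
rewrite /kundt_form /ucoord /vcoord /xcoord.
have two : (2 : R) != 0 by rewrite pnatr_eq0.
set u := xi 0 iu; set v := xi 0 iv.
have E l : (xi *m gmx y) 0 l = u * gmx y iu l + \sum_i xi 0 (ix i) * gmx y (ix i) l + v * gmx y iv l.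
  by rewrite mxE sum_index.
rewrite [RHS]mxE sum_index !E !gmxE !mxE -/u -/v.
under eq_bigr do rewrite mxE.
under [X in _ + X]eq_bigr => i _ do under eq_bigr => j _ do rewrite !mxE.
have -> : \sum_i xi 0 (ix i) * gmx y (ix i) iu = 2^-1 * \sum_i y (fW i) * xi 0 (ix i).
  by rewrite mulr_sumr; apply: eq_bigr => i _; rewrite gmxE; ring.
have -> : \sum_i xi 0 (ix i) * gmx y (ix i) iv = 0.
  by rewrite big1// => i _; rewrite gmxE mulr0.
have -> : \sum_i (xi *m gmx y) 0 (ix i) * xi^T (ix i) 0 =
   2^-1 * u * \sum_i y (fW i) * xi 0 (ix i) +
   \sum_i \sum_j y (fh i j) * xi 0 (ix i) * xi 0 (ix j).
  rewrite mulr_sumr exchange_big -big_split; apply: eq_bigr => i _ /=.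
  rewrite E !gmxE !mxE mulr0 addr0 mulrDl mulr_suml; congr (_ + _); first by ring.
  by apply: eq_bigr => j _; rewrite gmxE; ring.
move: (\sum_i y (fW i) * xi 0 (ix i)) (\sum_i \sum_j _) => S T.
by field.
Qed.

(** Polarization: the value at ['e_i + 'e_j] isolates twice the entry (i, j). *)
Lemma quad_form_inj (A B : 'M[R]_n) : A^T = A -> B^T = B ->
  (forall xi : pt, (xi *m A *m xi^T) 0 0 = (xi *m B *m xi^T) 0 0) -> A = B.
Proof.
move=> sA sB H; have E (C : 'M[R]_(1 + m + 1)) (i j : 'I_(1 + m + 1)) : C i j = (('e_i : pt) *m C *m ('e_j : pt)^T) 0 0.
  rewrite mxE (bigD1 j)//= big1 => [|k kj]; last by rewrite !mxE eqxx (negbTE kj) mulr0.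
  rewrite addr0 [X in _ * X]mxE [X in _ * X]mxE !eqxx mulr1 mxE (bigD1 i)//=.
  rewrite big1 => [|k ki]; first by rewrite mxE !eqxx mul1r addr0.
  by rewrite mxE (negbTE ki) andbF mul0r.
have pol (C : 'M[R]_n) (a b : pt) : C^T = C ->
    ((a + b) *m C *m (a + b)^T) 0 0 = (a *m C *m a^T) 0 0 + (b *m C *m b^T) 0 0 +
       2 * (a *m C *m b^T) 0 0.
  move=> sC; have ba : b *m C *m a^T = (a *m C *m b^T)^T.
    by rewrite !trmx_mul trmxK sC mulmxA.
  rewrite linearD /= !mulmxDl !mulmxDr ba !mxE; ring.
apply/matrixP => i j; rewrite (E A) (E B).
have two : (2 : R) != 0 by rewrite pnatr_eq0.
apply: (mulfI two).
have := H ('e_i + 'e_j); rewrite !pol// !H.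
by move/addrI.
Qed.

Lemma trmx_conj J M : M^T = M -> (J *m M *m J^T)^T = J *m M *m J^T.
Proof. by move=> sM; rewrite !trmx_mul trmxK sM mulmxA. Qed.

Definition xblock J : 'M[R]_m := \matrix_(i, j) J (ix i) (ix j).

(** Rows are indexed by the variable of differentiation and columns by the component, so that a
    metric pulls back as J G J^T. The conditions say that the new u depends on u alone, the new x on
    (u, x), and that v_v is the inverse of u_u. *)
Record kjac J : Prop := Kjac {
  kjac_xu : forall i, J (ix i) iu = 0;
  kjac_vu : J iv iu = 0;
  kjac_vx : forall i, J iv (ix i) = 0;
  kjac_uv : J iu iu * J iv iv = 1;
  kjac_det : \det (xblock J) != 0 }.

Lemma conj_mxE J y a b : (J *m gmx y *m J^T) a b =
  J a iu * y fH * J b iu + 2^-1 * \sum_i y (fW i) * (J a iu * J b (ix i) + J a (ix i) * J b iu) +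
  \sum_i \sum_j J a (ix i) * y (fh i j) * J b (ix j)
  + 2^-1 * (J a iu * J b iv + J a iv * J b iu).
Proof.
have E l : (J *m gmx y) a l = J a iu * gmx y iu l + \sum_i J a (ix i) * gmx y (ix i) l + J a iv * gmx y iv l.
  by rewrite mxE sum_index.
rewrite mxE sum_index !E !gmxE ![J^T _ _]mxE.
have -> : \sum_i J a (ix i) * gmx y (ix i) iu = 2^-1 * \sum_i y (fW i) * J a (ix i).
  by rewrite mulr_sumr; apply: eq_bigr => i _; rewrite gmxE; ring.
have -> : \sum_i J a (ix i) * gmx y (ix i) iv = 0.
  by rewrite big1// => i _; rewrite gmxE mulr0.
have -> : \sum_i (J *m gmx y) a (ix i) * J^T (ix i) b =
   2^-1 * J a iu * \sum_i y (fW i) * J b (ix i) +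
   \sum_i \sum_j J a (ix i) * y (fh i j) * J b (ix j).
  rewrite mulr_sumr exchange_big -big_split; apply: eq_bigr => i _ /=.
  rewrite E !gmxE [J^T _ _]mxE mulr0 addr0 mulrDl mulr_suml; congr (_ + _); first by ring.
  by apply: eq_bigr => j _; rewrite gmxE.
have -> : \sum_i y (fW i) * (J a iu * J b (ix i) + J a (ix i) * J b iu) =
  J a iu * (\sum_i y (fW i) * J b (ix i)) + J b iu * (\sum_i y (fW i) * J a (ix i)).
  by rewrite !mulr_sumr -big_split; apply: eq_bigr => i _ /=; ring.
ring.
Qed.

(** The entries of the pullback in the column of v reduce to half of [J a iu * J iv iv]; hence they
    equal 1/2 for a = u and vanish otherwise, as in any Kundt metric. *)
Lemma gmx_pull J y : kjac J -> gmx (comps (J *m gmx y *m J^T)) = J *m gmx y *m J^T.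
Proof.
move=> [xu vu vx uv _].
have sM := trmx_conj J (gmx_sym y); set M := J *m _ *m _ in sM *.
have symM a b : M a b = M b a by rewrite -{1}sM mxE.
have Mv a : M a iv = 2^-1 * (J a iu * J iv iv).
  rewrite /M conj_mxE vu mulr0 big1 => [|i _]; last by rewrite vx !mulr0 addr0 mulr0.
  by rewrite big1 => [|i _]; [ring|rewrite big1// => j _; rewrite vx mulr0].
have two : (2 : R) != 0 by rewrite pnatr_eq0.
have Wx i : gmx (comps M) iu (ix i) = M iu (ix i).
  by rewrite gmxE /= mulrA mulVf ?mul1r.
have Vu : M iu iv = 2^-1 by rewrite Mv uv mulr1.
have Vx i : M (ix i) iv = 0 by rewrite Mv xu mul0r mulr0.
apply/matrixP => a b; case: (indexP a) => [|i|]; case: (indexP b) => [|j|] //.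
- by rewrite gmxE.
- by rewrite gmxE Vu.
- by rewrite symM -Wx !gmxE.
- by rewrite gmxE comps_fh.
- by rewrite gmxE Vx.
- by rewrite gmxE symM Vu.
- by rewrite gmxE symM Vx.
- by rewrite gmxE Mv vu mul0r mulr0.
Qed.

Lemma hmx_pull J y : kjac J ->
  hmx (comps (J *m gmx y *m J^T)) = xblock J *m hmx y *m (xblock J)^T.
Proof.
move=> [xu _ _ _ _]; apply/matrixP => i j.
rewrite mxE comps_fh; last exact: trmx_conj (gmx_sym y).
rewrite conj_mxE !xu big1 => [|k _]; last by ring.
rewrite !(mul0r, mulr0, add0r, addr0) mxE.
under [RHS]eq_bigr => k _ do rewrite mxE mulr_suml.
rewrite exchange_big; apply: eq_bigr => k _ /=; apply: eq_bigr => l _.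
by rewrite !mxE.
Qed.

Lemma det_kjac J : kjac J -> \det J != 0.
Proof.
move=> [xu vu vx uv dN].
have uv0 : J iu iu * J iv iv != 0 by rewrite uv oner_neq0.
rewrite -[J]submxK.
have dl : dlsubmx J = 0.
  apply/matrixP => i j; rewrite !mxE (ord1 i).
  case: (split_ordP j) => l ->; last exact: (vx l).
  by rewrite (ord1 l).
rewrite dl det_ublock.
have ul : ulsubmx J = block_mx (J iu iu)%:M (\row_j J iu (ix j)) 0 (xblock J).
  apply/matrixP => i j; case: (split_ordP i) => k ->; case: (split_ordP j) => l ->.
  - by rewrite block_mxEul !mxE (ord1 k) (ord1 l) eqxx.
  - by rewrite block_mxEur !mxE (ord1 k).
  - by rewrite block_mxEdl !mxE (ord1 l) -[RHS](xu k).
  - by rewrite block_mxEdr !mxE.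
have dr : drsubmx J = (J iv iv)%:M.
  by apply/matrixP => i j; rewrite !mxE (ord1 i) (ord1 j) eqxx.
rewrite ul dr det_ublock !det_scalar1.
by move: uv0; rewrite mulf_eq0 negb_or => /andP[u0 v0]; rewrite !mulf_neq0.
Qed.

Lemma det_neq0_inj p (A : 'M[R]_p) : (forall x : 'rV_p, x *m A = 0 -> x = 0) -> \det A != 0.
Proof. by move=> /inj_row_free; rewrite row_free_unit unitmxE unitfE. Qed.

Lemma in_FP y : in_F y <-> forall w : 'rV[R]_m, w != 0 -> 0 < (w *m hmx y *m w^T) 0 0.
Proof.
have E (w : 'rV[R]_m) : (w *m hmx y *m w^T) 0 0 = \sum_i \sum_j y (fh i j) * w 0 i * w 0 j.
  rewrite mxE exchange_big; apply: eq_bigr => j _ /=.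
  rewrite !mxE mulr_suml; apply: eq_bigr => i _; rewrite !mxE; ring.
by split=> H w /H; rewrite E.
Qed.

Lemma in_F_det y : in_F y -> \det (hmx y) != 0.
Proof.
move=> /in_FP Fy; apply: det_neq0_inj => w wh; apply/eqP/contraT => /Fy.
by rewrite wh mul0mx mxE ltxx.
Qed.

Lemma in_F_pull J y : kjac J -> in_F y -> in_F (comps (J *m gmx y *m J^T)).
Proof.
move=> kJ /in_FP Fy; apply/in_FP => w w0; rewrite hmx_pull//.
rewrite !mulmxA -mulmxA -trmx_mul; apply: Fy; apply: contra w0 => /eqP wN.
have /eqP := kjac_det kJ.
have uN : xblock J \in unitmx by rewrite unitmxE unitfE kjac_det.
by rewrite -[w](mulmxK uN) wN mul0mx eqxx.
Qed.

(** A vector of the kernel vanishes componentwise: its u-component by the column of v, then its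
    x-components because h is regular, and finally its v-component by the column of u. *)
Lemma det_gmx y : \det (hmx y) != 0 -> \det (gmx y) != 0.
Proof.
move=> dh; have two : (2 : R) != 0 by rewrite pnatr_eq0.
apply: det_neq0_inj => xi xiG.
have E l : xi 0 iu * gmx y iu l + \sum_i xi 0 (ix i) * gmx y (ix i) l + xi 0 iv * gmx y iv l = 0.
  by have := congr1 (fun M : pt => M 0 l) xiG; rewrite [in X in X -> _]mxE sum_index => ->; rewrite mxE.
have u0 : xi 0 iu = 0.
  have := E iv; rewrite !gmxE big1 => [|i _]; last by rewrite gmxE mulr0.
  by rewrite mulr0 !addr0 => /eqP; rewrite mulf_eq0 invr_eq0 (negbTE two) orbF => /eqP.
have x0 i : xi 0 (ix i) = 0.
  pose w : 'rV[R]_m := \row_i xi 0 (ix i).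
  have wh : w *m hmx y = 0.
    apply/rowP => j; have := E (ix j); rewrite u0 !gmxE mul0r add0r mulr0 addr0 => Ej.
    by rewrite !mxE -[in RHS]Ej; apply: eq_bigr => k _; rewrite gmxE !mxE.
  have uh : hmx y \in unitmx by rewrite unitmxE unitfE.
  have : w = 0 by rewrite -[w](mulmxK uh) wh mul0mx.
  by move/rowP/(_ i); rewrite !mxE.
apply/rowP => l; rewrite mxE; case: (indexP l) => [||]//.
have := E iu; rewrite u0 !gmxE mul0r big1 => [|i _]; last by rewrite x0 mul0r.
by rewrite !add0r => /eqP; rewrite mulf_eq0 invr_eq0 (negbTE two) orbF => /eqP.
Qed.

End KundtAlgebra.

(** * Equality of jets *)

Section JetEquality.
Variables (R : realType) (n : nat).
Local Notation pt := 'rV[R]_n.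
Implicit Types (f g h : pt -> R) (a : pt) (phi : 'I_n -> pt -> R).

(** With a parameter space of two points, the calculus of [jets_in] becomes a calculus of
    congruences between jets, composition and division by a Jacobian included. *)
Definition agree (k : bool -> R) : Prop := k true = k false.

Lemma sf_agree : subfield_on setT agree.
Proof.
by split=> [c|f g|f g|f _]; rewrite /agree // => -> // ->.
Qed.

Lemma agree_ext (f g : bool -> R) : (forall c, setT c -> f c = g c) -> agree f -> agree g.
Proof. by rewrite /agree => E; rewrite !E. Qed.

Definition pairf f g (x : bool * pt) : R := if x.1 then f x.2 else g x.2.

Definition jeq r a f g := jets_in setT agree (fun=> a) r (pairf f g).

Lemma jeqP r a f g : jeq r a f g <->
  [/\ smooth_at a f, smooth_at a g &
     forall ls, (size ls <= r)%N -> ipartial ls f a = ipartial ls g a].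
Proof.
split=> [j|[sf sg E]].
  split; [exact: (jets_in_smooth j (c := true) I)|exact: (jets_in_smooth j (c := false) I)|].
  by move=> ls lr; exact: (jets_in_ipartial agree_ext j lr).
apply: (ipartial_jets_in agree_ext) => [[] _ //|ls lr]; exact: E.
Qed.

Lemma jeq_refl r a f : smooth_at a f -> jeq r a f f.
Proof. by move=> sf; apply/jeqP. Qed.

Lemma jeq_sym r a f g : jeq r a f g -> jeq r a g f.
Proof. by move=> /jeqP[sf sg E]; apply/jeqP; split=> // ls lr; rewrite E. Qed.

Lemma jeq_trans r a f g h : jeq r a f g -> jeq r a g h -> jeq r a f h.
Proof.
move=> /jeqP[sf sg E] /jeqP[_ sh E']; apply/jeqP; split=> // ls lr.
by rewrite E// E'.
Qed.

Lemma jeq_near r a f g : smooth_at a f -> {near a, f =1 g} -> jeq r a f g.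
Proof.
move=> sf fg; apply/jeqP; split=> // [|ls _]; first exact: smooth_at_eq fg sf.
exact: nbhs_singleton (ipartial_eq ls fg).
Qed.

Lemma jeq_le r r' a f g : (r <= r')%N -> jeq r' a f g -> jeq r a f g.
Proof. by move=> rr'; exact: jets_in_le. Qed.

Lemma jeq_val r a f g : jeq r a f g -> f a = g a.
Proof. by move=> /jeqP[_ _ /(_ [::])]; apply. Qed.

Lemma jeq_partial r a f g l : jeq r.+1 a f g -> jeq r a (partial l f) (partial l g).
Proof.
move=> /jeqP[sf sg E]; apply/jeqP; split; try exact: smooth_at_partial.
by move=> ls lr; rewrite -!ipartial_rcons E// size_rcons.
Qed.

Lemma pairf_op (op : R -> R -> R) f f' g g' :
  (fun x => op (pairf f f' x) (pairf g g' x)) =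
  pairf (fun y => op (f y) (g y)) (fun y => op (f' y) (g' y)).
Proof. by apply/funext => -[[] y]. Qed.

Lemma jeq_add r a f f' g g' : jeq r a f f' -> jeq r a g g' ->
  jeq r a (fun y => f y + g y) (fun y => f' y + g' y).
Proof.
by move=> jf jg; rewrite /jeq -(pairf_op +%R); exact: (jets_in_add sf_agree agree_ext jf jg).
Qed.

Lemma jeq_mul r a f f' g g' : jeq r a f f' -> jeq r a g g' ->
  jeq r a (fun y => f y * g y) (fun y => f' y * g' y).
Proof.
by move=> jf jg; rewrite /jeq -(pairf_op *%R); exact: (jets_in_mul sf_agree agree_ext jf jg).
Qed.

Lemma jeq_base_image phi phi' a : (forall i, phi i a = phi' i a) ->
  base_image (fun i => pairf (phi i) (phi' i)) (fun=> a) = fun=> row_fun phi a.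
Proof.
move=> E; apply/funext => -[] //; apply/rowP => i; rewrite !mxE /pairf /=.
by rewrite E.
Qed.

Lemma jeq_comp r a phi phi' f f' : (forall i, jeq r a (phi i) (phi' i)) ->
  jeq r (row_fun phi a) f f' -> jeq r a (f \o row_fun phi) (f' \o row_fun phi').
Proof.
move=> jp; have E i := jeq_val (jp i).
rewrite {1}/jeq -(jeq_base_image E) => jf.
have := jets_in_comp sf_agree agree_ext jp jf.
by apply: jets_in_eq => [|c _]; [exact: agree_ext|apply: near_all => y; case: c].
Qed.

Definition jac phi (y : pt) : 'M[R]_n := \matrix_(i, l) partial i (phi l) y.

Lemma jeq_compV r a phi f f' : (forall i, smooth_at a (phi i)) -> \det (jac phi a) != 0 ->
  smooth_at (row_fun phi a) f -> smooth_at (row_fun phi a) f' ->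
  jeq r a (f \o row_fun phi) (f' \o row_fun phi) -> jeq r (row_fun phi a) f f'.
Proof.
move=> sp dJ sf sf' j.
have jp i : jeq r a (phi i) (phi i) by exact: jeq_refl.
have bE : base_image (fun i => pairf (phi i) (phi i)) (fun=> a) = fun=> row_fun phi a.
  exact: jeq_base_image.
rewrite /jeq -bE; apply: (jets_in_compV sf_agree agree_ext _ jp).
- move=> c _; rewrite (_ : gjac _ _ = jac phi a)//.
  by apply/matrixP => i l; rewrite !mxE; case: c.
- by move=> c _; rewrite bE; case: c.
- by apply: jets_in_eq j => [|c _]; [exact: agree_ext|apply: near_all => y; case: c].
Qed.

Definition compm (phi psi : 'I_n -> pt -> R) : 'I_n -> pt -> R := fun l => phi l \o row_fun psi.

Definition idm : 'I_n -> pt -> R := fun l y => y 0 l.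

Lemma row_fun_compm phi psi y : row_fun (compm phi psi) y = row_fun phi (row_fun psi y).
Proof. by apply/rowP => i; rewrite !mxE. Qed.

Lemma row_fun_idm y : row_fun idm y = y.
Proof. by apply/rowP => i; rewrite !mxE. Qed.

Lemma jac_idm y : jac idm y = 1%:M.
Proof. by apply/matrixP => i l; rewrite !mxE partial_coord. Qed.

Lemma jac_compm phi psi a : (forall i, smooth_at a (psi i)) ->
  (forall i, smooth_at (row_fun psi a) (phi i)) ->
  jac (compm phi psi) a = jac psi a *m jac phi (row_fun psi a).
Proof.
move=> sp sf; apply/matrixP => i l; rewrite !mxE (partial_comp i sp (sf l)).
by apply: eq_bigr => j _; rewrite !mxE mulrC.
Qed.

End JetEquality.

(** * Pullback of sections *)

Section Pullback.
Variables (R : realType) (m : nat).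
Local Notation n := (1 + m + 1)%N.
Local Notation pt := 'rV[R]_(1 + m + 1).
Implicit Types (s : pt -> fiber_index m -> R) (a b : pt) (phi psi : 'I_n -> pt -> R).

Definition pull phi s (y : pt) : fiber_index m -> R :=
  comps (jac phi y *m gmx (s (row_fun phi y)) *m (jac phi y)^T).

(** The pseudogroup seen through its Jacobians alone, which is all that computations with pullbacks
    use. The explicit form with C, A, B is left in [kundt_transf_kmap] and produced again in
    [param_map_transf]. *)
Definition kmap a phi : Prop :=
  (forall l, smooth_at a (phi l)) /\ \forall y \near a, kjac (jac phi y).

Lemma kmap_kjac a phi : kmap a phi -> kjac (jac phi a).
Proof. by case=> _; exact: nbhs_singleton. Qed.

Lemma pull_idm s : pull (@idm R n) s = s.
Proof.
apply/funext => y; rewrite /pull jac_idm mul1mx trmx1 mulmx1 row_fun_idm.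
exact: compsK.
Qed.

(** A pullback is stored through [comps], so functoriality depends on the inner one being again of
    Kundt form; this is known only near the image point, whence the conclusion near b. *)
Lemma pull_compm psi phi s b : kmap b psi -> kmap (row_fun psi b) phi ->
  \forall y \near b, pull psi (pull phi s) y = pull (compm phi psi) s y.
Proof.
move=> [spsi _] [sphi kphi].
have cpsi := row_fun_continuous spsi.
have n1 : \forall y \near b, forall i, smooth_at y (psi i).
  by apply: near_forall_fin => i; exact: smooth_at_near.
have n2 : \forall y \near b, forall i, smooth_at (row_fun psi y) (phi i).
  have H : \forall z \near row_fun psi b, forall i, smooth_at z (phi i).
    by apply: near_forall_fin => i; exact: smooth_at_near.
  exact: (cpsi _ H).
have n3 : \forall y \near b, kjac (jac phi (row_fun psi y)) by exact: (cpsi _ kphi).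
apply: filterS3 n1 n2 n3 => y s1 s2 k; rewrite /pull.
rewrite (jac_compm s1 s2) row_fun_compm gmx_pull//.
by rewrite trmx_mul !mulmxA.
Qed.

End Pullback.

Section JetsPull.
Variables (R : realType) (m : nat) (Gam : Type) (G : set Gam).
Variable K : (Gam -> R) -> Prop.
Hypothesis sfK : subfield_on G K.
Hypothesis K_ext : forall f g, (forall c, G c -> f c = g c) -> K f -> K g.
Local Notation n := (1 + m + 1)%N.
Local Notation pt := 'rV[R]_(1 + m + 1).
Implicit Types (b : Gam -> pt) (phi : 'I_n -> Gam * pt -> R).

Definition gfiber (s : fiber_index m -> Gam * pt -> R) phi (x : Gam * pt) : fiber_index m -> R :=
  fun c => compf (s c) phi x.

Definition gpull (s : fiber_index m -> Gam * pt -> R) phi (x : Gam * pt) : 'M[R]_n :=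
  gjac phi x *m gmx (gfiber s phi x) *m (gjac phi x)^T.

Lemma in_mx_gmx T (P : (T -> R) -> Prop) (E : set T) (y : T -> fiber_index m -> R) :
  subfield_on E P -> (forall c, P (fun t => y t c)) -> in_mx P (fun t => gmx (y t)).
Proof.
move=> sP Py a b; have Ph c : P (fun t => 2^-1 * y t c).
  exact: (sf_mul sP (sf_cst sP _) (Py c)).
case: (indexP a) => [|i|]; case: (indexP b) => [|j|].
- by rewrite (_ : (fun t => _) = fun t => y t (fH m))//; apply/funext => t; rewrite gmxE.
- by rewrite (_ : (fun t => _) = fun t => 2^-1 * y t (fW j))//; apply/funext => t; rewrite gmxE.
- by rewrite (_ : (fun t => _) = fun t => 2^-1); [exact: (sf_cst sP)|apply/funext => t; rewrite gmxE].
- by rewrite (_ : (fun t => _) = fun t => 2^-1 * y t (fW i))//; apply/funext => t; rewrite gmxE.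
- by rewrite (_ : (fun t => _) = fun t => y t (fh i j))//; apply/funext => t; rewrite gmxE.
- by rewrite (_ : (fun t => _) = fun t => 0); [exact: (sf_cst sP)|apply/funext => t; rewrite gmxE].
- by rewrite (_ : (fun t => _) = fun t => 2^-1); [exact: (sf_cst sP)|apply/funext => t; rewrite gmxE].
- by rewrite (_ : (fun t => _) = fun t => 0); [exact: (sf_cst sP)|apply/funext => t; rewrite gmxE].
- by rewrite (_ : (fun t => _) = fun t => 0); [exact: (sf_cst sP)|apply/funext => t; rewrite gmxE].
Qed.

Lemma in_comps T (P : (T -> R) -> Prop) (E : set T) (M : T -> 'M[R]_n) c :
  subfield_on E P -> in_mx P M -> P (fun t => comps (M t) c).
Proof.
move=> sP PM; case: c => [[[]|i]|ij] /=; try exact: PM.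
exact: (sf_mul sP (sf_cst sP _) (PM _ _)).
Qed.

Lemma jets_in_gpull b r phi s : (forall i, jets_in G K b r.+1 (phi i)) ->
  (forall c, jets_in G K (base_image phi b) r (s c)) ->
  in_mx (jets_in G K b r) (gpull s phi).
Proof.
move=> jp js; have sJ := sf_jets_in sfK K_ext b r.
have jJ := jets_in_gjac jp.
have jP i : jets_in G K b r (phi i) by exact: jets_in_pred (jp i).
apply: (in_mx_mul sJ); last exact: (in_mx_tr jJ).
apply: (in_mx_mul sJ jJ); apply: (in_mx_gmx sJ) => c.
exact: (jets_in_comp sfK K_ext jP (js c)).
Qed.

End JetsPull.

Section JeqPull.
Variables (R : realType) (m : nat).
Local Notation n := (1 + m + 1)%N.
Local Notation pt := 'rV[R]_(1 + m + 1).
Implicit Types (s : pt -> fiber_index m -> R) (a b : pt) (phi psi : 'I_n -> pt -> R).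

Definition sjeq r a s s' := forall c, jeq r a (fun y => s y c) (fun y => s' y c).

Lemma sjeq_trans r a s1 s2 s3 : sjeq r a s1 s2 -> sjeq r a s2 s3 -> sjeq r a s1 s3.
Proof. by move=> H1 H2 c; exact: jeq_trans (H1 c) (H2 c). Qed.

Lemma sjeq_sym r a s1 s2 : sjeq r a s1 s2 -> sjeq r a s2 s1.
Proof. by move=> H c; exact: jeq_sym (H c). Qed.

Lemma sjeq_refl r a s : (forall c, smooth_at a (fun y => s y c)) -> sjeq r a s s.
Proof. by move=> H c; exact: jeq_refl (H c). Qed.

Lemma sjeq_near r a s s' : (forall c, smooth_at a (fun y => s y c)) ->
  (\forall y \near a, s y = s' y) -> sjeq r a s s'.
Proof.
by move=> H E c; apply: jeq_near (H c) _; apply: filterS E => y ->.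
Qed.

(** The Jacobian costs one order. This is why transformations act on k-jets of sections through
    their own (k + 1)-jets. *)
Lemma sjeq_pull r a phi phi' s s' : (forall i, jeq r.+1 a (phi i) (phi' i)) ->
  sjeq r (row_fun phi a) s s' -> sjeq r a (pull phi s) (pull phi' s').
Proof.
move=> jp js c.
pose P := fun i => pairf (phi i) (phi' i).
pose S := fun c => pairf (fun y => s y c) (fun y => s' y c).
have bE := jeq_base_image (fun i => jeq_val (jp i)).
have jS c' : jets_in setT (@agree R) (base_image P (fun=> a)) r (S c') by rewrite bE; exact: js.
have jM := jets_in_gpull (@sf_agree R) (@agree_ext R) jp jS.
have := in_comps c (sf_jets_in (@sf_agree R) (@agree_ext R) _ _) jM.
have compsE (M M' : 'M[R]_n) : M = M' -> comps M c = comps M' c by move=> ->.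
apply: jets_in_eq => [|t _]; first exact: agree_ext.
apply: near_all => y; rewrite /pairf /=.
by case: t; apply: compsE; congr (_ *m gmx _ *m _^T); try (by apply/matrixP => i l; rewrite !mxE);
  apply/funext => c'; rewrite /gfiber /compf /S /pairf /=; congr (_ _ _); apply/rowP => i; rewrite !mxE.
Qed.

Lemma smooth_at_pull a phi s : (forall i, smooth_at a (phi i)) ->
  (forall c, smooth_at (row_fun phi a) (fun y => s y c)) ->
  forall c, smooth_at a (fun y => pull phi s y c).
Proof.
move=> sp ss c.
have j : sjeq 0 a (pull phi s) (pull phi s).
  by apply: sjeq_pull => [i|]; [exact: jeq_refl|exact: sjeq_refl].
by have /jeqP[] := j c.
Qed.

End JeqPull.

Section DifferentialRow.
Variables (R : realType) (n p : nat).
Implicit Types (f : 'rV[R]_n -> 'rV[R]_p).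

Lemma smooth_diff_row f a : (forall j, smooth_at a (fun y => f y 0 j)) ->
  differentiable f a /\ forall v j, 'd f a v 0 j = \sum_l v 0 l * partial l (fun y => f y 0 j) a.
Proof.
move=> sf; have df j : differentiable (fun y => f y 0 j) a.
  have /smooth_atP[U [oU Ua sU]] := sf j.
  by have [] := smooth_diff oU sU Ua.
have dfa : differentiable f a.
  rewrite (_ : f = fun y => \sum_(j < p) f y 0 j *: ('e_j : 'rV[R]_p)); last first.
    by apply/funext => y; exact: row_sum_delta.
  rewrite (_ : (fun y => _) = \sum_(j < p) (fun y => f y 0 j *: ('e_j : 'rV[R]_p))).
    by apply: differentiable_sum => j; exact: differentiableZl.
  by apply/funext => y; rewrite fct_sumE.
split=> // v j; rewrite -deriveE// derive_mx; last exact: diff_derivable.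
rewrite mxE derive_partial//; exact: sf.
Qed.

End DifferentialRow.

(** * Coordinates u, x, v, and the Jacobians of elements of the pseudogroup *)

Section Coordinates.
Variables (R : realType) (m : nat).
Local Notation n := (1 + m + 1)%N.
Local Notation pt := 'rV[R]_(1 + m + 1).
Local Notation iu := (iu m).
Local Notation iv := (iv m).

Lemma mkpt_u u (x : 'rV[R]_m) v : mkpt u x v 0 iu = u.
Proof. by rewrite /mkpt /Defs.iu !row_mxEl mxE eqxx. Qed.
Lemma mkpt_x u (x : 'rV[R]_m) v i : mkpt u x v 0 (ix i) = x 0 i.
Proof. by rewrite /mkpt /ix row_mxEl row_mxEr. Qed.
Lemma mkpt_v u (x : 'rV[R]_m) v : mkpt u x v 0 iv = v.
Proof. by rewrite /mkpt /Defs.iv row_mxEr mxE eqxx. Qed.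
Definition mkptE := (mkpt_u, mkpt_x, mkpt_v).

Lemma mkpt_coords (y : pt) : mkpt (ucoord y) (xcoord y) (vcoord y) = y.
Proof.
apply/rowP => l; case: (indexP l) => [|i|]; rewrite mkptE//.
by rewrite mxE.
Qed.

Definition uxcoord (y : pt) : R * 'rV[R]_m := (ucoord y, xcoord y).

Lemma ucoord_affine h (v x : pt) : ucoord (h *: v + x) = h *: ucoord v + ucoord x.
Proof. by rewrite /ucoord !mxE. Qed.

Lemma uxcoord_affine h (v x : pt) : uxcoord (h *: v + x) = h *: uxcoord v + uxcoord x.
Proof.
rewrite /uxcoord; congr (_, _); first exact: ucoord_affine.
by apply/rowP => i; rewrite !mxE.
Qed.

Lemma ucoord_continuous : continuous (@ucoord R m).
Proof. exact: coord_continuous. Qed.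

Lemma uxcoord_continuous : continuous uxcoord.
Proof.
move=> y.
have H : {for y, continuous (@xcoord R m)}.
  apply/continuous_rowP => i; rewrite (_ : (fun z => _) = fun z : pt => z 0 (ix i)).
    exact: coord_continuous.
  by apply/funext => z; rewrite mxE.
exact: (cvg_pair (@ucoord_continuous y) H).
Qed.

Definition of_u (t : R) : pt := mkpt t 0 0.
Definition of_ux (z : R * 'rV[R]_m) : pt := mkpt z.1 z.2 0.

Lemma of_u_affine h (v x : R) : of_u (h *: v + x) = h *: of_u v + of_u x.
Proof.
apply/rowP => l; rewrite [RHS]mxE [X in _ = X + _]mxE.
by case: (indexP l) => [|i|]; rewrite !mkptE ?mxE ?mulr0 ?addr0.
Qed.

Lemma of_ux_affine h (v x : R * 'rV[R]_m) : of_ux (h *: v + x) = h *: of_ux v + of_ux x.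
Proof.
apply/rowP => l; rewrite [RHS]mxE [X in _ = X + _]mxE.
by case: (indexP l) => [|i|]; rewrite !mkptE ?mxE ?mulr0 ?addr0.
Qed.

Lemma continuous_coords (T : topologicalType) (f : T -> pt) t :
  (forall l, {for t, continuous (fun z => f z 0 l)}) -> {for t, continuous f}.
Proof.
move=> cf; apply/cvgrPdist_lt => e e0; near=> y.
rewrite /Num.Def.normr /= mx_normrE (bigmax_lt _ e0)// => -[i j] _.
rewrite !mxE (ord1 i); move: j {i}; near: y.
by apply: filter_forall => j; have /cvgrPdist_lt := cf j; apply.
Unshelve. all: by end_near. Qed.

Lemma of_u_continuous : continuous of_u.
Proof.
move=> t; apply: continuous_coords => l; case: (indexP l) => [|i|].
- by rewrite (_ : (fun z => _) = id); [exact: cvg_id|apply/funext => z; rewrite mkptE].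
- rewrite (_ : (fun z => _) = fun=> 0); first exact: cvg_cst.
  by apply/funext => z; rewrite mkptE mxE.
- rewrite (_ : (fun z => _) = fun=> 0); first exact: cvg_cst.
  by apply/funext => z; rewrite mkptE.
Qed.

Lemma of_ux_continuous : continuous of_ux.
Proof.
move=> t; apply: continuous_coords => l; case: (indexP l) => [|i|].
- by rewrite (_ : (fun z => _) = fst); [exact: cvg_fst|apply/funext => z; rewrite mkptE].
- rewrite (_ : (fun z => _) = (fun x : 'rV[R]_m => x 0 i) \o snd).
    apply: continuous_comp; [exact: cvg_snd|exact: coord_continuous].
  by apply/funext => z; rewrite /= mkptE.
- rewrite (_ : (fun z => _) = fun=> 0); first exact: cvg_cst.
  by apply/funext => z; rewrite mkptE.
Qed.

Lemma ucoord_delta l : ucoord ('e_l : pt) = (l == iu)%:R.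
Proof. by rewrite /ucoord mxE eqxx eq_sym. Qed.

Definition slice (u : R) (z : 'rV[R]_m) : R * 'rV[R]_m := (u, z).

Lemma slice_affine u (h : R) (v x : 'rV[R]_m) :
  slice u (h *: v + x) = h *: slice 0 v + slice u x.
Proof. by rewrite /slice; congr (_, _) => /=; rewrite scaler0 add0r. Qed.

Lemma slice_continuous u : continuous (slice u).
Proof. by move=> z; exact: (cvg_pair (cvg_cst u) (@cvg_id _ (nbhs z))). Qed.

Lemma jacobian_slice (A : R * 'rV[R]_m -> 'rV[R]_m) u x (V : set 'rV[R]_m) :
  open V -> V x -> (forall i, smooth_on V (fun z => A (u, z) 0 i : R)) ->
  'J (fun z => A (u, z)) x =
  \matrix_(i, j) 'D_(uxcoord ('e_(ix i) : pt)) (fun z => A z 0 j : R) (u, x).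
Proof.
move=> oV Vx sAl; have [_ dE] := smooth_diff_row (fun i => smooth_on_at oV Vx (sAl i)).
apply/matrixP => i j; rewrite !mxE dE (bigD1 i)//= mxE !eqxx mul1r big1 => [|k ki].
  rewrite addr0 partialE.
  have -> : 'D_('e_i) (fun z => A (u, z) 0 j) x =
      'D_(slice 0 'e_i) (fun z => A z 0 j : R) (slice u x).
    exact: (iterD_affine (slice_affine u) (fun z => A z 0 j) [:: 'e_i] x).
  congr (derive _ _ _); rewrite /slice /uxcoord ucoord_delta index_eqE; congr (_, _).
  by apply/rowP => k; rewrite !mxE !eqxx index_eqE.
by rewrite mxE eqxx (negbTE ki) mul0r.
Qed.

Lemma uxcoord_delta_v : uxcoord ('e_iv : pt) = 0.
Proof.
rewrite /uxcoord ucoord_delta index_eqE; congr (_, _).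
by apply/rowP => j; rewrite !mxE eqxx index_eqE.
Qed.

Lemma derive_ucoord (f : R -> R) (v x : pt) :
  'D_v (f \o @ucoord R m) x = 'D_(ucoord v) f (ucoord x).
Proof. exact: (iterD_affine ucoord_affine f [:: v] x). Qed.

Lemma derive_uxcoord (f : R * 'rV[R]_m -> R) (v x : pt) :
  'D_v (f \o uxcoord) x = 'D_(uxcoord v) f (uxcoord x).
Proof. exact: (iterD_affine uxcoord_affine f [:: v] x). Qed.

End Coordinates.

Section KundtTransf.
Variables (R : realType) (m : nat).
Local Notation n := (1 + m + 1)%N.
Local Notation pt := 'rV[R]_(1 + m + 1).
Local Notation iu := (iu m).
Local Notation iv := (iv m).
Implicit Types (a : pt).

Definition mcoord (phi : pt -> pt) (l : 'I_n) (y : pt) : R := phi y 0 l.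

Lemma row_fun_mcoord phi : row_fun (mcoord phi) = phi.
Proof. by apply/funext => y; apply/rowP => l; rewrite mxE. Qed.

(** C, A and B enter through the affine projections to u and to (u, x), which kill the direction of
    v; so v is differentiated only where it occurs linearly, with coefficient 1 / C'. *)
Lemma kundt_transf_kmap a phi : kundt_transf a phi -> kmap a (mcoord phi).
Proof.
move=> [U [C [A [B [oU Ua [sC sA sB] nd E]]]]].
have sCu : smooth_on U (C \o @ucoord R m).
  apply: smooth_on_subset (smooth_on_affine (@ucoord_affine R m) (@ucoord_continuous R m) sC).
  by move=> y Uy; exists y.
have sC'u : smooth_on U ((fun t => derive1 C t) \o @ucoord R m).
  have sC' : smooth_on (@ucoord R m @` U) (derive1 C).
    by rewrite (_ : derive1 C = 'D_1 C); [exact: smooth_on_derive|apply/funext => t; exact: derive1E].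
  apply: smooth_on_subset (smooth_on_affine (@ucoord_affine R m) (@ucoord_continuous R m) sC').
  by move=> y Uy; exists y.
have sAux : smooth_on U (A \o @uxcoord R m).
  apply: smooth_on_subset (smooth_on_affine (@uxcoord_affine R m) (@uxcoord_continuous R m) sA).
  by move=> y Uy; exists y.
have sBux : smooth_on U (B \o @uxcoord R m).
  apply: smooth_on_subset (smooth_on_affine (@uxcoord_affine R m) (@uxcoord_continuous R m) sB).
  by move=> y Uy; exists y.
have Eu y : U y -> mcoord phi iu y = C (ucoord y) by move=> Uy; rewrite /mcoord E// mkptE.
have Ex i y : U y -> mcoord phi (ix i) y = A (uxcoord y) 0 i.
  by move=> Uy; rewrite /mcoord E// mkptE.
have Ev y : U y -> mcoord phi iv y = y 0 iv * (derive1 C (ucoord y))^-1 + B (uxcoord y).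
  by move=> Uy; rewrite /mcoord E// mkptE.
have sU l : smooth_on U (mcoord phi l).
  case: (indexP l) => [|i|].
  - by apply: smooth_on_eq sCu => // y Uy; rewrite Eu.
  - have /smooth_on_rowP : smooth_on U (A \o @uxcoord R m) by [].
    move=> /(_ oU)/(_ i) sAi; apply: smooth_on_eq sAi => // y Uy; by rewrite Ex.
  - apply: (smooth_on_eq oU (f := fun y : pt => y 0 iv * (derive1 C (ucoord y))^-1 + B (uxcoord y))).
      by move=> y Uy; rewrite Ev.
    apply: (smooth_on_add oU _ sBux).
    apply: (smooth_on_mul oU (smooth_on_coord iv oU)).
    by apply: (smooth_on_inv oU _ sC'u) => y /nd[].
have sat l y : U y -> smooth_at y (mcoord phi l).
  by move=> Uy; apply: (smooth_on_at oU Uy); exact: sU.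
split; first by move=> l; exact: sat.
apply: (open_nearT oU Ua) => y Uy.
have [C0 dA] := nd y Uy.
have nEu l : partial l (mcoord phi iu) y = 'D_(ucoord ('e_l : pt)) C (ucoord y).
  rewrite partialE -(derive_ucoord (C)).
  by apply: near_eq_derive; apply: (open_nearT oU Uy) => z; exact: Eu.
have nEx l i : partial l (mcoord phi (ix i)) y = 'D_(uxcoord ('e_l : pt)) (fun z => A z 0 i) (uxcoord y).
  rewrite partialE -(derive_uxcoord (fun z => A z 0 i)).
  by apply: near_eq_derive; apply: (open_nearT oU Uy) => z; exact: Ex.
split.
- by move=> i; rewrite mxE nEu ucoord_delta index_eqE derive0.
- by rewrite mxE nEu ucoord_delta index_eqE derive0.
- by move=> i; rewrite mxE nEx uxcoord_delta_v derive0.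
- rewrite mxE nEu ucoord_delta eqxx -derive1E mxE.
  have -> : partial iv (mcoord phi iv) y = (derive1 C (ucoord y))^-1.
    have s1 : smooth_at y (fun y : pt => (derive1 C (ucoord y))^-1).
      by apply: smooth_at_inv => //; exact: (smooth_on_at oU Uy sC'u).
    have s2 : smooth_at y (fun y : pt => B (uxcoord y)) by exact: (smooth_on_at oU Uy sBux).
    have nE : {near y, mcoord phi iv =1
        fun y : pt => y 0 iv * (derive1 C (ucoord y))^-1 + B (uxcoord y)}.
      by apply: (open_nearT oU Uy) => z; exact: Ev.
    rewrite (nbhs_singleton (partial_eq iv nE)).
    rewrite (partial_add iv (smooth_at_mul (smooth_at_coord y iv) s1) s2).
    rewrite (partial_mul iv (smooth_at_coord y iv) s1) partial_coord eqxx mul1r.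
    rewrite !partialE.
    rewrite (derive_ucoord (fun t => (derive1 C t)^-1)).
    rewrite ucoord_delta index_eqE derive0 mulr0 addr0.
    rewrite (derive_uxcoord (B)).
    by rewrite uxcoord_delta_v derive0 addr0.
  by rewrite divff.
- rewrite (_ : xblock _ = 'J (fun z => A (ucoord y, z)) (xcoord y))//.
  pose V := [set z : 'rV[R]_m | U (mkpt (ucoord y) z (vcoord y))].
  pose emb (z : 'rV[R]_m) := mkpt (ucoord y) z (vcoord y).
  have cemb : continuous (emb : 'rV[R]_m -> pt).
    move=> z; apply: continuous_coords => l; case: (indexP l) => [|i|].
    + rewrite (_ : (fun z => _) = fun=> ucoord y); first exact: cst_continuous.
      by apply/funext => z'; rewrite mkptE.
    + rewrite (_ : (fun z => _) = fun z : 'rV[R]_m => z 0 i); first exact: coord_continuous.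
      by apply/funext => z'; rewrite mkptE.
    + rewrite (_ : (fun z => _) = fun=> vcoord y); first exact: cst_continuous.
      by apply/funext => z'; rewrite mkptE.
  have oV : open V by exact: (open_comp (fun z _ => cemb z)).
  have Vx : V (xcoord y) by rewrite /V /= mkpt_coords.
  have uxE z : uxcoord (emb z) = (ucoord y, z).
    rewrite /uxcoord /emb /ucoord mkptE; congr (_, _).
    by apply/rowP => i; rewrite mxE mkptE.
  have sAl i : smooth_on V (fun z => A (ucoord y, z) 0 i : R).
    have sAV : smooth_on V (A \o slice (ucoord y)).
      have := smooth_on_affine (@slice_affine R m (ucoord y)) (@slice_continuous R m (ucoord y)) sA.
      apply: smooth_on_subset; by move=> z Vz; exists (emb z) => //; exact: uxE.
    exact: ((smooth_on_rowP _ oV).1 sAV i).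
  rewrite (jacobian_slice oV Vx sAl).
  by apply/matrixP => i j; rewrite !mxE nEx.
Qed.

End KundtTransf.

(** * Positive definite matrices by Schur complements *)

Section PositiveDefinite.
Variable R : realType.

Definition qf p (A : 'M[R]_p) (w : 'rV[R]_p) : R := (w *m A *m w^T) 0 0.

Definition posdef p (A : 'M[R]_p) := A^T = A /\ forall w, w != 0 -> 0 < qf A w.

Definition schur p (A : 'M[R]_(1 + p)) : 'M[R]_p :=
  drsubmx A - (A 0 0)^-1 *: ((ursubmx A)^T *m ursubmx A).

(** Completion of the square in the first coordinate. *)
Lemma qf_schur p (A : 'M[R]_(1 + p)) (x : R) (y : 'rV[R]_p) : A^T = A -> A 0 0 != 0 ->
  qf A (row_mx x%:M y) =
  A 0 0 * (x + (A 0 0)^-1 * (ursubmx A *m y^T) 0 0) ^+ 2 + qf (schur A) y.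
Proof.
move=> sA a0; rewrite /schur; set a := A 0 0 in a0 *.
set b := ursubmx A; set D := drsubmx A.
have ulE : ulsubmx A = a%:M.
  rewrite [LHS]mx11_scalar; congr (_%:M).
  by rewrite !mxE; congr (A _ _); apply: val_inj.
have dlE : dlsubmx A = b^T by rewrite /b trmx_ursub sA.
rewrite /qf -[A in LHS]submxK ulE dlE -/b -/D tr_row_mx mul_row_block mul_row_col.
have E1 : y *m b^T = ((b *m y^T) 0 0)%:M.
  by rewrite -[LHS]trmxK trmx_mul trmxK [(b *m _) in LHS]mx11_scalar tr_scalar_mx.
have E2 : b *m y^T = ((b *m y^T) 0 0)%:M by exact: mx11_scalar.
rewrite E1 tr_scalar_mx !mulmxDl -[x%:M *m b *m _]mulmxA E2.
rewrite mulmxBr mulmxBl -scalemxAr -scalemxAl [y *m (b^T *m b)]mulmxA E1 -[_ *m b *m y^T]mulmxA E2.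
rewrite -!scalar_mxM; set q := y *m D *m y^T; set be := (b *m y^T) 0 0.
rewrite !mxE eqxx !mulr1n; by field.
Qed.

Lemma schur_sym p (A : 'M[R]_(1 + p)) : A^T = A -> (schur A)^T = schur A.
Proof.
move=> sA; rewrite /schur linearB /= linearZ /= trmx_mul trmxK trmx_drsub sA.
by [].
Qed.

Lemma row_mx_decomp p (w : 'rV[R]_(1 + p)) : w = row_mx (w 0 0)%:M (rsubmx w).
Proof.
rewrite -[LHS]hsubmxK; congr row_mx; rewrite [LHS]mx11_scalar; congr (_%:M).
by rewrite mxE; congr (w _ _); apply: val_inj.
Qed.

Lemma posdef_schur p (A : 'M[R]_(1 + p)) : A^T = A ->
  posdef A <-> 0 < A 0 0 /\ posdef (schur A).
Proof.
move=> sA; split=> [[_ pA]|[a0 [_ pS]]].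
  have a0 : 0 < A 0 0.
    have <- : qf A (delta_mx 0 0) = A 0 0 by rewrite /qf -rowE trmx_delta -colE !mxE.
    apply: pA; apply/eqP => /rowP/(_ 0)/eqP.
    by rewrite !mxE !eqxx oner_eq0.
  split=> //; split; first exact: schur_sym.
  move=> y y0.
  have := pA (row_mx (- ((A 0 0)^-1 * (ursubmx A *m y^T) 0 0))%:M y).
  rewrite qf_schur ?gt_eqF// addNr expr0n mulr0 add0r; apply.
  apply: contra y0 => /eqP/(congr1 (@rsubmx R 1 1 p)).
  by rewrite row_mxKr linear0 => ->.
split=> // w w0; rewrite (row_mx_decomp w) qf_schur ?gt_eqF//.
have [y0|y0] := eqVneq (rsubmx w) 0.
  rewrite y0 /qf mul0mx mul0mx trmx0 mulmx0 !mxE mulr0 !addr0 pmulr_rgt0//.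
  rewrite exprn_even_gt0//=; apply: contra w0 => /eqP x0.
  by rewrite (row_mx_decomp w) x0 y0 raddf0 row_mx0.
apply: ltr_wpDl; last exact: pS.
by apply: mulr_ge0; [exact: ltW|exact: sqr_ge0].
Qed.

Lemma cholesky p (A : 'M[R]_p) : posdef A -> exists2 L : 'M[R]_p, \det L != 0 & A = L *m L^T.
Proof.
elim: p A => [|p IH] A pA.
  by exists A; [rewrite det_mx00 oner_neq0|apply/matrixP => -[]].
have sA : A^T = A by case: pA.
have [a0 pS] := (posdef_schur sA).1 pA.
have [L dL LE] := IH _ pS.
pose r := Num.sqrt (A 0 0).
have r0 : r != 0 by rewrite gt_eqF// sqrtr_gt0.
have rr : r * r = A 0 0 by rewrite -expr2 sqr_sqrtr// ltW.
pose L' : 'M[R]_(1 + p) := block_mx r%:M 0 (r^-1 *: (ursubmx (A : 'M[R]_(1 + p)))^T) L.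
have dL' : \det L' != 0 by rewrite det_lblock det_scalar1 mulf_neq0.
suff E : (A : 'M[R]_(1 + p)) = L' *m L'^T by exists L'.
rewrite /L' tr_block_mx mulmx_block tr_scalar_mx !trmx0 !mulmx0 !mul0mx !addr0 -scalar_mxM rr.
rewrite linearZ /= trmxK -scalemxAl -!scalemxAr mul_scalar_mx mul_mx_scalar !scalerA.
rewrite !mulVf// !scale1r -scalemxAl scalerA -LE /schur.
rewrite -[LHS](@submxK _ 1 p 1 p); congr block_mx.
- rewrite [LHS]mx11_scalar; congr (_%:M).
  by rewrite !mxE; congr (A _ _); apply: val_inj.
- have sA' : (A : 'M[R]_(1 + p))^T = A := sA.
  by rewrite trmx_ursub sA'.
- by rewrite -invfM rr addrC subrK.
Qed.

(** The Schur criterion reduces positivity, by induction on the size, to finitely many strict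
    inequalities between continuous functions; no compactness of a sphere is invoked. *)
Lemma posdef_near (T : topologicalType) (t0 : T) p (A : T -> 'M[R]_p) :
  (forall i j, {for t0, continuous (fun t => A t i j)}) ->
  (forall t, (A t)^T = A t) -> posdef (A t0) -> \forall t \near t0, posdef (A t).
Proof.
elim: p A => [|p IH] A cA sA pA.
  near=> t; split=> // w w0; case/eqP: w0.
  by apply/rowP => -[].
have [a0 pS] := (posdef_schur (sA t0)).1 pA.
have nS : \forall t \near t0, posdef (@schur p (A t)).
  apply: IH pS => [i j|t]; last exact: schur_sym.
  rewrite (_ : (fun t => _) = fun t => A t (rshift 1 i) (rshift 1 j) -
      (A t 0 0)^-1 * (A t 0 (rshift 1 i) * A t 0 (rshift 1 j))); last first.
    apply/funext => t; rewrite !mxE big_ord1 !mxE.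
    by congr (_ - _ * (A t _ _ * A t _ _)); apply: val_inj.
  apply: continuousB; first exact: cA.
  apply: continuousM; first by apply: continuousV; [rewrite gt_eqF|exact: cA].
  by apply: continuousM; exact: cA.
have na : \forall t \near t0, 0 < A t 0 0.
  by apply: (cvgr_gt (A t0 0 0)) => //; exact: cA.
by apply: filterS2 nS na => t St at0; apply/(posdef_schur (sA t)).
Unshelve. all: by end_near. Qed.

End PositiveDefinite.

(** * Jet vectors, and orbits in terms of pullbacks *)

Section JetVectors.
Variables (R : realType) (m k : nat).
Local Notation n := (1 + m + 1)%N.
Local Notation pt := 'rV[R]_(1 + m + 1).
Implicit Types (p q : jet_vec R m k) (s : pt -> fiber_index m -> R) (a b : pt).

Lemma hmx_sym (y : fiber_index m -> R) : (hmx y)^T = hmx y.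
Proof. by apply/matrixP => i j; rewrite !mxE fhC. Qed.

Lemma in_F_posdef (y : fiber_index m -> R) : in_F y <-> posdef (hmx y).
Proof. by rewrite in_FP; split=> [H|[_ H]]; [split; [exact: hmx_sym|exact: H]|exact: H]. Qed.

Lemma in_F_near s a : (forall c, smooth_at a (fun y => s y c)) -> in_F (s a) ->
  \forall y \near a, in_F (s y).
Proof.
move=> ss /in_F_posdef Fa.
have H : \forall y \near a, posdef (hmx (s y)).
  apply: posdef_near Fa => [i j|y]; last exact: hmx_sym.
  rewrite (_ : (fun y => _) = fun y => s y (fh i j)); last by apply/funext => y; rewrite mxE.
  exact: smooth_at_continuous.
by apply: filterS H => y /in_F_posdef.
Qed.

Lemma jcoord_jet_base s a l : jcoord (jet k s a) (inl l) = a 0 l.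
Proof. by rewrite /jcoord /jet mxE enum_rankK. Qed.

Lemma jcoord_jet s a c sigma :
  jcoord (jet k s a) (inr (c, sigma)) = multi_derive sigma (fun y => s y c) a.
Proof. by rewrite /jcoord /jet mxE enum_rankK. Qed.

Lemma jcoord_inj p q : (forall c, jcoord p c = jcoord q c) -> p = q.
Proof. by move=> H; apply/rowP => r; rewrite -(enum_valK r); exact: H. Qed.

Lemma jet_sjeq s s' a : sjeq k a s s' -> jet k s a = jet k s' a.
Proof.
move=> H; apply: jcoord_inj => -[l|[c sigma]]; first by rewrite !jcoord_jet_base.
rewrite !jcoord_jet !multi_deriveE; have /jeqP[_ _] := H c; apply.
exact: size_flat.
Qed.

Definition jbase p : pt := \row_l jcoord p (inl l).

Definition jpoly p (y : pt) (c : fiber_index m) : R :=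
  tpoly (fun sigma => jcoord p (inr (c, sigma))) (jbase p) y.

Lemma ipartial_jpoly p c ls : (size ls <= k)%N ->
  ipartial ls (fun y => jpoly p y c) (jbase p) = jcoord p (inr (c, mi k ls)).
Proof. exact: ipartial_tpoly. Qed.

Lemma smooth_at_jpoly p a c : smooth_at a (fun y => jpoly p y c).
Proof. exact: smooth_at_tpoly. Qed.

Lemma jbase_jet s a : jbase (jet k s a) = a.
Proof. by apply/rowP => l; rewrite mxE jcoord_jet_base. Qed.

Lemma jet_jpoly p : jet k (jpoly p) (jbase p) = p.
Proof.
apply: jcoord_inj => -[l|[c sigma]]; first by rewrite jcoord_jet_base mxE.
by rewrite jcoord_jet multi_derive_tpoly.
Qed.

Lemma sjeq_jpoly s a : (forall c, smooth_at a (fun y => s y c)) ->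
  sjeq k a s (jpoly (jet k s a)).
Proof.
move=> ss c; apply/jeqP; split; [exact: ss|exact: smooth_at_jpoly|move=> ls lk].
have E : jbase (jet k s a) = a by exact: jbase_jet.
by rewrite -[X in _ = _ X]E ipartial_jpoly// jcoord_jet multi_derive_mi.
Qed.

Lemma mi_nil : mi k [::] = multi_index0 m k.
Proof.
apply: expo_inj => l; rewrite expo_mi//.
by rewrite /expo /= ffunE.
Qed.

Lemma jpoly_base p c : jpoly p (jbase p) c = jcoord p (inr (c, multi_index0 m k)).
Proof. by rewrite -mi_nil -ipartial_jpoly. Qed.

Lemma jet_spaceE p : jet_space p <-> in_F (jpoly p (jbase p)).
Proof.
rewrite /jet_space /=; have -> // : (fun c => jcoord p (inr (c, multi_index0 m k))) = jpoly p (jbase p).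
by apply/funext => c; rewrite jpoly_base.
Qed.

Lemma multi_derive_nil (f : pt -> R) a : multi_derive (multi_index0 m k) f a = f a.
Proof.
rewrite multi_deriveE (_ : flat _ = [::])//; apply/nilP; rewrite /nilp size_count.
by rewrite big1// => l _; rewrite count_flat /expo /= ffunE.
Qed.

End JetVectors.

Section Orbits.
Variables (R : realType) (m k : nat).
Local Notation n := (1 + m + 1)%N.
Local Notation pt := 'rV[R]_(1 + m + 1).
Implicit Types (p q : jet_vec R m k) (s : pt -> fiber_index m -> R) (a b : pt).
Implicit Types (phi psi : 'I_n -> pt -> R).

Lemma diff_row_fun phi a (xi : pt) : (forall l, smooth_at a (phi l)) ->
  'd (row_fun phi) a xi = xi *m jac phi a.
Proof.
move=> sp; have sr l : smooth_at a (fun y => row_fun phi y 0 l).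
  rewrite (_ : (fun y => _) = phi l)//; by apply/funext => y; rewrite mxE.
have [_ dE] := smooth_diff_row sr.
apply/rowP => l; rewrite dE mxE; apply: eq_bigr => j _; rewrite mxE; congr (_ * partial _ _ _).
by apply/funext => y; rewrite mxE.
Qed.

Lemma kundt_form_pull phi a y y' : (forall l, smooth_at a (phi l)) -> kjac (jac phi a) ->
  (forall xi : pt, kundt_form y xi = kundt_form y' ('d (row_fun phi) a xi)) <->
  y = comps (jac phi a *m gmx y' *m (jac phi a)^T).
Proof.
move=> sp kJ; split=> [H|E xi].
  rewrite -[LHS]compsK; congr comps; apply: quad_form_inj.
  - exact: gmx_sym.
  - exact: trmx_conj (gmx_sym y').
  - move=> xi; rewrite -kundt_formE H diff_row_fun// kundt_formE trmx_mul.
    by rewrite !mulmxA.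
rewrite diff_row_fun// !kundt_formE {1}E gmx_pull// trmx_mul.
by rewrite !mulmxA.
Qed.

Lemma orbit_elim p q : kundt_orbit p q -> exists a phi s s',
  [/\ kmap a phi, (forall c, smooth_at a (fun y => s y c)) /\
      (forall c, smooth_at (row_fun phi a) (fun y => s' y c)),
      \forall y \near a, s y = pull phi s' y,
      p = jet k s a & q = jet k s' (row_fun phi a)].
Proof.
move=> [a [Phi [s [s' [kT [[U [oU Ua sU _]] [U' [oU' U'a sU' _]]] E -> ->]]]]].
have kP := kundt_transf_kmap kT.
exists a, (mcoord Phi), s, s'; rewrite row_fun_mcoord; split=> //.
  by split=> c; [exact: (smooth_on_at oU Ua)|exact: (smooth_on_at oU' U'a)].
case: kP => sP kP.
have nP : \forall y \near a, forall l, smooth_at y (mcoord Phi l).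
  by apply: near_forall_fin => l; exact: smooth_at_near.
apply: filterS3 E kP nP => y Ey kJ sy.
by apply/(kundt_form_pull _ _ sy kJ) => xi; rewrite row_fun_mcoord; exact: Ey.
Qed.

Lemma local_section_near s a : (forall c, smooth_at a (fun y => s y c)) -> in_F (s a) ->
  local_section a s.
Proof.
move=> ss Fa.
have nS : \forall y \near a, forall c, smooth_at y (fun y => s y c).
  by apply: near_forall_fin => c; exact: smooth_at_near.
have nSF : \forall y \near a, (forall c, smooth_at y (fun y => s y c)) /\ in_F (s y).
  by apply: filterS2 nS (in_F_near ss Fa).
have [U [oU Ua UP]] := near_openP nSF.
exists U; split; [exact: oU|exact: Ua|move=> c|by move=> y /UP[]].
by apply: smooth_at_on => y /UP[].
Qed.

Lemma orbit_intro a phi s' : kundt_transf a (row_fun phi) -> kmap a phi ->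
  (forall c, smooth_at (row_fun phi a) (fun y => s' y c)) -> in_F (s' (row_fun phi a)) ->
  kundt_orbit (jet k (pull phi s') a) (jet k s' (row_fun phi a)).
Proof.
move=> kT kP ss' F'; have kJ := kmap_kjac kP; case: kP => sP nJ.
exists a, (row_fun phi), (pull phi s'), s'; split=> //.
  split; last exact: local_section_near.
  apply: local_section_near; first exact: smooth_at_pull.
  exact: in_F_pull.
have nP : \forall y \near a, forall l, smooth_at y (phi l).
  by apply: near_forall_fin => l; exact: smooth_at_near.
apply: filterS2 nJ nP => y kJy sy.
by apply/(kundt_form_pull _ _ sy kJy).
Qed.

(** From phi psi = id to order r one gets psi phi psi = psi to order r, and psi can be cancelled on
    the right by [jeq_compV]. *)
Lemma jeq_inverse r phi psi b : (forall l, smooth_at b (psi l)) -> \det (jac psi b) != 0 ->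
  (forall l, smooth_at (row_fun psi b) (phi l)) ->
  row_fun phi (row_fun psi b) = b ->
  (forall l, jeq r b (compm phi psi l) (@idm R n l)) ->
  forall l, jeq r (row_fun psi b) (compm psi phi l) (@idm R n l).
Proof.
move=> spsi dJ sphi bE H l.
apply: (jeq_compV spsi dJ).
- by apply: (smooth_at_comp sphi); rewrite bE; exact: spsi.
- exact: smooth_at_coord.
have -> : compm psi phi l \o row_fun psi = psi l \o row_fun (compm phi psi).
  by apply/funext => y; rewrite /compm /= row_fun_compm.
have -> : @idm R n l \o row_fun psi = psi l \o row_fun (@idm R n).
  by apply/funext => y; rewrite /= row_fun_idm /idm mxE.
apply: jeq_comp H _; rewrite row_fun_compm bE; exact: jeq_refl.
Qed.

(** To order k, s' agrees with psi^* phi^* s' = psi^* s, and hence with psi^* of the Taylor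
    polynomial of s. Only the (k + 1)-jet of psi matters, so an inverse of phi on jets can replace
    the true one. *)
Lemma orbit_pull_sub a phi s s' psi :
  kmap a phi -> (forall c, smooth_at a (fun y => s y c)) ->
  (forall c, smooth_at (row_fun phi a) (fun y => s' y c)) ->
  (\forall y \near a, s y = pull phi s' y) ->
  kmap (row_fun phi a) psi -> row_fun psi (row_fun phi a) = a ->
  (forall l, jeq k.+1 a (compm psi phi l) (@idm R n l)) ->
  jet k s' (row_fun phi a) = jet k (pull psi (jpoly (jet k s a))) (row_fun phi a).
Proof.
move=> kphi ss ss' sE kpsi psia inv; set b := row_fun phi a in ss' kpsi psia *.
have [sphi _] := kphi; have [spsi _] := kpsi.
have inv' := jeq_inverse sphi (det_kjac (kmap_kjac kphi)) spsi psia inv.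
apply: jet_sjeq; apply: sjeq_sym.
have r1 i : jeq k.+1 b (psi i) (psi i) by exact: jeq_refl.
apply: (@sjeq_trans _ _ _ _ _ (pull psi s)).
  by apply: sjeq_pull r1 _; rewrite psia; apply: sjeq_sym; exact: sjeq_jpoly.
apply: (@sjeq_trans _ _ _ _ _ (pull psi (pull phi s'))).
  apply: sjeq_pull r1 _; rewrite psia; exact: sjeq_near.
apply: (@sjeq_trans _ _ _ _ _ (pull (compm phi psi) s')).
  apply: sjeq_near; last by apply: pull_compm => //; rewrite psia.
  apply: smooth_at_pull => // c; rewrite psia.
  by apply: smooth_at_pull => // c'; exact: ss'.
rewrite -[X in sjeq _ _ _ X](@pull_idm R m).
by apply: sjeq_pull inv' _; apply: sjeq_refl => c; rewrite row_fun_compm psia; exact: ss'.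
Qed.

(** The definition of the orbit asks for an actual isometry between two sections. As psi inverts phi
    on jets only, the section representing p is taken to be phi^* psi^* of the Taylor polynomial,
    which has the same k-jet as the polynomial itself. *)
Lemma orbit_pull_sup p psi phi b : jet_space p ->
  kmap b psi -> row_fun psi b = jbase p ->
  kundt_transf (jbase p) (row_fun phi) -> kmap (jbase p) phi -> row_fun phi (jbase p) = b ->
  (forall l, jeq k.+1 b (compm phi psi l) (@idm R n l)) ->
  kundt_orbit p (jet k (pull psi (jpoly p)) b).
Proof.
move=> /jet_spaceE Fp kpsi psib kT kphi phia inv.
have [sphi _] := kphi; have [spsi _] := kpsi.
have inv' : forall l, jeq k.+1 (jbase p) (compm psi phi l) (@idm R n l).
  rewrite -psib; apply: jeq_inverse => //.
  - exact: det_kjac (kmap_kjac kpsi).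
  - by move=> l; rewrite psib; exact: sphi.
  - by rewrite psib.
pose s' := pull psi (jpoly p).
have ss' c : smooth_at b (fun y => s' y c).
  by apply: smooth_at_pull => // c'; exact: smooth_at_jpoly.
have pE : p = jet k (pull phi s') (jbase p).
  rewrite -{1}(jet_jpoly p); apply: jet_sjeq; apply: sjeq_sym.
  apply: (@sjeq_trans _ _ _ _ _ (pull (compm psi phi) (jpoly p))).
    apply: sjeq_near; first by apply: smooth_at_pull => // c; rewrite phia; exact: ss'.
    by apply: pull_compm => //; rewrite phia.
  rewrite -[X in sjeq _ _ _ X](@pull_idm R m).
  by apply: sjeq_pull inv' _; apply: sjeq_refl => c; exact: smooth_at_jpoly.
suff : kundt_orbit (jet k (pull phi s') (jbase p)) (jet k s' b) by rewrite -pE.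
rewrite -[X in jet k s' X]phia; apply: orbit_intro => //.
  by move=> c; rewrite phia.
rewrite phia /s' /pull; apply: in_F_pull; first exact: kmap_kjac.
by rewrite psib.
Qed.

End Orbits.

(** * Inversion of jets with prescribed variables *)

Section JetSurjectivity.
Variables (R : realType) (m r : nat).
Local Notation n := (1 + m + 1)%N.
Local Notation pt := 'rV[R]_(1 + m + 1).
Implicit Types (f g : pt -> R) (a b : pt) (phi : 'I_n -> pt -> R).

Lemma ipartial_lin a (c : R) f g ls : smooth_at a f -> smooth_at a g ->
  ipartial ls (fun y => c * f y + g y) a = c * ipartial ls f a + ipartial ls g a.
Proof.
elim: ls a => //= l ls IH a sf sg.
have nE : {near a, ipartial ls (fun y => c * f y + g y) =1
    fun y => c * ipartial ls f y + ipartial ls g y}.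
  by apply: filterS2 (smooth_at_near sf) (smooth_at_near sg) => y; exact: IH.
rewrite (nbhs_singleton (partial_eq l nE)).
have If := smooth_at_ipartial ls sf; have Ig := smooth_at_ipartial ls sg.
have sc := smooth_at_cst a c.
rewrite (partial_add l (smooth_at_mul sc If) Ig) (partial_mul l sc If).
by rewrite partial_cst mul0r add0r.
Qed.

Lemma ipartial_cst0 a ls : ipartial ls (fun=> 0 : R) a = 0.
Proof.
elim: ls a => //= l ls IH a; rewrite (_ : ipartial ls _ = fun=> 0); last exact/funext.
exact: partial_cst.
Qed.

Lemma ipartial_lincomb a (I : Type) (s : seq I) (c : I -> R) (F : I -> pt -> R) ls :
  (forall i, smooth_at a (F i)) ->
  ipartial ls (fun y => \sum_(i <- s) c i * F i y) a = \sum_(i <- s) c i * ipartial ls (F i) a.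
Proof.
move=> sF; elim: s => [|i s IH].
  rewrite big_nil -[RHS](ipartial_cst0 a ls); congr (ipartial _ _ _).
  by apply/funext => y; rewrite big_nil.
rewrite big_cons -IH -ipartial_lin.
- by congr (ipartial _ _ _); apply/funext => y; rewrite big_cons.
- exact: sF.
- by apply: smooth_at_sum => j; apply: smooth_at_mul; [exact: smooth_at_cst|exact: sF].
Qed.

Variable T : pred 'I_n.

Definition supported (tau : multi_index m r) := [forall l, (expo tau l == 0%N) || T l].

Lemma partial_mono_out b tau l y : supported tau -> ~~ T l ->
  partial l (mono b (expo tau)) y = 0.
Proof.
move=> /forallP/(_ l) st /negbTE Tl; rewrite Tl orbF in st.
by rewrite partial_mono (eqP st).
Qed.

Lemma ipartial_out a g ls l : smooth_at a g -> l \in ls ->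
  {near a, partial l g =1 fun=> 0} -> ipartial ls g a = 0.
Proof.
move=> sg lls g0; have := lls; case/splitPr => p1 p2.
have pe : perm_eq (p1 ++ l :: p2) (rcons (p1 ++ p2) l).
  by rewrite -cats1 -catA perm_cat2l -cat1s perm_catC.
rewrite (ipartial_perm sg pe) ipartial_rcons.
by rewrite (nbhs_singleton (ipartial_eq _ g0)) ipartial_cst0.
Qed.

(** Sending the coefficients of a polynomial to the jet of its composite with phi is a linear map
    between spaces of equal dimension, injective by [jeq_compV] and therefore onto. The predicate T
    keeps the polynomial within the variables allowed for a component of a Kundt map. *)
Lemma jet_surj a phi g : (forall l, smooth_at a (phi l)) -> \det (jac phi a) != 0 ->
  (forall l i, ~~ T l -> T i -> {near a, partial l (phi i) =1 fun=> 0}) ->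
  smooth_at a g ->
  (forall ls, (size ls <= r)%N -> ~~ all T ls -> ipartial ls g a = 0) ->
  exists c : multi_index m r -> R, (forall tau, ~~ supported tau -> c tau = 0) /\
    jeq r a (tpoly c (row_fun phi a) \o row_fun phi) g.
Proof.
move=> sphi dJ phi0 sg g0; set b := row_fun phi a.
pose F (tau : multi_index m r) : pt -> R := mono b (expo tau) \o row_fun phi.
have sF tau : smooth_at a (F tau) by apply: smooth_at_comp => //; exact: smooth_at_mono.
have F0 tau l : supported tau -> ~~ T l -> {near a, partial l (F tau) =1 fun=> 0}.
  move=> st Tl.
  have n1 : \forall y \near a, forall i, smooth_at y (phi i).
    by apply: near_forall_fin => i; exact: smooth_at_near.
  have n2 : \forall y \near a, forall i, T i -> partial l (phi i) y = 0.
    apply: near_forall_fin => i; case: (boolP (T i)) => [Ti|_]; last exact: near_all.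
    by apply: filterS (phi0 l i Tl Ti) => y ->.
  apply: filterS2 n1 n2 => y s1 s2.
  rewrite (partial_comp l s1 (smooth_at_mono _ _ _)) big1// => i _.
  case: (boolP (T i)) => [Ti|Ti]; first by rewrite s2// mulr0.
  by rewrite partial_mono_out// mul0r.
have sup_all ls tau : supported tau -> ~~ all T ls -> ipartial ls (F tau) a = 0.
  move=> st /allPn[l lls Tl]; exact: ipartial_out (sF tau) lls (F0 tau l st Tl).
have nsup (sigma : multi_index m r) : ~~ supported sigma -> ~~ all T (flat sigma).
  rewrite negb_forall => /existsP[l]; rewrite negb_or => /andP[e0 Tl].
  by apply/allPn; exists l => //; rewrite -has_pred1 has_count count_flat lt0n.
have tpolyE (c : multi_index m r -> R) :
    tpoly c b \o row_fun phi = fun y => \sum_tau c tau * F tau y by [].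
(* Unsupported coefficients are mapped to themselves. The matrix is then square, and the two kinds
   do not interfere, as composites of supported monomials have no derivatives in unsupported
   directions. *)
pose M : 'M[R]_#|{: multi_index m r}| := \matrix_(i, j)
  if supported (enum_val i) then ipartial (flat (enum_val j)) (F (enum_val i)) a
  else (i == j)%:R.
have cM (c : 'rV[R]_#|{: multi_index m r}|) (sigma : multi_index m r) :
    (c *m M) 0 (enum_rank sigma) =
    \sum_tau c 0 (enum_rank tau) * (if supported tau then ipartial (flat sigma) (F tau) a
      else (tau == sigma)%:R).
  rewrite mxE (reindex enum_rank) /=; last exact: onW_bij (enum_rank_bij _).
  apply: eq_bigr => tau _; rewrite mxE !enum_rankK.
  by rewrite (inj_eq enum_rank_inj).
have out (c : 'rV[R]_#|{: multi_index m r}|) sigma : ~~ supported sigma ->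
    (c *m M) 0 (enum_rank sigma) = c 0 (enum_rank sigma).
  move=> ns; rewrite cM (bigD1 sigma)//= (negbTE ns) eqxx mulr1 big1 ?addr0// => tau ts.
  case: ifP => st; last by rewrite (negbTE ts) mulr0.
  by rewrite sup_all ?mulr0//; exact: nsup.
have inn (c : 'rV[R]_#|{: multi_index m r}|) :
    (forall sigma, ~~ supported sigma -> c 0 (enum_rank sigma) = 0) ->
    forall sigma, (c *m M) 0 (enum_rank sigma) =
      ipartial (flat sigma) (fun y => \sum_tau c 0 (enum_rank tau) * F tau y) a.
  move=> c0 sigma; rewrite cM ipartial_lincomb//; apply: eq_bigr => tau _.
  by case: (boolP (supported tau)) => // /c0 ->; rewrite !mul0r.
have sP (c : multi_index m r -> R) : smooth_at a (fun y => \sum_tau c tau * F tau y).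
  by apply: smooth_at_sum => j; apply: smooth_at_mul; [exact: smooth_at_cst|exact: sF].
have sup_flat ls (c : 'rV[R]_#|{: multi_index m r}|) : (size ls <= r)%N ->
    ipartial ls (fun y => \sum_tau c 0 (enum_rank tau) * F tau y) a =
    ipartial (flat (mi r ls)) (fun y => \sum_tau c 0 (enum_rank tau) * F tau y) a.
  by move=> lr; apply: ipartial_perm (sP _) (perm_flat_mi lr).
have dM : \det M != 0.
  apply: det_neq0_inj => c cM0.
  have cout sigma : ~~ supported sigma -> c 0 (enum_rank sigma) = 0.
    by move=> ns; rewrite -out// cM0 mxE.
  have J0 : jeq r a (tpoly (fun tau => c 0 (enum_rank tau)) b \o row_fun phi)
      ((fun=> 0) \o row_fun phi).
    rewrite tpolyE; apply/jeqP; split; [exact: sP|exact: smooth_at_cst|move=> ls lr].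
    by rewrite [RHS]ipartial_cst0 sup_flat// -inn// cM0 mxE.
  have /jeqP[_ _ E] := jeq_compV sphi dJ (smooth_at_tpoly _ _ _) (smooth_at_cst _ 0) J0.
  apply/rowP => i; rewrite mxE -(enum_valK i).
  have := E (flat (enum_val i)) (size_flat _).
  by rewrite ipartial_cst0 ipartial_tpoly ?size_flat// mi_flat.
have uM : M \in unitmx by rewrite unitmxE unitfE.
pose t : 'rV[R]_#|{: multi_index m r}| := \row_i ipartial (flat (enum_val i)) g a.
pose c := t *m invmx M.
have cE : c *m M = t by rewrite mulmxKV.
have cout sigma : ~~ supported sigma -> c 0 (enum_rank sigma) = 0.
  move=> ns; rewrite -out// cE mxE enum_rankK.
  by apply: g0; [exact: size_flat|exact: nsup].
exists (fun tau => c 0 (enum_rank tau)); split; first exact: cout.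
rewrite tpolyE; apply/jeqP; split; [exact: sP|exact: sg|move=> ls lr].
rewrite sup_flat// -inn// cE mxE enum_rankK.
by apply/esym; apply: ipartial_perm sg (perm_flat_mi lr).
Qed.

End JetSurjectivity.

Lemma sf_smooth_at (R : realType) n (a : 'rV[R]_n) : subfield_on [set a] (smooth_at a).
Proof.
split=> [c|f g|f g|f f0 sf].
- exact: smooth_at_cst.
- exact: smooth_at_add.
- exact: smooth_at_mul.
- by apply: smooth_at_inv => //; exact: f0.
Qed.

(** * The parametrized family of Kundt maps *)

Section PolynomialMaps.
Variables (R : realType) (m r : nat).
Local Notation n := (1 + m + 1)%N.
Local Notation pt := 'rV[R]_(1 + m + 1).
Local Notation iu := (iu m).
Local Notation iv := (iv m).
Implicit Types (a b y : pt) (c l : 'I_n) (tau : multi_index m r.+1).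

(* The coordinates on which component c of a Kundt map may depend
   (for c = v, up to the term in v fixed by the component u). *)
Definition vars c : pred 'I_n := fun l => if c == iu then l == iu else l != iv.

Definition param := {x : 'I_n * multi_index m r.+1 | supported (vars x.1) x.2}.

Local Notation Gam := 'rV[R]_#|{: param}|.
Implicit Types (gam : Gam).

Definition coef gam c tau : R :=
  oapp (fun i : param => gam 0 (enum_rank i)) 0 (insub (c, tau)).

Lemma coef_out gam c tau : ~~ supported (vars c) tau -> coef gam c tau = 0.
Proof. by move=> ns; rewrite /coef insubN. Qed.

Lemma coef_val gam (i : param) : coef gam (val i).1 (val i).2 = gam 0 (enum_rank i).
Proof. by rewrite /coef -surjective_pairing valK. Qed.

Definition coef_of (f : 'I_n -> multi_index m r.+1 -> R) : Gam :=
  \row_i f (val (enum_val i)).1 (val (enum_val i)).2.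

Lemma coef_ofK f c tau : supported (vars c) tau -> coef (coef_of f) c tau = f c tau.
Proof.
move=> st; rewrite /coef insubT /= mxE enum_rankK //.
Qed.

Definition tau0 : multi_index m r.+1 := mi r.+1 [::].

Lemma supported_tau0 T : supported T tau0.
Proof. by apply/forallP => l; rewrite expo_mi. Qed.

(** All maps of the family take their base point to a prescribed point a. The constant coefficients
    are thereby free to record the base point, which is also the base point of the pulled-back jet;
    [pcoef] puts a in their place. *)
Definition pbase gam : pt := \row_c coef gam c tau0.

Definition pcoef a gam c tau : R := if tau == tau0 then a 0 c else coef gam c tau.

Lemma pcoef_out a gam c tau : ~~ supported (vars c) tau -> pcoef a gam c tau = 0.
Proof.
move=> ns; rewrite /pcoef; case: eqP => [E|_]; last exact: coef_out.
by rewrite E supported_tau0 in ns.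
Qed.

Definition pf a gam c : pt -> R := tpoly (pcoef a gam c) (pbase gam).

(** The component v cannot be a polynomial, since its v-derivative is the inverse of the
    u-derivative of the component u. The factor of this term vanishes at the base point, so there
    the derivatives not involving v are those of the polynomial part. *)
Definition param_map a gam c (y : pt) : R :=
  if c == iv then pf a gam iv y + (y 0 iv - pbase gam 0 iv) / partial iu (pf a gam iu) y
  else pf a gam c y.

Lemma smooth_at_pf z a gam c : smooth_at z (pf a gam c).
Proof. exact: smooth_at_tpoly. Qed.

Lemma ipartial_pf a gam c ls : (size ls <= r.+1)%N ->
  ipartial ls (pf a gam c) (pbase gam) = pcoef a gam c (mi r.+1 ls).
Proof. exact: ipartial_tpoly. Qed.

Lemma pf_base a gam c : pf a gam c (pbase gam) = a 0 c.
Proof. by rewrite -[LHS]/(ipartial [::] _ _) ipartial_pf// /pcoef eqxx. Qed.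

Lemma mi1_neq0 l : mi r.+1 [:: l] == tau0 = false.
Proof.
apply/negP => /eqP /(congr1 (fun t => expo t l)).
by rewrite !expo_mi//= eqxx.
Qed.

Lemma partial_pf_base a gam c l :
  partial l (pf a gam c) (pbase gam) = coef gam c (mi r.+1 [:: l]).
Proof. by rewrite -[LHS]/(ipartial [:: l] _ _) ipartial_pf// /pcoef mi1_neq0. Qed.

Lemma partial_pf_out a gam c l y : ~~ vars c l -> partial l (pf a gam c) y = 0.
Proof.
move=> vl; rewrite /pf /tpoly partial_sum => [|tau]; last first.
  by apply: smooth_at_mul; [exact: smooth_at_cst|exact: smooth_at_mono].
rewrite big1// => tau _.
rewrite (partial_mul l (smooth_at_cst y _) (smooth_at_mono _ _ _)) partial_cst mul0r add0r.
case: (boolP (supported (vars c) tau)) => [st|/(pcoef_out a gam) ->]; last by rewrite mul0r.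
by rewrite (partial_mono_out _ _ st)// mulr0.
Qed.

Lemma pf_agree a gam c y (y' : pt) : (forall l, vars c l -> y 0 l = y' 0 l) ->
  pf a gam c y = pf a gam c y'.
Proof.
move=> yz; apply: eq_bigr => tau _.
case: (boolP (supported (vars c) tau)) => [/forallP st|/(pcoef_out a gam) ->]; last by rewrite !mul0r.
congr (_ * _); apply: eq_bigr => l _; rewrite /pw.
by case/orP: (st l) => [/eqP ->|/yz ->//]; rewrite !expr0.
Qed.

Definition Gset : set Gam := [set gam | coef gam iu (mi r.+1 [:: iu]) != 0 /\
  \det (\matrix_(i, j) coef gam (ix j) (mi r.+1 [:: ix i])) != 0].

Definition pjac a gam y : 'M[R]_m := \matrix_(i, j) partial (ix i) (pf a gam (ix j)) y.

Definition pdom a gam : set pt :=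
  [set y | partial iu (pf a gam iu) y != 0 /\ \det (pjac a gam y) != 0].

Lemma smooth_at_detpjac a gam y : smooth_at y (fun y => \det (pjac a gam y)).
Proof.
apply: (sf_det (sf_smooth_at y)) => i j.
rewrite (_ : (fun y => _) = partial (ix i) (pf a gam (ix j))).
  exact: smooth_at_partial (smooth_at_pf _ _ _ _).
by apply/funext => z; rewrite mxE.
Qed.

Lemma pdom_base a gam : Gset gam <-> pdom a gam (pbase gam).
Proof.
rewrite /pdom /= partial_pf_base; rewrite (_ : pjac _ _ _ = \matrix_(i, j) coef gam (ix j) (mi r.+1 [:: ix i]))//.
by apply/matrixP => i j; rewrite !mxE partial_pf_base.
Qed.

Lemma pdom_open a gam : open (pdom a gam).
Proof.
apply: openI.
  apply: (@open_comp _ _ (partial iu (pf a gam iu)) [set z : R | z != 0]) => [y _|].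
    exact: smooth_at_continuous (smooth_at_partial _ (smooth_at_pf _ _ _ _)).
  exact: open_neq.
apply: (@open_comp _ _ (fun y => \det (pjac a gam y)) [set z : R | z != 0]) => [y _|].
  exact: smooth_at_continuous (smooth_at_detpjac _ _ _).
exact: open_neq.
Qed.

Lemma smooth_at_param_map a gam c y : pdom a gam y -> smooth_at y (param_map a gam c).
Proof.
move=> [U0 _]; rewrite /param_map; case: eqP => _; last exact: smooth_at_pf.
apply: smooth_at_add; first exact: smooth_at_pf.
apply: smooth_at_mul; last first.
  by apply: smooth_at_inv => //; exact: smooth_at_partial (smooth_at_pf _ _ _ _).
by apply: smooth_at_add; [exact: smooth_at_coord|exact: smooth_at_cst].
Qed.

Lemma param_map_base a gam : row_fun (param_map a gam) (pbase gam) = a.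
Proof.
apply/rowP => c; rewrite mxE /param_map; case: eqP => [->|_]; last exact: pf_base.
by rewrite pf_base subrr mul0r addr0.
Qed.

Lemma jac_param_map a gam y : pdom a gam y -> kjac (jac (param_map a gam) y).
Proof.
move=> dy; have [U0 D0] := dy.
have E c : c != iv -> param_map a gam c = pf a gam c.
  by move=> /negbTE cv; apply/funext => z; rewrite /param_map cv.
have Eu : param_map a gam iu = pf a gam iu by apply: E; rewrite index_eqE.
have Ex i : param_map a gam (ix i) = pf a gam (ix i) by apply: E; rewrite index_eqE.
split.
- by move=> i; rewrite mxE Eu partial_pf_out// /vars eqxx index_eqE.
- by rewrite mxE Eu partial_pf_out// /vars eqxx index_eqE.
- by move=> i; rewrite mxE Ex partial_pf_out// /vars !index_eqE.
- have -> : jac (param_map a gam) y iu iu = partial iu (pf a gam iu) y by rewrite mxE Eu.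
  have -> : jac (param_map a gam) y iv iv = (partial iu (pf a gam iu) y)^-1; last by rewrite divff.
  rewrite mxE (_ : param_map a gam iv = fun y => pf a gam iv y +
      (y 0 iv + - pbase gam 0 iv) * (partial iu (pf a gam iu) y)^-1); last first.
    by apply/funext => z; rewrite /param_map eqxx.
  have s1 := smooth_at_pf y a gam iv.
  have s2 : smooth_at y (fun y : pt => y 0 iv + - pbase gam 0 iv).
    by apply: smooth_at_add; [exact: smooth_at_coord|exact: smooth_at_cst].
  have su := smooth_at_partial iu (smooth_at_pf y a gam iu).
  have s3 := smooth_at_inv su U0.
  rewrite (partial_add iv s1 (smooth_at_mul s2 s3)) (partial_mul iv s2 s3).
  rewrite (partial_add iv (smooth_at_coord y iv) (smooth_at_cst y _)) partial_cst partial_coord.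
  rewrite partial_pf_out; last by rewrite /vars !index_eqE.
  rewrite (partial_inv iv su U0) partial_comm; last exact: smooth_at_pf.
  rewrite (_ : partial iv (pf a gam iu) = fun=> 0); last first.
    by apply/funext => z; rewrite partial_pf_out// /vars eqxx index_eqE.
  rewrite partial_cst eqxx /=; ring.
- rewrite (_ : xblock _ = pjac a gam y)//.
  by apply/matrixP => i j; rewrite !mxE Ex.
Qed.

Lemma param_map_kmap a gam : Gset gam -> kmap (pbase gam) (param_map a gam).
Proof.
move=> /(pdom_base a) Gg; split; first by move=> l; exact: smooth_at_param_map.
by apply: open_nearT (@pdom_open a gam) Gg _ => y; exact: jac_param_map.
Qed.

Lemma param_map_transf a gam : Gset gam -> kundt_transf (pbase gam) (row_fun (param_map a gam)).
Proof.
move=> Gg; pose C t := pf a gam iu (of_u m t).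
pose A (z : R * 'rV[R]_m) := \row_j pf a gam (ix j) (of_ux z) : 'rV[R]_m.
pose F (z : R * 'rV[R]_m) := pf a gam iv (of_ux z).
have sC : smooth_on setT C.
  apply: (smooth_on_affine (@of_u_affine R m) (@of_u_continuous R m) (U := setT)).
  by apply: smooth_at_on => y _; exact: smooth_at_pf.
have sA j : smooth_on setT (fun z => A z 0 j : R).
  rewrite (_ : (fun z => _) = pf a gam (ix j) \o @of_ux R m); last first.
    by apply/funext => z; rewrite mxE.
  apply: (smooth_on_affine (@of_ux_affine R m) (@of_ux_continuous R m) (U := setT)).
  by apply: smooth_at_on => y _; exact: smooth_at_pf.
have sF : smooth_on setT F.
  apply: (smooth_on_affine (@of_ux_affine R m) (@of_ux_continuous R m) (U := setT)).
  by apply: smooth_at_on => y _; exact: smooth_at_pf.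
have CE : pf a gam iu = C \o @ucoord R m.
  apply/funext => y; apply: pf_agree => l; rewrite /vars eqxx => /eqP ->.
  by rewrite mkptE.
have xvE c y : c != iu -> pf a gam c y = pf a gam c (of_ux (uxcoord y)).
  move=> cu; apply: pf_agree => l; rewrite /vars (negbTE cu) /of_ux.
  by case: (indexP l) => [|i|]; rewrite ?eqxx// !mkptE// mxE.
have dC y : derive1 C (ucoord y) = partial iu (pf a gam iu) y.
  by rewrite CE partialE derive_ucoord ucoord_delta eqxx derive1E.
have pE y : row_fun (param_map a gam) y = mkpt (C (ucoord y)) (A (uxcoord y))
    (vcoord y / derive1 C (ucoord y) + (F (uxcoord y) - pbase gam 0 iv / derive1 C (ucoord y))).
  apply/rowP => l; rewrite mxE; case: (indexP l) => [|i|]; rewrite mkptE /param_map ?index_eqE.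
  - by rewrite CE.
  - by rewrite mxE xvE// index_eqE.
  - rewrite dC /F -xvE ?index_eqE// mulrBl; rewrite /vcoord; ring.
have [U0 D0] := (pdom_base a gam).1 Gg.
(* Expanding [(y_v - b_v) / C'] leaves [- b_v / C'], a function of u, which is absorbed in B. *)
exists (pdom a gam), C, A, (fun z => F z - pbase gam 0 iv / derive1 C z.1); split.
- exact: pdom_open.
- exact/pdom_base.
- split.
  + by apply: smooth_on_subset sC.
  + have oT : open [set: R * 'rV[R]_m] by exact: openT.
    have := (smooth_on_rowP A oT).2 sA; exact: smooth_on_subset.
  + have sd : smooth_on setT (derive1 C).
      rewrite (_ : derive1 C = 'D_1 C); last by apply/funext => t; exact: derive1E.
      exact: smooth_on_derive.
    pose W := [set z : R * 'rV[R]_m | derive1 C z.1 != 0].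
    have fst_affine (h : R) (v x : R * 'rV[R]_m) : (h *: v + x).1 = h *: v.1 + x.1 by [].
    have fst_continuous : continuous (@fst R 'rV[R]_m) by move=> z; exact: cvg_fst.
    have sd1 : smooth_on setT (derive1 C \o @fst R 'rV[R]_m).
      by have := smooth_on_affine fst_affine fst_continuous sd.
    have oW : open W.
      apply: (@open_comp _ _ (derive1 C \o fst) [set z : R | z != 0]); last exact: open_neq.
      by move=> z _; exact: smooth_on_continuous sd1 I.
    have WU : [set (ucoord b, xcoord b) | b in pdom a gam] `<=` W.
      by move=> _ [y [Uy _] <-]; rewrite /W /= dC.
    apply: (smooth_on_subset WU).
    have sI : smooth_on W (fun z : R * 'rV[R]_m => (derive1 C z.1)^-1).
      apply: (smooth_on_inv oW); first by move=> z.
      exact: (smooth_on_subset (fun z _ => I) sd1).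
    have sF' : smooth_on W F by apply: smooth_on_subset sF.
    apply: smooth_on_eq oW _ (smooth_on_add oW sF'
      (smooth_on_mul oW (smooth_on_cst (- pbase gam 0 iv) oW) sI)) => z _.
    by rewrite mulNr.
- move=> y [Uy Dy]; split; first by rewrite dC.
  rewrite (@jacobian_slice R m A _ _ setT) //; first last.
  + move=> i; have := smooth_on_affine (@slice_affine R m (ucoord y)) (@slice_continuous R m (ucoord y)) (sA i).
    by apply: smooth_on_subset.
  + exact: openT.
  rewrite (_ : \matrix_(i, j) _ = pjac a gam y)//; apply/matrixP => i j.
  rewrite !mxE partialE -/(uxcoord y).
  rewrite -(derive_uxcoord (fun z => A z 0 j)); congr (derive _ _ _).
  by apply/funext => z; rewrite /= mxE [RHS]xvE// index_eqE.
- by move=> y _ /=; rewrite pE.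
Qed.

End PolynomialMaps.

Lemma jeq_inv (R : realType) n r (a : 'rV[R]_n) f f' : f a != 0 -> jeq r a f f' ->
  jeq r a (fun y => (f y)^-1) (fun y => (f' y)^-1).
Proof.
move=> fa j; rewrite /jeq (_ : pairf _ _ = fun x => (pairf f f' x)^-1); last first.
  by apply/funext => -[[] y].
apply: (jets_in_inv (@sf_agree R) (@agree_ext R)) => // -[[] y] [_ /= ->] //.
by rewrite /pairf /= -(jeq_val j).
Qed.

Section InverseJets.
Variables (R : realType) (m r : nat).
Local Notation n := (1 + m + 1)%N.
Local Notation pt := 'rV[R]_(1 + m + 1).
Local Notation iu := (iu m).
Local Notation iv := (iv m).
Implicit Types (a b : pt) (c l : 'I_n) (phi : 'I_n -> pt -> R).

Lemma vars_v c : vars c iv = false.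
Proof. by rewrite /vars; case: eqP => _; rewrite ?index_eqE ?eqxx. Qed.

Lemma kmap_vars a phi c l i : kmap a phi -> ~~ vars c l -> vars c i ->
  {near a, partial l (phi i) =1 fun=> 0}.
Proof.
move=> [_ nJ] vl vi; apply: filterS nJ => y [xu vu vx _ _].
have E (j i' : 'I_n) : partial j (phi i') y = jac phi y j i' by rewrite mxE.
rewrite E; move: vl vi; rewrite /vars; case: eqP => _.
  by move=> lu /eqP ->; case: (indexP l) lu => [|k|]; rewrite ?eqxx.
rewrite negbK => /eqP -> iv'; case: (indexP i) iv' => [|k|]; by rewrite ?eqxx.
Qed.

Lemma partial_tpoly_out q (C : multi_index m q -> R) b T l y :
  (forall tau, ~~ supported T tau -> C tau = 0) -> ~~ T l ->
  partial l (tpoly C b) y = 0.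
Proof.
move=> C0 Tl; rewrite /tpoly partial_sum => [|tau]; last first.
  by apply: smooth_at_mul; [exact: smooth_at_cst|exact: smooth_at_mono].
rewrite big1// => tau _.
rewrite (partial_mul l (smooth_at_cst y _) (smooth_at_mono _ _ _)) partial_cst mul0r add0r.
case: (boolP (supported T tau)) => [st|/C0 ->]; last by rewrite mul0r.
by rewrite (partial_mono_out _ _ st Tl) mulr0.
Qed.

(** Every Kundt map has an inverse on jets within the family. For the components u and x this is
    [jet_surj] applied to the coordinate functions. For v, the term fixed by the component u is
    subtracted first, and it must be shown that the remainder has no v-derivatives in its jet. *)
Lemma param_map_surj a phi : kmap a phi -> exists gam : 'rV[R]_#|{: param m r}|,
  [/\ Gset gam, pbase gam = row_fun phi a &
      forall l, jeq r.+1 a (compm (param_map a gam) phi l) (@idm R n l)].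
Proof.
move=> kphi; have [sphi nJ] := kphi; have dJ := det_kjac (kmap_kjac kphi).
set b := row_fun phi a.
have nphi : \forall y \near a, forall l, smooth_at y (phi l).
  by apply: near_forall_fin => l; exact: smooth_at_near.
have exC c : exists C : multi_index m r.+1 -> R, c != iv ->
    (forall tau, ~~ supported (vars c) tau -> C tau = 0) /\
    jeq r.+1 a (tpoly C b \o row_fun phi) (@idm R n c).
  case: (eqVneq c iv) => [->|cv]; first by exists (fun=> 0).
  have [||C CP] := @jet_surj R m r.+1 (vars c) a phi (@idm R n c) sphi dJ _ (smooth_at_coord _ _).
  - by move=> l i; exact: kmap_vars.
  - move=> ls _ /allPn[l lls vl]; apply: ipartial_out (smooth_at_coord _ _) lls _.
    apply: near_all => y; rewrite partial_coord; case: eqP => // lc.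
    by move: vl; rewrite lc /vars cv; case: ifP => // ->.
  - by exists C.
have [C CP] := choice exC.
have Cu := CP iu; rewrite index_eqE in Cu; have {Cu} [//|Cu0 Cuj] := Cu.
pose fu := tpoly (C iu) b.
have sfu y : smooth_at y fu by exact: smooth_at_tpoly.
have fu0 l y : l != iu -> partial l fu y = 0.
  by move=> lu; apply: partial_tpoly_out Cu0 _; rewrite /vars eqxx.
(* This is the u-derivative of the composite component u, which is u to order r + 1; hence h is 1 to
   order r. *)
pose h (y : pt) := partial iu fu (row_fun phi y) * partial iu (phi iu) y.
have hj : jeq r a h (fun=> 1).
  have := jeq_partial iu Cuj.
  have -> : partial iu (@idm R n iu) = fun=> 1 by apply/funext => y; rewrite partial_coord eqxx.
  apply: jeq_trans; apply: jeq_sym; apply: jeq_near.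
    by apply: smooth_at_partial; exact: smooth_at_comp.
  apply: filterS nphi => y sy; rewrite (partial_comp iu sy (sfu _)) (bigD1 iu)//= big1 ?addr0//.
  by move=> i iu'; rewrite fu0// mul0r.
have ha : h a = 1 by exact: jeq_val hj.
have Ua : partial iu fu b != 0.
  by apply/eqP => U0; move: ha; rewrite /h U0 mul0r => /esym/eqP; rewrite oner_eq0.
pose w (y : pt) := (partial iu fu (row_fun phi y))^-1.
have sU : smooth_at a (partial iu fu \o row_fun phi).
  by apply: smooth_at_comp => //; exact: smooth_at_partial.
have sw : smooth_at a w by exact: smooth_at_inv sU Ua.
pose q (y : pt) := phi iv y + - b 0 iv.
have sq : smooth_at a q by apply: smooth_at_add; [exact: sphi|exact: smooth_at_cst].
(* The part of v left to the polynomial. Its v-derivative is 1 - 1 / h, which vanishes to order r;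
   this is just what is needed for the derivatives of g of order at most r + 1 that involve v. *)
pose g (y : pt) := y 0 iv + -1 * (q y * w y).
have sqw : smooth_at a (fun y => -1 * (q y * w y)).
  by apply: smooth_at_mul; [exact: smooth_at_cst|exact: smooth_at_mul].
have sg : smooth_at a g by apply: smooth_at_add; [exact: smooth_at_coord|exact: sqw].
have dvg : {near a, partial iv g =1 fun y => 1 + -1 * (h y)^-1}.
  apply: filterS3 nphi nJ (filterI (smooth_at_near sw) (filterI (smooth_at_near sU) (smooth_at_neq0 sU Ua))).
  move=> y sy [xu vu vx uv _] [swy [sUy Uy]].
  have sqy : smooth_at y q by apply: smooth_at_add; [exact: sy|exact: smooth_at_cst].
  rewrite (partial_add iv (smooth_at_coord y iv) (smooth_at_mul (smooth_at_cst y _) (smooth_at_mul sqy swy))).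
  rewrite (partial_mul iv (smooth_at_cst y _) (smooth_at_mul sqy swy)) partial_cst mul0r add0r.
  rewrite (partial_mul iv sqy swy) partial_coord eqxx.
  have -> : partial iv w y = 0.
    rewrite (partial_inv iv sUy Uy) (partial_comp iv sy (smooth_at_partial iu (sfu _))).
    rewrite big1 ?mulr0// => i _; rewrite partial_comm//.
    case: (eqVneq i iu) => [->|iu']; first by have := vu; rewrite mxE => ->; rewrite mulr0.
    rewrite (_ : partial i fu = fun=> 0); first by rewrite partial_cst mul0r.
    by apply/funext => z; exact: fu0.
  rewrite mulr0 addr0 (partial_add iv (sy iv) (smooth_at_cst y _)) partial_cst addr0.
  congr (_ + _ * _); rewrite /h /w invfM mulrC; congr (_ * _).
  have uv' : partial iu (phi iu) y * partial iv (phi iv) y = 1 by have := uv; rewrite !mxE.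
  have u0 : partial iu (phi iu) y != 0.
    by apply/eqP => u0; move: uv'; rewrite u0 mul0r => /esym/eqP; rewrite oner_eq0.
  by apply: (mulfI u0); rewrite uv' divff.
have g0 : jeq r a (partial iv g) (fun=> 0).
  apply: jeq_trans (jeq_near _ _ dvg) _; first exact: smooth_at_partial.
  have h1 : h a != 0 by rewrite ha oner_neq0.
  have := jeq_add (jeq_refl r (smooth_at_cst a 1)) (jeq_mul (jeq_refl r (smooth_at_cst a (-1))) (jeq_inv h1 hj)).
  by rewrite invr1 mulr1 subrr.
have [||Cv [Cv0 Cvj]] := @jet_surj R m r.+1 (vars iv) a phi g sphi dJ _ sg.
- by move=> l i; exact: kmap_vars.
- move=> ls lr /allPn[l lls]; rewrite /vars index_eqE negbK => /eqP lv.
  rewrite lv in lls.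
  have [p1 [p2 lsE]] : exists p1 p2, ls = p1 ++ iv :: p2.
    by case/splitPr: lls => p1 p2; exists p1, p2.
  rewrite lsE in lr *.
  have pe : perm_eq (p1 ++ iv :: p2) (rcons (p1 ++ p2) iv).
    by rewrite -cats1 -catA perm_cat2l -cat1s perm_catC.
  rewrite (ipartial_perm sg pe) ipartial_rcons.
  have /jeqP[_ _ ->] := g0; first exact: ipartial_cst0.
  by have := perm_size pe; rewrite size_rcons => E; rewrite -ltnS -E.
pose C' c := if c == iv then Cv else C c.
have C'0 c tau : ~~ supported (vars c) tau -> C' c tau = 0.
  rewrite /C'; case: (eqVneq c iv) => [->|cv]; first exact: Cv0.
  by have [H _] := CP c cv; exact: H.
pose gam := coef_of (fun c tau => if tau == tau0 m r then b 0 c else C' c tau).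
have cE c tau : coef gam c tau = if tau == tau0 m r then b 0 c else C' c tau.
  case: (boolP (supported (vars c) tau)) => st; first by rewrite coef_ofK.
  rewrite coef_out// C'0//; case: eqP => // E.
  by rewrite E supported_tau0 in st.
have bE : pbase gam = b by apply/rowP => c; rewrite mxE cE eqxx.
have val0 (D : multi_index m r.+1 -> R) f : jeq r.+1 a (tpoly D b \o row_fun phi) f -> D (tau0 m r) = f a.
  by move=> /jeq_val <-; rewrite /= -/b -[RHS]/(ipartial [::] (tpoly D b) b) ipartial_tpoly.
have pE c : pf a gam c = tpoly (C' c) b.
  rewrite /pf bE; congr (tpoly _ b); apply/funext => tau; rewrite /pcoef cE.
  case: eqP => // ->; rewrite /C'; case: (eqVneq c iv) => [->|cv].
    by rewrite (val0 _ _ Cvj) /g /q -/b [b 0 iv]mxE subrr mul0r mulr0 addr0.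
  by have [_ j] := CP c cv; rewrite (val0 _ _ j).
have C'u : C' iu = C iu by rewrite /C' index_eqE.
have pu : pf a gam iu = fu by rewrite pE C'u.
exists gam; split=> [|//|l].
- apply/(pdom_base a); rewrite bE; split; first by rewrite pu.
  have xE i : pf a gam (ix i) = tpoly (C (ix i)) b by rewrite pE /C' index_eqE.
  (* First-order part of the inversion: the new x has no v-derivative and the new u no x-derivative,
     so the chain rule closes on the x-blocks. *)
  have NE : xblock (jac phi a) *m pjac a gam b = 1%:M.
    apply/matrixP => i j; have [|Cx0 /(jeq_partial (ix i)) /jeq_val] := CP (ix j).
      by rewrite index_eqE.
    rewrite (partial_comp (ix i) sphi (smooth_at_tpoly _ _ _)) partial_coord index_eqE => E.
    rewrite [RHS]mxE -E sum_index -/b [LHS]mxE.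
    have [xu _ _ _ _] := kmap_kjac kphi.
    have := xu i; rewrite mxE => ->; rewrite mulr0 add0r.
    rewrite (partial_tpoly_out _ _ Cx0); last by rewrite vars_v.
    rewrite mul0r addr0; apply: eq_bigr => k _; rewrite !mxE xE; exact: mulrC.
  have [uN uP] := mulmx1_unit NE.
  by move: uP; rewrite unitmxE unitfE.
- case: (eqVneq l iv) => [->|lv].
    have -> : @idm R n iv = fun y => g y + q y * w y.
      by apply/funext => y; rewrite /g /idm mulN1r subrK.
    have -> : compm (param_map a gam) phi iv = fun y => (tpoly Cv b \o row_fun phi) y + q y * w y.
      by apply/funext => y; rewrite /compm /= /param_map eqxx pu pE /C' eqxx /q /w bE mxE.
    by apply: jeq_add Cvj (jeq_refl _ _); exact: smooth_at_mul.
  have [_ j] := CP l lv.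
  rewrite (_ : compm _ _ _ = tpoly (C l) b \o row_fun phi)//.
  by apply/funext => y; rewrite /compm /= /param_map (negbTE lv) pE /C' (negbTE lv).
Qed.

End InverseJets.

(** * Orbits as images of the parameter space *)

Section OrbitParametrization.
Variables (R : realType) (m k : nat).
Local Notation n := (1 + m + 1)%N.
Local Notation pt := 'rV[R]_(1 + m + 1).
Local Notation Gam := 'rV[R]_#|{: param m k}|.
Implicit Types (p q : jet_vec R m k) (gam : Gam).

Definition tsec p gam := pull (param_map (jbase p) gam) (jpoly p).

Definition tjet p gam : jet_vec R m k := jet k (tsec p gam) (pbase gam).

(** Both inclusions invert a jet within the family: that of the transformation defining a point of
    the orbit, or that of the map with parameter gam, for which the inverse found is itself an
    element of the pseudogroup. *)
Lemma kundt_orbit_tjet p : jet_space p -> kundt_orbit p = tjet p @` @Gset R m k.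
Proof.
move=> Fp; apply/seteqP; split=> [q /orbit_elim|_ [gam Gg <-]].
  move=> [a [phi [s [s' [kphi [ss ss'] sE pE ->]]]]].
  have ba : jbase p = a by rewrite pE jbase_jet.
  have [gam [Gg gb inv]] := param_map_surj k kphi.
  exists gam => //; rewrite /tjet /tsec ba gb pE.
  apply/esym; apply: orbit_pull_sub => //; rewrite -gb.
    exact: param_map_kmap.
  exact: param_map_base.
have kpsi := param_map_kmap (jbase p) Gg.
have pb := param_map_base (jbase p) gam.
have [gam' [Gg' gb' inv]] := param_map_surj k kpsi.
rewrite pb in gb'.
apply: (orbit_pull_sup (phi := param_map (pbase gam) gam')) => //.
- by rewrite -gb'; exact: param_map_transf.
- by rewrite -gb'; exact: param_map_kmap.
- by rewrite -gb'; exact: param_map_base.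
Qed.

End OrbitParametrization.

(** * Functions determined by a map, and injective immersions *)

Section SmoothInstances.
Variables (R : realType) (d : nat).
Local Notation Gam := 'rV[R]_d.
Implicit Types (f g : Gam -> R) (G : set Gam).

Lemma sf_smooth_on G : open G -> subfield_on G (smooth_on G : (Gam -> R) -> Prop).
Proof.
move=> oG; split=> [c|f g|f g|f].
- exact: smooth_on_cst.
- exact: smooth_on_add.
- exact: smooth_on_mul.
- exact: smooth_on_inv.
Qed.

Lemma smooth_on_ext G f g : open G -> (forall c, G c -> f c = g c) -> smooth_on G f -> smooth_on G g.
Proof. exact: smooth_on_eq. Qed.

Variables (D : nat) (F : Gam -> 'rV[R]_D) (G : set Gam).

(* The functions determined by F to first order: if all coordinates of G
   are such, then F is an injective immersion. *)
Definition determined f : Prop :=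
  [/\ smooth_on G f, forall c c', G c -> G c' -> F c = F c' -> f c = f c' &
      forall c v, G c -> (forall j, 'D_v (fun c => F c 0 j) c = 0) -> 'D_v f c = 0].

Lemma determined_ext f g : open G -> (forall c, G c -> f c = g c) -> determined f -> determined g.
Proof.
move=> oG fg [sf jf df]; split.
- exact: smooth_on_eq fg sf.
- by move=> c c' Gc Gc' E; rewrite -!fg//; exact: jf.
- move=> c v Gc H; rewrite -(df c v Gc H); apply/esym; apply: near_eq_derive.
  by apply: (open_nearT oG Gc) => y; exact: fg.
Qed.

Lemma sf_determined : open G -> subfield_on G determined.
Proof.
move=> oG; split=> [c|f g [sf jf df] [sg jg dg]|f g [sf jf df] [sg jg dg]|f f0 [sf jf df]].
- split=> // [|a v _ _]; first exact: smooth_on_cst.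
  exact: derive_cst.
- split; first exact: smooth_on_add.
    by move=> c c' Gc Gc' E; rewrite (jf c c')// (jg c c').
  move=> c v Gc H.
  rewrite (@deriveD _ _ _ f g c v (smooth_on_derivable sf Gc) (smooth_on_derivable sg Gc)).
  by rewrite df// dg// addr0.
- split; first exact: smooth_on_mul.
    by move=> c c' Gc Gc' E; rewrite (jf c c')// (jg c c').
  move=> c v Gc H.
  rewrite (@deriveM _ _ f g c v (smooth_on_derivable sf Gc) (smooth_on_derivable sg Gc)).
  by rewrite df// dg// !scaler0 addr0.
- split; first exact: smooth_on_inv.
    by move=> c c' Gc Gc' E; rewrite (jf c c').
  move=> c v Gc H.
  rewrite (deriveV (f0 c Gc) (smooth_on_derivable sf Gc)).
  by rewrite df// scaler0.
Qed.

Lemma determined_coord j : open G -> smooth_on G F -> determined (fun c => F c 0 j).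
Proof.
move=> oG /(smooth_on_rowP _ oG)/(_ j) sF; split; [exact: sF|by move=> c c' _ _ ->|].
by move=> c v _ H; exact: H.
Qed.

Lemma immersed_chart : open G -> smooth_on G F -> (forall i, determined (fun c => c 0 i)) ->
  immersed_submanifold d (F @` G).
Proof.
move=> oG sF det; exists (fun i => if i == 0%N then G else set0), (fun=> F); split.
(* One chart covers everything and the other ones are empty; compatibility then reduces to
   injectivity. *)
- move=> i; case: eqP => _; first by split.
  by split; [exact: open0|move=> vs x []].
- move=> i; case: eqP => _ c c'; rewrite !inE; last by [].
  move=> Gc Gc' E; apply/rowP => j; have [_ H _] := det j; exact: H.
- move=> i; case: eqP => _ c Gc; last by case: Gc.
  apply/eqP; rewrite -/(row_free _); apply: inj_row_free => v vJ.
  have [dF _] := smooth_diff_row (fun j => smooth_on_at oG Gc ((smooth_on_rowP _ oG).1 sF j)).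
  have DF : 'D_v F c = 0 by rewrite deriveEjacobian.
  apply/rowP => j; have [_ _ H] := det j.
  have [_ E] := is_derive_coord c v j.
  rewrite mxE -E; apply: H => // j'.
  have := congr1 (fun M : 'rV[R]_D => M 0 j') DF.
  rewrite derive_mx; last exact: diff_derivable.
  by rewrite !mxE.
- apply/seteqP; split=> [q Gq|q [i _]]; first by exists 0%N.
  by case: eqP => // _ [c []].
- move=> i j V oV VU; case: eqP => _; last by rewrite set0I; exact: open0.
  have [j0|j0] := eqVneq j 0%N; last first.
    rewrite (_ : _ `&` _ = set0); first exact: open0.
    apply/seteqP; split=> // c [_ [c' /VU]]; by rewrite (negbTE j0).
  rewrite (_ : _ `&` _ = V)//; apply/seteqP; split=> [c [Gc [c' Vc' E]]|c Vc].
    suff <- : c' = c by [].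
    have Gc' : G c' by have := VU c' Vc'; rewrite j0 eqxx.
    by apply/rowP => l; have [_ H _] := det l; exact: H.
  split; last by exists c.
  by have := VU c Vc; rewrite j0 eqxx.
Qed.

End SmoothInstances.

(** * Jets of pulled-back sections as functions of the parameters *)

Section TargetJetSmooth.
Variables (R : realType) (m k : nat).
Local Notation n := (1 + m + 1)%N.
Local Notation pt := 'rV[R]_(1 + m + 1).
Local Notation iu := (iu m).
Local Notation iv := (iv m).
Local Notation Gam := 'rV[R]_#|{: param m k}|.
Local Notation G := (@Gset R m k).
Implicit Types (p : jet_vec R m k).

Lemma smooth_on_coef U c tau : open U -> smooth_on U (fun gam : Gam => coef gam c tau).
Proof.
move=> oU; rewrite /coef; case: insub => [i|] /=; last exact: smooth_on_cst.
exact: smooth_on_coord.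
Qed.

Lemma Gset_open : open G.
Proof.
have sT := sf_smooth_on (@openT Gam).
apply: openI.
  apply: (@open_comp _ _ (fun gam : Gam => coef gam iu (mi k.+1 [:: iu])) [set z : R | z != 0]).
    by move=> y _; exact: smooth_on_continuous (smooth_on_coef _ _ openT) I.
  exact: open_neq.
apply: (@open_comp _ _ (fun gam : Gam => \det (\matrix_(i, j) coef gam (ix j) (mi k.+1 [:: ix i])))
  [set z : R | z != 0]); last exact: open_neq.
move=> y _; apply: (@smooth_on_continuous _ _ _ setT) => //.
apply: (sf_det sT) => i j; rewrite (_ : (fun t => _) = fun t => coef t (ix j) (mi k.+1 [:: ix i])).
  by apply: smooth_on_coef; exact: openT.
by apply/funext => t; rewrite mxE.
Qed.

Variable K : (Gam -> R) -> Prop.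
Hypothesis sfK : subfield_on G K.
Hypothesis K_ext : forall f g, (forall c, G c -> f c = g c) -> K f -> K g.

Lemma jets_in_param_map a r : (forall c tau, K (fun gam => coef gam c tau)) ->
  forall c, jets_in G K (@pbase R m k) r (fun x => param_map a x.1 c x.2).
Proof.
move=> Kc.
have Kb i : K (fun gam => pbase gam 0 i).
  by apply: K_ext (Kc i (tau0 m k)) => gam _; rewrite mxE.
have jpf c r' : jets_in G K (@pbase R m k) r' (fun x => pf a x.1 c x.2).
  apply: (jets_in_tpoly sfK K_ext (c := fun gam => pcoef a gam c) r' _ Kb) => sigma.
  rewrite /pcoef; case: eqP => _; last exact: Kc.
  exact: (sf_cst sfK).
have sJ := sf_jets_in sfK K_ext (@pbase R m k) r.
move=> c; rewrite /param_map; case: eqP => _; last exact: jpf.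
apply: (sf_add sJ); first exact: jpf.
apply: (sf_mul sJ).
  apply: (sf_sub sJ); first exact: (jets_in_coord sfK K_ext r (Kb iv)).
  exact: (jets_in_base sfK K_ext _ r (Kb iv)).
apply: (sf_inv sJ).
  move=> [gam y] [/= Gg ->].
  by have [] := (pdom_base a gam).1 Gg.
have := jets_in_partial iu (jpf iu r.+1).
by rewrite /gpartial.
Qed.

Lemma base_image_param_map a :
  base_image (fun c x => param_map a x.1 c x.2) (@pbase R m k) = fun=> a.
Proof. by apply/funext => gam; exact: param_map_base. Qed.

Lemma jets_in_jpoly_cst p r c :
  jets_in G K (fun=> jbase p) r (fun x => jpoly p x.2 c).
Proof.
apply: (jets_in_tpoly sfK K_ext (c := fun _ sigma => jcoord p (inr (c, sigma))) (b := fun=> jbase p)).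
  by move=> sigma; exact: (sf_cst sfK).
by move=> i; exact: (sf_cst sfK).
Qed.

Lemma tsecE p (gam : Gam) y : tsec p gam y =
  comps (gpull (fun c x => jpoly p x.2 c) (fun c x => param_map (jbase p) x.1 c x.2) (gam, y)).
Proof.
by rewrite /tsec /pull /gpull; congr (comps (_ *m gmx _ *m _)).
Qed.

Lemma jets_in_tsec p c r : (forall c tau, K (fun gam => coef gam c tau)) ->
  jets_in G K (@pbase R m k) r (fun x => tsec p x.1 x.2 c).
Proof.
move=> Kc; rewrite (_ : (fun x => _) = fun x => comps
  (gpull (fun c x => jpoly p x.2 c) (fun c x => param_map (jbase p) x.1 c x.2) x) c); last first.
  by apply/funext => -[gam y]; rewrite /= tsecE.
apply: (in_comps _ (sf_jets_in sfK K_ext _ _)); apply: (jets_in_gpull sfK K_ext).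
  exact: jets_in_param_map.
move=> c'; rewrite base_image_param_map; exact: jets_in_jpoly_cst.
Qed.

Lemma tjet_in p j : (forall c tau, K (fun gam => coef gam c tau)) -> K (fun gam => tjet p gam 0 j).
Proof.
move=> Kc; rewrite -(enum_valK j); case: (enum_val j) => [l|[c sigma]].
  apply: K_ext (Kc l (tau0 m k)) => gam _.
  by rewrite -[RHS]/(jcoord _ _) jcoord_jet_base mxE.
apply: K_ext (jets_in_ipartial K_ext (jets_in_tsec p c k Kc) (size_flat sigma)) => gam _.
by rewrite -[RHS]/(jcoord _ _) jcoord_jet multi_deriveE.
Qed.

End TargetJetSmooth.

Lemma smooth_on_tjet (R : realType) m k (p : jet_vec R m k) : smooth_on (@Gset R m k) (tjet p).
Proof.
have oG := @Gset_open R m k.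
apply/(smooth_on_rowP _ oG) => j; apply: (tjet_in (sf_smooth_on oG)).
  by move=> f g; exact: smooth_on_eq.
by move=> c tau; exact: smooth_on_coef.
Qed.

(** * Higher derivatives of a transformation from those of the metrics *)

Section FreenessStep.
Variables (R : realType) (m : nat) (Gam : Type) (G : set Gam).
Variable K : (Gam -> R) -> Prop.
Hypothesis sfK : subfield_on G K.
Hypothesis K_ext : forall f g, (forall c, G c -> f c = g c) -> K f -> K g.
Local Notation n := (1 + m + 1)%N.
Local Notation pt := 'rV[R]_(1 + m + 1).
Variables (b : Gam -> pt) (psi : 'I_n -> Gam * pt -> R) (s : fiber_index m -> Gam * pt -> R).
Variable r : nat.
Local Notation Jets := (jets_in G K b).

Hypothesis jpsi : forall i, Jets r.+1 (psi i).
Hypothesis js : forall c, jets_in G K (base_image psi b) r.+1 (s c).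
Hypothesis jP : in_mx (Jets r.+1) (gpull s psi).
Hypothesis detJ : forall c, G c -> \det (gjac psi (c, b c)) != 0.
Hypothesis detG : forall c, G c -> \det (gmx (gfiber s psi (c, b c))) != 0.

Let Gh (x : Gam * pt) : 'M[R]_n := gmx (gfiber s psi x).

Let jGh : in_mx (Jets r.+1) Gh.
Proof.
apply: (in_mx_gmx (sf_jets_in sfK K_ext b r.+1)) => c.
exact: (jets_in_comp sfK K_ext jpsi (js c)).
Qed.

Let sJr := sf_jets_in sfK K_ext b r.
Let jJ : in_mx (Jets r) (gjac psi) := jets_in_gjac jpsi.

(** Second derivatives of psi, with the index of the component lowered by the target metric and
    pulled back. *)
Let e q k l (x : Gam * pt) : R := \sum_a gpartial q (gpartial k (psi a)) x *
  \sum_i Gh x a i * gjac psi x l i.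

Let smooth_psi y c l : smooth_at y (fun y => psi l (c, y)) ->
  forall k, smooth_at y (fun y => gjac psi (c, y) k l).
Proof.
move=> sy k; rewrite (_ : (fun y => _) = partial k (fun y => psi l (c, y))).
  exact: smooth_at_partial.
by apply/funext => z; rewrite mxE.
Qed.

Let nsmooth c : G c -> \forall y \near b c,
  (forall l, smooth_at y (fun y => psi l (c, y))) /\
  (forall i j, smooth_at y (fun y => Gh (c, y) i j)).
Proof.
move=> Gc; have n1 : \forall y \near b c, forall l, smooth_at y (fun y => psi l (c, y)).
  by apply: near_forall_fin => l; exact: smooth_at_near (jets_in_smooth (jpsi l) Gc).
have n2 : \forall y \near b c, forall i j, smooth_at y (fun y => Gh (c, y) i j).
  apply: near_forall_fin => i; apply: near_forall_fin => j.
  exact: smooth_at_near (jets_in_smooth (jGh i j) Gc).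
exact: filterS2 n1 n2.
Qed.

Let e_sym q k l : germ_eq G b (e q k l) (e k q l).
Proof.
move=> c Gc; apply: filterS (nsmooth Gc) => y [sy _].
by apply: eq_bigr => a _; congr (_ * _); rewrite /gpartial /=; exact: partial_comm.
Qed.

Let gmx_symE x i j : Gh x i j = Gh x j i.
Proof. by rewrite -{1}[Gh x]gmx_sym mxE. Qed.

(** The derivative of the pulled-back metric without the term in which its coefficients are
    differentiated. By this formula it is known from first derivatives of psi, while the product
    rule expresses it through second ones. *)
Let S q k l (x : Gam * pt) : R := gpartial q (fun x => gpull s psi x k l) x -
  \sum_a gjac psi x k a * \sum_i gpartial q (fun x => Gh x a i) x * gjac psi x l i.

Let SE q k l : germ_eq G b (S q k l) (fun x => e q k l x + e q l k x).
Proof.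
move=> c Gc; apply: filterS (nsmooth Gc) => y [sy sGy].
pose b' (c' : Gam) := y.
have sJ k' a : smooth_at y (fun y => gjac psi (c, y) k' a) by apply: smooth_psi; exact: sy.
have sInner a : smooth_at y (fun y => \sum_i Gh (c, y) a i * gjac psi (c, y) l i).
  by apply: smooth_at_sum => i; apply: smooth_at_mul; [exact: sGy|exact: sJ].
have dJ k' a : gpartial q (fun x => gjac psi x k' a) (c, y) = gpartial q (gpartial k' (psi a)) (c, y).
  by rewrite /gpartial /=; congr (partial _ _ _); apply/funext => z; rewrite mxE.
rewrite /S (_ : (fun x => gpull s psi x k l) =
    fun x => \sum_a gjac psi x k a * \sum_i Gh x a i * gjac psi x l i); last first.
  apply/funext => x; rewrite /gpull mxE.
  under eq_bigr => i _ do rewrite mxE mulr_suml.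
  rewrite exchange_big; apply: eq_bigr => a _; rewrite mulr_sumr.
  by apply: eq_bigr => i _; rewrite !mxE mulrA.
have -> : gpartial q (fun x => \sum_a gjac psi x k a * \sum_i Gh x a i * gjac psi x l i) (c, y) =
  \sum_a (gpartial q (gpartial k (psi a)) (c, y) * (\sum_i Gh (c, y) a i * gjac psi (c, y) l i) +
   gjac psi (c, y) k a * ((\sum_i gpartial q (fun x => Gh x a i) (c, y) * gjac psi (c, y) l i) +
     \sum_i Gh (c, y) a i * gpartial q (gpartial l (psi i)) (c, y))).
  rewrite {1}/gpartial /= partial_sum => [|a]; last by apply: smooth_at_mul; [exact: sJ|exact: sInner].
  apply: eq_bigr => a _; rewrite (partial_mul q (sJ k a) (sInner a)).
  congr (_ * _ + _ * _); first exact: dJ.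
  rewrite partial_sum => [|i]; last by apply: smooth_at_mul; [exact: sGy|exact: sJ].
  rewrite -big_split; apply: eq_bigr => i _.
  rewrite (partial_mul q (sGy a i) (sJ l i)); congr (_ + _ * _); exact: dJ.
have -> : e q l k (c, y) = \sum_a gjac psi (c, y) k a *
    \sum_i Gh (c, y) a i * gpartial q (gpartial l (psi i)) (c, y).
  rewrite /e; under eq_bigr do rewrite mulr_sumr.
  rewrite exchange_big; apply: eq_bigr => a _; rewrite mulr_sumr.
  by apply: eq_bigr => i _; rewrite gmx_symE mulrCA mulrA [RHS]mulrA mulrC mulrA.
rewrite /e -sumrB -big_split; apply: eq_bigr => a _ /=; ring.
Qed.

Let jS q k l : Jets r (S q k l).
Proof.
apply: (sf_sub sJr); first exact: jets_in_partial (jP k l).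
apply: (sf_sum sJr) => a; apply: (sf_mul sJr); first exact: jJ.
apply: (sf_sum sJr) => i; apply: (sf_mul sJr); last exact: jJ.
exact: jets_in_partial (jGh a i).
Qed.

(* e is symmetric in its first two indices and S is its symmetrization in the last two:
   Koszul formula. *)
Let je q k l : Jets r (e q k l).
Proof.
apply: (jets_in_eq K_ext (f := fun x => 2^-1 * (S q k l x + S k q l x - S l q k x))); last first.
  apply: (sf_mul sJr); first exact: (sf_cst sJr).
  by apply: (sf_sub sJr); [exact: (sf_add sJr)|].
move=> c Gc.
have two : (2 : R) != 0 by rewrite pnatr_eq0.
apply: filterS3 (SE q k l Gc) (SE k q l Gc)
  (filterI (SE l q k Gc) (filterI (e_sym k q l Gc) (filterI (e_sym q l k Gc) (e_sym k l q Gc)))).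
move=> y -> -> [-> [E1 [E2 E3]]].
by rewrite E1 E2 E3; field.
Qed.

(** The index is raised again by the inverse of [B], the target metric times the transposed
    Jacobian. *)
Lemma jets_in_second q k a : Jets r (gpartial q (gpartial k (psi a))).
Proof.
pose B (x : Gam * pt) := Gh x *m (gjac psi x)^T.
have jGr : in_mx (Jets r) Gh by move=> i j; exact: jets_in_pred (jGh i j).
have jB : in_mx (Jets r) B by apply: (in_mx_mul sJr jGr); exact: in_mx_tr.
have detB c : G c -> \det (B (c, b c)) != 0.
  by move=> Gc; rewrite det_mulmx det_tr mulf_neq0 ?detG ?detJ.
have jI := in_mx_inv sJr (A := B).
have {jI} jI : in_mx (Jets r) (fun x => (\det (B x))^-1 *: \adj (B x)).
  by apply: jI jB => -[c y] [/= Gc ->]; exact: detB.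
apply: (jets_in_eq K_ext (f := fun x => \sum_l e q k l x * ((\det (B x))^-1 *: \adj (B x)) l a)); last first.
  by apply: (sf_sum sJr) => l; apply: (sf_mul sJr); [exact: je|exact: jI].
move=> c Gc.
have nD := smooth_at_neq0 (jets_in_smooth (sf_det sJr jB) Gc) (detB c Gc).
apply: filterS nD => y Dy.
pose D : 'rV[R]_n := \row_a gpartial q (gpartial k (psi a)) (c, y).
have eE l : e q k l (c, y) = (D *m B (c, y)) 0 l.
  rewrite mxE; apply: eq_bigr => a' _; rewrite [in RHS]mxE; congr (_ * _).
  by rewrite mxE; apply: eq_bigr => i _; rewrite !mxE.
under eq_bigr do rewrite eE.
set I := _ *: _; transitivity ((D *m B (c, y) *m I) 0 a); first by rewrite [RHS]mxE.
by rewrite /I -mulmxA -scalemxAr mul_mx_adj scale_scalar_mx mulVf// mulmx1 mxE.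
Qed.

Lemma jets_in_next a : Jets r.+2 (psi a).
Proof.
have jp := jpsi a.
split=> [c Gc||k]; [exact: (jets_in_smooth jp Gc)|exact: (jets_in_val jp)|].
have jk := jets_in_partial k jp.
split=> [c Gc||q]; [exact: (jets_in_smooth jk Gc)|exact: (jets_in_val jk)|].
exact: jets_in_second.
Qed.

End FreenessStep.

(** * Invariants and their transformation laws *)

Section DifferentialInvariants.
Variables (R : realType) (m : nat).
Local Notation n := (1 + m + 1)%N.
Local Notation pt := 'rV[R]_(1 + m + 1).
Local Notation iu := (iu m).
Local Notation iv := (iv m).
Implicit Types (s : pt -> fiber_index m -> R) (a b y : pt) (psi : 'I_n -> pt -> R).

(* Unlike [invmx], a rational function of the entries of A. *)
Definition ainv p (A : 'M[R]_p) := (\det A)^-1 *: \adj A.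

Lemma ainvE p (A : 'M[R]_p) : \det A != 0 -> ainv A = invmx A.
Proof. by move=> dA; rewrite /invmx unitmxE unitfE dA. Qed.

Lemma ainv_conj p (N A : 'M[R]_p) : \det N != 0 -> \det A != 0 ->
  N^T *m ainv (N *m A *m N^T) *m N = ainv A.
Proof.
move=> dN dA; rewrite !ainvE ?det_mulmx ?det_tr ?mulf_neq0//.
have uN : N \in unitmx by rewrite unitmxE unitfE.
have uA : A \in unitmx by rewrite unitmxE unitfE.
have uNT : N^T \in unitmx by rewrite unitmx_tr.
have uNA : N *m A \in unitmx by rewrite unitmx_mul uN.
have inv2 (B C : 'M[R]_p) : B \in unitmx -> C \in unitmx -> invmx (B *m C) = invmx C *m invmx B.
  move=> uB uC; have uBC : B *m C \in unitmx by rewrite unitmx_mul uB.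
  apply: (can_inj (mulKmx uBC)).
  by rewrite mulmxV// -mulmxA [C *m _]mulmxA mulmxV// mul1mx mulmxV.
by rewrite !inv2// mulKVmx// mulmxKV.
Qed.

Definition wv s y : 'rV[R]_m := \row_i partial iv (fun y => s y (fW i)) y.
Definition inv1 s y : R := (wv s y *m ainv (hmx (s y)) *m (wv s y)^T) 0 0.
Definition inv1_v s y : R := partial iv (inv1 s) y.
Definition inv1_x s y : 'rV[R]_m := \row_i partial (ix i) (inv1 s) y.
Definition zv s y : 'rV[R]_m := \row_i partial iv (fun y => wv s y 0 i) y.
Definition curl s y : 'M[R]_m := \matrix_(k, l)
  (partial (ix l) (fun y => wv s y 0 k) y - partial (ix k) (fun y => wv s y 0 l) y).
Definition curl0 s y : 'M[R]_m := curl s y -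
  (inv1_v s y)^-1 *: ((zv s y)^T *m inv1_x s y - (inv1_x s y)^T *m zv s y).
(** Raising an index by h and lowering it by the 2-form is an endomorphism of covectors; all its
    iterates on w transform as w does. *)
Definition krylov s y (j : nat) : 'rV[R]_m :=
  iter j (fun e => e *m ainv (hmx (s y)) *m curl0 s y) (wv s y).
Definition krymx s y : 'M[R]_m := \matrix_(i, l) krylov s y i 0 l.

Lemma smooth_at_hmx s y : (forall c, smooth_at y (fun y => s y c)) ->
  in_mx (smooth_at y) (fun y => hmx (s y)).
Proof.
move=> sy i j.
by rewrite (_ : (fun y => _) = fun y => s y (fh i j)); [exact: sy|apply/funext => z; rewrite mxE].
Qed.

Lemma smooth_at_hmx_det s y : (forall c, smooth_at y (fun y => s y c)) ->
  smooth_at y (fun y => \det (hmx (s y))).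
Proof. by move=> sy; apply: (sf_det (sf_smooth_at y)); exact: smooth_at_hmx. Qed.

Lemma smooth_at_wv s y : (forall c, smooth_at y (fun y => s y c)) -> in_mx (smooth_at y) (wv s).
Proof.
move=> sy i j.
rewrite (_ : (fun y => _) = partial iv (fun y => s y (fW j))); last by apply/funext => z; rewrite mxE.
by apply: smooth_at_partial; exact: sy.
Qed.

Lemma smooth_at_inv1 s y : (forall c, smooth_at y (fun y => s y c)) ->
  \det (hmx (s y)) != 0 -> smooth_at y (inv1 s).
Proof.
move=> sy d0; have sf := sf_smooth_at y.
have sw := smooth_at_wv sy.
apply: (in_mx_mul sf _ (in_mx_tr sw)); apply: (in_mx_mul sf sw).
by apply: (in_mx_inv sf) (smooth_at_hmx sy) => z ->.
Qed.

Section Transformation.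
Variables (psi : 'I_n -> pt -> R) (s : pt -> fiber_index m -> R).
Local Notation J := (jac psi).
Local Notation N y := (xblock (jac psi y)).
Local Notation Psi := (row_fun psi).
Implicit Types (k l q : 'I_n).

(** Whatever will be differentiated is required near the point and not only at it. The condition is
    thereby open ([reg_near]), and transformation laws can be differentiated in turn. *)
Record reg y : Prop := Reg {
  reg_psi : forall l, smooth_at y (psi l);
  reg_s : forall c, smooth_at (Psi y) (fun y => s y c);
  reg_jac : \forall z \near y, kjac (J z);
  reg_h : forall i j, \forall z \near Psi y, partial iv (fun y => s y (fh i j)) z = 0;
  reg_det : \det (hmx (s (Psi y))) != 0 }.

Lemma reg_near y : reg y -> \forall y \near y, reg y.
Proof.
case=> sp ss kp hv dh; have cp := row_fun_continuous sp.
have n1 : \forall y \near y, forall l, smooth_at y (psi l).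
  by apply: near_forall_fin => l; exact: smooth_at_near (sp l).
have n2 : \forall y \near y, forall c, smooth_at (Psi y) (fun y => s y c).
  have H : \forall z \near Psi y, forall c, smooth_at z (fun y => s y c).
    by apply: near_forall_fin => c; exact: smooth_at_near (ss c).
  exact: (cp _ H).
have n3 : \forall y \near y, \forall z \near y, kjac (J z) by exact: near_join.
have n4 : \forall y \near y, forall i j, \forall z \near Psi y, partial iv (fun y => s y (fh i j)) z = 0.
  have H : \forall z \near Psi y, forall i j, \forall z \near z, partial iv (fun y => s y (fh i j)) z = 0.
    apply: near_forall_fin => i; apply: near_forall_fin => j; apply: near_join; exact: hv.
  exact: (cp _ H).
have n5 : \forall y \near y, \det (hmx (s (Psi y))) != 0.
  exact: (cp _ (smooth_at_neq0 (smooth_at_hmx_det ss) dh)).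
apply: filterS3 n1 n2 (filterI n3 (filterI n4 n5)) => z H1 H2 [H3 [H4 H5]].
by split.
Qed.

Let kj y : reg y -> kjac (J y).
Proof. by move=> /reg_jac; exact: nbhs_singleton. Qed.

Let jE k l : (fun y => J y k l) = partial k (psi l).
Proof. by apply/funext => y; rewrite mxE. Qed.

Let smJ y k l : reg y -> smooth_at y (fun y => J y k l).
Proof. by move=> ry; rewrite jE; apply: smooth_at_partial; exact: reg_psi. Qed.

Let dJ_comm y q k l : reg y -> partial q (fun y => J y k l) y = partial k (fun y => J y q l) y.
Proof. by move=> ry; rewrite !jE; apply: partial_comm; exact: reg_psi. Qed.

Let dJ0 y q k l : reg y -> (\forall z \near y, J z k l = 0) -> partial q (fun y => J y k l) y = 0.
Proof.
move=> ry n0; have := @partial_eq R n y (fun y => J y k l) (fun=> 0) q n0.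
by move/nbhs_singleton ->; rewrite partial_cst.
Qed.

(** Only v_u depends on v, through the derivative of v / C'(u). After exchanging derivatives, one
    entry of the row of v is differentiated: it vanishes identically, or it is v_v = 1 / u_u, a
    function of u. *)
Lemma partial_v_jac y k l : reg y -> ~~ ((k == iu) && (l == iv)) ->
  partial iv (fun y => J y k l) y = 0.
Proof.
move=> ry kl; have nk := reg_jac ry.
have nuv : \forall z \near y, J z iv iu = 0 by apply: filterS nk => z; exact: kjac_vu.
have nxu i : \forall z \near y, J z (ix i) iu = 0 by apply: filterS nk => z /kjac_xu.
have nvx i : \forall z \near y, J z iv (ix i) = 0 by apply: filterS nk => z /kjac_vx.
rewrite dJ_comm//; case: (indexP l) kl => [_|i _|]; [exact: dJ0|exact: dJ0|].
rewrite eqxx andbT => ku.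
have uu0 : J y iu iu != 0.
  by apply/eqP => u0; have := kjac_uv (kj ry); rewrite u0 mul0r => /eqP; rewrite eq_sym oner_eq0.
have E : {near y, (fun y => J y iv iv) =1 fun y => (J y iu iu)^-1}.
  apply: filterS2 nk (smooth_at_neq0 (smJ iu iu ry) uu0) => z /kjac_uv uv z0.
  by apply: (mulfI z0); rewrite uv mulfV.
rewrite (nbhs_singleton (partial_eq k E)) partial_inv//; last exact: smJ.
rewrite dJ_comm// dJ0 ?mulr0//.
by case: (indexP k) ku => [|i|]//; rewrite eqxx.
Qed.

Let smc y f : reg y -> smooth_at (Psi y) f -> smooth_at y (fun y => f (Psi y)).
Proof. by move=> ry; apply: smooth_at_comp; exact: reg_psi. Qed.

Lemma partial_psi y f l : reg y -> smooth_at (Psi y) f ->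
  partial l (fun y => f (Psi y)) y = \sum_a partial a f (Psi y) * J y l a.
Proof.
move=> ry sf; rewrite (partial_comp l (reg_psi ry) sf).
by apply: eq_bigr => a _; rewrite mxE.
Qed.

Let partial_v_psi y f : reg y -> smooth_at (Psi y) f ->
  partial iv (fun y => f (Psi y)) y = partial iv f (Psi y) * J y iv iv.
Proof.
move=> ry sf; rewrite partial_psi// sum_index (kjac_vu (kj ry)) mulr0 add0r.
by rewrite big1 ?add0r// => i _; rewrite (kjac_vx (kj ry)) mulr0.
Qed.

Let partial_x_psi y f i : reg y -> smooth_at (Psi y) f ->
  partial (ix i) (fun y => f (Psi y)) y =
  \sum_j partial (ix j) f (Psi y) * J y (ix i) (ix j) + partial iv f (Psi y) * J y (ix i) iv.
Proof. by move=> ry sf; rewrite partial_psi// sum_index (kjac_xu (kj ry)) mulr0 add0r. Qed.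

Lemma pull_fW y (k : 'I_m) : reg y -> pull psi s y (fW k) =
  J y iu iu * (\sum_i s (Psi y) (fW i) * J y (ix k) (ix i) + J y (ix k) iv) +
  2 * \sum_i \sum_j J y iu (ix i) * s (Psi y) (fh i j) * J y (ix k) (ix j).
Proof.
move=> ry; rewrite /pull /= conj_mxE (kjac_xu (kj ry)).
have -> : \sum_i s (Psi y) (fW i) * (J y iu iu * J y (ix k) (ix i) + J y iu (ix i) * 0) =
   J y iu iu * \sum_i s (Psi y) (fW i) * J y (ix k) (ix i).
  by rewrite mulr_sumr; apply: eq_bigr => i _; ring.
move: (\sum_i _) (\sum_i _) => A B.
by field.
Qed.

Lemma hmx_pull_reg y : reg y -> hmx (pull psi s y) = N y *m hmx (s (Psi y)) *m (N y)^T.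
Proof. by move=> ry; rewrite /pull hmx_pull//; exact: kj. Qed.

(** In [pull_fW] the v-derivative falls on W alone, h and the relevant entries of the Jacobian being
    independent of v. It produces a factor v_v, which cancels the u_u in front. *)
Lemma wv_pullE y (k : 'I_m) : reg y ->
  wv (pull psi s) y 0 k = \sum_i wv s (Psi y) 0 i * J y (ix k) (ix i).
Proof.
move=> ry; rewrite mxE.
pose F1 z := \sum_i s (Psi z) (fW i) * J z (ix k) (ix i) + J z (ix k) iv.
pose F2 z := \sum_i \sum_j J z iu (ix i) * s (Psi z) (fh i j) * J z (ix k) (ix j).
have E : {near y, (fun y => pull psi s y (fW k)) =1 fun y => J y iu iu * F1 y + 2 * F2 y}.
  by apply: filterS (reg_near ry) => z rz; exact: pull_fW.
have sW i : smooth_at y (fun y => s (Psi y) (fW i)).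
  by apply: (@smc _ (fun y => s y (fW i)) ry); exact: reg_s.
have sh i j : smooth_at y (fun y => s (Psi y) (fh i j)).
  by apply: (@smc _ (fun y => s y (fh i j)) ry); exact: reg_s.
have sJh i j : smooth_at y (fun z => J z iu (ix i) * s (Psi z) (fh i j)).
  by apply: smooth_at_mul => //; exact: smJ.
have sF1 : smooth_at y (fun z => \sum_i s (Psi z) (fW i) * J z (ix k) (ix i)).
  by apply: smooth_at_sum => i; apply: smooth_at_mul => //; exact: smJ.
have sF2i i : smooth_at y (fun z => \sum_j J z iu (ix i) * s (Psi z) (fh i j) * J z (ix k) (ix j)).
  by apply: smooth_at_sum => j; apply: smooth_at_mul => //; exact: smJ.
have sF2 : smooth_at y F2 by apply: smooth_at_sum.
have dF2 : partial iv F2 y = 0.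
  rewrite partial_sum// big1// => i _; rewrite partial_sum => [|j]; last first.
    by apply: smooth_at_mul => //; exact: smJ.
  rewrite big1// => j _; rewrite (partial_mul iv (sJh i j) (smJ _ _ ry)).
  rewrite (partial_mul iv (smJ _ _ ry) (sh i j)).
  rewrite (@partial_v_psi _ (fun y => s y (fh i j)) ry (reg_s ry _)).
  rewrite (nbhs_singleton (reg_h ry i j)) !partial_v_jac ?index_eqE ?andbF//.
  by rewrite !(mul0r, mulr0, addr0).
have sF1' : smooth_at y F1 by apply: smooth_at_add => //; exact: smJ.
rewrite (nbhs_singleton (partial_eq iv E)).
rewrite (partial_add iv (smooth_at_mul (smJ iu iu ry) sF1') (smooth_at_mul (smooth_at_cst y 2) sF2)).
rewrite (partial_mul iv (smJ iu iu ry) sF1') (partial_mul iv (smooth_at_cst y 2) sF2).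
rewrite dF2 partial_cst partial_v_jac ?index_eqE ?andbF// !(mul0r, mulr0, addr0) add0r.
rewrite (partial_add iv sF1 (smJ _ _ ry)) partial_v_jac ?index_eqE// addr0.
rewrite partial_sum => [|i]; last by apply: smooth_at_mul => //; exact: smJ.
rewrite mulr_sumr; apply: eq_bigr => i _.
rewrite (partial_mul iv (sW i) (smJ _ _ ry)) (@partial_v_psi _ (fun y => s y (fW i)) ry (reg_s ry _)).
rewrite partial_v_jac ?index_eqE// mulr0 addr0 [wv _ _ 0 i]mxE.
by rewrite mulrA [X in X * _]mulrCA (kjac_uv (kj ry)) mulr1.
Qed.

Lemma wv_pull y : reg y -> wv (pull psi s) y = wv s (Psi y) *m (N y)^T.
Proof.
move=> ry; apply/rowP => k; rewrite wv_pullE// [RHS]mxE.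
by apply: eq_bigr => i _; rewrite !mxE.
Qed.

Let sw y i : reg y -> smooth_at (Psi y) (fun y => wv s y 0 i).
Proof. by move=> ry; exact: smooth_at_wv (reg_s ry) 0 i. Qed.

Lemma partial_wv_pull y q (k : 'I_m) : reg y ->
  partial q (fun y => wv (pull psi s) y 0 k) y =
  \sum_i (partial q (fun y => wv s (Psi y) 0 i) y * J y (ix k) (ix i) +
          wv s (Psi y) 0 i * partial q (fun y => J y (ix k) (ix i)) y).
Proof.
move=> ry; pose F z := \sum_i wv s (Psi z) 0 i * J z (ix k) (ix i).
have E : {near y, (fun y => wv (pull psi s) y 0 k) =1 F}.
  by apply: filterS (reg_near ry) => z rz; exact: wv_pullE.
have sw' i : smooth_at y (fun y => wv s (Psi y) 0 i) by exact: (smc ry (sw i ry)).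
rewrite (nbhs_singleton (partial_eq q E)) partial_sum => [|i]; last first.
  by apply: smooth_at_mul => //; exact: smJ.
by apply: eq_bigr => i _; rewrite (partial_mul q (sw' i) (smJ _ _ ry)).
Qed.

Lemma zv_pull y : reg y -> zv (pull psi s) y = J y iv iv *: (zv s (Psi y) *m (N y)^T).
Proof.
move=> ry; apply/rowP => k; rewrite mxE partial_wv_pull// [RHS]mxE [X in _ * X]mxE mulr_sumr.
apply: eq_bigr => i _; rewrite (partial_v_psi ry (sw i ry)) partial_v_jac ?index_eqE// !mxE; ring.
Qed.

(** Second derivatives of the components x are symmetric and drop out of the curl. The extra term
    comes from v_x: the x-derivative of a composite contains its v-derivative, here z. *)
Lemma curl_pull y : reg y -> let V := \row_(l < m) J y (ix l) iv in
  curl (pull psi s) y = N y *m curl s (Psi y) *m (N y)^T +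
   ((zv s (Psi y) *m (N y)^T)^T *m V - V^T *m (zv s (Psi y) *m (N y)^T)).
Proof.
move=> ry V.
pose W i j := partial (ix j) (fun y => wv s y 0 i) (Psi y).
have E (k l : 'I_m) : partial (ix l) (fun y => wv (pull psi s) y 0 k) y =
    (N y *m (\matrix_(i, j) W i j) *m (N y)^T) k l +
    (zv s (Psi y) *m (N y)^T) 0 k * V 0 l +
    \sum_i wv s (Psi y) 0 i * partial (ix l) (fun y => J y (ix k) (ix i)) y.
  rewrite partial_wv_pull// big_split; congr (_ + _) => /=.
  rewrite [X in _ = X + _]mxE [X in _ = _ + X * _]mxE mulr_suml.
  transitivity (\sum_i \sum_j N y k i * W i j * N y l j + \sum_i zv s (Psi y) 0 i * (N y)^T i k * V 0 l).
    rewrite -big_split; apply: eq_bigr => i _ /=.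
    rewrite (partial_x_psi _ ry (sw i ry)) mulrDl mulr_suml !mxE; congr (_ + _); last by ring.
    by apply: eq_bigr => j _; rewrite !mxE /W; ring.
  congr (_ + _); rewrite exchange_big; apply: eq_bigr => j _ /=.
  by rewrite [in RHS]mxE mulr_suml; apply: eq_bigr => i _; rewrite !mxE.
have curlE : curl s (Psi y) = (\matrix_(i, j) W i j) - (\matrix_(i, j) W i j)^T.
  by apply/matrixP => i j; rewrite !mxE.
apply/matrixP => k l; rewrite mxE E E curlE mulmxBr mulmxBl.
have -> : N y *m (\matrix_(i, j) W i j)^T *m (N y)^T = (N y *m (\matrix_(i, j) W i j) *m (N y)^T)^T.
  by rewrite !trmx_mul trmxK mulmxA.
move: (N y *m _ *m _) (zv s (Psi y) *m _) => M z.
under [X in _ - (_ + X)]eq_bigr do rewrite dJ_comm//.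
move: (\sum_i _) => T; rewrite !mxE !big_ord1 !mxE; ring.
Qed.

Lemma inv1_pull y : reg y -> inv1 (pull psi s) y = inv1 s (Psi y).
Proof.
move=> ry; rewrite /inv1 wv_pull// hmx_pull_reg// trmx_mul trmxK.
have := ainv_conj (kjac_det (kj ry)) (reg_det ry).
by set Q := ainv _ => E; rewrite -E !mulmxA.
Qed.

Lemma partial_inv1_pull y l : reg y -> partial l (inv1 (pull psi s)) y =
  \sum_a partial a (inv1 s) (Psi y) * J y l a.
Proof.
move=> ry; have E : {near y, inv1 (pull psi s) =1 fun y => inv1 s (Psi y)}.
  by apply: filterS (reg_near ry) => z rz; exact: inv1_pull.
rewrite (nbhs_singleton (partial_eq l E)) partial_psi//.
by apply: smooth_at_inv1; [exact: reg_s|exact: reg_det].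
Qed.

Lemma inv1_v_pull y : reg y -> inv1_v (pull psi s) y = inv1_v s (Psi y) * J y iv iv.
Proof.
move=> ry; rewrite /inv1_v partial_inv1_pull// sum_index (kjac_vu (kj ry)) mulr0 add0r.
by rewrite big1 ?add0r// => i _; rewrite (kjac_vx (kj ry)) mulr0.
Qed.

Lemma inv1_x_pull y : reg y -> inv1_x (pull psi s) y =
  inv1_x s (Psi y) *m (N y)^T + inv1_v s (Psi y) *: \row_l J y (ix l) iv.
Proof.
move=> ry; apply/rowP => l; rewrite mxE partial_inv1_pull// sum_index (kjac_xu (kj ry)) mulr0 add0r.
by rewrite !mxE; congr (_ + _); apply: eq_bigr => i _; rewrite !mxE.
Qed.

(** The law of I_x has the inhomogeneous term I_v v_x, so the quotient by I_v subtracts exactly the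
    extra term of [curl_pull]; the factors v_v of z and of I_v cancel. *)
Lemma curl0_pull y : reg y -> inv1_v s (Psi y) != 0 ->
  curl0 (pull psi s) y = N y *m curl0 s (Psi y) *m (N y)^T.
Proof.
move=> ry I0; have uv := kjac_uv (kj ry).
have vv0 : J y iv iv != 0.
  by apply/eqP => v0; move: uv; rewrite v0 mulr0 => /eqP; rewrite eq_sym oner_eq0.
rewrite /curl0 curl_pull// zv_pull// inv1_x_pull// inv1_v_pull//.
set V := \row_l _; set z := zv _ _; set I := inv1_x _ _; set c := inv1_v _ _; set A := N y *m curl _ _ *m _.
rewrite mulmxBr [in RHS]mulmxBl -/A -[N y *m (_ *: _)]scalemxAr -[_ *: _ *m (N y)^T]scalemxAl.
rewrite [N y *m (_ - _)]mulmxBr [(_ - _) *m (N y)^T]mulmxBl.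
have -> : N y *m (z^T *m I) *m (N y)^T = (z *m (N y)^T)^T *m (I *m (N y)^T).
  by rewrite trmx_mul trmxK !mulmxA.
have -> : N y *m (I^T *m z) *m (N y)^T = (I *m (N y)^T)^T *m (z *m (N y)^T).
  by rewrite trmx_mul trmxK !mulmxA.
move: (z *m _) (I *m _) => {}z {}I; apply/matrixP => k l.
rewrite !mxE !big_ord1 !mxE; field.
by rewrite I0 /c; move: vv0; rewrite mxE.
Qed.

Lemma krylov_pull y j : reg y -> inv1_v s (Psi y) != 0 ->
  krylov (pull psi s) y j = krylov s (Psi y) j *m (N y)^T.
Proof.
move=> ry I0; elim: j => [|j IH]; first exact: wv_pull.
rewrite /krylov /= in IH *; rewrite IH hmx_pull_reg// curl0_pull//.
have := ainv_conj (kjac_det (kj ry)) (reg_det ry).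
by rewrite !mulmxA; move: (iter _ _ _) => e E; rewrite -[X in X *m _ *m _]mulmxA -[X in X *m _ *m _]mulmxA [(N y)^T *m (_ *m _)]mulmxA E.
Qed.

Lemma krymx_pull y : reg y -> inv1_v s (Psi y) != 0 ->
  krymx (pull psi s) y = krymx s (Psi y) *m (N y)^T.
Proof.
move=> ry I0; apply/matrixP => i l; rewrite mxE krylov_pull// !mxE.
by apply: eq_bigr => j _; rewrite !mxE.
Qed.

End Transformation.
End DifferentialInvariants.

(** * First derivatives of a transformation from the invariants *)

Section InvariantsIn.
Variables (R : realType) (m : nat) (Gam : Type) (G : set Gam).
Variable K : (Gam -> R) -> Prop.
Hypothesis sfK : subfield_on G K.
Hypothesis K_ext : forall f g, (forall c, G c -> f c = g c) -> K f -> K g.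
Local Notation n := (1 + m + 1)%N.
Local Notation pt := 'rV[R]_(1 + m + 1).
Local Notation iu := (iu m).
Local Notation iv := (iv m).
Local Notation Jets := (jets_in G K).

Definition csec (s : fiber_index m -> Gam * pt -> R) (c : Gam) : pt -> fiber_index m -> R :=
  fun y f => s f (c, y).

Section Values.
Variables (b : Gam -> pt) (s : fiber_index m -> Gam * pt -> R).
Hypothesis js : forall f, Jets b 2 (s f).
Hypothesis det_s : forall c, G c -> \det (hmx (csec s c (b c))) != 0.

Let sJ r := sf_jets_in sfK K_ext b r.

Let jhmx : in_mx (Jets b 2) (fun x => hmx (csec s x.1 x.2)).
Proof.
move=> i j; rewrite (_ : (fun x => _) = s (fh i j)); first exact: js.
by apply/funext => -[c y]; rewrite mxE.
Qed.

Let jwv : in_mx (Jets b 1) (fun x => wv (csec s x.1) x.2).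
Proof.
move=> i j; rewrite (_ : (fun x => _) = gpartial iv (s (fW j))).
  exact: jets_in_partial (js _).
by apply/funext => -[c y]; rewrite mxE.
Qed.

Let jinv1 : Jets b 1 (fun x => inv1 (csec s x.1) x.2).
Proof.
have jh i j := jets_in_pred (jhmx i j).
apply: (in_mx_mul (sJ 1) _ (in_mx_tr jwv)); apply: (in_mx_mul (sJ 1) jwv).
by apply: (in_mx_inv (sJ 1)) jh => -[c y] [/= Gc ->]; exact: det_s.
Qed.

Lemma partial_inv1_in l : K (fun c => partial l (inv1 (csec s c)) (b c)).
Proof. exact: jets_in_val (jets_in_partial l jinv1). Qed.

Lemma inv1_v_in : K (fun c => inv1_v (csec s c) (b c)).
Proof. exact: partial_inv1_in. Qed.

Lemma inv1_x_in : in_mx K (fun c => inv1_x (csec s c) (b c)).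
Proof.
move=> i j; have := partial_inv1_in (ix j); apply: K_ext => c _.
by rewrite mxE.
Qed.

Lemma hmx_in : in_mx K (fun c => hmx (csec s c (b c))).
Proof. by move=> i j; exact: jets_in_val (jhmx i j). Qed.

Hypothesis inv1_v_neq0 : forall c, G c -> inv1_v (csec s c) (b c) != 0.

Lemma curl0_in : in_mx K (fun c => curl0 (csec s c) (b c)).
Proof.
have dw i l : K (fun c => partial l (fun y => wv (csec s c) y 0 i) (b c)).
  exact: jets_in_val (jets_in_partial l (jwv 0 i)).
have zin : in_mx K (fun c => zv (csec s c) (b c)).
  by move=> i j; have := dw j iv; apply: K_ext => c _; rewrite mxE.
have cin : in_mx K (fun c => curl (csec s c) (b c)).
  move=> i j; have := sf_sub sfK (dw i (ix j)) (dw j (ix i)).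
  by apply: K_ext => c _; rewrite mxE.
have xin := inv1_x_in.
apply: (in_mx_sub sfK cin); apply: (in_mx_scale sfK).
  by apply: (sf_inv sfK) inv1_v_in => c Gc; exact: inv1_v_neq0.
apply: (in_mx_sub sfK).
  exact: (in_mx_mul sfK (in_mx_tr zin) xin).
exact: (in_mx_mul sfK (in_mx_tr xin) zin).
Qed.

Lemma krymx_in : in_mx K (fun c => krymx (csec s c) (b c)).
Proof.
move=> i l; have kin j : in_mx K (fun c => krylov (csec s c) (b c) j).
  elim: j => [|j IH]; first by move=> i' l'; exact: jets_in_val (jwv i' l').
  apply: (in_mx_mul sfK _ curl0_in); apply: (in_mx_mul sfK IH).
  by apply: (in_mx_inv sfK) hmx_in => c Gc; exact: det_s.
by have := kin i 0 l; apply: K_ext => c _; rewrite mxE.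
Qed.

End Values.

Section BaseStep.
Variables (b : Gam -> pt) (psi : 'I_n -> Gam * pt -> R) (s : fiber_index m -> Gam * pt -> R).
Definition cmap (c : Gam) : 'I_n -> pt -> R := fun l y => psi l (c, y).
Definition pulled (f : fiber_index m) (x : Gam * pt) : R := pull (cmap x.1) (csec s x.1) x.2 f.
Local Notation a := (base_image psi b).
Hypothesis js : forall f, Jets a 2 (s f).
Hypothesis jp : forall f, Jets b 2 (pulled f).
Hypothesis regb : forall c, G c -> reg (cmap c) (csec s c) (b c).
Hypothesis inv1_v_neq0 : forall c, G c -> inv1_v (csec s c) (a c) != 0.
Hypothesis kry_neq0 : forall c, G c -> \det (krymx (csec s c) (a c)) != 0.
Hypothesis psi_in : forall l, K (fun c => psi l (c, b c)).

Local Notation J c := (gjac psi (c, b c)).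
Local Notation N c := (xblock (J c)).

Let ds c : G c -> \det (hmx (csec s c (a c))) != 0.
Proof. by move=> /regb; exact: reg_det. Qed.

Let kj c : G c -> kjac (J c).
Proof. by move=> /regb /reg_jac; exact: nbhs_singleton. Qed.

Let pE c : csec pulled c = pull (cmap c) (csec s c).
Proof. by []. Qed.

Let dp c : G c -> \det (hmx (csec pulled c (b c))) != 0.
Proof.
move=> Gc; rewrite pE (hmx_pull_reg (regb Gc)) !det_mulmx det_tr.
by rewrite !mulf_neq0 ?(kjac_det (kj Gc))//; exact: ds.
Qed.

Let Jvv0 c : G c -> J c iv iv != 0.
Proof.
move=> Gc; apply/eqP => v0; have := kjac_uv (kj Gc).
by rewrite v0 mulr0 => /eqP; rewrite eq_sym oner_eq0.
Qed.

Let ip0 c : G c -> inv1_v (csec pulled c) (b c) != 0.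
Proof.
by move=> Gc; rewrite pE (inv1_v_pull (regb Gc)) mulf_neq0//; [exact: inv1_v_neq0|exact: Jvv0].
Qed.

Let jvv : K (fun c => J c iv iv).
Proof.
have := sf_div sfK inv1_v_neq0 (inv1_v_in jp dp) (inv1_v_in js ds).
by apply: K_ext => c Gc; rewrite pE (inv1_v_pull (regb Gc)) mulrC mulrA mulVf ?mul1r//; exact: inv1_v_neq0.
Qed.

Let juu : K (fun c => J c iu iu).
Proof.
have := sf_inv sfK Jvv0 jvv; apply: K_ext => c Gc.
by apply: (mulIf (Jvv0 Gc)); rewrite mulVf ?Jvv0// (kjac_uv (kj Gc)).
Qed.

(** Two matrices of frames related by the transpose of N determine it. *)
Let jN : in_mx K (fun c => N c).
Proof.
have kin : in_mx K (fun c => ainv (krymx (csec s c) (a c)) *m krymx (csec pulled c) (b c)).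
  apply: (in_mx_mul sfK); last exact: (krymx_in jp dp ip0).
  exact: (in_mx_inv sfK kry_neq0 (krymx_in js ds inv1_v_neq0)).
move=> i j; have := kin j i; apply: K_ext => c Gc.
rewrite pE (krymx_pull (regb Gc)); last exact: inv1_v_neq0.
rewrite (ainvE (kry_neq0 Gc)) mulKmx ?unitmxE ?unitfE ?kry_neq0//.
by rewrite [LHS]mxE.
Qed.

Let jV : in_mx K (fun c => \row_(l < m) J c (ix l) iv).
Proof.
have kin : in_mx K (fun c => (inv1_v (csec s c) (a c))^-1 *:
    (inv1_x (csec pulled c) (b c) - inv1_x (csec s c) (a c) *m (N c)^T)).
  apply: (in_mx_scale sfK); first exact: (sf_inv sfK inv1_v_neq0 (inv1_v_in js ds)).
  apply: (in_mx_sub sfK); first exact: (inv1_x_in jp dp).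
  exact: (in_mx_mul sfK (inv1_x_in js ds) (in_mx_tr jN)).
move=> i j; have := kin i j; apply: K_ext => c Gc.
rewrite pE (inv1_x_pull (regb Gc)) addrC addKr scalerA mulVf ?scale1r//.
exact: inv1_v_neq0.
Qed.

(** The law [pull_fW] of W, in which everything else is known by now, is solved for the
    u-derivatives of x by inverting h N^T. *)
Let jX : in_mx K (fun c => \row_(i < m) J c iu (ix i)).
Proof.
have wp : in_mx K (fun c => wrow (csec pulled c (b c))).
  by move=> i j; have := jets_in_val (jp (fW j)); apply: K_ext => c _; rewrite mxE.
have ws : in_mx K (fun c => wrow (csec s c (a c))).
  by move=> i j; have := jets_in_val (js (fW j)); apply: K_ext => c _; rewrite mxE.
have kin : in_mx K (fun c => 2^-1 *: (wrow (csec pulled c (b c)) -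
     J c iu iu *: (wrow (csec s c (a c)) *m (N c)^T + \row_(l < m) J c (ix l) iv)) *m
     ainv (hmx (csec s c (a c)) *m (N c)^T)).
  have hN : in_mx K (fun c => hmx (csec s c (a c)) *m (N c)^T).
    exact: (in_mx_mul sfK (hmx_in js) (in_mx_tr jN)).
  apply: (in_mx_mul sfK); last first.
    apply: (in_mx_inv sfK) hN => c Gc.
    by rewrite det_mulmx det_tr mulf_neq0 ?ds// (kjac_det (kj Gc)).
  apply: (in_mx_scale sfK (sf_cst sfK _)); apply: (in_mx_sub sfK wp).
  apply: (in_mx_scale sfK juu); apply: (in_mx_add sfK _ jV).
  exact: (in_mx_mul sfK ws (in_mx_tr jN)).
move=> i j; have := kin i j; apply: K_ext => c Gc.
have -> : wrow (csec pulled c (b c)) = J c iu iu *: (wrow (csec s c (a c)) *m (N c)^T + \row_l J c (ix l) iv) +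
    2 *: (\row_(i < m) J c iu (ix i) *m (hmx (csec s c (a c)) *m (N c)^T)).
  apply/rowP => k; rewrite [LHS]mxE pE (pull_fW k (regb Gc)) !mxE.
  congr (_ * (_ + _) + _ * _).
    by apply: eq_bigr => i' _; rewrite !mxE.
  apply: eq_bigr => i' _; rewrite !mxE mulr_sumr; apply: eq_bigr => j' _.
  by rewrite !mxE mulrA.
rewrite addrC addKr scalerA mulVf ?pnatr_eq0// scale1r.
have dhN : \det (hmx (csec s c (a c)) *m (N c)^T) != 0.
  by rewrite det_mulmx det_tr mulf_neq0 ?ds// (kjac_det (kj Gc)).
by rewrite ainvE// mulmxK// unitmxE unitfE.
Qed.

(** The u-derivative of I is the one equation left; v_u occurs in it with the coefficient I_v. *)
Let juv : K (fun c => J c iu iv).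
Proof.
have dIs := partial_inv1_in js ds.
have kin : K (fun c => (partial iu (inv1 (csec pulled c)) (b c) -
    (partial iu (inv1 (csec s c)) (a c) * J c iu iu +
     \sum_i partial (ix i) (inv1 (csec s c)) (a c) * (\row_(i < m) J c iu (ix i)) 0 i)) /
    inv1_v (csec s c) (a c)).
  apply: (sf_div sfK inv1_v_neq0 _ (inv1_v_in js ds)).
  apply: (sf_sub sfK (partial_inv1_in jp dp iu)).
  apply: (sf_add sfK (sf_mul sfK (dIs iu) juu)).
  by apply: (sf_sum sfK) => i; apply: (sf_mul sfK (dIs _)); exact: jX.
apply: K_ext kin => c Gc; apply: (mulIf (inv1_v_neq0 Gc)).
rewrite divfK ?inv1_v_neq0// pE (partial_inv1_pull iu (regb Gc)) sum_index.
under [X in _ - (_ + X)]eq_bigr do rewrite mxE.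
by rewrite addrC addKr mulrC.
Qed.

Lemma jets_in_first l : Jets b 1 (psi l).
Proof.
have sp c : G c -> smooth_at (b c) (fun y => psi l (c, y)) by move=> /regb /reg_psi; apply.
split=> [//||q]; first exact: psi_in.
split=> [c Gc||]; [exact: (smooth_at_partial q (sp c Gc))| |exact: I].
have : K (fun c => J c q l); last by apply: K_ext => c _; rewrite mxE.
case: (indexP q) => [|i|]; case: (indexP l) => [|j|].
- exact: juu.
- by have := jX 0 j; apply: K_ext => c _; rewrite mxE.
- exact: juv.
- by apply: K_ext (sf_cst sfK 0) => c /kj /kjac_xu ->.
- by have := jN i j; apply: K_ext => c _; rewrite mxE.
- by have := jV 0 i; apply: K_ext => c _; rewrite mxE.
- by apply: K_ext (sf_cst sfK 0) => c /kj /kjac_vu ->.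
- by apply: K_ext (sf_cst sfK 0) => c /kj /kjac_vx ->.
- exact: jvv.
Qed.

End BaseStep.
End InvariantsIn.

(** * Free action on generic jets of order at least 2 *)

Section KundtJets.
Variables (R : realType) (m k : nat).
Local Notation n := (1 + m + 1)%N.
Local Notation pt := 'rV[R]_(1 + m + 1).
Local Notation iu := (iu m).
Local Notation iv := (iv m).

(** All coefficients of the Taylor polynomial of h that involve v are zero. The Kundt condition thus
    holds at every point and not only to order k, as the invariants require. *)
Lemma kundt_jpoly_h (p : jet_vec R m k) i j y : kundt_equation p ->
  partial iv (fun y => jpoly p y (fh i j)) y = 0.
Proof.
move=> [_ Ep]; apply: (@partial_tpoly_out R m k _ _ (predC1 iv)) => [tau|]; last by rewrite /= eqxx.
rewrite /supported negb_forall => /existsP[l]; rewrite negb_or => /andP[t0 /negPn/eqP lv].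
by apply: Ep; rewrite lt0n -lv.
Qed.

Lemma ipartial_coord_mul (g : pt -> R) a l (c : R) ls : smooth_at a g -> l \notin ls ->
  ipartial ls (fun y => (y 0 l - c) * g y) a = (a 0 l - c) * ipartial ls g a.
Proof.
elim: ls a => //= q ls IH a sg; rewrite inE negb_or => /andP[lq lls].
have E : {near a, ipartial ls (fun y => (y 0 l - c) * g y) =1 fun y => (y 0 l - c) * ipartial ls g y}.
  by apply: filterS (smooth_at_near sg) => y sy; exact: IH.
have sc : smooth_at a (fun y => y 0 l - c) := smooth_at_add (smooth_at_coord a l) (smooth_at_cst a (- c)).
rewrite (nbhs_singleton (partial_eq q E)) (partial_mul q sc (smooth_at_ipartial ls sg)).
rewrite (partial_add q (smooth_at_coord a l) (smooth_at_cst a (- c))) partial_cst partial_coord.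
by rewrite eq_sym (negbTE lq) addr0 mul0r add0r.
Qed.

(** Makes the parameters readable from psi: each non-constant supported coefficient is a derivative
    of psi at the base point along u and x. *)
Lemma ipartial_param_map (a : pt) (gam : 'rV[R]_#|{: param m k}|) c ls : Gset gam ->
  (size ls <= k.+1)%N -> iv \notin ls ->
  ipartial ls (param_map a gam c) (pbase gam) = pcoef a gam c (mi k.+1 ls).
Proof.
move=> Gg lsk ivls; rewrite -ipartial_pf//.
have [cv|cv] := eqVneq c iv; last first.
  by congr (ipartial _ _ _); apply/funext => y; rewrite /param_map (negbTE cv).
pose g y := (partial iu (pf a gam iu) y)^-1.
have sg : smooth_at (pbase gam) g.
  apply: smooth_at_inv; first exact: (smooth_at_partial iu (smooth_at_pf _ _ _ _)).
  by have [] := (pdom_base a gam).1 Gg.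
have sc : smooth_at (pbase gam) (fun y : pt => y 0 iv - pbase gam 0 iv).
  exact: smooth_at_add (smooth_at_coord _ iv) (smooth_at_cst _ (- _)).
rewrite cv (_ : param_map a gam iv =
    fun y => 1 * pf a gam iv y + (y 0 iv - pbase gam 0 iv) * g y); last first.
  by apply/funext => y; rewrite /param_map eqxx mul1r.
rewrite (ipartial_lin 1 _ (smooth_at_pf _ _ _ _) (smooth_at_mul sc sg)) mul1r.
by rewrite ipartial_coord_mul// subrr mul0r addr0.
Qed.

End KundtJets.

Section Freeness.
Variables (R : realType) (m k : nat).
Local Notation n := (1 + m + 1)%N.
Local Notation pt := 'rV[R]_(1 + m + 1).
Local Notation iu := (iu m).
Local Notation iv := (iv m).
Local Notation Gam := 'rV[R]_#|{: param m k}|.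
Local Notation G := (@Gset R m k).
Variable p : jet_vec R m k.

Definition generic_jet := [/\ kundt_equation p, inv1_v (jpoly p) (jbase p) != 0 &
  \det (krymx (jpoly p) (jbase p)) != 0].

Variable K : (Gam -> R) -> Prop.
Hypothesis sfK : subfield_on G K.
Hypothesis K_ext : forall f g, (forall c, G c -> f c = g c) -> K f -> K g.
Hypothesis tjet_K : forall j, K (fun gam => tjet p gam 0 j).
Hypothesis k2 : (2 <= k)%N.
Hypothesis gp : generic_jet.

Local Notation psi := (fun c (x : Gam * pt) => param_map (jbase p) x.1 c x.2).
Local Notation s := (fun c (x : Gam * pt) => jpoly p x.2 c).
Local Notation b := (@pbase R m k).
Local Notation Jets := (jets_in G K).

Let pbase_K l : K (fun gam => pbase gam 0 l).
Proof.
apply: K_ext (tjet_K (enum_rank (inl l))) => gam _.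
by rewrite -[LHS]/(jcoord _ _) jcoord_jet_base.
Qed.

Let kp gam : G gam -> kmap (b gam) (param_map (jbase p) gam).
Proof. exact: param_map_kmap. Qed.

Let stsec gam c : G gam -> smooth_at (b gam) (fun y => tsec p gam y c).
Proof.
move=> Gg; apply: smooth_at_pull => [i|c']; last exact: smooth_at_jpoly.
exact: (kp Gg).1.
Qed.

Let jtsec c : Jets b k (fun x => tsec p x.1 x.2 c).
Proof.
apply: (ipartial_jets_in K_ext) => [gam Gg|ls lsk]; first exact: stsec.
apply: K_ext (tjet_K (enum_rank (inr (c, mi k ls)))) => gam Gg.
rewrite -[LHS]/(jcoord _ _) jcoord_jet multi_derive_mi//; exact: stsec.
Qed.

Let regp gam : G gam -> reg (param_map (jbase p) gam) (jpoly p) (b gam).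
Proof.
move=> Gg; case: (kp Gg) => sp kjp; case: gp => Ep _ _.
split; [exact: sp|move=> c; exact: smooth_at_jpoly|exact: kjp| |].
  by move=> i j; apply: near_all => z; exact: kundt_jpoly_h.
rewrite param_map_base; apply: in_F_det; apply/jet_spaceE; exact: Ep.1.
Qed.

Let biE : base_image psi b = fun=> jbase p.
Proof. exact: base_image_param_map. Qed.

Let js r c : Jets (base_image psi b) r (s c).
Proof. by rewrite biE; exact: jets_in_jpoly_cst. Qed.

Lemma jets_in_param_map1 l : Jets b 1 (psi l).
Proof.
case: gp => Ep I0 D0.
apply: (jets_in_first sfK K_ext (psi := psi) (s := s)).
- exact: js.
(* The bound k >= 2 is used here: I_v and the corrected curl contain second derivatives of the
   section. *)
- by move=> f; exact: (jets_in_le k2 (jtsec f)).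
- exact: regp.
- by move=> gam Gg; rewrite biE.
- by move=> gam Gg; rewrite biE.
- move=> l'; apply: K_ext (sf_cst sfK (jbase p 0 l')) => gam _.
  by have := congr1 (fun M : pt => M 0 l') (param_map_base (jbase p) gam); rewrite mxE.
Qed.

Lemma jets_in_param_map_next r : (r < k)%N ->
  (forall l, Jets b r.+1 (psi l)) -> forall l, Jets b r.+2 (psi l).
Proof.
move=> rk jp l; apply: (jets_in_next sfK K_ext jp (js r.+1)).
- move=> i j; have jg : in_mx (Jets b k) (fun x => gmx (tsec p x.1 x.2)).
    exact: (in_mx_gmx (sf_jets_in sfK K_ext b k)).
  apply: (jets_in_eq K_ext _ (jets_in_le rk (jg i j))) => gam Gg.
  apply: filterS (kp Gg).2 => y kj.
  by rewrite tsecE gmx_pull.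
- by move=> gam /kp /kmap_kjac /det_kjac.
- move=> gam Gg; apply: det_gmx.
  have -> : gfiber s psi (gam, b gam) = jpoly p (jbase p).
    by apply/funext => c; rewrite -[in RHS](param_map_base (jbase p) gam).
  by apply: in_F_det; apply/jet_spaceE; case: gp => -[].
Qed.

Lemma jets_in_param_map_all l : Jets b k.+1 (psi l).
Proof.
have H r : (r <= k)%N -> forall l, Jets b r.+1 (psi l).
  elim: r => [_|r IH rk]; first exact: jets_in_param_map1.
  by apply: jets_in_param_map_next => //; apply: IH; exact: ltnW.
exact: H.
Qed.

(** The constant coefficients are base coordinates of the jet, and the other ones are derivatives of
    psi of order at most k + 1. With K the class of determined functions, this is the injective
    immersion. *)
Lemma coef_K c tau : K (fun gam => coef gam c tau).
Proof.
have [->|t0] := eqVneq tau (tau0 m k).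
  by apply: K_ext (pbase_K c) => gam _; rewrite mxE.
have [st|nst] := boolP (supported (vars c) tau); last first.
  by apply: K_ext (sf_cst sfK 0) => gam _; rewrite coef_out.
have ivt : iv \notin flat tau.
  rewrite -has_pred1 has_count count_flat -leqNgt leqn0.
  by move/forallP: st => /(_ iv); rewrite vars_v orbF.
apply: K_ext (jets_in_ipartial K_ext (jets_in_param_map_all c) (size_flat tau)) => gam Gg.
by rewrite (ipartial_param_map _ _ Gg)// ?size_flat// mi_flat /pcoef (negbTE t0).
Qed.

End Freeness.

Lemma kundt_orbit_generic (R : realType) m k (p : jet_vec R m k) : (2 <= k)%N -> generic_jet p ->
  immersed_submanifold #|{: param m k}| (kundt_orbit p).
Proof.
move=> k2 gp; have [[Fp _] _ _] := gp.
have oG := @Gset_open R m k; rewrite kundt_orbit_tjet//.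
have sT := @smooth_on_tjet R m k p.
apply: immersed_chart => // i.
rewrite (_ : (fun c => _) = fun gam => coef gam (val (enum_val i)).1 (val (enum_val i)).2).
  apply: (coef_K (sf_determined _ oG) _ _ k2 gp) => [f g|j]; first exact: determined_ext.
  exact: determined_coord.
by apply/funext => gam; rewrite (coef_val gam (enum_val i)) enum_valK.
Qed.

(** * The equation as a submanifold, and the orbits inside it *)

Section JetCoordinates.
Variables (R : realType) (m k : nat).
Local Notation n := (1 + m + 1)%N.
Local Notation pt := 'rV[R]_(1 + m + 1).
Local Notation iv := (iv m).
Implicit Types (p q : jet_vec R m k) (c : jet_index m k).

Definition free_coord c : bool :=
  match c with inr (inr _, sigma) => expo sigma iv == 0%N | _ => true end.

Lemma kundt_equationE p :
  kundt_equation p <-> jet_space p /\ forall c, ~~ free_coord c -> jcoord p c = 0.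
Proof.
split=> -[Fp Ep]; split=> //.
  case=> [//|[[//|ij] sigma]] /=; rewrite -lt0n => s0.
  by rewrite -fh_sorted; exact: Ep.
by move=> i j sigma s0; apply: Ep; rewrite /= -lt0n.
Qed.

Definition jvec (f : jet_index m k -> R) : jet_vec R m k := \row_r f (enum_val r).

Lemma jcoord_jvec f c : jcoord (jvec f) c = f c.
Proof. by rewrite /jcoord mxE enum_rankK. Qed.

Lemma jcoord_continuous c (p : jet_vec R m k) : {for p, continuous (fun p => jcoord p c)}.
Proof. exact: coord_continuous. Qed.

Lemma jet_space_open : open (@jet_space R m k).
Proof.
rewrite openE => p Fp.
have H : \forall q \near p, posdef (hmx (fun c : fiber_index m => jcoord (q : jet_vec R m k) (inr (c, multi_index0 m k)))).
  apply: posdef_near => [i j|q|]; last exact/in_F_posdef; last exact: hmx_sym.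
  rewrite (_ : (fun q => _) = fun q => jcoord q (inr (fh i j, multi_index0 m k))).
    exact: jcoord_continuous.
  by apply/funext => q; rewrite mxE.
by apply: filterS H => q /in_F_posdef.
Qed.

Section Slots.
Variable Q : pred (jet_index m k).
Local Notation V := 'rV[R]_#|{: {c : jet_index m k | Q c}}|.

Definition slot (x : V) c : R := oapp (fun i => x 0 (enum_rank i)) 0 (insub c).

Lemma slot_out x c : ~~ Q c -> slot x c = 0.
Proof. by move=> Qc; rewrite /slot insubF//; exact: negbTE. Qed.

Lemma slotE (x : V) i : x 0 i = slot x (val (enum_val i)).
Proof. by rewrite /slot valK /= enum_valK. Qed.

Definition unslot (f : jet_index m k -> R) : V := \row_i f (val (enum_val i)).

Lemma slot_unslot f c : Q c -> slot (unslot f) c = f c.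
Proof. by move=> Qc; rewrite /slot insubT /= mxE enum_rankK. Qed.

Lemma smooth_on_slot U c : open U -> smooth_on U (fun x : V => slot x c).
Proof.
move=> oU; rewrite /slot; case: insub => [i|] /=; last exact: smooth_on_cst.
exact: smooth_on_coord.
Qed.

End Slots.

Definition free_dim := #|{: {c : jet_index m k | free_coord c}}|.

Lemma kundt_equation_immersed : immersed_submanifold free_dim (@kundt_equation R m k).
Proof.
pose F (x : 'rV[R]_free_dim) := jvec (slot x).
pose U := [set x | jet_space (F x)].
have sFT : smooth_on setT F.
  apply/(smooth_on_rowP _ openT) => r.
  rewrite (_ : (fun x => _) = fun x => slot x (enum_val r)); last by apply/funext => x; rewrite mxE.
  by apply: smooth_on_slot; exact: openT.
have oU : open U.
  apply: (@open_comp _ _ F); last exact: jet_space_open.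
  by move=> x _; exact: smooth_on_continuous sFT I.
rewrite (_ : kundt_equation (k := k) = F @` U).
  apply: immersed_chart; [exact: oU|by apply: smooth_on_subset sFT|].
  move=> i; pose c0 : {c : jet_index m k | free_coord c} := enum_val i.
  rewrite (_ : (fun x => _) = fun x => F x 0 (enum_rank (val c0))).
    apply: (determined_coord _ oU); exact: smooth_on_subset sFT.
  by apply/funext => x; rewrite -[RHS]/(jcoord _ _) jcoord_jvec slotE.
apply/seteqP; split=> [p /kundt_equationE[Fp Ep]|_ [x Ux <-]]; last first.
  by apply/kundt_equationE; split=> // c nc; rewrite jcoord_jvec slot_out.
have E : F (unslot free_coord (jcoord p)) = p.
  apply: jcoord_inj => c; rewrite jcoord_jvec.
  by have [fc|nc] := boolP (free_coord c); [exact: slot_unslot|rewrite slot_out// Ep].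
by exists (unslot free_coord (jcoord p)) => //; rewrite /U /= E.
Qed.

(** Columns of a chart's Jacobian vanish outside the free coordinates, so its rank d is at most
    their number. This makes the truncated difference of dimensions below a true one. *)
Lemma immersed_dim_le d (S : set (jet_vec R m k)) p : immersed_submanifold d S ->
  S `<=` @kundt_equation R m k -> S p -> (d <= free_dim)%N.
Proof.
move=> [U [f [sf _ rk SE _]]] SK; rewrite {1}SE => -[i _ [x Ux _]].
have [oU sfi] := sf i.
rewrite -(rk i x Ux); set J := 'J (f i) x.
pose ev (a : 'I_free_dim) : jet_index m k := val (enum_val a : {c : jet_index m k | free_coord c}).
pose B : 'M[R]_(free_dim, #|{: jet_index m k}|) :=
  \matrix_(a, r) (enum_val r == ev a)%:R.
have sfr r : smooth_on (U i) (fun y => f i y 0 r : R) := (smooth_on_rowP _ oU).1 sfi r.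
have [dF _] := smooth_diff_row (fun j => smooth_on_at oU Ux (sfr j)).
have J0 a r : ~~ free_coord (enum_val r) -> J a r = 0.
  move=> nr; have : ('D_('e_a) (f i) x) 0 r = 0.
    rewrite derive_mx; last exact: diff_derivable.
    rewrite mxE; transitivity ('D_('e_a) (fun=> 0 : R) x); last exact: derive_cst.
    apply: near_eq_derive.
    apply: (open_nearT oU Ux) => y Uy.
    have : kundt_equation (f i y) by apply: SK; rewrite SE; exists i => //; exists y.
    by move=> /kundt_equationE[_ /(_ _ nr)]; rewrite /jcoord enum_valK.
  rewrite deriveEjacobian// -/J mxE (bigD1 a)//= mxE !eqxx mul1r big1 ?addr0// => b ba.
  by rewrite mxE (negbTE ba) andbF mul0r.
have -> : J = (J *m B^T) *m B.
  apply/matrixP => a r; rewrite [RHS]mxE.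
  have E b : (J *m B^T) a b = J a (enum_rank (ev b)).
    rewrite mxE (bigD1 (enum_rank (ev b)))//= !mxE enum_rankK eqxx mulr1 big1 ?addr0// => q qb.
    rewrite !mxE; have [qE|_] := eqVneq (enum_val q) (ev b); last by rewrite mulr0.
    by move: qb; rewrite -qE enum_valK eqxx.
  have [fr|nr] := boolP (free_coord (enum_val r)); last first.
    rewrite J0// big1// => b _; rewrite E [B _ _]mxE.
    have [rE|_] := eqVneq (enum_val r) (ev b); last by rewrite mulr0.
    by move: nr; rewrite rE (valP (enum_val b)).
  pose c0 : {c : jet_index m k | free_coord c} := exist _ (enum_val r) fr.
  have e0 : ev (enum_rank c0) = enum_val r by rewrite /ev enum_rankK.
  rewrite (bigD1 (enum_rank c0))//= E [B _ _]mxE e0 enum_valK eqxx mulr1 big1 ?addr0// => b bc.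
  rewrite [B _ _]mxE; have [rE|_] := eqVneq (enum_val r) (ev b); last by rewrite mulr0.
  by case/eqP: bc; rewrite -[b]enum_valK; congr enum_rank; apply: val_inj; rewrite /= rE.
exact: leq_trans (mulmx_max_rank _ _) (leqnn _).
Qed.

End JetCoordinates.

Section OrbitsInEquation.
Variables (R : realType) (m k : nat).
Local Notation n := (1 + m + 1)%N.
Local Notation pt := 'rV[R]_(1 + m + 1).
Local Notation iu := (iu m).
Local Notation iv := (iv m).

(** Functions with zero derivative at a point form a field. The entries of N h N^T, the pulled-back
    h, then lie in it because those of N and of h do. *)
Lemma sf_partial0 (a : pt) l :
  subfield_on [set a] (fun f => smooth_at a f /\ partial l f a = 0).
Proof.
split=> [c|f g [sf f0] [sg g0]|f g [sf f0] [sg g0]|f fa [sf f0]].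
- by split; [exact: smooth_at_cst|exact: partial_cst].
- by split; [exact: smooth_at_add|rewrite (partial_add l sf sg) f0 g0 addr0].
- by split; [exact: smooth_at_mul|rewrite (partial_mul l sf sg) f0 g0 mul0r mulr0 addr0].
- have fa0 := fa a erefl.
  by split; [exact: smooth_at_inv|rewrite (partial_inv l sf fa0) f0 mulr0].
Qed.

Lemma partial_v_pull_h psi (s : pt -> fiber_index m -> R) y i j : reg psi s y ->
  partial iv (fun y => pull psi s y (fh i j)) y = 0.
Proof.
move=> ry; have sf := sf_partial0 y iv.
have E : {near y, (fun y => pull psi s y (fh i j)) =1
    fun y => (xblock (jac psi y) *m hmx (s (row_fun psi y)) *m (xblock (jac psi y))^T) i j}.
  by apply: filterS (reg_near ry) => z rz; rewrite -hmx_pull_reg// mxE.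
rewrite (nbhs_singleton (partial_eq iv E)).
have jN : in_mx (fun f => smooth_at y f /\ partial iv f y = 0) (fun y => xblock (jac psi y)).
  move=> a b; rewrite (_ : (fun y => _) = fun y => jac psi y (ix a) (ix b)).
    split; last by apply: (partial_v_jac ry); rewrite ?index_eqE.
    rewrite (_ : (fun y => _) = partial (ix a) (psi (ix b))); last by apply/funext => z; rewrite mxE.
    exact: (smooth_at_partial _ (reg_psi ry _)).
  by apply/funext => z; rewrite mxE.
apply: (in_mx_mul sf (in_mx_mul sf jN _) (in_mx_tr jN) i j).2 => a b.
rewrite (_ : (fun y => _) = (fun y => s y (fh a b)) \o row_fun psi); last first.
  by apply/funext => z; rewrite mxE.
split; first exact: (smooth_at_comp (reg_psi ry) (reg_s ry _)).
rewrite (partial_psi iv ry (reg_s ry (fh a b))) sum_index.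
have kj := nbhs_singleton (reg_jac ry).
rewrite (kjac_vu kj) mulr0 add0r (nbhs_singleton (reg_h ry a b)) mul0r addr0.
by rewrite big1// => l _; rewrite (kjac_vx kj) mulr0.
Qed.

Lemma reg_param_map (p : jet_vec R m k) (gam : 'rV[R]_#|{: param m k}|) :
  kundt_equation p -> Gset gam -> reg (param_map (jbase p) gam) (jpoly p) (pbase gam).
Proof.
move=> Ep Gg; case: (param_map_kmap (jbase p) Gg) => sp kjp.
split; [exact: sp|move=> c; exact: smooth_at_jpoly|exact: kjp| |].
  by move=> i j; apply: near_all => z; exact: kundt_jpoly_h.
by rewrite param_map_base; apply: in_F_det; apply/jet_spaceE; exact: Ep.1.
Qed.

Lemma kundt_orbit_equation (p : jet_vec R m k) :
  kundt_equation p -> kundt_orbit p `<=` @kundt_equation R m k.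
Proof.
move=> Ep q; rewrite kundt_orbit_tjet; last exact: Ep.1.
move=> [gam Gg <-]; have rg := reg_param_map Ep Gg.
have kp := param_map_kmap (jbase p) Gg.
have sq c : smooth_at (pbase gam) (fun y => tsec p gam y c).
  by apply: smooth_at_pull => [i|c']; [exact: kp.1|exact: smooth_at_jpoly].
split.
  rewrite /jet_space /=; have -> : (fun c => jcoord (tjet p gam) (inr (c, multi_index0 m k))) =
      tsec p gam (pbase gam).
    by apply/funext => c; rewrite jcoord_jet multi_derive_nil.
  apply: in_F_pull; first exact: kmap_kjac.
  by rewrite param_map_base; apply/jet_spaceE; exact: Ep.1.
move=> i j sigma s0; rewrite jcoord_jet multi_deriveE; apply: (ipartial_out (l := iv)); first exact: sq.
  by rewrite -has_pred1 has_count count_flat.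
by apply: filterS (reg_near rg) => z rz; exact: partial_v_pull_h.
Qed.

End OrbitsInEquation.

(** * Genericity is open and dense *)

Section RationalFunctions.
Variable R : realType.
Implicit Types (G : set R) (f g : R -> R) (P Q : {poly R}).

Definition rat_on G f := exists P Q, forall t, G t -> Q.[t] != 0 /\ f t = P.[t] / Q.[t].

Lemma sf_rat_on G : subfield_on G (rat_on G).
Proof.
split=> [c|f g [P [Q fE]] [P' [Q' gE]]|f g [P [Q fE]] [P' [Q' gE]]|f f0 [P [Q fE]]].
- by exists c%:P, 1 => t _; rewrite !hornerE divr1 oner_neq0.
- exists (P * Q' + P' * Q), (Q * Q') => t Gt.
  have [Q0 ->] := fE t Gt; have [Q0' ->] := gE t Gt.
  by rewrite !hornerE mulf_neq0//; split=> //; field; rewrite Q0 Q0'.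
- exists (P * P'), (Q * Q') => t Gt.
  have [Q0 ->] := fE t Gt; have [Q0' ->] := gE t Gt.
  by rewrite !hornerM mulf_neq0// invfM mulrACA.
- exists Q, P => t Gt; have [Q0 fPQ] := fE t Gt; have := f0 t Gt; rewrite fPQ.
  by rewrite mulf_eq0 negb_or => /andP[P0 _]; rewrite invf_div.
Qed.

Lemma rat_on_ext G f g : (forall t, G t -> f t = g t) -> rat_on G f -> rat_on G g.
Proof.
by move=> fg [P [Q fE]]; exists P, Q => t Gt; rewrite -fg//; exact: fE.
Qed.

(** After splitting off the highest power of X - a, the cofactor does not vanish at a, hence not
    near a. *)
Lemma poly_neq0_near P a : P != 0 -> \forall t \near a^', P.[t] != 0.
Proof.
move=> P0; have [mu [q]] := multiplicity_XsubC P a.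
rewrite P0 /= => qa ->.
have cq : {for a, continuous (fun t : R => q.[t])} by exact: continuous_horner.
have nq : \forall t \near a, q.[t] != 0.
  have oD : open [set y : R | y != 0] by exact: open_neq.
  exact: cq _ (open_nbhs_nbhs (conj oD qa)).
rewrite /dnbhs /= near_withinE; apply: filterS nq => t qt ta.
by rewrite !hornerE mulf_neq0// expf_neq0// subr_eq0.
Qed.

(** One value at a possibly distant point shows that the numerator is not the zero polynomial; in
    this way a single generic jet yields generic jets near any other. *)
Lemma rat_on_neq0_near G f a t1 : rat_on G f -> G t1 -> f t1 != 0 ->
  (\forall t \near a^', G t) -> \forall t \near a^', f t != 0.
Proof.
move=> [P [Q fE]] Gt1 f1 nG.
have P0 : P != 0.
  by apply: contra_neq f1 => P0; rewrite (fE _ Gt1).2 P0 horner0 mul0r.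
apply: filterS2 nG (poly_neq0_near a P0) => t /fE[Q0 ->] Pt.
by rewrite mulf_neq0 ?invr_eq0.
Qed.

End RationalFunctions.

Section GenericFamily.
Variables (R : realType) (m k : nat) (Gam : Type) (G : set Gam).
Variable K : (Gam -> R) -> Prop.
Hypothesis sfK : subfield_on G K.
Hypothesis K_ext : forall f g, (forall c, G c -> f c = g c) -> K f -> K g.
Local Notation pt := 'rV[R]_(1 + m + 1).
Variable P : Gam -> jet_vec R m k.
Hypothesis P_in : forall c, K (fun t => jcoord (P t) c).
Hypothesis P_jet : forall t, G t -> jet_space (P t).

Let s (f : fiber_index m) (x : Gam * pt) := jpoly (P x.1) x.2 f.

Let js f : jets_in G K (fun t => jbase (P t)) 2 (s f).
Proof.
apply: (jets_in_tpoly sfK K_ext (c := fun t sigma => jcoord (P t) (inr (f, sigma)))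
  (b := fun t => jbase (P t))) => [sigma|i]; first exact: P_in.
by apply: K_ext (P_in (inl i)) => t _; rewrite mxE.
Qed.

Let ds t : G t -> \det (hmx (csec s t (jbase (P t)))) != 0.
Proof. by move=> Gt; apply: in_F_det; apply/jet_spaceE; exact: P_jet. Qed.

Lemma family_inv1_v_in : K (fun t => inv1_v (jpoly (P t)) (jbase (P t))).
Proof. exact: (inv1_v_in sfK K_ext js ds). Qed.

Lemma family_krymx_in : (forall t, G t -> inv1_v (jpoly (P t)) (jbase (P t)) != 0) ->
  K (fun t => \det (krymx (jpoly (P t)) (jbase (P t)))).
Proof. by move=> I0; apply: (sf_det sfK); exact: (krymx_in sfK K_ext js ds I0). Qed.

End GenericFamily.

Lemma open_smooth_neq0 (R : realType) d (U : set 'rV[R]_d) (f : 'rV[R]_d -> R) :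
  open U -> smooth_on U f -> open [set x | U x /\ f x != 0].
Proof.
move=> oU sf; rewrite openE => x [Ux fx].
have oD : open [set y : R | y != 0] by exact: open_neq.
have nf : \forall y \near x, f y != 0.
  exact: (smooth_on_continuous sf Ux) _ (open_nbhs_nbhs (conj oD fx)).
have nU : \forall y \near x, U y by exact: open_nbhs_nbhs.
exact: filterS2 nU nf.
Qed.

Lemma line_continuous (R : realType) d (p v : 'rV[R]_d) (t : R) :
  {for t, continuous (fun t : R => p + t *: v)}.
Proof.
apply/continuous_rowP => i; rewrite (_ : (fun t => _) = fun t => p 0 i + t * v 0 i).
  apply: continuousD; first exact: cst_continuous.
  by apply: (@continuousM _ _ idfun (fun=> v 0 i)); [exact: cvg_id|exact: cst_continuous].
by apply/funext => z; rewrite !mxE.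
Qed.

Section GenericOpen.
Variables (R : realType) (m k : nat).
Implicit Types (p : jet_vec R m k).

(** The equation itself is left out, so that the set is open among all jet vectors, as
    [generic_orbit_codim] demands. *)
Definition generic_set : set (jet_vec R m k) :=
  [set p | (jet_space p /\ inv1_v (jpoly p) (jbase p) != 0) /\
           \det (krymx (jpoly p) (jbase p)) != 0].

Lemma generic_setP p : kundt_equation p -> generic_set p -> generic_jet p.
Proof. by move=> Ep [[_ I0] D0]. Qed.

Let jcoord_smooth U c : open U -> smooth_on U (fun p => jcoord p c).
Proof. by move=> oU; exact: smooth_on_coord. Qed.

Lemma generic_set_open : open generic_set.
Proof.
have oJ := @jet_space_open R m k.
have ext (U : set (jet_vec R m k)) : open U ->
  forall f g : jet_vec R m k -> R, (forall c, U c -> f c = g c) -> smooth_on U f -> smooth_on U g.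
  by move=> oU f g; exact: smooth_on_ext.
have o1 := open_smooth_neq0 oJ (family_inv1_v_in (sf_smooth_on oJ) (ext _ oJ)
  (P := id) (fun c => jcoord_smooth c oJ) (fun _ H => H)).
apply: (open_smooth_neq0 o1); apply: (family_krymx_in (sf_smooth_on o1) (ext _ o1) (P := id)).
- by move=> c; exact: jcoord_smooth.
- by move=> p [].
- by move=> p [].
Qed.

Lemma near_line_jet_space p p1 : jet_space p ->
  \forall t \near (0 : R), jet_space (p + t *: (p1 - p)).
Proof.
move=> Fp; have cl : {for 0, continuous (fun t : R => p + t *: (p1 - p))}.
  exact: line_continuous.
have := cl _ (open_nbhs_nbhs (conj (@jet_space_open R m k) _)); apply.
by rewrite scale0r addr0.
Qed.

(** On the line from p to p1 the coordinates fixed by the equation stay zero, and the quantities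
    that must not vanish are rational in t. Being nonzero at t = 1, they are nonzero for all small t
    other than 0. *)
Lemma generic_dense p1 : kundt_equation p1 -> generic_set p1 ->
  @kundt_equation R m k `<=` closure (@kundt_equation R m k `&` generic_set).
Proof.
move=> E1 [[F1 I1] D1] p Ep.
pose P (t : R) := p + t *: (p1 - p).
have P1 : P 1 = p1 by rewrite /P scale1r addrC subrK.
have jP t c : jcoord (P t) c = jcoord p c + t * (jcoord p1 c - jcoord p c).
  by rewrite /jcoord !mxE.
pose G := [set t | jet_space (P t)].
have P_in H c : rat_on H (fun t => jcoord (P t) c).
  exists ((jcoord p c)%:P + 'X * (jcoord p1 c - jcoord p c)%:P), 1 => t _.
  by rewrite jP !hornerE divr1 oner_neq0.
have nG : \forall t \near 0^', G t.
  by rewrite /dnbhs /= near_withinE; apply: filterS (near_line_jet_space p1 Ep.1) => t.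
have G1 : G 1 by rewrite /G /= P1.
have rI := family_inv1_v_in (sf_rat_on G) (@rat_on_ext R G) (P_in G) (fun _ H => H).
have I1' : inv1_v (jpoly (P 1)) (jbase (P 1)) != 0 by rewrite P1.
have nI := rat_on_neq0_near rI G1 I1' nG.
(* I_v is a denominator in the Krylov matrix, so its zeros are removed before rationality of the
   determinant is claimed. *)
pose G' := [set t | G t /\ inv1_v (jpoly (P t)) (jbase (P t)) != 0].
have nG' : \forall t \near 0^', G' t by apply: filterS2 nG nI.
have rD : rat_on G' (fun t => \det (krymx (jpoly (P t)) (jbase (P t)))).
  by apply: (family_krymx_in (sf_rat_on G') (@rat_on_ext R G') (P_in G')) => t [].
have G'1 : G' 1 by split; rewrite ?P1.
have D1' : \det (krymx (jpoly (P 1)) (jbase (P 1))) != 0 by rewrite P1.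
have nD := rat_on_neq0_near rD G'1 D1' nG'.
move=> B nB.
have cl : P @ 0^' --> p.
  have : P @ nbhs (0 : R) --> p.
    rewrite -[X in _ --> X](_ : P 0 = p); last by rewrite /P scale0r addr0.
    exact: line_continuous.
  by apply: cvg_trans; apply: cvg_app; exact: cvg_within.
have [t [Bt [Gt It] Dt]] : exists t, [/\ B (P t), G' t & \det (krymx (jpoly (P t)) (jbase (P t))) != 0].
  have ne : \forall t \near 0^', [/\ B (P t), G' t & \det (krymx (jpoly (P t)) (jbase (P t))) != 0].
    have nB' : \forall t \near 0^', B (P t) := cl _ nB.
    by apply: filterS3 nB' nG' nD => t.
  have [t Ht] := @filter_ex _ _ (Proper_dnbhs_numFieldType (0 : R)) _ ne.
  by exists t.
exists (P t); split=> //; split=> //.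
apply/kundt_equationE; split=> // c nc.
have /kundt_equationE[_ /(_ _ nc) p0] := Ep.
have /kundt_equationE[_ /(_ _ nc) q0] := E1.
by rewrite jP p0 q0 subrr mulr0 addr0.
Qed.

End GenericOpen.

(** * A generic jet in each dimension *)

Section GenericExample.
Variables (R : realType) (m k : nat).
Local Notation n := (1 + m.+1 + 1)%N.
Local Notation pt := 'rV[R]_(1 + m.+1 + 1).
Local Notation iv := (iv m.+1).
Local Notation xprev j y := ((y : pt) 0 (ix (inord j : 'I_m.+1))).
Hypothesis k2 : (2 <= k)%N.

(* w = (1 + v, x^0, x^1, ...): at the origin, inv1 = w h^-1 w^T has v-derivative 2 and
   x-derivative 0, and curl0 is skew with entries 1 next to the diagonal. *)
Definition sample_section (y : pt) (f : fiber_index m.+1) : R :=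
  match f with
  | inl (inl _) => 0
  | inl (inr i) => if i == 0 :> nat then y 0 iv + 2^-1 * (y 0 iv * y 0 iv) else y 0 iv * xprev i.-1 y
  | inr ij => ((val ij).1 == (val ij).2)%:R
  end.

Local Notation s := sample_section.

Lemma smooth_at_sample a f : smooth_at a (fun y => s y f).
Proof.
case: f => [[[]|i]|ij] /=; [exact: smooth_at_cst| |exact: smooth_at_cst].
have sv := smooth_at_coord a iv.
case: (i == 0 :> nat); last exact: smooth_at_mul sv (smooth_at_coord a _).
exact: smooth_at_add sv (smooth_at_mul (smooth_at_cst a _) (smooth_at_mul sv sv)).
Qed.

Lemma wv_sample y i : wv s y 0 i = if i == 0 :> nat then 1 + y 0 iv else xprev i.-1 y.
Proof.
have sv := smooth_at_coord y iv.
rewrite mxE /=; case: (boolP (i == 0 :> nat)) => i0.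
  rewrite (partial_add iv sv (smooth_at_mul (smooth_at_cst y _) (smooth_at_mul sv sv))).
  rewrite (partial_mul iv (smooth_at_cst y _) (smooth_at_mul sv sv)) (partial_mul iv sv sv).
  by rewrite partial_cst partial_coord eqxx /=; field.
rewrite (partial_mul iv sv (smooth_at_coord y _)) !partial_coord eqxx index_eqE.
by rewrite mulr0 addr0 mul1r.
Qed.

Lemma hmx_sample y : hmx (s y) = 1%:M.
Proof.
apply/matrixP => i j; rewrite !mxE /=.
by case: (leqP i j) => //= _; rewrite eq_sym.
Qed.

Lemma inv1_sample y : inv1 s y = \sum_i wv s y 0 i * wv s y 0 i.
Proof.
rewrite /inv1 hmx_sample ainvE ?det1 ?oner_neq0// invmx1 mulmx1 mxE.
by apply: eq_bigr => i _; rewrite [_^T _ _]mxE.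
Qed.

Let smw y i : smooth_at y (fun y => wv s y 0 i).
Proof. exact: smooth_at_wv (smooth_at_sample y) 0 i. Qed.

Lemma partial_wv_sample y l i :
  partial l (fun y => wv s y 0 i) y =
  if i == 0 :> nat then (l == iv)%:R else (l == ix (inord i.-1 : 'I_m.+1))%:R.
Proof.
have [i0|i0] := boolP (i == 0 :> nat).
  rewrite (_ : (fun y => _) = fun y : pt => 1 + y 0 iv).
    by rewrite (partial_add l (smooth_at_cst y 1) (smooth_at_coord y iv)) partial_cst partial_coord add0r.
  by apply/funext => z; rewrite wv_sample i0.
rewrite (_ : (fun y => _) = fun y : pt => xprev i.-1 y); first by rewrite partial_coord.
by apply/funext => z; rewrite wv_sample (negbTE i0).
Qed.

Lemma wv_sample0 i : wv s 0 0 i = (i == 0 :> nat)%:R.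
Proof. by rewrite wv_sample !mxE addr0; case: eqP. Qed.

Lemma partial_inv1_sample l : partial l (inv1 s) 0 = 2 * (l == iv)%:R.
Proof.
rewrite (_ : inv1 s = fun y => \sum_i wv s y 0 i * wv s y 0 i); last first.
  by apply/funext => y; exact: inv1_sample.
rewrite partial_sum => [|i]; last exact: smooth_at_mul (smw 0 i) (smw 0 i).
rewrite (bigD1 ord0)//= (partial_mul l (smw 0 ord0) (smw 0 ord0)) partial_wv_sample !wv_sample0 /=.
rewrite big1 => [|i i0]; first by rewrite mulr1 mul1r addr0 mulr2n mulrDl mul1r.
have i0' : (i == 0 :> nat) = false by apply/negbTE.
by rewrite (partial_mul l (smw 0 i) (smw 0 i)) !wv_sample0 i0' mul0r mulr0 addr0.
Qed.

Lemma inv1_v_sample : inv1_v s 0 = 2.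
Proof. by rewrite /inv1_v partial_inv1_sample eqxx mulr1. Qed.

Lemma curl0_sample : curl0 s 0 =
  \matrix_(i, j) (((i == j.+1 :> nat)%:R : R) - (j == i.+1 :> nat)%:R).
Proof.
have -> : curl0 s 0 = curl s 0.
  have x0 : inv1_x s 0 = 0 by apply/rowP => i; rewrite !mxE partial_inv1_sample index_eqE mulr0.
  by rewrite /curl0 x0 mulmx0 trmx0 mul0mx subrr scaler0 subr0.
have E (i j : 'I_m.+1) : partial (ix j) (fun y => wv s y 0 i) 0 = (i == j.+1 :> nat)%:R.
  rewrite partial_wv_sample index_eqE; case: i => -[|i] //= im.
  rewrite index_eqE eqSS -val_eqE /= inordK; last exact: ltnW.
  by rewrite eq_sym.
by apply/matrixP => i j; rewrite !mxE !E.
Qed.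

(** The matrix of curl0 at the origin is tridiagonal, so each step of the iteration reaches exactly
    one further coordinate, with coefficient -1. The Krylov matrix is triangular with diagonal
    entries 1 or -1. *)
Lemma det_krymx_sample : \det (krymx s 0) != 0.
Proof.
have step (e : 'rV[R]_m.+1) (l : 'I_m.+1) : (e *m curl0 s 0) 0 l =
    (\sum_(i < m.+1 | i == l.+1 :> nat) e 0 i) - (\sum_(i < m.+1 | l == i.+1 :> nat) e 0 i).
  rewrite mxE curl0_sample [X in _ = X - _]big_mkcond [X in _ = _ - X]big_mkcond -sumrB.
  by apply: eq_bigr => i _; rewrite mxE mulrBr !mulr_natr !mulrb.
have K j : (forall l : 'I_m.+1, (j < l)%N -> krylov s 0 j 0 l = 0) /\
    forall l : 'I_m.+1, l = j :> nat -> krylov s 0 j 0 l = (-1) ^+ j.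
  elim: j => [|j [IH0 IH1]].
    by split=> l; rewrite /krylov /= wv_sample0; case: (l : nat).
  have kS l : krylov s 0 j.+1 0 l = (krylov s 0 j *m curl0 s 0) 0 l.
    by rewrite /krylov /= hmx_sample ainvE ?det1 ?oner_neq0// invmx1 mulmx1.
  split=> l jl; rewrite kS step.
    rewrite !big1 ?subrr// => i /eqP il; apply: IH0.
      by rewrite -ltnS -il.
    by rewrite il; exact: leqW (ltnW jl).
  rewrite big1 ?sub0r => [|i /eqP il]; last by apply: IH0; rewrite il jl.
  have jm : (j < m.+1)%N by apply: leq_trans (ltn_ord l); rewrite jl.
  rewrite (bigD1 (Ordinal jm)) ?jl//= IH1// big1 ?addr0 ?exprS ?mulN1r// => i /andP[/eqP il].
  by case/eqP; apply: val_inj => /=; case: il => ->.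
rewrite det_trig; last first.
  by apply/is_trig_mxP => i j ij; rewrite mxE; apply: (K i).1.
apply/prodf_neq0 => i _; rewrite mxE (K i).2// expf_neq0// oppr_eq0 oner_neq0.
Qed.

Definition sample_jet : jet_vec R m.+1 k := jet k s 0.

Lemma sample_jet_equation : kundt_equation sample_jet.
Proof.
split.
  rewrite /jet_space /=; have -> : (fun c => jcoord sample_jet (inr (c, multi_index0 m.+1 k))) = s 0.
    by apply/funext => c; rewrite jcoord_jet multi_derive_nil.
  apply/in_FP => w w0; rewrite hmx_sample mulmx1 mxE.
  have sq i : 0 <= w 0 i * w^T i 0 by rewrite [w^T _ _]mxE -expr2 sqr_ge0.
  rewrite lt_neqAle sumr_ge0// andbT eq_sym psumr_eq0//.
  apply: contra w0 => /allP H; apply/eqP/rowP => i; rewrite mxE.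
  have := H i (mem_index_enum i); rewrite [w^T _ _]mxE /= mulf_eq0 orbb => /eqP.
  by [].
move=> i j sigma s0; rewrite jcoord_jet multi_deriveE.
apply: (ipartial_out (l := iv)); first exact: smooth_at_sample.
  by rewrite -has_pred1 has_count count_flat.
by apply: near_all => y; rewrite /= partial_cst.
Qed.

(** The invariants were computed for the section, whereas genericity concerns its Taylor polynomial
    of degree k. The class [agree] shows that they depend on the 2-jet only. *)
Lemma sample_jet_generic : generic_set sample_jet.
Proof.
have b0 : jbase sample_jet = 0 by rewrite jbase_jet.
pose S f := pairf (fun y => s y f) (fun y => jpoly sample_jet y f).
have sj := sjeq_jpoly k (smooth_at_sample 0).
have jS f : jets_in setT (@agree R) (fun=> 0) 2 (S f) by exact: jeq_le k2 (sj f).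
have dS c : setT c -> \det (hmx (csec S c 0)) != 0.
  have d1 : \det (hmx (s 0)) != 0 by rewrite hmx_sample det1 oner_neq0.
  move=> _; case: c; first exact: d1.
  have -> : csec S false 0 = s 0.
    by apply/funext => f; rewrite /csec /S /pairf /= (jeq_val (sj f)).
  exact: d1.
have sf := @sf_agree R; have ex := @agree_ext R.
have vE : inv1_v s 0 = inv1_v (jpoly sample_jet) 0 := inv1_v_in sf ex jS dS.
have v2 : inv1_v s 0 != 0 by rewrite inv1_v_sample pnatr_eq0.
have kE i j : krymx s 0 i j = krymx (jpoly sample_jet) 0 i j.
  apply: (krymx_in sf ex jS dS) => -[] _; first exact: v2.
  by rewrite -[csec S false]/(jpoly sample_jet) -vE.
have mE : krymx s 0 = krymx (jpoly sample_jet) 0 by apply/matrixP.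
split; first split; first exact: sample_jet_equation.1.
  by rewrite b0 -vE.
by rewrite b0 -mE det_krymx_sample.
Qed.

End GenericExample.

(** * Transport of metrics in orders 0 and 1 *)

Section FirstOrder.
Variables (R : realType) (m : nat).
Local Notation n := (1 + m + 1)%N.
Local Notation iu := (iu m).
Local Notation iv := (iv m).
Implicit Types (y : fiber_index m -> R).

(* Householder reflection. *)
Lemma orthogonal_transport p (a b : 'rV[R]_p) : a *m a^T = b *m b^T ->
  exists2 O : 'M[R]_p, O *m O^T = 1%:M & a *m O^T = b.
Proof.
move=> ab; have [<-|neq] := eqVneq a b; first by exists 1%:M; rewrite trmx1 mulmx1.
pose d := a - b; pose s := (d *m d^T) 0 0.
have dd : d *m d^T = s%:M by rewrite /s -mx11_scalar.
have s0 : s != 0.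
  apply: contra_neq neq => /eqP; rewrite /s mxE psumr_eq0 => [/allP H|i _]; last first.
    by rewrite [d^T _ _]mxE -expr2 sqr_ge0.
  apply/rowP => i; have := H i (mem_index_enum i).
  by rewrite [d^T _ _]mxE /= mulf_eq0 orbb !mxE subr_eq0 => /eqP.
have ad : (a *m d^T) 0 0 = 2^-1 * s.
  have two : (2 : R) != 0 by rewrite pnatr_eq0.
  have ba : (b *m a^T) 0 0 = (a *m b^T) 0 0 by rewrite -[b *m a^T]trmxK trmx_mul trmxK mxE.
  have E : s = 2 * (a *m d^T) 0 0.
    rewrite /s /d linearB /= mulmxBl !mulmxBr -ab !mxE.
    rewrite -[\sum_j b 0 j * _]/(_) in ba *; move: ba; rewrite !mxE => ->; ring.
  by rewrite E mulrA mulVf ?mul1r.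
pose O := 1%:M - (2 / s) *: (d^T *m d).
have Ot : O^T = O by rewrite /O linearB /= trmx1 linearZ /= trmx_mul trmxK.
exists O; rewrite Ot.
  rewrite /O mulmxBr !mulmxBl !mul1mx mulmx1 -scalemxAl -scalemxAr scalerA.
  rewrite mulmxA -[d^T *m d *m d^T]mulmxA dd mul_mx_scalar -scalemxAl scalerA.
  have -> : 2 / s * (2 / s) * s = 2 / s + 2 / s by field.
  by rewrite scalerDl opprB !addrA subrK addrK.
rewrite /O mulmxBr mulmx1 -scalemxAr mulmxA.
have -> : a *m d^T = (2^-1 * s)%:M by rewrite -ad -mx11_scalar.
rewrite mul_scalar_mx scalerA (_ : 2 / s * (2^-1 * s) = 1); last by field.
by rewrite scale1r /d opprB addrC subrK.
Qed.

(** With h = L L^T and h' = L' L'^T, the hypothesis says that w and w' have equal Euclidean length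
    in orthonormal frames; an orthogonal T matches them, and N = L' T L^-1. *)
Lemma posdef_transport p (h h' : 'M[R]_p) (w w' : 'rV[R]_p) : posdef h -> posdef h' ->
  w *m ainv h *m w^T = w' *m ainv h' *m w'^T ->
  exists N, [/\ \det N != 0, N *m h *m N^T = h' & w *m N^T = w'].
Proof.
move=> /cholesky[L dL hE] /cholesky[L' dL' hE'].
have uL : L \in unitmx by rewrite unitmxE unitfE.
have uL' : L' \in unitmx by rewrite unitmxE unitfE.
have uLT : L^T \in unitmx by rewrite unitmx_tr.
have uLT' : L'^T \in unitmx by rewrite unitmx_tr.
have hV (M : 'M[R]_p) (v : 'rV[R]_p) : \det M != 0 ->
    v *m ainv (M *m M^T) *m v^T = (v *m invmx M^T) *m (v *m invmx M^T)^T.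
  move=> dM; have uM : M \in unitmx by rewrite unitmxE unitfE.
  have uMT : M^T \in unitmx by rewrite unitmx_tr.
  have := ainv_conj dM (_ : \det (1%:M : 'M[R]_p) != 0); rewrite det1 oner_neq0 mulmx1 => /(_ isT).
  rewrite [ainv 1%:M]ainvE ?det1 ?oner_neq0// invmx1 => E.
  have {}E : ainv (M *m M^T) = invmx M^T *m invmx M.
    by rewrite -[LHS](mulKmx uMT) -[M^T *m _](mulmxK uM) E mul1mx.
  rewrite E trmx_mul trmx_inv trmxK !mulmxA.
  by [].
rewrite hE hE' !hV// => /orthogonal_transport[T TT wT].
have uT : \det T != 0.
  have := congr1 determinant TT; rewrite det_mulmx det_tr det1 => T1.
  by apply/eqP => T0; move: T1; rewrite T0 mul0r => /eqP; rewrite eq_sym oner_eq0.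
exists (L' *m T *m invmx L); split.
- by rewrite !det_mulmx det_inv !mulf_neq0 ?invr_eq0.
- rewrite !trmx_mul trmx_inv !mulmxA mulmxKV// -[_ *m L^T *m _]mulmxA mulmxV// mulmx1.
  by rewrite -[L' *m T *m _]mulmxA TT mulmx1.
- by rewrite !trmx_mul trmx_inv !mulmxA wT -mulmxA mulVmx// mulmx1.
Qed.

(** Jacobians with u_u = v_v = 1 and x_u = 0. Under these W is shifted by v_x = V and H by v_u = c,
    so that N alone has to be chosen with care. *)
Definition kmx (N : 'M[R]_m) (V : 'rV[R]_m) (c : R) : 'M[R]_n :=
  block_mx (block_mx 1 0 0 N) (col_mx c%:M V^T) 0 1.

Lemma kmx_kjac N V c : \det N != 0 -> kjac (kmx N V c).
Proof.
move=> dN; rewrite /kmx /Defs.iu /Defs.iv /ix; split.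
- by move=> i; rewrite /Defs.iu /ix block_mxEul block_mxEdl mxE.
- by rewrite /Defs.iu /Defs.iv block_mxEdl mxE.
- by move=> i; rewrite /ix /Defs.iv block_mxEdl mxE.
- by rewrite /Defs.iu /Defs.iv block_mxEul block_mxEul block_mxEdr !mxE !eqxx mulr1.
- rewrite (_ : xblock _ = N)//.
  by apply/matrixP => i j; rewrite mxE /ix block_mxEul block_mxEdr.
Qed.

Lemma fiber_transport y y' N : \det N != 0 -> N *m hmx y *m N^T = hmx y' ->
  exists J, [/\ kjac J, xblock J = N & J *m gmx y *m J^T = gmx y'].
Proof.
move=> dN NE; pose V := wrow y' - wrow y *m N^T; pose c := y' (fH m) - y (fH m).
have kJ := kmx_kjac V c dN; set J := kmx N V c in kJ.
have Jxx i j : J (ix i) (ix j) = N i j by rewrite /J /kmx /ix block_mxEul block_mxEdr.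
have Juu : J iu iu = 1 by rewrite /J /kmx /Defs.iu block_mxEul block_mxEul mxE eqxx.
have Jux i : J iu (ix i) = 0 by rewrite /J /kmx /Defs.iu /ix block_mxEul block_mxEur mxE.
have Juv : J iu iv = c by rewrite /J /kmx /Defs.iu /Defs.iv block_mxEur col_mxEu mxE eqxx.
have Jxv i : J (ix i) iv = V 0 i by rewrite /J /kmx /Defs.iv /ix block_mxEur col_mxEd mxE.
have xJ : xblock J = N by apply/matrixP => i j; rewrite mxE Jxx.
exists J; split=> //; rewrite -gmx_pull//; congr gmx.
have two : (2 : R) != 0 by rewrite pnatr_eq0.
apply/funext => -[[[]|i]|ij].
- rewrite /= conj_mxE Juu Juv !big1 => [|i _|i _].
  + by rewrite /c /fH; field.
  + by rewrite big1// => j _; rewrite Jux !mul0r.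
  + by rewrite Jux; ring.
- rewrite /= conj_mxE Juu (kjac_xu kJ) Jxv [X in _ + X + _]big1 => [|j _]; last first.
    by rewrite big1// => l _; rewrite Jux !mul0r.
  have -> : \sum_j y (fW j) * (1 * J (ix i) (ix j) + J iu (ix j) * 0) = (wrow y *m N^T) 0 i.
    by rewrite mxE; apply: eq_bigr => j _; rewrite [wrow y 0 j]mxE [N^T _ _]mxE Jxx mul1r mulr0 addr0.
  have -> : V 0 i = y' (fW i) - (wrow y *m N^T) 0 i by rewrite 3!mxE.
  by rewrite /fW; field.
- have := congr1 (fun M : 'M[R]_m => M (val ij).1 (val ij).2) (hmx_pull y kJ).
  by rewrite xJ NE !mxE !fh_sorted.
Qed.

End FirstOrder.

(** * Kundt maps with prescribed derivatives of order at most 2 *)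

Section Realization.
Variables (R : realType) (m k : nat).
Local Notation n := (1 + m + 1)%N.
Local Notation pt := 'rV[R]_(1 + m + 1).
Local Notation iu := (iu m).
Local Notation iv := (iv m).
Variables (p : jet_vec R m k) (b : pt) (J : 'M[R]_n) (Psi : 'I_n -> 'I_n -> 'I_n -> R).
Hypothesis kJ : kjac J.
(** Symmetry, and then what the Kundt form imposes on second derivatives: the new u depends on u
    alone, the new x not on v, and v_v on u alone. The last relation is the u-derivative of v_v = 1
    / u_u. *)
Hypothesis PsiC : forall q i l, Psi q i l = Psi i q l.
Hypothesis Psi_u : forall q i, ~~ ((q == iu) && (i == iu)) -> Psi q i iu = 0.
Hypothesis Psi_vx : forall q i, Psi iv q (ix i) = 0.
Hypothesis Psi_vv : forall q, q != iu -> Psi iv q iv = 0.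
Hypothesis Psi_vuv : Psi iv iu iv = - (J iv iv * J iv iv) * Psi iu iu iu.

Definition jet2_coef l (tau : multi_index m k.+1) : R :=
  match flat tau with
  | [::] => b 0 l
  | [:: i] => J i l
  | [:: q; i] => Psi q i l
  | _ => 0
  end.

Definition jet2_param : 'rV[R]_#|{: param m k}| := coef_of jet2_coef.
Local Notation gam := jet2_param.
Local Notation psi := (param_map (jbase p) jet2_param).

Lemma coef_jet2 l tau : coef gam l tau = if supported (vars l) tau then jet2_coef l tau else 0.
Proof. by case: ifP => st; [exact: coef_ofK|rewrite coef_out// st]. Qed.

Lemma flat_mi_small (ls : seq 'I_n) : (size ls <= 1)%N -> flat (mi k.+1 ls) = ls.
Proof.
move=> l1; apply: perm_small_eq => //; rewrite perm_sym; apply: perm_flat_mi.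
exact: leq_trans l1 _.
Qed.

Lemma supported_mi (T : pred 'I_n) (ls : seq 'I_n) : (size ls <= k.+1)%N -> supported T (mi k.+1 ls) = all T ls.
Proof.
move=> lsk; apply/forallP/allP => [H l lls|H l].
  by have := H l; rewrite expo_mi// -leqn0 leqNgt -has_count has_pred1 lls.
by have [/H ->|] := boolP (l \in ls); rewrite ?orbT// expo_mi// -has_pred1 has_count -leqNgt leqn0 => ->.
Qed.

Lemma pbase_jet2 : pbase gam = b.
Proof.
apply/rowP => l; rewrite mxE coef_jet2 supported_tau0 /jet2_coef.
by rewrite /tau0 flat_mi_small.
Qed.

Lemma coef_jet2_1 l i : coef gam l (mi k.+1 [:: i]) = if vars l i then J i l else 0.
Proof.
rewrite coef_jet2 supported_mi//= andbT /jet2_coef.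
by rewrite flat_mi_small.
Qed.

Lemma coef_jet2_2 l q i : (1 <= k)%N ->
  coef gam l (mi k.+1 [:: q; i]) = if vars l q && vars l i then Psi q i l else 0.
Proof.
move=> k1; rewrite coef_jet2 supported_mi//= andbT /jet2_coef.
have := perm_flat_mi (ls := [:: q; i]) (k := k.+1) (k1 : (size [:: q; i] <= k.+1)%N).
move=> pe; have sz := perm_size pe; case: (flat _) pe sz => [//|x [//|y [|//]]] pe _.
have : [:: q; i] = [:: x; y] \/ [:: q; i] = [:: y; x].
  have := perm_mem pe x; rewrite !inE eqxx /= => /orP[/eqP xq|/eqP xi].
    move: pe; rewrite xq perm_cons => pe'.
    by left; congr (_ :: _); exact: perm_small_eq pe'.
  have pe' : perm_eq [:: i; q] [:: x; y] by rewrite (perm_trans _ pe)// (perm_catC [:: i] [:: q]).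
  move: pe'; rewrite xi perm_cons => pe'.
  by right; have [->] := perm_small_eq (isT : (size [:: y] <= 1)%N) pe'.
by case=> -[-> ->] //; rewrite PsiC.
Qed.

Lemma Gset_jet2 : Gset gam.
Proof.
split; first by rewrite coef_jet2_1 /vars !eqxx; apply/eqP => u0; have := kjac_uv kJ;
  rewrite u0 mul0r => /eqP; rewrite eq_sym oner_eq0.
rewrite (_ : (\matrix_(i, j) _) = xblock J); first exact: kjac_det kJ.
by apply/matrixP => i j; rewrite !mxE coef_jet2_1 /vars !index_eqE.
Qed.

Lemma jac_jet2 : jac psi b = J.
Proof.
have kj : kjac (jac psi b).
  by rewrite -pbase_jet2; exact: kmap_kjac (param_map_kmap (jbase p) Gset_jet2).
have E q l : q != iv -> jac psi b q l = if vars l q then J q l else 0.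
  move=> qv; rewrite mxE -coef_jet2_1 -pbase_jet2.
  rewrite -[partial q _ _]/(ipartial [:: q] _ _) (ipartial_param_map _ _ Gset_jet2)//.
    by rewrite /pcoef mi1_neq0.
  by rewrite inE eq_sym.
have Euu : jac psi b iu iu = J iu iu by rewrite E ?index_eqE// /vars !eqxx.
have uu0 : J iu iu != 0.
  by apply/eqP => u0; have := kjac_uv kJ; rewrite u0 mul0r => /eqP; rewrite eq_sym oner_eq0.
apply/matrixP => q l; case: (indexP q) => [|i|].
- by rewrite E ?index_eqE// /vars !index_eqE; case: ifP => //; case: ifP.
- rewrite E ?index_eqE// /vars !index_eqE; case: ifP => // /eqP ->.
  by rewrite (kjac_xu kJ).
- case: (indexP l) => [|j|].
  + by rewrite (kjac_vu kj) (kjac_vu kJ).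
  + by rewrite (kjac_vx kj) (kjac_vx kJ).
  + by apply: (mulfI uu0); rewrite (kjac_uv kJ) -Euu (kjac_uv kj).
Qed.

(** Derivatives along u and x are coefficients by construction. Those involving v are not
    parameters: for the map they follow from its Kundt form, and they agree with Psi by the
    constraints. *)
Lemma second_jet2 q i l : (1 <= k)%N -> kundt_equation p ->
  partial q (partial i (psi l)) b = Psi q i l.
Proof.
move=> k1 Ep; have rg := reg_param_map Ep Gset_jet2; rewrite pbase_jet2 in rg.
have sp l' : smooth_at b (psi l') := reg_psi rg l'.
have E q' i' l' : q' != iv -> i' != iv -> partial q' (partial i' (psi l')) b = Psi q' i' l'.
  move=> qv iv'; rewrite -[LHS]/(ipartial [:: q'; i'] _ _) -pbase_jet2.
  rewrite (ipartial_param_map _ _ Gset_jet2)//; last by rewrite !inE !(eq_sym iv) negb_or qv.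
  rewrite /pcoef; case: eqP => [/(congr1 (fun t => expo t q'))|_].
    by rewrite !expo_mi//= eqxx.
  rewrite coef_jet2_2// /vars; case: (eqVneq l' iu) => [->|lu]; last by rewrite qv iv'.
  by case: ifP => // /negbT qi; rewrite Psi_u.
have jE k' l' : (fun y => jac psi y k' l') = partial k' (psi l').
  by apply/funext => y; rewrite mxE.
have V i' l' : partial iv (partial i' (psi l')) b = Psi iv i' l'.
  have [/andP[/eqP -> /eqP ->]|niv] := boolP ((i' == iu) && (l' == iv)).
    rewrite partial_comm// -jE Psi_vuv -(E iu iu iu) ?index_eqE// -!jE.
    have uu0 : jac psi b iu iu != 0.
      by rewrite jac_jet2; apply/eqP => u0; have := kjac_uv kJ;
        rewrite u0 mul0r => /eqP; rewrite eq_sym oner_eq0.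
    have su : smooth_at b (fun y => jac psi y iu iu) by rewrite jE; exact: smooth_at_partial.
    have near_eq : {near b, (fun y => jac psi y iv iv) =1 fun y => (jac psi y iu iu)^-1}.
      apply: filterS2 (reg_jac rg) (smooth_at_neq0 su uu0) => z /kjac_uv uv z0.
      by apply: (mulfI z0); rewrite uv mulfV.
    rewrite (nbhs_singleton (partial_eq iu near_eq)) partial_inv//.
    by rewrite -(nbhs_singleton near_eq) jac_jet2 mulN1r.
  rewrite -jE (partial_v_jac rg niv).
  case: (indexP l') niv => [_|j _|]; first by rewrite Psi_u// index_eqE.
    by rewrite Psi_vx.
  by rewrite eqxx andbT => iu'; rewrite Psi_vv.
have [->|qv] := eqVneq q iv; first exact: V.
have [->|iv'] := eqVneq i iv; last exact: E.
by rewrite partial_comm// V PsiC.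
Qed.

End Realization.

(** * Orbits in orders 0 and 1 *)

Section FirstOrderOrbits.
Variables (R : realType) (m : nat).
Local Notation n := (1 + m + 1)%N.
Local Notation pt := 'rV[R]_(1 + m + 1).
Local Notation iu := (iu m).
Local Notation iv := (iv m).
Implicit Types (s : pt -> fiber_index m -> R) (y : pt).

Definition dmx p q l (A : pt -> 'M[R]_(p, q)) y : 'M[R]_(p, q) :=
  \matrix_(i, j) partial l (fun y => A y i j) y.

Lemma dmx_mul p q r l (A : pt -> 'M[R]_(p, q)) (B : pt -> 'M[R]_(q, r)) y :
  in_mx (smooth_at y) A -> in_mx (smooth_at y) B ->
  dmx l (fun y => A y *m B y) y = dmx l A y *m B y + A y *m dmx l B y.
Proof.
move=> sA sB; apply/matrixP => i j; rewrite !mxE.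
rewrite (_ : (fun y => _) = fun y => \sum_a A y i a * B y a j); last first.
  by apply/funext => z; rewrite mxE.
rewrite partial_sum => [|a]; last exact: smooth_at_mul (sA i a) (sB a j).
rewrite -big_split; apply: eq_bigr => a _.
by rewrite (partial_mul l (sA i a) (sB a j)) !mxE.
Qed.

Lemma dmx_tr p q l (A : pt -> 'M[R]_(p, q)) y : dmx l (fun y => (A y)^T) y = (dmx l A y)^T.
Proof.
apply/matrixP => i j; rewrite !mxE; congr (partial _ _ _).
by apply/funext => z; rewrite mxE.
Qed.

Lemma dmx_eq p q l (A B : pt -> 'M[R]_(p, q)) y : {near y, A =1 B} -> dmx l A y = dmx l B y.
Proof.
move=> AB; apply/matrixP => i j; rewrite !mxE.
by apply: (nbhs_singleton (partial_eq l _)); apply: filterS AB => z ->.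
Qed.

Definition dgmx s l y := dmx l (fun y => gmx (s y)) y.

Lemma dgmx_sym s l y i j : dgmx s l y i j = dgmx s l y j i.
Proof.
by rewrite !mxE; congr (partial _ _ _); apply/funext => z; rewrite -[in LHS]gmx_sym mxE.
Qed.

Lemma dgmx_v s l y j : dgmx s l y iv j = 0.
Proof.
have E c : (forall y, gmx (s y) iv j = c) -> dgmx s l y iv j = 0.
  move=> H; rewrite mxE (_ : (fun y => _) = fun=> c); first exact: partial_cst.
  by apply/funext => z; exact: H.
case: (indexP j) E => [|i|] E.
- by apply: (E 2^-1) => z; rewrite gmxE.
- by apply: (E 0) => z; rewrite gmxE.
- by apply: (E 0) => z; rewrite gmxE.
Qed.

Lemma dgmx_xx s l y i j : dgmx s l y (ix i) (ix j) = partial l (fun y => s y (fh i j)) y.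
Proof. by rewrite mxE; congr (partial _ _ _); apply/funext => z; rewrite gmxE. Qed.

Lemma dgmx_vxu s y i : (forall c, smooth_at y (fun y => s y c)) ->
  dgmx s iv y (ix i) iu = 2^-1 * wv s y 0 i.
Proof.
move=> ss; rewrite mxE (_ : (fun y => _) = fun y => 2^-1 * s y (fW i)); last first.
  by apply/funext => z; rewrite gmxE.
by rewrite (partial_mul iv (smooth_at_cst y _) (ss _)) partial_cst mul0r add0r mxE.
Qed.

Lemma partial_comps s l y c : (forall c, smooth_at y (fun y => s y c)) ->
  partial l (fun y => s y c) y = comps (dgmx s l y) c.
Proof.
move=> ss; have E : {near y, (fun y => s y c) =1 fun y => comps (gmx (s y)) c}.
  by apply: near_all => z; rewrite compsK.
case: c E => [[[]|i]|ij] E; rewrite (nbhs_singleton (partial_eq l E)) /=.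
- by rewrite mxE.
- have sg : smooth_at y (fun y => gmx (s y) iu (ix i)).
    rewrite (_ : (fun y => _) = fun y => 2^-1 * s y (fW i)); last by apply/funext => z; rewrite gmxE.
    exact: smooth_at_mul (smooth_at_cst y _) (ss _).
  by rewrite (partial_mul l (smooth_at_cst y _) sg) partial_cst mul0r add0r mxE.
- by rewrite mxE.
Qed.

(* The second derivatives Psi of the transformation are determined by the first derivatives
   of the two metrics as Christoffel symbols are; that they satisfy the constraints on the
   2-jets of Kundt transformations follows from kundt_equation and from wJ. *)
Section ChristoffelSolution.
Variables (p q : jet_vec R m 1) (J : 'M[R]_n).
Hypothesis Ep : kundt_equation p.
Hypothesis Eq : kundt_equation q.
Hypothesis kJ : kjac J.
Local Notation a := (jbase p).
Local Notation b := (jbase q).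
Local Notation Gp := (gmx (jpoly p a)).
Hypothesis JE : J *m Gp *m J^T = gmx (jpoly q b).
Hypothesis wJ : wv (jpoly p) a *m (xblock J)^T = wv (jpoly q) b.

Let C l : 'M[R]_n := \sum_c J l c *: dgmx (jpoly p) c a.
Let T l : 'M[R]_n := dgmx (jpoly q) l b - J *m C l *m J^T.
Let E l : 'M[R]_n := \matrix_(k, j) (2^-1 * (T l k j + T k l j - T j l k)).
Let M : 'M[R]_n := Gp *m J^T.
Let Psi l k c : R := (E l *m invmx M) k c.

Let uM : M \in unitmx.
Proof.
rewrite unitmxE unitfE det_mulmx det_tr mulf_neq0//; last exact: det_kjac.
by apply: det_gmx; apply: in_F_det; apply/jet_spaceE; case: Ep.
Qed.

Let C_E l i j : C l i j = \sum_c J l c * dgmx (jpoly p) c a i j.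
Proof. by rewrite summxE; apply: eq_bigr => c _; rewrite mxE. Qed.

Let T_E l k j : T l k j = dgmx (jpoly q) l b k j - (J *m C l *m J^T) k j.
Proof. by rewrite [LHS]mxE; congr (_ + _); rewrite [LHS]mxE. Qed.

Let E_E l k j : E l k j = 2^-1 * (T l k j + T k l j - T j l k).
Proof. by rewrite [LHS]mxE. Qed.

Let M_E i j : M i j = \sum_l Gp i l * J j l.
Proof. by rewrite [LHS]mxE; apply: eq_bigr => l _; rewrite [J^T _ _]mxE. Qed.

Let uu0 : J iu iu != 0.
Proof.
by apply/eqP => u0; have := kjac_uv kJ; rewrite u0 mul0r => /eqP; rewrite eq_sym oner_eq0.
Qed.

Let vv0 : J iv iv != 0.
Proof.
by apply/eqP => v0; have := kjac_uv kJ; rewrite v0 mulr0 => /eqP; rewrite eq_sym oner_eq0.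
Qed.

Let Jv k : J iv k = if k == iv then J iv iv else 0.
Proof.
by case: (indexP k) => [|i|]; rewrite ?index_eqE ?(kjac_vu kJ) ?(kjac_vx kJ).
Qed.

Let C_sym l i j : C l i j = C l j i.
Proof.
by rewrite !C_E; apply: eq_bigr => c _; rewrite dgmx_sym.
Qed.

Let C_v l j : C l iv j = 0.
Proof. by rewrite C_E big1// => c _; rewrite dgmx_v mulr0. Qed.

Let conjE (A : 'M[R]_n) k j :
  (J *m A *m J^T) k j = \sum_i J k i * \sum_l A i l * J j l.
Proof.
rewrite -mulmxA mxE; apply: eq_bigr => i _; congr (_ * _).
by rewrite mxE; apply: eq_bigr => l _; rewrite mxE.
Qed.

Let T_sym l k j : T l k j = T l j k.
Proof.
rewrite !T_E dgmx_sym; congr (_ - _); rewrite !conjE; under eq_bigr do rewrite mulr_sumr.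
rewrite exchange_big; apply: eq_bigr => i _ /=; rewrite mulr_sumr.
by apply: eq_bigr => i' _; rewrite C_sym; ring.
Qed.

Let T_v l j : T l iv j = 0.
Proof.
rewrite T_E dgmx_v add0r conjE big1 ?oppr0// => i _.
by rewrite Jv; case: eqP => [->|_]; rewrite ?mul0r// big1 ?mulr0// => c _; rewrite C_v mul0r.
Qed.

Let C_vE i j : C iv i j = J iv iv * dgmx (jpoly p) iv a i j.
Proof.
rewrite C_E (bigD1 iv)//= big1 ?addr0// => c cv.
by rewrite Jv (negbTE cv) mul0r.
Qed.

Let conj_x (A : 'M[R]_n) k j : (forall l, A iv l = 0) -> (forall l, A l iv = 0) ->
  (J *m A *m J^T) (ix k) j =
  \sum_i J (ix k) (ix i) * (A (ix i) iu * J j iu + \sum_l A (ix i) (ix l) * J j (ix l)).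
Proof.
move=> Av Av'; rewrite conjE sum_index (kjac_xu kJ) mul0r add0r [X in _ * X]big1 ?mulr0 ?addr0.
  by apply: eq_bigr => i _; congr (_ * _); rewrite sum_index Av' mul0r addr0.
by move=> l _; rewrite Av mul0r.
Qed.

Let Cv_v l : C iv l iv = 0. Proof. by rewrite C_sym C_v. Qed.

Let T_vxx k j : T iv (ix k) (ix j) = 0.
Proof.
rewrite T_E dgmx_xx kundt_jpoly_h// add0r conj_x; [|exact: C_v|exact: Cv_v].
rewrite big1 ?oppr0// => i _; rewrite (kjac_xu kJ) mulr0 add0r big1 ?mulr0// => l _.
by rewrite C_vE dgmx_xx kundt_jpoly_h// mulr0 mul0r.
Qed.

Let smp y c : smooth_at y (fun y => jpoly p y c) := smooth_at_jpoly p y c.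
Let smq y c : smooth_at y (fun y => jpoly q y c) := smooth_at_jpoly q y c.

(** The entry is half the difference between w at q and the transported w at p, the factor u_u v_v
    being 1; [wJ] makes it vanish. *)
Let T_vxu k : T iv (ix k) iu = 0.
Proof.
rewrite T_E (dgmx_vxu _ (smq b)) -wJ conj_x; [|exact: C_v|exact: Cv_v].
rewrite [(_ *m _) 0 k]mxE mulr_sumr -sumrB big1// => i _.
rewrite big1 => [|l _]; last by rewrite C_vE dgmx_xx kundt_jpoly_h// mulr0 mul0r.
rewrite C_vE (dgmx_vxu _ (smp a)) [(xblock J)^T _ _]mxE [xblock J _ _]mxE.
have -> : J (ix k) (ix i) * (J iv iv * (2^-1 * wv (jpoly p) a 0 i) * J iu iu + 0) =
  (J iu iu * J iv iv) * (2^-1 * (wv (jpoly p) a 0 i * J (ix k) (ix i))) by ring.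
by rewrite (kjac_uv kJ) mul1r subrr.
Qed.

Let E_v k j : E iv k j = 2^-1 * T iv k j.
Proof. by rewrite E_E !T_v addr0 subr0. Qed.

Let T_v0 k j : ~~ ((k == iu) && (j == iu)) -> T iv k j = 0.
Proof.
by case: (indexP k) => [|k'|]; case: (indexP j) => [|j'|]; rewrite ?eqxx// => _;
  rewrite ?(T_vxu, T_vxx, T_v)// T_sym ?(T_vxu, T_v).
Qed.

Let EC l k j : E l k j = E k l j.
Proof. by rewrite !E_E (T_sym j l k) [T l k j + _]addrC. Qed.

Let PsiC l k c : Psi l k c = Psi k l c.
Proof.
by rewrite /Psi [LHS]mxE [RHS]mxE; apply: eq_bigr => i _; rewrite EC.
Qed.

Let PsiM l : (\matrix_(k, c) Psi l k c) *m M = E l.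
Proof.
have -> : \matrix_(k, c) Psi l k c = E l *m invmx M by apply/matrixP => k c; rewrite [LHS]mxE.
by rewrite (mulmxKV uM).
Qed.

Let Mv i : M i iv = 2^-1 * J iv iv * (i == iu)%:R.
Proof.
rewrite M_E (bigD1 iv)//= big1 ?addr0 => [|l lv]; last by rewrite Jv (negbTE lv) mulr0.
case: (indexP i) => [|j|]; rewrite gmxE ?index_eqE ?mulr1 ?mul0r ?mulr0//.
Qed.

(** Column v of [M] is nonzero in row u only, so column v of the equation Psi M = E isolates the
    component u of Psi. *)
Let Psi_u l k : ~~ ((l == iu) && (k == iu)) -> Psi l k iu = 0.
Proof.
move=> lk; have := congr1 (fun A : 'M[R]_n => A k iv) (PsiM l).
rewrite [X in X = _ -> _]mxE (bigD1 iu)//= big1 ?addr0 => [|i iu']; last by rewrite Mv (negbTE iu') !mulr0.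
rewrite Mv eqxx mulr1 [(\matrix_(_, _) _) _ _]mxE => /esym.
rewrite E_E (T_sym l k) (T_sym k l) !T_v addr0 sub0r T_v0// oppr0 mulr0 => /esym/eqP.
have c0 : 2^-1 * J iv iv != 0 by rewrite mulf_neq0 ?invr_eq0 ?pnatr_eq0.
by rewrite mulf_eq0 (negbTE c0) orbF => /eqP.
Qed.

Let Psi_vE k c : Psi iv k c = if (k == iu) && (c == iv) then T iv iu iu * J iv iv else 0.
Proof.
(* The expected solution is checked by multiplying with [M], whose inverse is never computed. *)
pose P : 'M[R]_n := \matrix_(k, c) if (k == iu) && (c == iv) then T iv iu iu * J iv iv else 0.
suff : P = E iv *m invmx M by move/(congr1 (fun A : 'M[R]_n => A k c)); rewrite [P _ _]mxE => ->.
apply: (can_inj (mulmxK uM)); rewrite (mulmxKV uM); apply/matrixP => i j.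
rewrite mxE E_v (bigD1 iv)//= big1 => [|l lv]; last by rewrite [P _ _]mxE (negbTE lv) andbF mul0r.
rewrite [P _ _]mxE eqxx andbT addr0.
have -> : M iv j = 2^-1 * J j iu.
  rewrite M_E (bigD1 iu)//= gmxE big1 ?addr0// => l lu.
  by case: (indexP l) lu => [|l'|]; rewrite ?eqxx// gmxE mul0r.
have [->|iu'] := eqVneq i iu; last by rewrite mul0r T_v0 ?(negbTE iu')// mulr0.
case: (indexP j) => [|j'|].
- have -> : T iv iu iu * J iv iv * (2^-1 * J iu iu) = (J iu iu * J iv iv) * (2^-1 * T iv iu iu) by ring.
  by rewrite (kjac_uv kJ) mul1r.
- by rewrite (kjac_xu kJ) !mulr0 T_v0 ?index_eqE ?andbF// mulr0.
- by rewrite (kjac_vu kJ) !mulr0 T_v0 ?index_eqE ?andbF// mulr0.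
Qed.

Let Psi_uuu : Psi iu iu iu = - (T iv iu iu * J iu iu).
Proof.
have := congr1 (fun A : 'M[R]_n => A iu iv) (PsiM iu).
rewrite [X in X = _ -> _]mxE (bigD1 iu)//= big1 ?addr0 => [|i iu']; last by rewrite Mv (negbTE iu') !mulr0.
rewrite Mv eqxx mulr1 [(\matrix_(_, _) _) _ _]mxE E_E.
rewrite (T_sym iu iu) !T_v addr0 sub0r => H.
have two : (2 : R) != 0 by rewrite pnatr_eq0.
apply: (mulIf vv0); apply: (mulfI (invr_neq0 two)).
have -> : 2^-1 * (Psi iu iu iu * J iv iv) = Psi iu iu iu * (2^-1 * J iv iv) by ring.
rewrite H mulNr -mulrA (kjac_uv kJ) mulr1.
by [].
Qed.

(** Both sides are multiples of the one entry of [T iv] that may be nonzero, and they match because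
    u_u v_v = 1. *)
Let Psi_vuv : Psi iv iu iv = - (J iv iv * J iv iv) * Psi iu iu iu.
Proof.
rewrite Psi_vE !eqxx Psi_uuu /=.
have -> : - (J iv iv * J iv iv) * - (T iv iu iu * J iu iu) = (J iu iu * J iv iv) * (T iv iu iu * J iv iv) by ring.
by rewrite (kjac_uv kJ) mul1r.
Qed.

Let Psi_vx l i : Psi iv l (ix i) = 0.
Proof. by rewrite Psi_vE index_eqE andbF. Qed.

Let Psi_vv l : l != iu -> Psi iv l iv = 0.
Proof. by move=> lu; rewrite Psi_vE (negbTE lu). Qed.

Let gam := jet2_param 1 b J Psi.
Let psi := param_map a gam.

Let Gg : Gset gam.
Proof. exact: Gset_jet2. Qed.

Let bE : pbase gam = b.
Proof. exact: pbase_jet2. Qed.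

Let rg : reg psi (jpoly p) b.
Proof. by have := reg_param_map Ep Gg; rewrite bE. Qed.

Let jacE : jac psi b = J.
Proof. exact: jac_jet2. Qed.

Let psib : row_fun psi b = a.
Proof. by rewrite -bE; exact: param_map_base. Qed.

Let tsecb : tsec p gam b = jpoly q b.
Proof. by rewrite /tsec /pull psib jacE JE compsK. Qed.

(** By the product rule the left side is E + E^T + J C J^T at index l. The Koszul combination was
    chosen so that E + E^T = T, and T was defined as the difference to be compensated. *)
Let dtsec l : dgmx (tsec p gam) l b = dgmx (jpoly q) l b.
Proof.
have near_gmx : {near b, (fun y => gmx (tsec p gam y)) =1
    fun y => jac psi y *m gmx (jpoly p (row_fun psi y)) *m (jac psi y)^T}.
  by apply: filterS (reg_near rg) => y ry; rewrite /tsec /pull gmx_pull//; exact: nbhs_singleton (reg_jac ry).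
have sJ : in_mx (smooth_at b) (jac psi).
  move=> i j; rewrite (_ : (fun y => _) = partial i (psi j)); last by apply/funext => y; rewrite mxE.
  exact: smooth_at_partial (reg_psi rg j).
have sGa : in_mx (smooth_at a) (fun y => gmx (jpoly p y)).
  exact: in_mx_gmx (sf_smooth_at a) (smp a).
have sG : in_mx (smooth_at b) (fun y => gmx (jpoly p (row_fun psi y))).
  move=> i j; apply: (@smooth_at_comp _ _ psi (fun y => gmx (jpoly p y) i j) b (reg_psi rg)).
  by rewrite psib; exact: sGa.
have sJT := in_mx_tr sJ.
have sJG := in_mx_mul (sf_smooth_at b) sJ sG.
have dJ : dmx l (jac psi) b = \matrix_(k, c) Psi l k c.
  apply/matrixP => k c; rewrite !mxE -(@second_jet2 _ _ 1 p b J Psi)//.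
  by congr (partial _ _ _); apply/funext => y; rewrite mxE.
have dG : dmx l (fun y => gmx (jpoly p (row_fun psi y))) b = C l.
  apply/matrixP => i j; rewrite mxE.
  have := @partial_psi _ _ psi (jpoly p) b (fun y => gmx (jpoly p y) i j) l rg.
  rewrite psib => ->; last exact: sGa.
  rewrite C_E; apply: eq_bigr => c _; rewrite jacE.
  by rewrite [dgmx _ _ _ _ _]mxE mulrC.
rewrite /dgmx (dmx_eq l near_gmx) (dmx_mul l sJG sJT) (dmx_mul l sJ sG) dmx_tr dJ dG jacE psib.
set P := \matrix_(k, c) _.
have -> : J *m Gp *m P^T = (P *m M)^T.
  by rewrite /M trmx_mul [(Gp *m _)^T]trmx_mul trmxK gmx_sym.
rewrite mulmxDl -[P *m Gp *m J^T]mulmxA -/M PsiM.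
rewrite -/(dgmx (jpoly q) l b).
have -> : dgmx (jpoly q) l b = T l + J *m C l *m J^T by rewrite /T subrK.
rewrite addrAC; congr (_ + _).
have two : (2 : R) != 0 by rewrite pnatr_eq0.
apply/matrixP => k j; by rewrite [LHS]mxE [(E l)^T _ _]mxE !E_E (T_sym l j k); field.
Qed.

Lemma christoffel_orbit : kundt_orbit p q.
Proof.
rewrite kundt_orbit_tjet; last by case: Ep.
exists gam => //; apply: jcoord_inj => -[l|[c sigma]].
  by rewrite jcoord_jet_base bE mxE.
rewrite jcoord_jet multi_deriveE bE -[in RHS](mi_flat sigma) -ipartial_jpoly ?size_flat//.
have := size_flat sigma; case: (flat sigma) => [|l [|//]] _ /=; first by rewrite tsecb.
rewrite (partial_comps _ _ (smq b)) -dtsec -partial_comps// => c'.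
apply: smooth_at_pull => [i|c'']; first exact: (reg_psi rg).
exact: smooth_at_jpoly.
Qed.

End ChristoffelSolution.

Lemma kundt_orbit1 (p q : jet_vec R m 1) : kundt_equation p -> kundt_equation q ->
  inv1 (jpoly p) (jbase p) = inv1 (jpoly q) (jbase q) -> kundt_orbit p q.
Proof.
move=> Ep Eq IE.
have /jet_spaceE/in_F_posdef hp := Ep.1; have /jet_spaceE/in_F_posdef hq := Eq.1.
have [|N [dN NE wE]] := posdef_transport (w := wv (jpoly p) (jbase p))
    (w' := wv (jpoly q) (jbase q)) hp hq.
  by rewrite [LHS]mx11_scalar [RHS]mx11_scalar; congr (_%:M).
have [J [kJ xJ JE]] := fiber_transport dN NE.
by apply: (christoffel_orbit Ep Eq kJ JE); rewrite xJ.
Qed.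

(** Only h has to be transported, so the covectors are taken to be 0; likewise second derivatives do
    not enter, and Psi is 0. *)
Lemma kundt_orbit0 (p q : jet_vec R m 0) : jet_space p -> jet_space q -> kundt_orbit p q.
Proof.
move=> Fp Fq.
have /jet_spaceE/in_F_posdef hp := Fp; have /jet_spaceE/in_F_posdef hq := Fq.
have [|N [dN NE _]] := posdef_transport (w := 0) (w' := 0) hp hq; first by rewrite !mul0mx.
have [J [kJ _ JE]] := fiber_transport dN NE.
pose gam := jet2_param 0 (jbase q) J (fun _ _ _ => 0).
have Gg : Gset gam by exact: Gset_jet2.
have bE : pbase gam = jbase q by exact: pbase_jet2.
rewrite kundt_orbit_tjet//; exists gam => //; apply: jcoord_inj => -[l|[c sigma]].
  by rewrite jcoord_jet_base bE mxE.
rewrite jcoord_jet multi_deriveE bE -[in RHS](mi_flat sigma) -ipartial_jpoly ?size_flat//.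
have := size_flat sigma; rewrite leqn0 size_eq0 => /eqP -> /=.
rewrite /tsec /pull -bE param_map_base bE jac_jet2// JE compsK.
by [].
Qed.

End FirstOrderOrbits.

(** * Level sets of the first-order invariant *)

Section FirstOrderInvariant.
Variables (R : realType) (m : nat).
Local Notation n := (1 + m.+1 + 1)%N.
Local Notation pt := 'rV[R]_(1 + m.+1 + 1).
Local Notation iv := (iv m.+1).
Local Notation index := (jet_index m.+1 1).
Local Notation vec := (jet_vec R m.+1 1).
Local Notation mi0 := (multi_index0 m.+1 1).
Local Notation miv := (mi 1 [:: iv]).
Implicit Types (p q : vec).

Definition hjet p : 'M[R]_m.+1 := hmx (fun f => jcoord p (inr (f, mi0))).
Definition wjet p : 'rV[R]_m.+1 := \row_i jcoord p (inr (fW i, miv)).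
Definition inv_jet p : R := (wjet p *m ainv (hjet p) *m (wjet p)^T) 0 0.

Lemma inv_jetE p : inv_jet p = inv1 (jpoly p) (jbase p).
Proof.
rewrite /inv_jet /inv1; have -> : wv (jpoly p) (jbase p) = wjet p.
  apply/rowP => i; rewrite !mxE.
  by rewrite -[partial _ _ _]/(ipartial [:: iv] (fun y => jpoly p y (fW i)) (jbase p)) ipartial_jpoly.
have -> // : hmx (jpoly p (jbase p)) = hjet p.
by apply/matrixP => i j; rewrite !mxE jpoly_base.
Qed.

Lemma inv1_jet (s : pt -> fiber_index m.+1 -> R) a : (forall c, smooth_at a (fun y => s y c)) ->
  inv1 (jpoly (jet 1 s a)) a = inv1 s a.
Proof.
move=> ss; have sj := sjeq_jpoly 1 ss; rewrite /inv1.
have -> : wv (jpoly (jet 1 s a)) a = wv s a.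
  by apply/rowP => i; rewrite !mxE (jeq_val (jeq_partial iv (sj (fW i)))).
have -> // : jpoly (jet 1 s a) a = s a.
by apply/funext => c; rewrite (jeq_val (sj c)).
Qed.

Lemma inv_jet_orbit p q : kundt_equation p -> kundt_orbit p q -> inv_jet q = inv_jet p.
Proof.
move=> Ep; rewrite kundt_orbit_tjet; last by case: Ep.
move=> [gam Gg <-]; have rg := reg_param_map Ep Gg.
rewrite !inv_jetE jbase_jet inv1_jet; last first.
  by apply: smooth_at_pull => [i|c']; [exact: (reg_psi rg)|exact: smooth_at_jpoly].
by rewrite (inv1_pull rg) param_map_base.
Qed.

Lemma hjet_posdef p : jet_space p -> posdef (hjet p).
Proof. by move=> /in_F_posdef. Qed.

Lemma posdef_det l (h : 'M[R]_l) : posdef h -> \det h != 0.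
Proof. by move=> /cholesky[L dL ->]; rewrite det_mulmx det_tr mulf_neq0. Qed.

Lemma posdef_inv_gt0 l (h : 'M[R]_l) (w : 'rV[R]_l) : posdef h -> w != 0 ->
  0 < (w *m ainv h *m w^T) 0 0.
Proof.
move=> ph w0; have dh := posdef_det ph; have [hs hp] := ph.
have uh : h \in unitmx by rewrite unitmxE unitfE.
have y0 : w *m invmx h != 0.
  by apply: contra w0 => /eqP E; rewrite -[w](mulmxKV uh) E mul0mx.
by have := hp _ y0; rewrite /qf mulmxKV// trmx_mul trmx_inv hs mulmxA ainvE.
Qed.

(* A point of the level set is given by h0 = h / h_00, y = w h^-1 and the other coordinates:
   h_00 is recovered from h_00 (y h0 y^T) = c. *)
Section LevelSet.
Variable c : R.
Hypothesis c0 : 0 < c.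

Definition level_set : set vec := [set q | kundt_equation q /\ inv_jet q = c].

Definition level_coord (e : index) : bool := free_coord e && (e != inr (fh ord0 ord0, mi0)).
Local Notation V := 'rV[R]_#|{: {e : index | level_coord e}}|.
Implicit Types (x : V).

Let h0 x : 'M[R]_m.+1 := \matrix_(i, j)
  if (i == ord0) && (j == ord0) then 1 else slot x (inr (fh i j, mi0)).
Let y x : 'rV[R]_m.+1 := \row_i slot x (inr (fW i, miv)).
Let D x : R := (y x *m h0 x *m (y x)^T) 0 0.
Let t x : R := c / D x.
Let Fc x (e : index) : R := match e with
  | inr (inr ij, sigma) => if sigma == mi0 then t x * h0 x (val ij).1 (val ij).2 else slot x e
  | inr (inl (inr i), sigma) => if sigma == miv then t x * (y x *m h0 x) 0 i else slot x e
  | _ => slot x e end.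
Let F x : vec := jvec (Fc x).
Let U0 : set V := [set x | posdef (h0 x)].
Let U : set V := [set x | U0 x /\ D x != 0].

Let h0_sym x : (h0 x)^T = h0 x.
Proof. by apply/matrixP => i j; rewrite !mxE andbC fhC. Qed.

Let hF x : hjet (F x) = t x *: h0 x.
Proof.
apply/matrixP => i j; rewrite [LHS]mxE jcoord_jvec /= eqxx [RHS]mxE.
by case: (leqP i j) => //= _; rewrite -[in LHS](h0_sym x) [in LHS]mxE.
Qed.

Let wF x : wjet (F x) = t x *: (y x *m h0 x).
Proof. by apply/rowP => i; rewrite [LHS]mxE jcoord_jvec /= eqxx [RHS]mxE. Qed.

Section Membership.
Variables (W : set V) (P : (V -> R) -> Prop).
Hypothesis sfP : subfield_on W P.
Hypothesis slotP : forall e, P (fun x => slot x e).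

Lemma level_h0_in : in_mx P h0.
Proof.
move=> i j; rewrite (_ : (fun x => _) = fun x =>
  if (i == ord0) && (j == ord0) then 1 else slot x (inr (fh i j, mi0))).
  by case: (_ && _); [exact: (sf_cst sfP)|exact: slotP].
by apply/funext => x; rewrite mxE.
Qed.

Lemma level_y_in : in_mx P y.
Proof.
move=> i j; rewrite (_ : (fun x => _) = fun x => slot x (inr (fW j, miv))); first exact: slotP.
by apply/funext => x; rewrite mxE.
Qed.

Lemma level_D_in : P D.
Proof.
exact: (in_mx_mul sfP (in_mx_mul sfP level_y_in level_h0_in) (in_mx_tr level_y_in)).
Qed.

Lemma level_F_in j : (forall x, W x -> D x != 0) -> P (fun x => F x 0 j).
Proof.
move=> D0; have Pt : P t by apply: (sf_div sfP D0); [exact: (sf_cst sfP)|exact: level_D_in].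
rewrite (_ : (fun x => _) = fun x => Fc x (enum_val j)); last by apply/funext => x; rewrite mxE.
rewrite /Fc; case: (enum_val j) => [l|[[[[]|i]|ij] sigma]]; [exact: slotP|exact: slotP| |].
  by case: (sigma == miv);
    [exact: (sf_mul sfP Pt (in_mx_mul sfP level_y_in level_h0_in _ _))|exact: slotP].
by case: (sigma == mi0); [exact: (sf_mul sfP Pt (level_h0_in _ _))|exact: slotP].
Qed.

End Membership.

Let U_gt0 x : U x -> 0 < D x.
Proof.
move=> [[_ ph] D0]; apply: ph; apply: contra D0 => /eqP y0.
by rewrite /D y0 !mul0mx mxE.
Qed.

Let t_gt0 x : U x -> 0 < t x.
Proof. by move=> Ux; rewrite divr_gt0// U_gt0. Qed.

Let oU0 : open U0.
Proof.
rewrite openE => x Ux; apply: posdef_near Ux => [i j|x']; last exact: h0_sym.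
have sT := sf_smooth_on (@openT V).
apply: (@smooth_on_continuous _ _ _ setT) => //; apply: (level_h0_in sT) => e.
by apply: smooth_on_slot; exact: openT.
Qed.

Let oU : open U.
Proof.
apply: (open_smooth_neq0 oU0); apply: (level_D_in (sf_smooth_on oU0)) => e.
by apply: smooth_on_slot; exact: oU0.
Qed.

Let sF : smooth_on U F.
Proof.
apply/(smooth_on_rowP _ oU) => j; apply: (level_F_in (sf_smooth_on oU)) => [e|x []//].
by apply: smooth_on_slot; exact: oU.
Qed.

Let y_rec x : U x -> wjet (F x) *m ainv (hjet (F x)) = y x.
Proof.
move=> Ux; have t0 : t x != 0 by rewrite gt_eqF ?t_gt0.
have dh : \det (h0 x) != 0 by apply: posdef_det; case: Ux.
have uh : h0 x \in unitmx by rewrite unitmxE unitfE.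
rewrite hF wF ainvE; last by rewrite detZ mulf_neq0 ?expf_neq0.
rewrite invmxZ; last by rewrite unitmxE unitfE detZ mulf_neq0 ?expf_neq0.
by rewrite -scalemxAl -scalemxAr scalerA mulfV// scale1r mulmxK.
Qed.

Lemma level_set_image : level_set = F @` U.
Proof.
apply/seteqP; split=> [q [Eq Iq]|_ [x Ux <-]].
  have ph := hjet_posdef Eq.1; have dh := posdef_det ph.
  have uh : hjet q \in unitmx by rewrite unitmxE unitfE.
  have a0 : 0 < hjet q ord0 ord0.
    have d0 : (delta_mx 0 ord0 : 'rV[R]_m.+1) != 0.
      by apply/eqP => /rowP/(_ ord0); rewrite !mxE !eqxx => /eqP; rewrite oner_eq0.
    have := ph.2 _ d0; rewrite /qf -rowE !mxE (bigD1 ord0)//= big1 ?addr0.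
      by rewrite !mxE !eqxx mulr1.
    by move=> i i0; rewrite !mxE (negbTE i0) mulr0.
  have a0' : hjet q ord0 ord0 != 0 by rewrite gt_eqF.
  pose x : V := unslot level_coord (fun e => match e with
    | inr (inr ij, sigma) => if sigma == mi0 then hjet q (val ij).1 (val ij).2 / hjet q ord0 ord0
                             else jcoord q e
    | inr (inl (inr i), sigma) => if sigma == miv then (wjet q *m ainv (hjet q)) 0 i else jcoord q e
    | _ => jcoord q e end).
  have free0 f : free_coord (inr (f, mi0) : index).
    by case: f => [[//|//]|ij] /=; rewrite /expo /= ffunE.
  have h0x : h0 x = (hjet q ord0 ord0)^-1 *: hjet q.
    apply/matrixP => i j; rewrite [LHS]mxE [RHS]mxE.
    case: ifP => [/andP[/eqP -> /eqP ->]|ij]; first by rewrite mulVf.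
    rewrite slot_unslot /level_coord ?free0//=; last first.
      apply/eqP => -[E]; move: ij.
      by move: E; case: (leqP i j) => _ [-> ->]; rewrite eqxx.
    rewrite eqxx mulrC; congr (_ * _); case: (leqP i j) => //= _.
    by rewrite -[in LHS](ph.1) mxE.
  have yx : y x = wjet q *m ainv (hjet q).
    apply/rowP => i; rewrite [LHS]mxE slot_unslot//= ?eqxx//.
  have Dx : D x = c / hjet q ord0 ord0.
    rewrite /D yx h0x -scalemxAr -scalemxAl mxE -Iq /inv_jet mulrC ainvE//.
    congr (_ * _); rewrite mulmxKV// trmx_mul trmx_inv ph.1.
    by rewrite mulmxA.
  have tx : t x = hjet q ord0 ord0.
    by rewrite /t Dx invf_div mulrCA mulfV ?mulr1// gt_eqF.
  have Ux : U x.
    split; last by rewrite Dx mulf_neq0 ?invr_eq0// gt_eqF.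
    split=> [|v v0]; first exact: h0_sym.
    rewrite /qf h0x -scalemxAr -scalemxAl mxE mulr_gt0 ?invr_gt0//; exact: ph.2.
  exists x => //; apply: jcoord_inj => e; rewrite jcoord_jvec.
  have /kundt_equationE[_ Eq0] := Eq.
  have S : level_coord e -> match e with
    | inr (inr ij, sigma) => sigma != mi0 | inr (inl (inr i), sigma) => sigma != miv | _ => true end ->
    slot x e = jcoord q e.
    move=> le; rewrite slot_unslot//; case: e le => [//|[[[[]|i]|ij] sigma]] //= le /negbTE -> //.
  have S' : ~~ free_coord e -> slot x e = jcoord q e.
    by move=> fe; rewrite slot_out ?Eq0// /level_coord (negbTE fe).
  case: e S S' => [l|[[[[]|i]|ij] sigma]] S S'; [exact: S|exact: S| |].
    rewrite /Fc; case: eqP => [->|/eqP ns]; last exact: S.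
    rewrite tx yx h0x -scalemxAr ainvE// mulmxKV//.
    by rewrite [X in _ * X]mxE mulrA mulfV// mul1r mxE.
  rewrite /Fc; case: eqP => [->|/eqP ns].
    by rewrite tx h0x [X in _ * X]mxE mulrA mulfV// mul1r mxE fh_sorted.
  have [fe|] := boolP (free_coord (inr (inr ij, sigma) : index)); last exact: S'.
  by apply: S => //; rewrite /level_coord fe /=; apply: contra ns => /eqP[_ ->].
have dh : \det (h0 x) != 0 by apply: posdef_det; case: Ux.
have t0 := t_gt0 Ux.
split.
  apply/kundt_equationE; split.
    apply/in_F_posdef; rewrite -/(hjet (F x)) hF; case: Ux => -[hs hp] _; split.
      by rewrite linearZ /= hs.
    by move=> v v0; rewrite /qf -scalemxAr -scalemxAl mxE mulr_gt0//; exact: hp.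
  case=> [//|[[//|ij] sigma]] ne; rewrite jcoord_jvec /=.
  rewrite /Fc; case: eqP => [s0|_]; first by move: ne; rewrite s0 /= /expo /= ffunE.
  by rewrite slot_out// /level_coord (negbTE ne).
rewrite /inv_jet y_rec// wF linearZ /= -scalemxAr mxE trmx_mul h0_sym mulmxA.
by rewrite /t -/(D x) divfK// gt_eqF// U_gt0.
Qed.

Lemma level_set_immersed : immersed_submanifold #|{: {e : index | level_coord e}}| level_set.
Proof.
rewrite level_set_image; apply: (immersed_chart oU sF) => i.
pose e0 : {e : index | level_coord e} := enum_val i; have /andP[fe ne] := valP e0.
have sfD := sf_determined F oU.
have coordK e : determined F U (fun x => jcoord (F x) e) by exact: determined_coord.
have hK : in_mx (determined F U) (fun x => hjet (F x)).
  move=> a b; rewrite (_ : (fun x => _) = fun x => jcoord (F x) (inr (fh a b, mi0)))//.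
  by apply/funext => x; rewrite [LHS]mxE.
have wK : in_mx (determined F U) (fun x => wjet (F x)).
  move=> a b; rewrite (_ : (fun x => _) = fun x => jcoord (F x) (inr (fW b, miv)))//.
  by apply/funext => x; rewrite [LHS]mxE.
have K_ext := fun f g => @determined_ext _ _ _ F U f g oU.
suff : determined F U (fun x => slot x (val e0)).
  by apply: K_ext => x _; rewrite slotE.
case: (val e0) fe ne => [l|[[[[]|j]|ij] sigma]] fe ne.
- by apply: K_ext (coordK (inl l)) => x _; rewrite jcoord_jvec.
- by apply: K_ext (coordK (inr (inl (inl tt), sigma))) => x _; rewrite jcoord_jvec.
- have [->|ns] := eqVneq sigma miv; last first.
    by apply: K_ext (coordK (inr (inl (inr j), sigma))) => x _; rewrite jcoord_jvec /Fc (negbTE ns).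
  have yK : in_mx (determined F U) (fun x => wjet (F x) *m ainv (hjet (F x))).
    apply: (in_mx_mul sfD wK); apply: (in_mx_inv sfD) hK => x Ux.
    rewrite hF detZ mulf_neq0//; first by rewrite expf_neq0// gt_eqF ?t_gt0.
    by apply: posdef_det; case: Ux.
  by apply: K_ext (yK 0 j) => x Ux; rewrite y_rec// mxE.
- have [s0|ns] := eqVneq sigma mi0; last first.
    by apply: K_ext (coordK (inr (inr ij, sigma))) => x _; rewrite jcoord_jvec /Fc (negbTE ns).
  have h00E x : hjet (F x) ord0 ord0 = t x by rewrite hF mxE mxE !eqxx mulr1.
  have h00n x : U x -> hjet (F x) ord0 ord0 != 0 by move=> Ux; rewrite h00E gt_eqF ?t_gt0.
  apply: K_ext (sf_div sfD h00n (hK (val ij).1 (val ij).2) (hK ord0 ord0)) => x Ux.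
  rewrite h00E hF mxE mulrC mulKf ?gt_eqF ?t_gt0// mxE s0.
  case: ifP => [/andP[/eqP i0 /eqP j0]|_]; last by rewrite fh_sorted.
  by move: ne; rewrite s0 -fh_sorted i0 j0 eqxx.
Qed.

End LevelSet.

Lemma card_level_coord : (#|{: {e : index | level_coord e}}| + 1)%N = free_dim m.+1 1.
Proof.
have f0 : free_coord (inr (fh ord0 ord0, mi0) : index) by rewrite /= /expo /= ffunE.
rewrite /free_dim !card_sig [RHS](cardD1 (inr (fh ord0 ord0, mi0) : index)) unfold_in f0 addnC.
by congr (_ + _)%N; apply: eq_card => e; rewrite !inE andbC.
Qed.

(** General position means that the v-derivative of the first W_i is nonzero. Then w is nonzero and
    I is positive, which excludes the level w = 0, where the chart of the level set degenerates. *)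
Lemma generic_orbit_codim1 : generic_orbit_codim R m.+1 1 1.
Proof.
pose e : index := inr (fW ord0, miv).
exists [set p | jcoord p e != 0]; split.
- apply: (@open_comp _ _ (fun p : vec => jcoord p e) [set z : R | z != 0]); last exact: open_neq.
  by move=> p _; exact: jcoord_continuous.
- move=> p Ep; have [pe|pe] := eqVneq (jcoord p e) 0; last by apply: subset_closure; split.
  (* Only the coordinate e is moved, and the equation does not constrain it. *)
  move=> B nB; pose v : vec := jvec (fun e' => (e' == e)%:R).
  pose P (t : R) := p + t *: v.
  have jP t e' : jcoord (P t) e' = jcoord p e' + t * (e' == e)%:R.
    by rewrite /jcoord !mxE enum_rankK.
  have cP : P @ nbhs (0 : R) --> p.
    rewrite -[X in _ --> X](_ : P 0 = p); last by rewrite /P scale0r addr0.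
    exact: line_continuous.
  have nF : \forall t \near (0 : R)^', jet_space (P t).
    rewrite /dnbhs /= near_withinE.
    have n0 : \forall t \near (0 : R), jet_space (P t).
      exact: cP _ (open_nbhs_nbhs (conj (@jet_space_open R m.+1 1) Ep.1)).
    by apply: filterS n0 => t.
  have nB' : \forall t \near (0 : R)^', B (P t).
    rewrite /dnbhs /= near_withinE.
    have n0 : \forall t \near (0 : R), B (P t) by exact: cP _ nB.
    by apply: filterS n0 => t.
  have n0 : \forall t \near (0 : R)^', t != 0 by exact: nbhs_dnbhs_neq.
  have ne : \forall t \near (0 : R)^', [/\ jet_space (P t), B (P t) & t != 0] by apply: filterS3 nF nB' n0.
  have [t [Ft Bt t0]] := @filter_ex _ _ (Proper_dnbhs_numFieldType (0 : R)) _ ne.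
  exists (P t); split=> //; split; last by rewrite /= jP pe eqxx mulr1 add0r.
  apply/kundt_equationE; split=> // e' ne'; rewrite jP.
  have /kundt_equationE[_ /(_ _ ne') ->] := Ep.
  by case: eqP ne' => [->//|_ _]; rewrite mulr0 addr0.
- move=> p Ep pe; have ph := hjet_posdef Ep.1.
  have w0 : wjet p != 0 by apply: contra pe => /eqP/rowP/(_ ord0); rewrite !mxE => ->.
  have c0 : 0 < inv_jet p by exact: posdef_inv_gt0.
  split; first exact: kundt_orbit_equation.
  exists #|{: {e : index | level_coord e}}|; split.
    by rewrite card_level_coord; exact: kundt_equation_immersed.
  rewrite (_ : kundt_orbit p = level_set (inv_jet p)); first exact: level_set_immersed.
  apply/seteqP; split=> [q pq|q [Eq Iq]].
    by split; [exact: kundt_orbit_equation pq|exact: inv_jet_orbit].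
  by apply: kundt_orbit1 => //; rewrite -!inv_jetE.
Qed.

End FirstOrderInvariant.

(** * Dimension counts *)

Section Counting.
Variables (m k : nat).
Local Notation n := (1 + m + 1)%N.
Local Notation iu := (iu m).
Local Notation iv := (iv m).

(** Restriction to T turns a supported multi-index into a tuple of naturals with sum at most k;
    extension by zero, through the position in [enum T], is the inverse. *)
Lemma card_supported (T : pred 'I_n) :
  #|[pred tau : multi_index m k | supported T tau]| = 'C(#|T| + k, k).
Proof.
set d := #|T|.
pose f (tau : multi_index m k) : d.-tuple 'I_k.+1 := [tuple val tau (enum_val i) | i < d].
have sum_f tau : supported T tau -> (\sum_(i <- f tau) i = \sum_l val tau l)%N.
  move=> /forallP st; rewrite big_tuple.
  transitivity (\sum_(i < d) val tau (enum_val i))%N.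
    by apply: eq_bigr => i _; rewrite (tnth_mktuple (fun i => val tau (enum_val i)) i).
  rewrite -(big_enum_val (A := T) (fun l => val tau l : nat)) [RHS](bigID (mem T)) /=.
  rewrite [X in _ = (_ + X)%N]big1 ?addn0// => l; rewrite unfold_in => Tl.
  by have := st l; rewrite (negbTE Tl) orbF => /eqP.
rewrite -cardsE -(card_in_imset (f := f)); last first.
  move=> tau tau'; rewrite !inE => /forallP st /forallP st' ff.
  apply: expo_inj => l; have [Tl|Tl] := boolP (T l).
    have := congr1 (fun t => tnth t (enum_rank_in Tl l)) ff.
    by rewrite !tnth_mktuple enum_rankK_in// /expo => ->.
  have := st l; have := st' l; rewrite !(negbTE Tl) !orbF => /eqP -> /eqP ->.
  by [].
rewrite -(bin_sub (leq_addl d k)) addnK.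
rewrite -card_partial_ord_partitions; apply: eq_card => t; rewrite [RHS]inE.
apply/imsetP/idP => [[tau]|tk].
  by rewrite inE => st ->; rewrite sum_f//; exact: valP tau.
pose g : {ffun 'I_n -> 'I_k.+1} := [ffun l => nth ord0 t (index l (enum T))].
have gT l : ~~ T l -> g l = ord0.
  by move=> Tl; rewrite ffunE nth_default// size_tuple memNindex ?mem_enum// -cardE.
have gE i : g (enum_val i) = tnth t i.
  rewrite ffunE (tnth_nth ord0) (enum_val_nth (enum_default i)) index_uniq ?enum_uniq//.
  by rewrite -cardE.
have gk : (\sum_l g l <= k)%N.
  rewrite (bigID (mem T)) /= [X in (_ + X)%N]big1 ?addn0 => [|l]; last by rewrite unfold_in => /gT ->.
  rewrite (big_enum_val (A := T) (fun l => g l : nat)) /=.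
  rewrite (eq_bigr (fun i => tnth t i : nat)) => [|i _]; last by rewrite gE.
  by move: tk; rewrite big_tuple.
exists (exist _ g gk); last by apply: eq_from_tnth => i; rewrite tnth_mktuple gE.
by rewrite inE; apply/forallP => l; have [|/gT gl] := boolP (T l); rewrite ?orbT// /expo /= gl.
Qed.

Lemma card_predC1_iv : #|predC1 iv| = m.+1.
Proof. by rewrite cardC1 card_ord addn1. Qed.

(** The summands are the m + 2 base coordinates, the m + 1 unknowns H and W_i with derivatives in
    all m + 2 variables, and the entries h_ij with derivatives in the m + 1 variables other than
    v. *)
Lemma free_dimE : free_dim m k =
  (m.+2 + m.+1 * 'C(m.+2 + k, k) + 'C(m.+1, 2) * 'C(m.+1 + k, k))%N.
Proof.
have n2 : n = m.+2 by rewrite addn1.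
rewrite /free_dim card_sig -sum1_card.
rewrite big_mkcond big_sumType /= [X in (X + _)%N](_ : _ = m.+2); last first.
  by rewrite sum_nat_const card_ord muln1 n2.
have all_s : #|{: multi_index m k}| = 'C(m.+2 + k, k).
  rewrite -[in RHS]n2 -[X in 'C(X + k, k)]card_ord -(card_supported predT).
  by apply: eq_card => tau; rewrite !inE; apply/esym/forallP => l; rewrite orbT.
have h_s : #|[pred tau : multi_index m k | expo tau iv == 0%N]| = 'C(m.+1 + k, k).
  rewrite -card_predC1_iv -card_supported; apply: eq_card => tau; rewrite !inE.
  apply/eqP/forallP => [t0 l|/(_ iv)]; last by rewrite /= eqxx orbF => /eqP.
  by rewrite /=; have [->|] := eqVneq l iv; rewrite ?orbT// t0.
have pairs : #|{: {ij : 'I_m * 'I_m | (ij.1 <= ij.2)%N}}| = 'C(m.+1, 2).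
  rewrite card_sig -sum1_card (eq_bigl (fun ij : 'I_m * 'I_m => xpredT ij.1 && (ij.1 <= ij.2)%N))//.
  rewrite -(pair_big_dep xpredT (fun i j : 'I_m => (i <= j)%N) (fun _ _ => 1%N)) /=.
  rewrite (exchange_big_dep xpredT)//= -triangular_sum big_mkord big_ord_recl /= add0n.
  apply: eq_bigr => j _; rewrite /bump /= add1n.
  by rewrite -(big_ord_widen _ (fun _ => 1%N) (ltn_ord j)) sum1_card card_ord.
rewrite -[RHS]addnA; congr (_ + _)%N.
transitivity (\sum_(f : fiber_index m) \sum_(tau : multi_index m k)
    if free_coord (inr (f, tau) : jet_index m k) then 1 else 0)%N.
  by rewrite pair_big; apply: eq_bigr => -[f tau] _.
rewrite big_sumType /=; congr (_ + _)%N.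
  under eq_bigr => f _ do rewrite sum1_card all_s.
  by rewrite sum_nat_const card_sum card_unit card_ord add1n.
under eq_bigr => f _ do rewrite -big_mkcond /= sum1_card h_s.
by rewrite sum_nat_const pairs.
Qed.

End Counting.

(** Polynomials of degree at most k + 1: one in the single variable u, and m + 1 of them, for x and
    v, in the m + 1 variables u and x. *)
Lemma card_param m k : #|{: param m k}| = (k.+2 + m.+1 * 'C(m.+2 + k, k.+1))%N.
Proof.
rewrite /param card_sig -sum1_card.
rewrite -(pair_big_dep xpredT (fun c tau => supported (vars (m := m) c) tau) (fun _ _ => 1%N)) /=.
under eq_bigr => c _ do rewrite sum1_card card_supported.
have V c : c != iu m -> #|vars c| = m.+1.
  move=> cu; transitivity #|predC1 (iv m)|; last exact: card_predC1_iv.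
  apply: eq_card => l.
  by rewrite unfold_in /vars (negbTE cu).
rewrite (bigD1 (iu m))//=; congr (_ + _)%N.
  rewrite (_ : #|_| = 1%N) ?add1n ?binSn//.
  transitivity #|pred1 (iu m)|; last exact: card1.
  by apply: eq_card => l; rewrite unfold_in /vars ?eqxx.
under eq_bigr => c cu do rewrite V//.
by rewrite sum_nat_const cardC1 card_ord addn1 addSn addnS.
Qed.

(** * Generic codimensions and the Hilbert function *)

Section GenericCodimensions.
Variables (R : realType) (m : nat).

Lemma generic_orbit_codim0 : generic_orbit_codim R m 0 0.
Proof.
have EE (p : jet_vec R m 0) : jet_space p -> kundt_equation p.
  by move=> Fp; split=> // i j sigma; case: (val sigma _) => -[].
exists setT; split; [exact: openT|by rewrite setIT; exact: subset_closure|].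
move=> p Ep _; split; first exact: kundt_orbit_equation.
have -> : kundt_orbit p = @kundt_equation R m 0.
  apply/seteqP; split; first exact: kundt_orbit_equation.
  by move=> q [Fq _]; apply: kundt_orbit0 => //; case: Ep.
by exists (free_dim m 0); rewrite addn0; split; exact: kundt_equation_immersed.
Qed.

(** Obtained from geometry instead of binomial estimates: the orbit of the sample jet is an immersed
    submanifold of the equation with this dimension. *)
Lemma param_le_free_dim k : (2 <= k)%N -> (#|{: param m.+1 k}| <= free_dim m.+1 k)%N.
Proof.
move=> k2; have se := sample_jet_equation R m k.
have oi := kundt_orbit_generic k2 (generic_setP se (sample_jet_generic R m k2)).
(* A parameter with identity Jacobian, to have a point of the orbit at which ranks can be
   compared. *)
pose gam : 'rV[R]_#|{: param m.+1 k}| :=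
  jet2_param k 0 (kmx (1%:M : 'M[R]_m.+1) 0 0) (fun _ _ _ => 0).
have Gg : Gset gam.
  by apply: Gset_jet2; apply: kmx_kjac; rewrite det1 oner_neq0.
apply: (immersed_dim_le oi (kundt_orbit_equation se) (p := tjet (sample_jet R m k) gam)).
by rewrite kundt_orbit_tjet; [exists gam|case: se].
Qed.

Lemma generic_orbit_codim2 k : (2 <= k)%N ->
  generic_orbit_codim R m.+1 k (free_dim m.+1 k - #|{: param m.+1 k}|).
Proof.
move=> k2; have sg := sample_jet_generic R m k2; have se := sample_jet_equation R m k.
exists (@generic_set R m.+1 k); split; [exact: generic_set_open|exact: generic_dense sg|].
move=> p Ep gp; split; first exact: kundt_orbit_equation.
exists #|{: param m.+1 k}|; split; last exact: kundt_orbit_generic (generic_setP Ep gp).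
by rewrite subnKC ?param_le_free_dim//; exact: kundt_equation_immersed.
Qed.

End GenericCodimensions.

Section HilbertFunction.
Variable m : nat.
Hypothesis param_le : forall k, (2 <= k)%N -> (#|{: param m.+1 k}| <= free_dim m.+1 k)%N.

Definition orbit_codim (k : nat) : nat :=
  match k with 0 => 0%N | 1 => 1%N | _ => (free_dim m.+1 k - #|{: param m.+1 k}|)%N end.

Lemma orbit_codimE k : (orbit_codim k.+2)%:Z =
  m.+3%:Z + m.+2%:Z * ('C(m + k + 5, k.+2)%:Z - 'C(m + k + 5, k.+3)%:Z)
  + 'C(m.+2, 2)%:Z * 'C(m + k + 4, k.+2)%:Z - k.+4%:Z.
Proof.
rewrite /orbit_codim -subzn ?param_le// free_dimE card_param.
have -> : (m.+3 + k.+2 = m + k + 5)%N by rewrite !addnS !addSn addn0.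
have -> : (m.+2 + k.+2 = m + k + 4)%N by rewrite !addnS !addSn addn0.
move: 'C(m + k + 5, k.+2) 'C(m + k + 5, k.+3) 'C(m + k + 4, k.+2) 'C(m.+2, 2) m.+3 m.+2 k.+4.
move=> a b c d e f g; rewrite !PoszD !PoszM; ring.
Qed.

Lemma hilbert_functionS (s : nat -> nat) k : hilbert_function s k.+1 = (s k.+1)%:Z - (s k)%:Z.
Proof. by []. Qed.

Lemma binC a b : 'C(a + b, a) = 'C(a + b, b).
Proof. by rewrite -(bin_sub (leq_addl a b)) addnK. Qed.

Lemma hilbert_orbit_codim2 : hilbert_function orbit_codim 2 =
  m.+3%:Z - 5 + (m.+3%:Z - 1) * ('C(m.+3 + 2, m.+3)%:Z - 'C(m.+3 + 2, m.+3 - 1)%:Z)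
  + 'C(m.+3 - 1, 2)%:Z * 'C(m.+3 + 1, m.+3 - 1)%:Z.
Proof.
have o1 : orbit_codim 1 = 1%N by [].
rewrite hilbert_functionS orbit_codimE o1 !subSS subn0 binC.
have -> : (m.+3 + 2 = m.+2 + 3)%N by rewrite !addnS !addSn addn0.
have -> : (m.+3 + 1 = m.+2 + 2)%N by rewrite !addnS !addSn addn0.
rewrite !binC addn0.
have -> : (m.+2 + 3 = m + 5)%N by rewrite !addnS !addSn addn0.
have -> : (m.+2 + 2 = m + 4)%N by rewrite !addnS !addSn addn0.
have -> : (m.+2%:Z = m.+3%:Z - 1) by rewrite -[m.+3]addn1 PoszD addrK.
move: (Posz m.+3) (Posz 'C(m + 5, 2)) (Posz 'C(m + 5, 3)) (Posz 'C(m.+2, 2)) (Posz 'C(m + 4, 2)).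
by move=> a b c d e; ring.
Qed.

Lemma hilbert_orbit_codimS k : hilbert_function orbit_codim k.+3 =
  (m.+3%:Z - 1) * ('C(m.+3 + k.+3 - 1, m.+3 - 1)%:Z - 'C(m.+3 + k.+3 - 1, m.+3 - 2)%:Z)
  + 'C(m.+3 - 1, 2)%:Z * 'C(m.+3 + k.+3 - 2, m.+3 - 2)%:Z - 1.
Proof.
rewrite hilbert_functionS !orbit_codimE.
have -> : (m.+3 + k.+3 - 1 = m.+2 + k.+3)%N by rewrite addSn subSS subn0.
have -> : (m.+3 + k.+3 - 2 = m.+1 + k.+3)%N by rewrite 2!addSn !subSS subn0.
rewrite !subSS !subn0 !binC.
have -> : (m.+2 + k.+3 = m.+1 + k.+4)%N by rewrite !addnS !addSn.
rewrite binC.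
have -> : (m.+1 + k.+4 = m + k + 5)%N by rewrite !addnS !addSn addn0.
have -> : (m.+1 + k.+3 = m + k + 4)%N by rewrite !addnS !addSn addn0.
have -> : (m + k.+1 + 5 = (m + k + 5).+1)%N by rewrite !addnS.
have -> : (m + k.+1 + 4 = (m + k + 4).+1)%N by rewrite !addnS.
have -> : (m.+2%:Z = m.+3%:Z - 1) by rewrite -[m.+3]addn1 PoszD addrK.
have -> : (k.+1.+4%:Z = k.+4%:Z + 1) by rewrite -addn1 PoszD.
rewrite (binS (m + k + 5) k.+2) (binS (m + k + 5) k.+3) (binS (m + k + 4) k.+2) !PoszD.
move: (Posz m.+3) (Posz k.+4) (Posz 'C(m.+2, 2)) (Posz 'C(m + k + 5, k.+2)) (Posz 'C(m + k + 5, k.+3)).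
move: (Posz 'C(m + k + 5, k.+4)) (Posz 'C(m + k + 4, k.+3)) (Posz 'C(m + k + 4, k.+2)).
move=> a b c d e f g h; ring.
Qed.

End HilbertFunction.

Lemma orbit_codim_spec (R : realType) m k : generic_orbit_codim R m.+1 k (orbit_codim m k).
Proof.
case: k => [|[|k]]; [exact: generic_orbit_codim0|exact: generic_orbit_codim1|].
exact: generic_orbit_codim2.
Qed.

Lemma bin3E a : ('C(a.+3, 3)%:R : rat) = (a%:R + 3) * (a%:R + 2) * (a%:R + 1) / 6.
Proof.
have E : ('C(a.+3, 3) * 6 = (a + 3) * (a + 2) * (a + 1))%N.
  by have := bin_ffact a.+3 3; rewrite !ffactnS ffactn0 muln1 /= mulnA addn3 addn2 addn1.
have := congr1 (fun x => x%:R : rat) E; rewrite /= !natrM !natrD => E'.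
by rewrite -E' mulfK.
Qed.

Lemma bin2E a : ('C(a.+2, 2)%:R : rat) = (a%:R + 2) * (a%:R + 1) / 2.
Proof.
have E : ('C(a.+2, 2) * 2 = (a + 2) * (a + 1))%N.
  by have := bin_ffact a.+2 2; rewrite !ffactnS ffactn0 muln1 /= addn2 addn1.
have := congr1 (fun x => x%:R : rat) E; rewrite /= !natrM !natrD => E'.
by rewrite -E' mulfK.
Qed.

Lemma hilbert_orbit_codim2_rat m : (forall k, (2 <= k)%N -> (#|{: param m.+1 k}| <= free_dim m.+1 k)%N) ->
  (hilbert_function (orbit_codim m) 2)%:~R =
  (m.+3%:R ^+ 4 - 4 * m.+3%:R ^+ 3 + 11 * m.+3%:R ^+ 2 + 16 * m.+3%:R - 72) / 12 :> rat.
Proof.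
move=> le; have o1 : orbit_codim m 1 = 1%N by [].
rewrite hilbert_functionS orbit_codimE// o1 addn0.
have -> : (m + 5 = m.+2.+3)%N by rewrite addnC.
have -> : (m + 4 = m.+2.+2)%N by rewrite addnC.
have Z (x : nat) : (x%:Z)%:~R = x%:R :> rat by rewrite -pmulrn.
move: (bin2E m) (bin2E m.+2) (bin2E m.+3) (bin3E m.+2).
move: 'C(m.+2, 2) 'C(m.+4, 2) 'C(m.+2.+3, 2) 'C(m.+2.+3, 3) => a b c d Ea Eb Ec Ed.
rewrite !(rmorphB, rmorphD, rmorphM) /= !Z Ea Eb Ec Ed -!natr1.
by field.
Qed.

Unset Implicit Arguments.
Local Close Scope classical_set_scope.

Theorem proposition4 (R : realType) (n : nat) (hn : (3 <= n)%N) :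
  exists s : nat -> nat,
    (forall k : nat, generic_orbit_codim R (n - 2) k (s k)) /\
    [/\ hilbert_function s 0 = 0,
        hilbert_function s 1 = 1,
        hilbert_function s 2 =
          n%:Z - 5
          + (n%:Z - 1) * ('C(n + 2, n)%:Z - 'C(n + 2, n - 1)%:Z)
          + 'C(n - 1, 2)%:Z * 'C(n + 1, n - 1)%:Z,
        (hilbert_function s 2)%:~R =
          (n%:R ^+ 4 - 4 * n%:R ^+ 3 + 11 * n%:R ^+ 2 + 16 * n%:R - 72) / 12
          :> rat &
        forall k : nat, (3 <= k)%N ->
          hilbert_function s k =
            (n%:Z - 1) *
              ('C(n + k - 1, n - 1)%:Z - 'C(n + k - 1, n - 2)%:Z)
            + 'C(n - 1, 2)%:Z * 'C(n + k - 2, n - 2)%:Z - 1].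
Proof.
(* From here on m is n - 3, so that m + 1 is the number of coordinates x^i and at least one of them
   exists. *)
case: n hn => [|[|[|m]]]// _; have nE : (m.+3 - 2 = m.+1)%N by rewrite !subSS subn0.
have le k := @param_le_free_dim R m k.
exists (orbit_codim m); split; first by move=> k; rewrite nE; exact: orbit_codim_spec.
split; [by []|by []|exact: hilbert_orbit_codim2|exact: hilbert_orbit_codim2_rat|].
by case=> [|[|[|k]]]// _; exact: hilbert_orbit_codimS.
Qed.
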